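(* Let $T>0$ be fixed and $h_n=T/n$. Assume that each of the drifts $B_1,\dots,B_4$ is globally Lipschitz and of class $C^4$ with all partial derivatives of order $0$ to $4$ of polynomial growth, and that $\sup_t\mathbb{E}[|Y_t|^{\ell}]<\infty$ for all $\ell\ge 0$ and each $Y\in\{\xi_0,\delta_0,\varepsilon_0,\zeta_0\}$. Suppose there is $\theta_0\in\operatorname{Int}\Theta$ with $\mathbf{\Sigma}_0=\mathbf{\Sigma}(\theta_0)$, that $\mathbf{\Sigma}(\theta_1)=\mathbf{\Sigma}(\theta_2)$ implies $\theta_1=\theta_2$ for $\theta_1,\theta_2\in\Theta$, and that $\operatorname{rank}\Delta=q$, where $\Delta=\partial_\theta\operatorname{vech}\mathbf{\Sigma}(\theta)|_{\theta=\theta_0}\in\mathbb{R}^{\bar p\times q}$. Then, as $h_n\to0$ (that is, $n\to\infty$), $\hat\theta_n\to\theta_0$ in probability and $$\sqrt n(\hat\theta_n-\theta_0)\to N_q\bigl(0,(\Delta^\top\mathbf{W}(\theta_0)^{-1}\Delta)^{-1}\bigr)\quad\text{in distribution.}$$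
   Context: Notation: for a symmetric $p\times p$ matrix $A$, $\operatorname{vech}A$ is the half-vectorization and $\mathbb{D}_p$ is the $p^2\times\bar p$ duplication matrix, $\operatorname{vec}A=\mathbb{D}_p\operatorname{vech}A$; $A^{+}$ is the Moore-Penrose inverse. $\mathbf{W}(\theta)=2\mathbb{D}_p^{+}(\mathbf{\Sigma}(\theta)\otimes\mathbf{\Sigma}(\theta))\mathbb{D}_p^{+\top}$. True model and data: $p_1,p_2,k_1,k_2,r_1,\dots,r_4\ge 1$ are fixed integers with $k_1\le p_1$, $k_2\le p_2$; $p=p_1+p_2$, $\bar p=p(p+1)/2$. $W_1,\dots,W_4$ are independent standard Wiener processes of dimensions $r_1,\dots,r_4$. The latent processes $\xi_0,\delta_0,\varepsilon_0,\zeta_0$, with values in $\mathbb{R}^{k_1},\mathbb{R}^{p_1},\mathbb{R}^{p_2},\mathbb{R}^{k_2}$, solve $d\xi_{0,t}=B_1(\xi_{0,t})dt+\mathbf{S}_{1,0}dW_{1,t}$, $d\delta_{0,t}=B_2(\delta_{0,t})dt+\mathbf{S}_{2,0}dW_{2,t}$, $d\varepsilon_{0,t}=B_3(\varepsilon_{0,t})dt+\mathbf{S}_{3,0}dW_{3,t}$, $d\zeta_{0,t}=B_4(\zeta_{0,t})dt+\mathbf{S}_{4,0}dW_{4,t}$ on $[0,T]$, with deterministic initial values $c_1,\dots,c_4$ and constant matrices $\mathbf{S}_{i,0}$. Put $\mathbf{\Sigma}_{\xi\xi,0}=\mathbf{S}_{1,0}\mathbf{S}_{1,0}^\top$, $\mathbf{\Sigma}_{\delta\delta,0}=\mathbf{S}_{2,0}\mathbf{S}_{2,0}^\top$,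 $\mathbf{\Sigma}_{\varepsilon\varepsilon,0}=\mathbf{S}_{3,0}\mathbf{S}_{3,0}^\top$, $\mathbf{\Sigma}_{\zeta\zeta,0}=\mathbf{S}_{4,0}\mathbf{S}_{4,0}^\top$; $\mathbf{\Sigma}_{\delta\delta,0}$ and $\mathbf{\Sigma}_{\varepsilon\varepsilon,0}$ are positive definite. Constant matrices: $\mathbf{\Lambda}_{x_1,0}\in\mathbb{R}^{p_1\times k_1}$ of full column rank, $\mathbf{\Lambda}_{x_2,0}\in\mathbb{R}^{p_2\times k_2}$, $\mathbf{\Gamma}_0\in\mathbb{R}^{k_2\times k_1}$, $\mathbf{B}_0\in\mathbb{R}^{k_2\times k_2}$ with zero diagonal, $\mathbf{\Psi}_0=\mathbb{I}_{k_2}-\mathbf{B}_0$ non-singular. The observed process is $\mathbb{X}_t=(\mathbb{X}_{1,t}^\top,\mathbb{X}_{2,t}^\top)^\top$ with $\mathbb{X}_{1,t}=\mathbf{\Lambda}_{x_1,0}\xi_{0,t}+\delta_{0,t}$, $\mathbb{X}_{2,t}=\mathbf{\Lambda}_{x_2,0}\eta_{0,t}+\varepsilon_{0,t}$, $\eta_{0,t}=\mathbf{B}_0\eta_{0,t}+\mathbf{\Gamma}_0\xi_{0,t}+\zeta_{0,t}$. With $t_i^n=ih_n$, $T=nh_n$, $\mathbb{Q}_{\mathbb{XX}}=\frac1T\sum_{i=1}^n(\mathbb{X}_{t_i^n}-\mathbb{X}_{t_{i-1}^n})(\mathbb{X}_{t_i^n}-\mathbb{X}_{t_{i-1}^n})^\top$.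 Parametric model: $\Theta\subset\mathbb{R}^q$ is convex and compact. For $\theta\in\Theta$ there are matrices $\mathbf{\Lambda}_{x_1},\mathbf{\Lambda}_{x_2},\mathbf{\Gamma},\mathbf{\Psi}=\mathbb{I}_{k_2}-\mathbf{B}$ ($\mathbf{B}$ with zero diagonal), $\mathbf{\Sigma}_{\xi\xi},\mathbf{\Sigma}_{\delta\delta},\mathbf{\Sigma}_{\varepsilon\varepsilon},\mathbf{\Sigma}_{\zeta\zeta}$ of respective sizes $p_1\times k_1$, $p_2\times k_2$, $k_2\times k_1$, $k_2\times k_2$, $k_1\times k_1$, $p_1\times p_1$, $p_2\times p_2$, $k_2\times k_2$, each entry being either a known constant or a coordinate of $\theta$ ($\theta$ collects the unknown, non-duplicated entries); $\mathbf{\Lambda}_{x_1}$ has full column rank, $\mathbf{\Psi}$ is non-singular, $\mathbf{\Sigma}_{\xi\xi},\mathbf{\Sigma}_{\zeta\zeta}$ are positive semidefinite, $\mathbf{\Sigma}_{\delta\delta},\mathbf{\Sigma}_{\varepsilon\varepsilon}$ positive definite. $\mathbf{\Sigma}(\theta)$ is the symmetric $p\times p$ matrix with blocks $\mathbf{\Sigma}^{11}=\mathbf{\Lambda}_{x_1}\mathbf{\Sigma}_{\xi\xi}\mathbf{\Lambda}_{x_1}^\top+\mathbf{\Sigma}_{\delta\delta}$, $\mathbf{\Sigma}^{12}=\mathbf{\Lambda}_{x_1}\mathbf{\Sigma}_{\xi\xi}\mathbf{\Gamma}^\top\mathbf{\Psi}^{-1\top}\mathbf{\Lambda}_{x_2}^\top$,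 $\mathbf{\Sigma}^{22}=\mathbf{\Lambda}_{x_2}\mathbf{\Psi}^{-1}(\mathbf{\Gamma}\mathbf{\Sigma}_{\xi\xi}\mathbf{\Gamma}^\top+\mathbf{\Sigma}_{\zeta\zeta})\mathbf{\Psi}^{-1\top}\mathbf{\Lambda}_{x_2}^\top+\mathbf{\Sigma}_{\varepsilon\varepsilon}$; $\mathbf{\Sigma}_0$ is the same expression evaluated at the true matrices (subscript $0$). Contrast and estimator: $\mathrm{F}(Q,\mathbf{\Sigma})=\log\det\mathbf{\Sigma}-\log\det Q+\operatorname{tr}(\mathbf{\Sigma}^{-1}Q)-p$ for $Q,\mathbf{\Sigma}$ positive definite. $\mathbb{F}_n(\theta)=\mathrm{F}(\mathbb{Q}_{\mathbb{XX}},\mathbf{\Sigma}(\theta))$ if $\mathbb{Q}_{\mathbb{XX}}$ is non-singular and $\mathbb{F}_n(\theta)=|\operatorname{vech}\mathbb{Q}_{\mathbb{XX}}-\operatorname{vech}\mathbf{\Sigma}(\theta)|^2$ otherwise. $\hat\theta_n\in\Theta$ is a minimum contrast estimator: $\mathbb{F}_n(\hat\theta_n)=\inf_{\theta\in\Theta}\mathbb{F}_n(\theta)$. *)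

(* Defs.v *)
From HB Require Import structures.
From mathcomp Require Import all_boot all_order all_algebra.
From mathcomp Require Import mxtens.
From mathcomp Require Import all_classical all_reals all_analysis.

Set Implicit Arguments.
Unset Strict Implicit.
Unset Printing Implicit Defensive.

Import Order.TTheory GRing.Theory Num.Theory.
Import numFieldNormedType.Exports.

Local Open Scope classical_set_scope.
Local Open Scope ring_scope.

Section Matrices.
Variable R : realType.

(* The library norm on matrices is the max norm. *)
Definition enorm n (x : 'cV[R]_n) : R := Num.sqrt (\sum_i x i 0 ^+ 2).

Definition psdmx n (A : 'M[R]_n) : Prop :=
  A^T = A /\ forall x : 'cV[R]_n, 0 <= (x^T *m A *m x) 0 0.

Definition pdmx n (A : 'M[R]_n) : Prop :=
  A^T = A /\ forall x : 'cV[R]_n, x != 0 -> 0 < (x^T *m A *m x) 0 0.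

(* Column stacking; [mxtens_unindex] is the row index decoding used by the
   Kronecker product [*t], so that row [j * m + i] of [vec A] is [A i j]. *)
Definition vec m n (A : 'M[R]_(m, n)) : 'cV[R]_(n * m) :=
  \col_k A (mxtens_unindex k).2 (mxtens_unindex k).1.

(* Positions on and below the diagonal, as pairs (column, row): their
   lexicographic enumeration lists the lower triangle column by column. *)
Definition lowtri p : {set 'I_p * 'I_p} := [set x : 'I_p * 'I_p | (x.1 <= x.2)%N].

Definition pbar p : nat := #|lowtri p|.

Lemma pbarE p : pbar p = (p * p.+1)./2.
Proof.
rewrite mulnC -[p in LHS]/(p.+1.-1) -bin2 -bin2_sum /pbar.
rewrite big_ltn // add0n big_add1 /= big_mkord.
rewrite -sum1_card (eq_bigl (fun x : 'I_p * 'I_p => (x.1 <= x.2)%N)); last first.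
  by move=> x; rewrite inE.
rewrite -(pair_big_dep xpredT (fun i j : 'I_p => i <= j)%N (fun=> fun=> 1%N)) /=.
rewrite (exchange_big_dep xpredT) //=; apply: eq_bigr => j _.
rewrite sum1_card -(card_ord j.+1).
rewrite -(fintype.card_image (f := widen_ord (ltn_ord j))); last first.
  by move=> a b /(congr1 val) /= /val_inj.
apply: eq_card => i; rewrite unfold_in; apply/idP/mapP => /= [ij|[x _ ->] /=].
  by exists (Ordinal (ij : i < j.+1)%N); [rewrite mem_enum | apply: val_inj].
exact: (ltn_ord x).
Qed.

Definition vech p (A : 'M[R]_p) : 'cV[R]_(pbar p) :=
  \col_k A (enum_val k).2 (enum_val k).1.

Definition dupmx p : 'M[R]_(p * p, pbar p) :=
  \matrix_(k, l) let x := mxtens_unindex k in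
    ((enum_val l == (x.1, x.2)) || (enum_val l == (x.2, x.1)))%:R.

Lemma dupmxP p (A : 'M[R]_p) : A^T = A -> vec A = dupmx p *m vech A.
Proof.
move=> symA; have Asym i j : A i j = A j i by rewrite -[in LHS]symA mxE.
apply/colP => k; rewrite !mxE; set x := mxtens_unindex k.
pose y := if (x.1 <= x.2)%N then (x.1, x.2) else (x.2, x.1).
have ylow : y \in lowtri p.
  by rewrite /y inE; case: (leqP x.1 x.2) => [|/ltnW].
have yE z : z \in lowtri p -> (z == (x.1, x.2)) || (z == (x.2, x.1)) = (z == y).
  move=> zl; apply/orP/eqP => [[]/eqP zE|->].
  - by move: zl; rewrite zE inE /y /= => ->.
  - move: zl; rewrite zE inE /y; case: (leqP x.1 x.2) => // a b.
    have /val_inj e : x.1 = x.2 :> nat by apply/anti_leq/andP.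
    by case: (x) e => ?? /= ->.
  - by rewrite /y; case: (leqP x.1 x.2) => _; rewrite eqxx; [left|right].
have dE l : dupmx p k l = (enum_val l == y)%:R by rewrite mxE -yE ?enum_valP.
rewrite (bigD1 (enum_rank_in ylow y)) //= dE mxE enum_rankK_in // eqxx mul1r.
rewrite big1 ?addr0 => [|l ln].
  by rewrite /y; case: (leqP x.1 x.2).
rewrite dE; case: eqP => [lE|]; last by rewrite mul0r.
by case/eqP: ln; apply: enum_val_inj; rewrite enum_rankK_in.
Qed.

Definition penrose m n (A : 'M[R]_(m, n)) (X : 'M[R]_(n, m)) : Prop :=
  [/\ A *m X *m A = A, X *m A *m X = X,
      (A *m X)^T = A *m X & (X *m A)^T = X *m A].

Lemma gram_unit m n (F : 'M[R]_(m, n)) : row_free F -> F *m F^T \in unitmx.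
Proof.
move=> Ff; rewrite -row_free_unit -kermx_eq0; apply/eqP/row_matrixP => i.
rewrite row0; set u := row i _.
have uFF : u *m (F *m F^T) = 0 by apply/sub_kermxP; exact: row_sub.
have uF0 : u *m F = 0.
  have : (u *m F) *m (u *m F)^T = 0.
    by rewrite trmx_mul mulmxA -(mulmxA u) uFF mul0mx.
  move=> /matrixP /(_ 0 0); rewrite !mxE => /eqP.
  rewrite psumr_eq0 => [/allP h|j _]; last by rewrite !mxE -expr2 sqr_ge0.
  apply/rowP => j; have := h j (mem_index_enum _).
  by rewrite !mxE -expr2 sqrf_eq0 => /eqP.
by apply: (row_free_inj Ff); rewrite uF0 mul0mx.
Qed.

Lemma penrose_factor m n r (C : 'M[R]_(m, r)) (F : 'M[R]_(r, n)) :
  row_free C^T -> row_free F -> exists X, penrose (C *m F) X.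
Proof.
move=> Cf Ff; have FU := gram_unit Ff.
have CU := gram_unit Cf; rewrite trmxK in CU.
pose GF := invmx (F *m F^T); pose GC := invmx (C^T *m C).
have tGF : GF^T = GF by rewrite /GF trmx_inv trmx_mul trmxK.
have tGC : GC^T = GC by rewrite /GC trmx_inv trmx_mul trmxK.
have FGF : F *m F^T *m GF = 1%:M := mulmxV FU.
have GCC : GC *m (C^T *m C) = 1%:M := mulVmx CU.
pose X := F^T *m (GF *m (GC *m C^T)).
have AX : C *m F *m X = C *m (GC *m C^T).
  by rewrite /X -!mulmxA (mulmxA F F^T) (mulmxA (F *m F^T) GF) FGF mul1mx.
have XA : X *m (C *m F) = F^T *m (GF *m F).
  by rewrite /X -!mulmxA (mulmxA C^T) (mulmxA GC) GCC mul1mx.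
exists X; split.
- by rewrite AX -!mulmxA (mulmxA C^T) (mulmxA GC) GCC mul1mx.
- by rewrite XA /X -!mulmxA (mulmxA F F^T) (mulmxA (F *m F^T) GF) FGF mul1mx.
- by rewrite AX !trmx_mul trmxK tGC mulmxA.
- by rewrite XA !trmx_mul trmxK tGF mulmxA.
Qed.

Definition mpinv m n (A : 'M[R]_(m, n)) : 'M[R]_(n, m) :=
  xget 0 [set X | penrose A X].

Lemma mpinvP m n (A : 'M[R]_(m, n)) : penrose A (mpinv A).
Proof.
suff [X PX] : exists X, penrose A X.
  by apply: (xgetPex 0 (P := [set X | penrose A X])); exists X.
rewrite -[A]mulmx_base; apply: penrose_factor; last exact: row_base_free.
by rewrite /row_free mxrank_tr; exact: col_base_full.
Qed.

Lemma penrose_uniq m n (A : 'M[R]_(m, n)) X Y :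
  penrose A X -> penrose A Y -> X = Y.
Proof.
move=> [AXA XAX AXt XAt] [AYA YAY AYt YAt].
have AXY : A *m X = A *m Y.
  rewrite -AXt -{1}AYA -mulmxA trmx_mul AXt AYt.
  by rewrite !mulmxA AXA.
have XAY : X *m A = Y *m A.
  rewrite -XAt -{1}AYA mulmxA mulmxA -(mulmxA (X *m A)) trmx_mul XAt YAt.
  by rewrite -(mulmxA Y) (mulmxA A X) AXA.
by rewrite -XAX XAY -mulmxA AXY mulmxA YAY.
Qed.
End Matrices.

Section Model.
Variables (R : realType) (p1 p2 k1 k2 : nat).

Record sem (K : Type) := Sem {
  Lx1 : 'M[K]_(p1, k1);
  Lx2 : 'M[K]_(p2, k2);
  Gam : 'M[K]_(k2, k1);
  Psi : 'M[K]_k2;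
  Sxixi : 'M[K]_k1;
  Sdd : 'M[K]_p1;
  See : 'M[K]_p2;
  Szz : 'M[K]_k2 }.

Definition sem_cov (m : sem R) : 'M[R]_(p1 + p2) :=
  let S12 := Lx1 m *m Sxixi m *m (Gam m)^T *m (invmx (Psi m))^T *m (Lx2 m)^T in
  block_mx
    (Lx1 m *m Sxixi m *m (Lx1 m)^T + Sdd m) S12
    S12^T
    (Lx2 m *m invmx (Psi m) *m (Gam m *m Sxixi m *m (Gam m)^T + Szz m)
       *m (invmx (Psi m))^T *m (Lx2 m)^T + See m).

Definition sem_admissible (m : sem R) : Prop :=
  [/\ \rank (Lx1 m) = k1,
      (forall i, (1%:M - Psi m) i i = 0) /\ Psi m \in unitmx,
      psdmx (Sxixi m) /\ psdmx (Szz m),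
      pdmx (Sdd m) & pdmx (See m)].

(* In a [sem (R + 'I_q)] an entry is either a known constant or (the index of)
   a coordinate of the parameter. *)
Definition param_entry q (theta : 'cV[R]_q) (e : R + 'I_q) : R :=
  match e with inl c => c | inr j => theta j 0 end.

Definition sem_at q (M : sem (R + 'I_q)) (theta : 'cV[R]_q) : sem R :=
  let ev m n (A : 'M[R + 'I_q]_(m, n)) := map_mx (param_entry theta) A in
  Sem (ev _ _ (Lx1 M)) (ev _ _ (Lx2 M)) (ev _ _ (Gam M)) (ev _ _ (Psi M))
      (ev _ _ (Sxixi M)) (ev _ _ (Sdd M)) (ev _ _ (See M)) (ev _ _ (Szz M)).

Definition Sigma q (M : sem (R + 'I_q)) (theta : 'cV[R]_q) : 'M[R]_(p1 + p2) :=
  sem_cov (sem_at M theta).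

End Model.

Section Contrast.
Variable R : realType.

Definition contrast p (Q S : 'M[R]_p) : R :=
  ln (\det S) - ln (\det Q) + \tr (invmx S *m Q) - p%:R.

Definition contrast_n p (Q S : 'M[R]_p) : R :=
  if Q \in unitmx then contrast Q S else enorm (vech Q - vech S) ^+ 2.

Definition quad_var Omega p (T : R) (X : R -> Omega -> 'cV[R]_p) (n : nat)
    (w : Omega) : 'M[R]_p :=
  let h := T / n%:R in
  T^-1 *: \sum_(1 <= i < n.+1)
    (X (i%:R * h) w - X ((i.-1)%:R * h) w) *m
    (X (i%:R * h) w - X ((i.-1)%:R * h) w)^T.

Definition observed Omega p1 p2 k1 k2 (L1 : 'M[R]_(p1, k1)) (L2 : 'M[R]_(p2, k2))
    (xi : R -> Omega -> 'cV[R]_k1) (delta : R -> Omega -> 'cV[R]_p1)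
    (eta : R -> Omega -> 'cV[R]_k2) (eps : R -> Omega -> 'cV[R]_p2) :
    R -> Omega -> 'cV[R]_(p1 + p2) :=
  fun t w => col_mx (L1 *m xi t w + delta t w) (L2 *m eta t w + eps t w).

Definition partial k (j : 'I_k) (f : 'cV[R]_k -> R) : 'cV[R]_k -> R :=
  fun x => 'D_(delta_mx j 0) f x.

Definition jacobian_mx q m (f : 'cV[R]_q -> 'cV[R]_m) (x : 'cV[R]_q) :
    'M[R]_(m, q) :=
  \matrix_(i, j) partial j (fun y => f y i 0) x.

(* W in terms of S = Sigma(theta). *)
Definition Wmx p (S : 'M[R]_p) : 'M[R]_(pbar p) :=
  2 *: (mpinv (dupmx R p) *m (S *t S) *m (mpinv (dupmx R p))^T).

Definition iter_partial k (s : seq 'I_k) (f : 'cV[R]_k -> R) : 'cV[R]_k -> R :=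
  foldr (@partial k) f s.

Definition globally_lipschitz k (B : 'cV[R]_k -> 'cV[R]_k) : Prop :=
  exists L : R, forall x y, enorm (B x - B y) <= L * enorm (x - y).

Definition class_C k (r : nat) (f : 'cV[R]_k -> R) : Prop :=
  (forall s : seq 'I_k, (size s < r)%N ->
     forall j x, derivable (iter_partial s f) x (delta_mx j 0)) /\
  (forall s : seq 'I_k, (size s <= r)%N -> continuous (iter_partial s f)).

Definition poly_growth k (f : 'cV[R]_k -> R) : Prop :=
  exists (C : R) (m : nat), forall x, `|f x| <= C * (1 + enorm x) ^+ m.

Definition regular_drift k (B : 'cV[R]_k -> 'cV[R]_k) : Prop :=
  globally_lipschitz B /\
  forall i : 'I_k,
    class_C 4 (fun x => B x i 0) /\
    forall s : seq 'I_k, (size s <= 4)%N ->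
      poly_growth (iter_partial s (fun x => B x i 0)).

End Contrast.

Notation borel_cV R k := (g_sigma_algebraType (@open 'cV[R]_k)).

Section Gaussian.
Variable R : realType.

(* The library's [normal_prob m 0] is not the point mass at [m]. *)
Definition gauss1 (m v : R) (A : set R) : \bar R :=
  if v == 0 then \d_m A else normal_prob m (Num.sqrt v) A.

Definition gaussian_vector d (Omega : measurableType d)
    (P : probability Omega R) k (Z : Omega -> 'cV[R]_k)
    (m : 'cV[R]_k) (V : 'M[R]_k) : Prop :=
  forall (u : 'cV[R]_k) (A : set R), measurable A ->
    P [set w | A ((u^T *m Z w) 0 0)] =
    gauss1 ((u^T *m m) 0 0) ((u^T *m V *m u) 0 0) A.

Definition cvg_in_probability d (Omega : measurableType d)
    (P : probability Omega R) k (X : nat -> Omega -> 'cV[R]_k)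
    (x : 'cV[R]_k) : Prop :=
  forall e : R, 0 < e ->
    P [set w | e <= enorm (X n w - x)] @[n --> \oo] --> 0%E.

Definition cvg_in_distribution d (Omega : measurableType d)
    (P : probability Omega R) k (X : nat -> Omega -> 'cV[R]_k)
    (mu : probability (borel_cV R k) R) : Prop :=
  forall f : 'cV[R]_k -> R, continuous f ->
    (exists M : R, forall x, `|f x| <= M) ->
    (\int[P]_w (f (X n w))%:E)%E @[n --> \oo] --> (\int[mu]_x (f x)%:E)%E.

Definition cvg_to_normal d (Omega : measurableType d)
    (P : probability Omega R) k (X : nat -> Omega -> 'cV[R]_k)
    (m : 'cV[R]_k) (V : 'M[R]_k) : Prop :=
  exists mu : probability (borel_cV R k) R,
    gaussian_vector mu (fun x : 'cV[R]_k => x) m V /\ cvg_in_distribution P X mu.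

End Gaussian.

Section Processes.
Context (R : realType) d (Omega : measurableType d) (P : probability Omega R).

Definition random_vector k (Z : Omega -> 'cV[R]_k) : Prop :=
  measurable_fun setT (Z : Omega -> borel_cV R k).

Definition sigma_vec k (Z : Omega -> 'cV[R]_k) : set (set Omega) :=
  preimage_set_system setT (Z : Omega -> borel_cV R k) measurable.

Definition sigma_proc (T : R) k (Y : R -> Omega -> 'cV[R]_k) :
    set (set Omega) :=
  <<s \bigcup_(t in `[0, T]) sigma_vec (Y t) >>.

Definition mutually_independent m (F : 'I_m -> set (set Omega)) : Prop :=
  forall (J : {set 'I_m}) (A : 'I_m -> set Omega),
    (forall i, i \in J -> F i (A i)) ->
    P (\bigcap_(i in [set` J]) A i) = (\prod_(i in J) P (A i))%E.

Record wiener (T : R) k (W : R -> Omega -> 'cV[R]_k) : Prop := Wiener {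
  wiener_meas : forall t, 0 <= t <= T -> random_vector (W t);
  wiener_0 : {ae P, forall w, W 0 w = 0};
  wiener_cont : {ae P, forall w,
    {within `[0, T], continuous (fun t => W t w)}};
  wiener_indep : forall (m : nat) (t : nat -> R),
    0 <= t 0%N -> (forall i, (i < m)%N -> t i < t i.+1) -> t m <= T ->
    mutually_independent
      (fun i : 'I_m => sigma_vec (fun w => W (t i.+1) w - W (t i) w));
  wiener_incr : forall s t, 0 <= s -> s < t -> t <= T ->
    gaussian_vector P (fun w => W t w - W s w) 0 (t - s)%:M }.

(* The noise is additive with a constant coefficient, so the stochastic
   integral of [S] is [S *m W t] and the equation is a pathwise one. *)
Record sde_solution (T : R) k r (W : R -> Omega -> 'cV[R]_r)
    (B : 'cV[R]_k -> 'cV[R]_k) (S : 'M[R]_(k, r)) (c : 'cV[R]_k)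
    (Y : R -> Omega -> 'cV[R]_k) : Prop := SdeSolution {
  sde_meas : forall t, 0 <= t <= T -> random_vector (Y t);
  sde_cont : {ae P, forall w,
    {within `[0, T], continuous (fun t => Y t w)}};
  sde_eq : {ae P, forall w, forall t, 0 <= t <= T ->
    Y t w = c + \col_i (\int[lebesgue_measure]_(s in `[0, t]) B (Y s w) i 0)
            + S *m W t w} }.

Definition bounded_moments (T : R) k (Y : R -> Omega -> 'cV[R]_k) : Prop :=
  forall l : R, 0 <= l ->
    (ereal_sup [set \int[P]_w (enorm (Y t w) `^ l)%:E | t in `[0%R, T]%classic]
       < +oo)%E.

End Processes.

(* Main.v *)
(* On [0, T] the observed path is a linear image of the Wiener processes plus a path with
   a continuous density. The latter contributes negligibly to the realized covariation Q,
   and what remains is an average of independent quadratic forms of Gaussian vectors, so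
   for every symmetric B the characteristic function of sqrt n tr (B (Q - Sigma_0))
   converges to that of N(0, 2 tr (B Sigma_0 B Sigma_0)). Convergence in distribution
   follows from convergence of characteristic functions and tightness, bounded continuous
   functions being approximated on cubes by trigonometric polynomials.

   Near (Sigma_0, theta_0) the contrast F(Q, Sigma(theta)) is, up to a relatively small
   error, the quadratic form of W^-1 at vech (Q - Sigma_0) - Delta (theta - theta_0).
   Compactness and identifiability force minimizers close to theta_0, whence
   theta_hat = theta_0 + G vech (Q - Sigma_0) + o(|Q - Sigma_0|) with
   G = (Delta^T W^-1 Delta)^-1 Delta^T W^-1 and G W G^T = (Delta^T W^-1 Delta)^-1. *)
Require Import Defs.
From HB Require Import structures.
From mathcomp Require Import all_boot all_order all_algebra.
From mathcomp Require Import mxtens ring lra.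
From mathcomp Require Import all_classical all_reals all_analysis.
From mathcomp Require Import measurable_realfun.

Set Implicit Arguments.
Unset Strict Implicit.
Unset Printing Implicit Defensive.

Import Order.TTheory GRing.Theory Num.Theory.
Import numFieldNormedType.Exports.

Local Open Scope classical_set_scope.
Local Open Scope ring_scope.

(** * Borel column vectors, independence and expectations *)

(** Drift increments are of order 1/n and noise increments of order n^(-1/2), so Cauchy-Schwarz
    alone bounds sqrt n times the sum of their products by a constant, which is not small. The
    missing gain comes path by path from the continuity of the drift density. Such pathwise
    statements become statements in probability by dominated convergence, after truncation by a
    statistic with bounded mean.

    Gaussian facts are drawn from the given Wiener processes: a sum of independent Gaussians has the
    law of a sum of adjacent increments, and the Gaussian characteristic function results from the
    central limit bound applied to ever finer increments. Only E exp(t X^2) is computed from the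
    density; it yields the moments. Characteristic functions appear as pairs of real cosines and
    sines.

    Statements about minimizers are deterministic, for every positive semidefinite matrix near
    Sigma_0 and every minimizer, so that probability enters only through sqrt n (Q - Sigma_0). The
    matrix estimates use Schur complements and Cholesky factors in place of eigenvalues. *)

Lemma open_box_bigcup (R : realType) k (U : set 'cV[R]_k) : open U ->
  U = \bigcup_(x : 'cV[rat]_k * nat)
    (\bigcap_(i in [set: 'I_k]) [set y : 'cV[R]_k | `|y i 0 - ratr (x.1 i 0)| < x.2.+1%:R^-1]
      `&` [set y | (\bigcap_(i in [set: 'I_k]) [set z : 'cV[R]_k | `|z i 0 - ratr (x.1 i 0)| < x.2.+1%:R^-1]) `<=` U]).
Proof.
move=> oU; apply/seteqP; split => [y Uy|y [[c n] _ [/= h1 h2]]]; last exact: h2.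
have [e /= e0 he] : exists2 e : R, 0 < e & ball y e `<=` U.
  by have /nbhs_ballP[e e0 he] := open_nbhs_nbhs (conj oU Uy); exists e.
(* A rational centre within 1/(n+1) of [y], with a box of that radius, keeps every point of the box
   within 2/(n+1) < e of [y]. *)
pose n := Num.bound (2 / e).
have nE : n.+1%:R^-1 *+ 2 < e.
  have h : 2 / e < n.+1%:R.
    rewrite (lt_le_trans (archi_boundP _))// ?ler_nat//; first by rewrite divr_ge0 ?ltW.
  by rewrite -[_ *+ 2]mulr_natl ltr_pdivrMr// mulrC -ltr_pdivrMr.
have /(_ _) hq (i : 'I_k) : exists r : rat, `|y i 0 - ratr r| < n.+1%:R^-1.
  have : (y i 0 - n.+1%:R^-1 < y i 0 + n.+1%:R^-1).
    by rewrite ltrBlDr -addrA ltrDl addr_gt0// invr_gt0.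
  move=> /rat_in_itvoo[r]; rewrite in_itv/= => /andP[r1 r2]; exists r.
  by rewrite ltr_distlC r1 r2.
have {hq}[q hq] := choice hq.
exists (\col_i q i, n) => //; split => [i _ /=|z hz]; first by rewrite mxE; exact: hq.
apply: he; rewrite /ball/= /mx_ball; split => // i j; rewrite (ord1 j).
rewrite /ball/=; have := hz i I; rewrite /= mxE => h; have := hq i => h'.
rewrite -(subrK (ratr (q i)) (y i 0)) -addrA (le_lt_trans (ler_normD _ _))//.
by rewrite [X in _ + X]distrC; apply: lt_trans nE; rewrite mulr2n ltrD.
Qed.

Lemma measurable_coord (R : realType) k (i : 'I_k) :
  measurable_fun setT (fun x : borel_cV R k => x i 0).
Proof.
apply: (measurability _ (RGenOInfty.measurableE R)) => _ [_ [a ->] <-].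
rewrite setTI; apply: sub_sigma_algebra; rewrite set_itvoy.
apply: open_comp => [x _|]; last exact: open_gt.
exact: coord_continuous.
Qed.

(** The Borel sets are generated by the open sets, and an open set is a countable union of rational
    boxes, whose preimages involve one coordinate at a time. *)
Lemma measurable_cV d (T : measurableType d) (R : realType) k
    (f : T -> borel_cV R k) :
  (forall i, measurable_fun setT (fun w => f w i 0)) -> measurable_fun setT f.
Proof.
move=> mf; apply: (@measurability _ _ _ _ setT f (@open 'cV[R]_k)) => //.
move=> _ [U oU <-]; rewrite setTI (open_box_bigcup oU) preimage_bigcup.
apply: countable_bigcupT_measurable => [|[q n]].
  exact: countableP.
rewrite preimage_setI; apply: measurableI => /=.
  rewrite preimage_bigcap; apply: fin_bigcap_measurable => // i _.
  have m1 : measurable_fun setT (fun w => `|f w i 0 - ratr (q i 0)|).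
    by apply: measurableT_comp => //; exact: measurable_funB.
  have := m1 measurableT `]-oo, n.+1%:R^-1[%classic (measurable_itv _).
  rewrite setTI [X in _ X -> _](_ : _ = f @^-1` [set y | `|y i 0 - ratr (q i 0)| < n.+1%:R^-1])//.
(* [Q] says that the box lies in [U]. It does not mention the point, so this preimage is everything
   or nothing. *)
set Q := (X in [set _ | X]); have [hQ|hQ] := pselect Q.
  by rewrite (_ : [set _ | Q] = setT) ?preimage_setT//; apply/seteqP; split.
by rewrite (_ : [set _ | Q] = set0) ?preimage_set0//; apply/seteqP; split.
Qed.

Lemma measurable_cVP d (T : measurableType d) (R : realType) k
    (f : T -> borel_cV R k) :
  measurable_fun setT f <-> (forall i, measurable_fun setT (fun w => f w i 0)).
Proof.
split => [mf i|]; last exact: measurable_cV.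
exact: (measurableT_comp (@measurable_coord R k i) mf).
Qed.

Lemma continuous_measurable_cV (R : realType) k (f : 'cV[R]_k -> R) :
  continuous f -> measurable_fun setT (f : borel_cV R k -> R).
Proof.
move=> cf; apply: (measurability _ (RGenOInfty.measurableE R)) => _ [_ [a ->] <-].
rewrite setTI; apply: sub_sigma_algebra; rewrite set_itvoy.
apply: open_comp => [x _|]; last exact: open_gt.
exact: cf.
Qed.

Section Independence.
Context d (T : measurableType d) (R : realType) (P : probability T R).

Definition indep2 (F G : set (set T)) : Prop :=
  forall A B, F A -> G B -> P (A `&` B) = (P A * P B)%E.

Lemma indep2C F G : indep2 F G -> indep2 G F.
Proof. by move=> h A B GA FB; rewrite setIC muleC; exact: h. Qed.

(** For fixed [B], the probability of the intersection with [B] and the product of the probabilities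
    are finite measures in [A]. They agree on the pi-system [F], hence on the sigma-algebra it
    generates. *)
Lemma indep2_sigmal F G : F `<=` measurable -> G `<=` measurable ->
  setI_closed F -> F setT -> indep2 F G -> indep2 <<s F >> G.
Proof.
move=> mF mG FI FT h A B sA GB; have mB := mG _ GB.
have p0 : 0 <= fine (P B) by apply: fine_ge0.
pose m1 : measure T R := mrestr P mB.
pose m2 : measure T R := mscale (NngNum p0) P.
suff : m1 A = m2 A.
  by rewrite /m1 /m2 /= /mrestr /mscale/= fineK ?fin_num_measure// muleC.
apply: (@g_sigma_algebra_measure_unique _ _ _ F mF (fun=> setT)) => //.
- by rewrite bigcup_const//; exists 0%N.
- by move=> C FC; rewrite /m1 /m2 /= /mrestr /mscale/= fineK ?fin_num_measure// muleC; exact: h.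
- move=> _; rewrite /m1 /= /mrestr setTI.
  by rewrite (le_lt_trans (probability_le1 _ _))// ltry.
Qed.

Lemma indep2_sigma F G : F `<=` measurable -> G `<=` measurable ->
  setI_closed F -> F setT -> setI_closed G -> G setT ->
  indep2 F G -> indep2 <<s F >> <<s G >>.
Proof.
move=> mF mG FI FT GI GT h; apply: indep2_sigmal => //.
  by apply: smallest_sub => //; exact: sigma_algebra_measurable.
by apply/indep2C/indep2_sigmal => //; exact/indep2C.
Qed.

Definition indep_rv (X Y : T -> R) := forall A B, measurable A -> measurable B ->
  P (X @^-1` A `&` Y @^-1` B) = (P (X @^-1` A) * P (Y @^-1` B))%E.

Lemma indep_rv_comp (X Y : T -> R) (f g : R -> R) :
  measurable_fun setT f -> measurable_fun setT g ->
  indep_rv X Y -> indep_rv (f \o X) (g \o Y).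
Proof.
move=> mf mg h A B mA mB; rewrite -[(f \o X) @^-1` A]/(X @^-1` (f @^-1` A)) -[(g \o Y) @^-1` B]/(Y @^-1` (g @^-1` B)).
by apply: h; rewrite -[_ @^-1` _]setTI; [exact: mf|exact: mg].
Qed.

Variables X Y : T -> R.
Hypotheses (mX : measurable_fun setT X) (mY : measurable_fun setT Y).
Hypothesis XY : indep_rv X Y.

HB.instance Definition _ := isMeasurableFun.Build _ _ _ _ X mX.
HB.instance Definition _ := isMeasurableFun.Build _ _ _ _ Y mY.

Let mXY : measurable_fun setT (fun w => (X w, Y w)).
Proof. exact: measurable_fun_pair. Qed.

Lemma indep_rv_pushforward (C : set (R * R)) : measurable C ->
  P [set w | C (X w, Y w)] =
  (distribution P X \x distribution P Y)%E C.
Proof.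
move=> mC; apply/esym.
pose XYm : {RV P >-> (R * R)%type} := HB.pack (fun w => (X w, Y w)) (isMeasurableFun.Build _ _ _ _ _ mXY).
by apply: (@product_measure_unique _ _ _ _ _ _ _ (distribution P XYm)) => // A B mA mB; exact: XY.
Qed.

(** The joint law is the product of the marginals: Tonelli on absolute values gives integrability of
    the product, and Fubini factors its mean. *)
Lemma indep_rv_integral :
  P.-integrable setT (EFin \o X) -> P.-integrable setT (EFin \o Y) ->
  P.-integrable setT (EFin \o (X \* Y)) /\
  (\int[P]_w (X w * Y w) = (\int[P]_w X w) * (\int[P]_w Y w))%R.
Proof.
move=> iX iY.
pose XYm : {RV P >-> (R * R)%type} := HB.pack (fun w => (X w, Y w)) (isMeasurableFun.Build _ _ _ _ _ mXY).
pose f (z : R * R) := (z.1 * z.2)%:E.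
have mf : measurable_fun setT f.
  by apply/measurable_EFinP/measurable_funM; [exact: measurable_fst|exact: measurable_snd].
have mE C : measurable C -> distribution P XYm C = (distribution P X \x distribution P Y)%E C.
  exact: indep_rv_pushforward.
have EY (h : R -> \bar R) (Z : {RV P >-> R}) : measurable_fun setT h ->
    P.-integrable setT (h \o Z) -> (\int[distribution P Z]_y h y = \int[P]_w h (Z w))%E.
  by move=> mh ih; rewrite integral_distribution.
have fin (Z : T -> R) : P.-integrable setT (EFin \o Z) ->
    (\int[P]_w (Z w)%:E)%E = (\int[P]_w Z w)%:E.
  by move=> iZ; rewrite /Rintegral fineK//; exact: integrable_fin_num.
have finn (Z : T -> R) : P.-integrable setT (EFin \o Z) ->
    (\int[P]_w `|Z w|%:E)%E = (\int[P]_w `|Z w|)%:E.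
  by move=> iZ; apply: fin; exact: integrable_norm.
have mn : measurable_fun setT (fun y : R => `|y|%:E).
  by apply/measurable_EFinP; exact: normr_measurable.
have if12 : (distribution P X \x distribution P Y)%E.-integrable setT f.
  apply/integrable12ltyP => //.
  under eq_integral.
    move=> x _; under eq_integral do rewrite /f /= normrM EFinM.
    rewrite ge0_integralZl//.
    rewrite (EY (fun y => `|y|%:E) Y)//; last exact: integrable_norm.
    rewrite finn// -EFinM.
    over.
  rewrite (EY (fun y => (`|y| * (\int[P]_w `|Y w|))%:E) X).
  - under eq_integral do rewrite EFinM.
    rewrite integralZr//; last exact: integrable_norm.
    by rewrite finn// -EFinM ltry.
  - by apply/measurable_EFinP; apply: measurable_funM => //; exact: normr_measurable.
  - apply: (eq_integrable measurableT (fun w => (\int[P]_w `|Y w|)%:E * (`|X w|)%:E)%E).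
      by move=> w _ /=; rewrite -EFinM mulrC.
    by apply: integrableZl => //; exact: integrable_norm.
have eqI (h : R * R -> \bar R) : (\int[distribution P XYm]_z h z =
    \int[distribution P X \x distribution P Y]_z h z)%E.
  by apply: eq_measure_integral => A mA _; exact: mE.
have ifP : P.-integrable setT (f \o XYm).
  apply/integrableP; split.
    by apply: measurableT_comp => //.
  move/integrableP : if12 => [_].
  rewrite -eqI.
  rewrite ge0_integral_distribution//; exact: measurableT_comp.
split => //.
apply: EFin_inj; rewrite -fin//.
transitivity (\int[distribution P XYm]_z f z)%E; first by rewrite integral_distribution.
rewrite eqI -integral12_prod_meas1// /fubini_F.
under eq_integral.
  move=> x _; under eq_integral do rewrite /f /= EFinM.
  rewrite (EY (fun y => x%:E * y%:E)%E Y)//; last 2 first.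
  - by apply/measurable_EFinP; exact: measurable_funM.
  - exact: integrableZl.
  rewrite integralZl// fin// -EFinM.
  over.
rewrite (EY (fun y => (y * (\int[P]_w Y w))%:E) X).
- under eq_integral do rewrite EFinM.
  by rewrite integralZr// fin// -EFinM.
- by apply/measurable_EFinP; apply: measurable_funM.
- apply: (eq_integrable measurableT (fun w => (\int[P]_w Y w)%:E * (X w)%:E)%E).
    by move=> w _ /=; rewrite -EFinM mulrC.
  exact: integrableZl.
Qed.
End Independence.

Section Expectation.
Context d (T : measurableType d) (R : realType) (P : probability T R).
Implicit Types X Y : T -> R.

Definition integ X := P.-integrable setT (EFin \o X).

Lemma integ_measurable X : integ X -> measurable_fun setT X.
Proof. by move=> /measurable_int /measurable_EFinP. Qed.

Lemma integ_bounded X (M : R) : measurable_fun setT X ->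
  (forall w, `|X w| <= M) -> integ X.
Proof.
move=> mX XM; apply: measurable_bounded_integrable => //.
  by rewrite (le_lt_trans (probability_le1 _ _))// ltry.
exists M; split; first exact: num_real.
by move=> x Mx w _ /=; rewrite (le_trans (XM w))// ltW.
Qed.

Lemma integ_cst c : integ (fun=> c).
Proof. exact: (@integ_bounded _ `|c|). Qed.

Lemma integD X Y : integ X -> integ Y -> integ (fun w => X w + Y w).
Proof. exact: integrableD. Qed.

Lemma integB X Y : integ X -> integ Y -> integ (fun w => X w - Y w).
Proof. exact: integrableB. Qed.

Lemma integZ c X : integ X -> integ (fun w => c * X w).
Proof. exact: integrableZl. Qed.

Lemma integ_norm X : integ X -> integ (fun w => `|X w|).
Proof. exact: integrable_norm. Qed.

Lemma integ_le X Y : measurable_fun setT X -> (forall w, `|X w| <= Y w) ->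
  integ Y -> integ X.
Proof.
move=> mX XY; apply: le_integrable => //; first exact/measurable_EFinP.
by move=> w _ /=; rewrite lee_fin (le_trans (XY w))// ler_norm.
Qed.

Lemma integ_sum (I : Type) (s : seq I) (Q : pred I) (X : I -> T -> R) :
  (forall i, integ (X i)) -> integ (fun w => \sum_(i <- s | Q i) X i w).
Proof.
move=> iX; elim: s => [|i s IH].
  have -> : (fun w => \sum_(i <- [::] | Q i) X i w) = (fun=> 0).
    by apply/funext => w; rewrite big_nil.
  exact: integ_cst.
have -> : (fun w => \sum_(j <- i :: s | Q j) X j w) =
    (fun w => (if Q i then X i w else 0) + \sum_(j <- s | Q j) X j w).
  by apply/funext => w; rewrite big_cons; case: ifP; rewrite ?add0r.
by apply: integD => //; case: (Q i) => //; exact: integ_cst.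
Qed.

Lemma Rintegral_prob_cst (c : R) : \int[P]_w c = c.
Proof.
rewrite Rintegral_cst//.
have h : fine (P [set: T]) = 1.
  have : P [set: T] = 1%E by exact: probability_setT.
  by move=> ->.
exact: (etrans (congr1 (fun x => c * x) h) (mulr1 c)).
Qed.

Lemma RintD X Y : integ X -> integ Y ->
  \int[P]_w (X w + Y w) = \int[P]_w X w + \int[P]_w Y w.
Proof. by move=> *; rewrite RintegralD. Qed.

Lemma RintB X Y : integ X -> integ Y ->
  \int[P]_w (X w - Y w) = \int[P]_w X w - \int[P]_w Y w.
Proof. by move=> *; rewrite RintegralB. Qed.

Lemma RintZ c X : integ X -> \int[P]_w (c * X w) = c * \int[P]_w X w.
Proof. by move=> *; rewrite RintegralZl. Qed.

Lemma Rint_sum (I : Type) (s : seq I) (Q : pred I) (X : I -> T -> R) :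
  (forall i, integ (X i)) ->
  \int[P]_w (\sum_(i <- s | Q i) X i w) = \sum_(i <- s | Q i) \int[P]_w X i w.
Proof.
move=> iX; elim: s => [|i s IH].
  under eq_Rintegral do rewrite big_nil.
  by rewrite big_nil Rintegral_prob_cst.
under eq_Rintegral do rewrite big_cons.
rewrite big_cons; case: ifP => Qi; last exact: IH.
by rewrite RintD ?IH//; exact: integ_sum.
Qed.

Lemma Rint_le X Y : integ X -> integ Y -> (forall w, X w <= Y w) ->
  \int[P]_w X w <= \int[P]_w Y w.
Proof. by move=> iX iY XY; apply: le_Rintegral. Qed.

Lemma Rint_norm_le X : integ X -> `|\int[P]_w X w| <= \int[P]_w `|X w|.
Proof. by move=> iX; apply: le_normr_Rintegral. Qed.

Lemma Rint_fin X : integ X -> (\int[P]_w (X w)%:E)%E = (\int[P]_w X w)%:E.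
Proof. by move=> iX; rewrite /Rintegral fineK//; exact: integrable_fin_num. Qed.

Lemma prob_fin A : measurable A -> P A = (fine (P A))%:E.
Proof. by move=> mA; rewrite fineK ?fin_num_measure. Qed.

Lemma prob_fine_le A B : measurable A -> measurable B -> A `<=` B ->
  fine (P A) <= fine (P B).
Proof. by move=> mA mB AB; rewrite -lee_fin -!prob_fin// le_measure ?inE. Qed.

Lemma prob_fine_leU A B C : measurable A -> measurable B -> measurable C ->
  A `<=` B `|` C -> fine (P A) <= fine (P B) + fine (P C).
Proof.
move=> mA mB mC ABC; rewrite -lee_fin EFinD -!prob_fin//.
rewrite (@le_trans _ _ (P (B `|` C)))//; last exact: measureU2.
by rewrite le_measure ?inE//; exact: measurableU.
Qed.

Lemma Rint_indic A : measurable A -> \int[P]_w (\1_A w : R) = fine (P A).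
Proof. by move=> mA; rewrite /Rintegral integral_indic// setIT. Qed.

Lemma integ_indic A : measurable A -> integ (\1_A : T -> R).
Proof.
move=> mA; apply: (@integ_bounded _ 1); first exact: measurable_indic.
by move=> w; rewrite indicE; case: (_ \in _); rewrite ?normr0 ?normr1.
Qed.

Lemma markov_ineq X (a : R) : 0 < a -> (forall w, 0 <= X w) -> integ X ->
  fine (P [set w | a <= X w]) <= (\int[P]_w X w) / a.
Proof.
move=> a0 X0 iX; have mX := integ_measurable iX.
have mA : measurable [set w | a <= X w].
  by rewrite -[X in measurable X]setTI; exact: measurable_fun_le.
rewrite ler_pdivlMr// mulrC -Rint_indic// -RintZ; last exact: integ_indic.
apply: Rint_le => //; first by apply: integZ; exact: integ_indic.
move=> w; rewrite indicE; case: (boolP (w \in _)); last by rewrite mulr0.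
by rewrite inE/= mulr1.
Qed.

End Expectation.

(** * Gaussian moments *)

Section RealInequalities.
Variable R : realType.
Implicit Types (f df g dg : R -> R) (x y : R).

Lemma ger0_is_derive_le f df (a b : R) :
  (forall x, is_derive x 1 f (df x)) -> a <= b ->
  (forall x, a <= x <= b -> 0 <= df x) -> f a <= f b.
Proof.
move=> fd ab df0.
have fc : {within `[a, b], continuous f}.
  apply: continuous_subspaceT => z.
  by apply: differentiable_continuous; apply/derivable1_diffP; have [] := fd z.
have [c] := MVT_segment ab (fun x _ => fd x) fc.
by rewrite in_itv/= => cab e; rewrite -subr_ge0 e mulr_ge0 ?subr_ge0// df0.
Qed.

(** The three nonnegative functions in the proof form a chain: each of the last two vanishes at 0
    and has the preceding one as derivative. *)
Lemma expRN_taylor x : 0 <= x -> [/\ 1 - x <= expR (- x),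
  expR (- x) <= 1 - x + x ^+ 2 / 2 & 1 - x + x ^+ 2 / 2 - x ^+ 3 / 6 <= expR (- x)].
Proof.
move=> x0.
have h1 y : 0 <= y -> 0 <= expR (- y) - 1 + y.
  by move=> y0; have := expR_ge1Dx (- y); lra.
have h2 y : 0 <= y -> 0 <= 1 - y + y ^+ 2 / 2 - expR (- y).
  move=> y0; pose f (z : R) := 1 - z + z ^+ 2 / 2 - expR (- z).
  have -> : 0 = f 0 by rewrite /f oppr0 expR0; ring.
  apply: (@ger0_is_derive_le f (fun z => expR (- z) - 1 + z)) => // [z|z /andP[z0 _]]; last exact: h1.
  rewrite /f; apply: is_derive_eq; by rewrite scaler0 /GRing.scale/=; field.
have h3 y : 0 <= y -> 0 <= expR (- y) - 1 + y - y ^+ 2 / 2 + y ^+ 3 / 6.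
  move=> y0; pose f (z : R) := expR (- z) - 1 + z - z ^+ 2 / 2 + z ^+ 3 / 6.
  have -> : 0 = f 0 by rewrite /f oppr0 expR0; ring.
  apply: (@ger0_is_derive_le f (fun z => 1 - z + z ^+ 2 / 2 - expR (- z))) => // [z|z /andP[z0 _]]; last exact: h2.
  rewrite /f; apply: is_derive_eq; by rewrite !scaler0 /GRing.scale/=; field.
have := h1 _ x0; have := h2 _ x0; have := h3 _ x0.
by split; lra.
Qed.

Lemma expRN_ge1Dx_sub x : 0 <= x ->
  `|expR (- x) - 1 + x - x ^+ 2 / 2| <= x ^+ 3 / 6.
Proof.
move=> x0; have [_ h2 h3] := expRN_taylor x0; have := exprn_ge0 3 x0.
by rewrite ler_norml => *; apply/andP; split; lra.
Qed.

(** The same chain of antiderivatives as for the exponential, started from cos <= 1 and alternating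
    between sine and cosine. *)
Lemma sin_cos_taylor x : 0 <= x ->
  [/\ x - x ^+ 3 / 6 <= sin x, sin x <= x,
      1 - x ^+ 2 / 2 <= cos x & cos x <= 1 - x ^+ 2 / 2 + x ^+ 4 / 24].
Proof.
move=> x0.
have h1 y : 0 <= y -> 0 <= y - sin y.
  move=> y0; pose f (z : R) := z - sin z.
  have -> : 0 = f 0 by rewrite /f sin0; ring.
  apply: (@ger0_is_derive_le f (fun z => 1 - cos z)) => //.
have h2 y : 0 <= y -> 0 <= cos y - 1 + y ^+ 2 / 2.
  move=> y0; pose f (z : R) := cos z - 1 + z ^+ 2 / 2.
  have -> : 0 = f 0 by rewrite /f cos0; ring.
  apply: (@ger0_is_derive_le f (fun z => z - sin z)) => // [z|z /andP[z0 _]]; last exact: h1.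
  by rewrite /f; apply: is_derive_eq; rewrite !scaler0 /GRing.scale/=; field.
have h3 y : 0 <= y -> 0 <= sin y - y + y ^+ 3 / 6.
  move=> y0; pose f (z : R) := sin z - z + z ^+ 3 / 6.
  have -> : 0 = f 0 by rewrite /f sin0; ring.
  apply: (@ger0_is_derive_le f (fun z => cos z - 1 + z ^+ 2 / 2)) => // [z|z /andP[z0 _]]; last exact: h2.
  by rewrite /f; apply: is_derive_eq; rewrite !scaler0 /GRing.scale/=; field.
have h4 y : 0 <= y -> 0 <= 1 - y ^+ 2 / 2 + y ^+ 4 / 24 - cos y.
  move=> y0; pose f (z : R) := 1 - z ^+ 2 / 2 + z ^+ 4 / 24 - cos z.
  have -> : 0 = f 0 by rewrite /f cos0; ring.
  apply: (@ger0_is_derive_le f (fun z => sin z - z + z ^+ 3 / 6)) => // [z|z /andP[z0 _]]; last exact: h3.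
  by rewrite /f; apply: is_derive_eq; rewrite !scaler0 /GRing.scale/=; field.
have := h1 _ x0; have := h2 _ x0; have := h3 _ x0; have := h4 _ x0.
by split; lra.
Qed.

Lemma normr_sin_sub_le x : `|sin x - x| <= `|x| ^+ 3 / 6.
Proof.
have h y : 0 <= y -> `|sin y - y| <= y ^+ 3 / 6.
  move=> y0; have [a b _ _] := sin_cos_taylor y0; have := exprn_ge0 3 y0.
  by rewrite ler_norml => *; apply/andP; split; lra.
have [x0|/ltW x0] := leP 0 x; first by rewrite (ger0_norm x0); exact: h.
rewrite (ler0_norm x0) -normrN opprD opprK -sinN.
by have := h (- x); rewrite oppr_ge0 opprK; exact.
Qed.

Lemma normr_cos_sub_le x : `|cos x - (1 - x ^+ 2 / 2)| <= x ^+ 4 / 24.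
Proof.
have h y : 0 <= y -> `|cos y - (1 - y ^+ 2 / 2)| <= y ^+ 4 / 24.
  move=> y0; have [_ _ a b] := sin_cos_taylor y0; have := exprn_ge0 4 y0.
  by rewrite ler_norml => *; apply/andP; split; lra.
have [x0|/ltW x0] := leP 0 x; first exact: h.
have := h (- x); rewrite cosN sqrrN oppr_ge0 (_ : (- x) ^+ 4 = x ^+ 4); last by ring.
exact.
Qed.

(** Serves to compare Taylor coefficients at 0: dividing by [s] and letting it tend to 0 kills [c1],
    after which dividing by [s ^+ 2] kills [c2]. *)
Lemma quadratic_O3_eq0 (c1 c2 K : R) :
  (forall s, 0 < s <= 1 -> `|c1 * s + c2 * s ^+ 2| <= K * s ^+ 3) -> c1 = 0 /\ c2 = 0.
Proof.
move=> h.
have key (c C : R) : (forall s : R, 0 < s <= 1 -> `|c| <= C * s) -> c = 0.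
  move=> hc; apply/eqP; rewrite -normr_le0; apply/ler_addgt0Pl => e e0; rewrite addr0.
  have [C0|C0] := leP C 0.
    by have := hc 1; rewrite ltr01 lexx => /(_ isT); rewrite mulr1 => /le_trans; apply; exact: ltW (le_lt_trans C0 e0).
  pose s := Num.min 1 (e / C).
  have s0 : 0 < s by rewrite lt_min ltr01 divr_gt0.
  apply: le_trans (hc s _) _; first by rewrite s0 ge_min lexx.
  by rewrite -ler_pdivlMl// mulrC /s ge_min lexx orbT.
have c10 : c1 = 0.
  apply: (key _ (`|K| + `|c2|)) => s /andP[s0 s1].
  have := h s; rewrite s0 s1 => /(_ isT) hs.
  rewrite -(ler_pM2r s0) -{1}(gtr0_norm s0) -normrM.
  have -> : c1 * s = (c1 * s + c2 * s ^+ 2) - c2 * s ^+ 2 by ring.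
  rewrite (le_trans (ler_normB _ _))// -mulrA mulrDl lerD//.
    rewrite (le_trans hs)// exprS expr2.
    rewrite (le_trans (ler_wpM2r _ (ler_norm _)))//; first by rewrite !mulr_ge0// ltW.
    by rewrite ler_wpM2l// -[leRHS]mul1r ler_wpM2r// mulr_ge0// ltW.
  by rewrite normrM expr2 [X in _ * X]ger0_norm// mulr_ge0// ltW.
split=> //; apply: (key _ K) => s /andP[s0 s1].
have := h s; rewrite s0 s1 c10 mul0r add0r normrM => /(_ isT).
rewrite [`|_ ^+ 2|]ger0_norm ?sqr_ge0// (_ : K * s ^+ 3 = K * s * s ^+ 2); last by ring.
by rewrite ler_pM2r// exprn_gt0.
Qed.

End RealInequalities.

Section NormalIntegral.
Variable R : realType.
Local Notation mu := (@lebesgue_measure R).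

(** The change of variables formula speaks of a Radon-Nikodym derivative, which uniqueness
    identifies almost everywhere with the Gaussian density. *)
Lemma ge0_integral_normal_prob (m s : R) (f : R -> \bar R) :
  measurable_fun setT f -> (forall x, 0 <= f x)%E ->
  (\int[normal_prob m s]_x f x = \int[mu]_x (f x * (normal_pdf m s x)%:E))%E.
Proof.
move=> mf f0; have dom := normal_prob_dominates m s.
rewrite -(Radon_Nikodym_SigmaFinite.change_of_variables dom)//.
have ig := Radon_Nikodym_SigmaFinite.f_integrable dom.
have mg := measurable_int _ ig.
have mpdf : measurable_fun setT (fun x : R => (normal_pdf m s x)%:E).
  by apply/measurable_EFinP; exact: measurable_normal_pdf.
apply: ae_eq_integral => //; [exact: emeasurable_funM..|].
have : ae_eq mu setT (Radon_Nikodym_SigmaFinite.f (normal_prob m s) mu)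
    (fun x : R => (normal_pdf m s x)%:E).
  apply: integral_ae_eq => // E _ mE.
  by rewrite -Radon_Nikodym_SigmaFinite.f_integral.
by apply: filterS => x /= h Dx; rewrite h.
Qed.

Lemma integral_expR_sqr_normal (s t : R) : s != 0 -> 0 < 1 - 2 * t * s ^+ 2 ->
  (\int[normal_prob 0 s]_x (expR (t * x ^+ 2))%:E =
   (Num.sqrt (1 - 2 * t * s ^+ 2))^-1%:E)%E.
Proof.
move=> s0 c0; set c := 1 - _ in c0 *.
rewrite ge0_integral_normal_prob; last 2 first.
- apply/measurable_EFinP; apply: measurableT_comp => //.
  by apply: measurable_funM => //; exact: measurable_funX.
- by move=> x; rewrite lee_fin expR_ge0.
(* The standard deviation for which exp(t x^2) times the centred density of deviation [s] is
   proportional to the centred density of deviation [u]. The ratio of the two peaks is the value of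
   the integral. *)
pose u := `|s| / Num.sqrt c.
have sc : 0 < Num.sqrt c by rewrite sqrtr_gt0.
have u0 : u != 0 by rewrite mulf_neq0// ?normr_eq0// invr_eq0 gt_eqF.
have u2 : u ^+ 2 = s ^+ 2 / c.
  by rewrite /u exprMn exprVn sqr_sqrtr ?ltW// real_normK ?num_real.
have pE : normal_peak s = (Num.sqrt c)^-1 * normal_peak u.
  rewrite /normal_peak u2 -invfM; congr (_^-1).
  rewrite -sqrtrM ?ltW//; congr Num.sqrt.
  by field; rewrite gt_eqF.
transitivity (\int[mu]_x ((Num.sqrt c)^-1%:E * (normal_pdf 0 u x)%:E))%E.
  apply: eq_integral => x _; rewrite !normal_pdfE// -!EFinM pE mulrCA -!mulrA.
  congr (_ * (_ * _))%:E.
  rewrite /normal_fun -expRD u2 !subr0; congr expR.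
  have cn : 1 - s ^+ 2 * (2 * t) != 0 by rewrite mulrC; exact: lt0r_neq0.
  have -> : s ^+ 2 / c *+ 2 = s ^+ 2 *+ 2 / c by rewrite mulrnAl.
  by rewrite invf_div mulrA /c; field.
have mpdf : measurable_fun setT (fun x : R => (normal_pdf 0 u x)%:E).
  by apply/measurable_EFinP; exact: measurable_normal_pdf.
rewrite ge0_integralZl ?integral_normal_pdf ?mule1//.
by move=> x _; rewrite lee_fin normal_pdf_ge0.
Qed.
End NormalIntegral.

Section GaussRv.
Context d (T : measurableType d) (R : realType) (P : probability T R).

(** Zero variance is included, as the point mass at 0: it occurs for linear forms that do not see
    the noise. *)
Definition gauss_rv (X : T -> R) (v : R) := measurable_fun setT X /\
  forall A, measurable A -> P (X @^-1` A) = gauss1 0 v A.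

Variables (X : T -> R) (v : R).
Hypotheses (v0 : 0 <= v) (gX : gauss_rv X v).

Let mX : measurable_fun setT X. Proof. by case: gX. Qed.
HB.instance Definition _ := isMeasurableFun.Build _ _ _ _ X mX.

Lemma integral_expR_sqr_gauss t : 0 < 1 - 2 * t * v ->
  (\int[P]_w (expR (t * X w ^+ 2))%:E = (Num.sqrt (1 - 2 * t * v))^-1%:E)%E.
Proof.
move=> c0; pose f (x : R) := (expR (t * x ^+ 2))%:E.
have mf : measurable_fun setT f.
  apply/measurable_EFinP; apply: measurableT_comp => //.
  by apply: measurable_funM => //; exact: measurable_funX.
have f0 x : (0 <= f x)%E by rewrite lee_fin expR_ge0.
transitivity (\int[distribution P X]_x f x)%E; first by rewrite ge0_integral_distribution.
have [vE|vn0] := eqVneq v 0.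
  rewrite (eq_measure_integral (dirac (0 : R))); last first.
    by move=> A mA _; have := gX.2 _ mA; rewrite /gauss1 vE eqxx.
  by rewrite integral_dirac//= diracT mul1e /f vE expr0n /= !mulr0 subr0 sqrtr1 invr1 expR0.
pose X' : T -> measurableTypeR R := X.
have mX' : measurable_fun setT X' by exact: mX.
pose X'' : {mfun T >-> measurableTypeR R} := HB.pack X' (isMeasurableFun.Build _ _ _ _ _ mX').
transitivity (\int[distribution P X'']_x f x)%E; first by rewrite !ge0_integral_distribution.
rewrite (eq_measure_integral (normal_prob 0 (Num.sqrt v))); last first.
  by move=> A mA _; have := gX.2 _ mA; rewrite /gauss1 (negbTE vn0).
by rewrite integral_expR_sqr_normal ?sqr_sqrtr// sqrtr_eq0 -ltNge lt0r vn0.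
Qed.

Lemma integrable_gaussX n : integ P (fun w => X w ^+ n).
Proof.
rewrite /integ.
(* Gives 2 t v = v / (2 (v + 1)) < 1, so that exp(t X^2) is integrable, and remains meaningful for v
   = 0. *)
pose t := (4 * (v + 1))^-1.
have v1 : 0 < v + 1 by rewrite ltr_wpDl.
have t0 : 0 < t by rewrite invr_gt0 mulr_gt0.
have tv : 0 < 1 - 2 * t * v.
  rewrite subr_gt0 /t mulrAC ltr_pdivrMr ?mulr_gt0// mul1r; lra.
have iE : P.-integrable setT (fun w => (expR (t * X w ^+ 2))%:E).
  apply/integrableP; split.
    apply/measurable_EFinP; apply: measurableT_comp => //.
    by apply: measurable_funM => //; exact: measurable_funX.
  under eq_integral do rewrite /= ger0_norm ?expR_ge0//.
  by rewrite integral_expR_sqr_gauss// ltry.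
have k0 : 0 <= (n%:R / t) ^+ n by rewrite exprn_ge0// divr_ge0// ltW.
apply: (le_integrable measurableT _ _ (integrableZl measurableT (1 + (n%:R / t) ^+ n) iE)).
  by apply/measurable_EFinP; exact: measurable_funX.
move=> w _; rewrite -EFinM !abse_EFin lee_fin [leRHS]ger0_norm ?mulr_ge0 ?addr_ge0 ?expR_ge0//.
rewrite normrX mulrDl mul1r.
have y0 : 0 <= `|X w| by [].
have [y1|y1] := leP `|X w| 1.
  rewrite ler_wpDr ?mulr_ge0 ?expR_ge0//.
  apply: (@le_trans _ _ 1); first exact: exprn_ile1.
  by rewrite -[leLHS]expR0 ler_expR mulr_ge0 ?sqr_ge0// ltW.
rewrite ler_wpDl ?expR_ge0//.
have [->|n0] := posnP n; first by rewrite !expr0 mul1r -[leLHS]expR0 ler_expR mulr_ge0 ?sqr_ge0// ltW.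
apply: (@le_trans _ _ ((`|X w| ^+ 2) ^+ n)).
  by rewrite lerXn2r ?nnegrE ?exprn_ge0// expr2 ler_pMr ?ltW// (lt_trans ltr01).
(* The inequality 1 + y <= exp y at y = t x^2 / n, raised to the power n, gives x^(2n) <= (n / t)^n
   exp(t x^2). *)
have n0' : 0 < n%:R :> R by rewrite ltr0n.
have -> : t * X w ^+ 2 = n%:R * (t / n%:R * X w ^+ 2) by field; rewrite gt_eqF.
rewrite expRM_natl -exprMn lerXn2r ?nnegrE ?exprn_ge0//.
  by rewrite mulr_ge0 ?expR_ge0// divr_ge0// ltW.
rewrite real_normK ?num_real// -ler_pdivrMl ?divr_gt0// invf_div.
by rewrite (le_trans _ (expR_ge1Dx _))// lerDr.
Qed.

Lemma Rintegral_expR_sqr_gauss s : 0 <= s ->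
  \int[P]_w expR (- (s * X w ^+ 2)) = (Num.sqrt (1 + 2 * s * v))^-1.
Proof.
move=> s0; rewrite /Rintegral.
under eq_integral do rewrite -mulNr.
rewrite integral_expR_sqr_gauss//= mulrN mulNr opprK//.
by rewrite ltr_wpDr// mulr_ge0// mulr_ge0.
Qed.

(* Compare the Taylor coefficients at s = 0 in E[exp(- s X^2)]^2 (1 + 2 v s) = 1. *)
Lemma gauss_moments : \int[P]_w (X w ^+ 2) = v /\ \int[P]_w (X w ^+ 4) = 3 * v ^+ 2.
Proof.
pose a := \int[P]_w (X w ^+ 2); pose m4 := \int[P]_w (X w ^+ 4).
pose b := m4 / 2; pose m6 := \int[P]_w (X w ^+ 6).
pose M s := \int[P]_w expR (- (s * X w ^+ 2)).
have a0 : 0 <= a by apply: Rintegral_ge0 => w _; exact: sqr_ge0.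
have b0 : 0 <= b.
  by rewrite divr_ge0//; apply: Rintegral_ge0 => w _; exact: (@exprn_even_ge0 _ 4).
have m60 : 0 <= m6.
  by apply: Rintegral_ge0 => w _; exact: (@exprn_even_ge0 _ 6).
have iM s : 0 <= s -> integ P (fun w => expR (- (s * X w ^+ 2))).
  move=> s0; apply: measurable_bounded_integrable => //.
  - by rewrite (le_lt_trans (probability_le1 _ _))// ltry.
  - apply: measurableT_comp => //; apply: measurableT_comp => //.
    by apply: measurable_funM => //; exact: measurable_funX.
  - exists 1; split; first exact: num_real.
    move=> x x1 w _ /=; rewrite (le_trans _ (ltW x1))// ger0_norm ?expR_ge0//.
    by rewrite -[leRHS]expR0 ler_expR oppr_le0 mulr_ge0// sqr_ge0.
have MK s : 0 <= s -> `|M s - (1 - a * s + b * s ^+ 2)| <= m6 / 6 * s ^+ 3.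
  move=> s0.
  have i2 := integZ s (integrable_gaussX 2).
  have i4 := integZ (s ^+ 2 / 2) (integrable_gaussX 4).
  have i6 := integZ (s ^+ 3 / 6) (integrable_gaussX 6).
  have i12 := integB (integ_cst P 1) i2.
  have i124 := integD i12 i4.
  have -> : 1 - a * s + b * s ^+ 2 = \int[P]_w (1 - s * X w ^+ 2 + s ^+ 2 / 2 * X w ^+ 4).
    rewrite RintD// RintB//; last exact: integ_cst.
    rewrite Rintegral_prob_cst !RintZ; [|exact: integrable_gaussX..].
    by rewrite -/a -/m4 /b; ring.
  rewrite -RintB//; last exact: iM.
  have i_ := integB (iM _ s0) i124.
  rewrite (le_trans (Rint_norm_le i_))//.
  have -> : m6 / 6 * s ^+ 3 = \int[P]_w (s ^+ 3 / 6 * X w ^+ 6).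
    by rewrite RintZ; [rewrite -/m6; ring|exact: integrable_gaussX].
  apply: Rint_le => //; first exact: integ_norm.
  move=> w; have := @expRN_ge1Dx_sub R (s * X w ^+ 2).
  rewrite mulr_ge0 ?sqr_ge0// => /(_ isT) h; rewrite (le_trans _ (le_trans h _))//.
    by rewrite le_eqVlt; apply/orP; left; apply/eqP; congr (`| _ |); ring.
  by rewrite le_eqVlt; apply/orP; left; apply/eqP; ring.
have M1 s : 0 <= s -> M s ^+ 2 * (1 + 2 * v * s) = 1.
  move=> s0; rewrite /M Rintegral_expR_sqr_gauss// exprVn sqr_sqrtr.
    by rewrite mulrAC [2 * v * s]mulrAC mulVf ?mul1r// lt0r_neq0// ltr_wpDr// !mulr_ge0.
  by rewrite ler_wpDr// !mulr_ge0.
have M01 s : 0 <= s -> 0 <= M s <= 1.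
  move=> s0; apply/andP; split; first by apply: Rintegral_ge0 => w _; exact: expR_ge0.
  rewrite /M Rintegral_expR_sqr_gauss// invf_le1; last first.
    by rewrite sqrtr_gt0 ltr_wpDr// !mulr_ge0.
  by rewrite -[leLHS]sqrtr1 ler_wsqrtr// lerDl !mulr_ge0.
(* The polynomial p = 1 - a s + b s^2 approximates E exp(- s X^2) up to order s^3. The first two
   arguments are the coefficients of s and s^2 in p^2 (1 + 2 v s) - 1; the constant collects those
   of s^3, s^4, s^5 and the error of p. Their vanishing gives a = v and b = 3 v^2 / 2. *)
have [] := @quadratic_O3_eq0 R (2 * v - 2 * a) (a ^+ 2 + 2 * b - 4 * a * v)
  (`|-2 * a * b + 2 * v * (a ^+ 2 + 2 * b)| + `|b ^+ 2 - 4 * a * b * v| + `|2 * v * b ^+ 2|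
   + (m6 / 6 * (2 + a + b)) * (1 + 2 * v)).
  move=> s /andP[s0 s1]; have s0' := ltW s0.
  pose p := 1 - a * s + b * s ^+ 2.
  set k3 := -2 * a * b + _; set k4 := b ^+ 2 - _; set k5 := 2 * v * b ^+ 2.
  have sX k : s ^+ (k + 3) <= s ^+ 3.
    by rewrite exprD ler_piMl ?exprn_ge0// exprn_ile1.
  have -> : (2 * v - 2 * a) * s + (a ^+ 2 + 2 * b - 4 * a * v) * s ^+ 2 =
     (p - M s) * (p + M s) * (1 + 2 * v * s) - (k3 * s ^+ 3 + k4 * s ^+ 4 + k5 * s ^+ 5).
    have -> : (p - M s) * (p + M s) * (1 + 2 * v * s) =
        p ^+ 2 * (1 + 2 * v * s) - M s ^+ 2 * (1 + 2 * v * s) by ring.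
    by rewrite M1// /p /k3 /k4 /k5; ring.
  rewrite (le_trans (ler_normB _ _))// [leRHS]mulrDl [leRHS]addrC lerD//; last first.
    rewrite (le_trans (ler_normD _ _))// [leRHS]mulrDl lerD//.
      rewrite (le_trans (ler_normD _ _))// [leRHS]mulrDl lerD//.
        by rewrite normrM (ger0_norm (exprn_ge0 3 s0')).
      by rewrite normrM (ger0_norm (exprn_ge0 4 s0')) ler_wpM2l// (sX 1%N).
    by rewrite normrM (ger0_norm (exprn_ge0 5 s0')) ler_wpM2l// (sX 2%N).
  rewrite !normrM [leRHS]mulrAC; apply: ler_pM => //.
    rewrite [leRHS]mulrAC; apply: ler_pM => //.
      by rewrite distrC; exact: MK.
    rewrite (le_trans (ler_normD _ _))//; have /andP[M0 ?] := M01 _ s0'.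
    rewrite (ger0_norm M0); apply: (@le_trans _ _ ((1 + a + b) + 1)); last by lra.
    apply: lerD => //; rewrite /p (le_trans (ler_normD _ _))// lerD//.
      rewrite (le_trans (ler_normB _ _))// normr1 lerD// normrM !ger0_norm//.
      by rewrite ler_piMr.
    by rewrite normrM !ger0_norm ?exprn_ge0// ler_piMr// exprn_ile1.
  rewrite ger0_norm; last by rewrite addr_ge0// !mulr_ge0.
  by rewrite lerD2l ler_piMr// mulr_ge0.
move=> e1 e2; have av : a = v by lra.
by split => //; rewrite -/m4; move: e2; rewrite av /b; lra.
Qed.
End GaussRv.

(** * A central limit theorem for characteristic functions *)

Section CharacteristicCLT.
Context d (T : measurableType d) (R : realType) (P : probability T R).

Lemma integ_cos (X : T -> R) : measurable_fun setT X -> integ P (fun w => cos (X w)).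
Proof.
move=> mX; apply: (@integ_bounded _ _ _ _ _ 1).
  by apply: measurableT_comp => //; apply: continuous_measurable_fun; exact: continuous_cos.
by move=> w; rewrite ler_norml cos_geN1 cos_le1.
Qed.

Lemma integ_sin (X : T -> R) : measurable_fun setT X -> integ P (fun w => sin (X w)).
Proof.
move=> mX; apply: (@integ_bounded _ _ _ _ _ 1).
  by apply: measurableT_comp => //; apply: continuous_measurable_fun; exact: continuous_sin.
by move=> w; rewrite ler_norml sin_geN1 sin_le1.
Qed.

Lemma normr_Ecos_le1 (X : T -> R) : measurable_fun setT X -> `|\int[P]_w cos (X w)| <= 1.
Proof.
move=> mX; have iX := integ_cos mX.
rewrite (le_trans (Rint_norm_le iX))// -[leRHS](Rintegral_prob_cst P).
apply: Rint_le; [exact: integ_norm|exact: integ_cst|].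
by move=> w; rewrite ler_norml cos_geN1 cos_le1.
Qed.

Lemma normr_Esin_le1 (X : T -> R) : measurable_fun setT X -> `|\int[P]_w sin (X w)| <= 1.
Proof.
move=> mX; have iX := integ_sin mX.
rewrite (le_trans (Rint_norm_le iX))// -[leRHS](Rintegral_prob_cst P).
apply: Rint_le; [exact: integ_norm|exact: integ_cst|].
by move=> w; rewrite ler_norml sin_geN1 sin_le1.
Qed.

(** Multiplicativity of the characteristic function on independent sums, split into real and
    imaginary parts. *)
Lemma indep_cos_sin (X Y : T -> R) :
  measurable_fun setT X -> measurable_fun setT Y -> indep_rv P X Y ->
  \int[P]_w cos (X w + Y w) = (\int[P]_w cos (X w)) * (\int[P]_w cos (Y w))
     - (\int[P]_w sin (X w)) * (\int[P]_w sin (Y w)) /\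
  \int[P]_w sin (X w + Y w) = (\int[P]_w sin (X w)) * (\int[P]_w cos (Y w))
     + (\int[P]_w cos (X w)) * (\int[P]_w sin (Y w)).
Proof.
move=> mX mY XY.
have mc : measurable_fun setT (@cos R).
  by apply: continuous_measurable_fun; exact: continuous_cos.
have ms : measurable_fun setT (@sin R).
  by apply: continuous_measurable_fun; exact: continuous_sin.
have h (f g : R -> R) : measurable_fun setT f -> measurable_fun setT g ->
    integ P (f \o X) -> integ P (g \o Y) -> integ P (fun w => f (X w) * g (Y w)) /\
    \int[P]_w (f (X w) * g (Y w)) = \int[P]_w f (X w) * \int[P]_w g (Y w).
  move=> mf mg iX iY; apply: (@indep_rv_integral _ _ _ _ (f \o X) (g \o Y)) => //.
  - exact: measurableT_comp.
  - exact: measurableT_comp.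
  - exact: indep_rv_comp.
have [i1 e1] := h _ _ mc mc (integ_cos mX) (integ_cos mY).
have [i2 e2] := h _ _ ms ms (integ_sin mX) (integ_sin mY).
have [i3 e3] := h _ _ ms mc (integ_sin mX) (integ_cos mY).
have [i4 e4] := h _ _ mc ms (integ_cos mX) (integ_sin mY).
split.
  by rewrite -e1 -e2 -RintB//; apply: eq_Rintegral => w _; rewrite cosD.
by rewrite -e3 -e4 -RintD//; apply: eq_Rintegral => w _; rewrite sinD.
Qed.

(** The factors of the characteristic function are replaced one at a time by the real number [rho].
    Each replacement costs [eta] for the cosine and [eta] for the sine, and earlier errors do not
    grow since [rho] is at most 1. *)
Lemma cos_sum_indep (n : nat) (a : nat -> T -> R) (rho eta : R) :
  0 <= rho <= 1 ->
  (forall i, (i < n)%N -> measurable_fun setT (a i)) ->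
  (forall i, (i < n)%N -> indep_rv P (fun w => \sum_(0 <= j < i) a j w) (a i)) ->
  (forall i, (i < n)%N -> `|\int[P]_w cos (a i w) - rho| <= eta /\
     `|\int[P]_w sin (a i w)| <= eta) ->
  `|\int[P]_w cos (\sum_(0 <= i < n) a i w) - rho ^+ n| <= 2 * n%:R * eta /\
  `|\int[P]_w sin (\sum_(0 <= i < n) a i w)| <= 2 * n%:R * eta.
Proof.
move=> /andP[rho0 rho1].
elim: n => [|n IH] ma ia ca.
  have -> : (fun w => cos (\sum_(0 <= i < 0) a i w)) = fun=> 1.
    by apply/funext => w; rewrite big_geq// cos0.
  have -> : (fun w => sin (\sum_(0 <= i < 0) a i w)) = fun=> 0.
    by apply/funext => w; rewrite big_geq// sin0.
  by rewrite !Rintegral_prob_cst expr0 subrr normr0 mulr0 mul0r.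
have [||| IHc IHs] := IH.
- by move=> i ?; apply: ma; exact: ltnW.
- by move=> i ?; apply: ia; exact: ltnW.
- by move=> i ?; apply: ca; exact: ltnW.
pose S w := \sum_(0 <= i < n) a i w.
have mS : measurable_fun setT S.
  have -> : S = (fun w => \sum_(i <- index_iota 0 n | (i < n)%N) a i w).
    by apply/funext => w; rewrite /S big_nat.
  elim: (index_iota 0 n) => [|i s ihs].
    by rewrite (_ : (fun w => _) = fun=> 0)//; apply/funext => w; rewrite big_nil.
  rewrite (_ : (fun w => _) = (fun w => (if (i < n)%N then a i w else 0) +
      \sum_(i <- s | (i < n)%N) a i w)); last first.
    by apply/funext => w; rewrite big_cons; case: ifP => // _; rewrite add0r.
  apply: measurable_funD => //; case: (ltnP i n) => // ni; apply: ma; exact: ltnW.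
have SE : (fun w => \sum_(0 <= i < n.+1) a i w) = fun w => S w + a n w.
  by apply/funext => w; rewrite big_nat_recr.
have -> : (fun w => cos (\sum_(0 <= i < n.+1) a i w)) = fun w => cos (S w + a n w).
  by apply/funext => w; rewrite -[S w + _]/((fun w => S w + a n w) w) -SE.
have -> : (fun w => sin (\sum_(0 <= i < n.+1) a i w)) = fun w => sin (S w + a n w).
  by apply/funext => w; rewrite -[S w + _]/((fun w => S w + a n w) w) -SE.
have [-> ->] := indep_cos_sin mS (ma _ (ltnSn n)) (ia _ (ltnSn n)).
have := normr_Ecos_le1 mS; have := normr_Esin_le1 mS.
have [] := ca _ (ltnSn n); move: IHc IHs; rewrite -/S.
set C := \int[P]_w cos (S w); set D := \int[P]_w sin (S w).
set c := \int[P]_w cos (a n w); set s := \int[P]_w sin (a n w).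
move=> IHc IHs hc hs D1 C1.
have eta0 : 0 <= eta := le_trans (normr_ge0 _) hs.
have n2 : 2 * n.+1%:R * eta = 2 * n%:R * eta + eta + eta.
  by rewrite -natr1; ring.
rewrite n2; split.
  have -> : C * c - D * s - rho ^+ n.+1 = (C - rho ^+ n) * rho + C * (c - rho) - D * s.
    by rewrite exprSr; ring.
  rewrite (le_trans (ler_normB _ _))// lerD//.
    rewrite (le_trans (ler_normD _ _))// lerD//.
      rewrite normrM (le_trans _ IHc)// (ger0_norm rho0).
      by rewrite ler_piMr.
    by rewrite normrM (le_trans _ hc)// ler_piMl.
  by rewrite normrM (le_trans _ hs)// ler_piMl.
have -> : D * c + C * s = D * rho + D * (c - rho) + C * s by ring.
rewrite (le_trans (ler_normD _ _))// lerD//.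
  rewrite (le_trans (ler_normD _ _))// lerD//.
    rewrite normrM (le_trans _ IHs)// (ger0_norm rho0).
    by rewrite ler_piMr.
  by rewrite normrM (le_trans _ hc)// ler_piMl.
by rewrite normrM (le_trans _ hs)// ler_piMl.
Qed.

(** The Taylor remainder of the sine asks for E |X|^3. The weight [lam] trades it for the second and
    fourth moments through 2 |X|^3 <= lam X^2 + X^4 / lam. *)
Lemma cos_sin_moments (X : T -> R) (v K lam : R) : 0 < lam ->
  integ P X -> integ P (fun w => X w ^+ 2) -> integ P (fun w => X w ^+ 4) ->
  \int[P]_w X w = 0 -> \int[P]_w (X w ^+ 2) = v -> \int[P]_w (X w ^+ 4) <= K ->
  `|\int[P]_w cos (X w) - expR (- (v / 2))| <= K / 24 + v ^+ 2 / 8 /\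
  `|\int[P]_w sin (X w)| <= (lam * v + K / lam) / 12.
Proof.
move=> lam0 iX iX2 iX4 EX EX2 EX4; have mX := integ_measurable iX.
have v0 : 0 <= v by rewrite -EX2; apply: Rintegral_ge0 => w _; exact: sqr_ge0.
split.
  have i1 := integB (integ_cst P 1) (integZ 2^-1 iX2).
  have i2 := integB (integ_cos mX) i1.
  have -> : \int[P]_w cos (X w) - expR (- (v / 2)) =
     \int[P]_w (cos (X w) - (1 - 2^-1 * X w ^+ 2)) - (expR (- (v / 2)) - (1 - v / 2)).
    rewrite RintB//; last exact: integ_cos.
    rewrite RintB//; [|exact: integ_cst|exact: integZ].
    by rewrite Rintegral_prob_cst RintZ// EX2; ring.
  rewrite (le_trans (ler_normB _ _))// lerD//.
    rewrite (le_trans (Rint_norm_le i2))//.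
    apply: (@le_trans _ _ (\int[P]_w (24^-1 * X w ^+ 4))).
      apply: Rint_le; [exact: integ_norm|exact: integZ|].
      by move=> w; rewrite ![_^-1 * _]mulrC; exact: normr_cos_sub_le.
    by rewrite RintZ// mulrC ler_pM2r.
  have v20 : 0 <= v / 2 by rewrite divr_ge0.
  have [h1 h2 _] := expRN_taylor v20.
  have -> : v ^+ 2 / 8 = (v / 2) ^+ 2 / 2 by field.
  by rewrite ler_norml; apply/andP; split; have := sqr_ge0 (v / 2); lra.
have i1 := integB (integ_sin mX) iX.
have -> : \int[P]_w sin (X w) = \int[P]_w (sin (X w) - X w).
  by rewrite RintB//; [rewrite EX subr0|exact: integ_sin].
rewrite (le_trans (Rint_norm_le i1))//.
have i2 := integD (integZ (lam / 12) iX2) (integZ (lam^-1 / 12) iX4).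
apply: (@le_trans _ _ (\int[P]_w (lam / 12 * X w ^+ 2 + lam^-1 / 12 * X w ^+ 4))).
  apply: Rint_le => //; first exact: integ_norm.
  move=> w; rewrite (le_trans (normr_sin_sub_le _))//.
  rewrite -[X w ^+ 4](_ : `|X w| ^+ 4 = _); last first.
    by rewrite -normrX ger0_norm// (@exprn_even_ge0 _ 4).
  rewrite -(real_normK (num_real (X w))); set y := `|X w|.
  rewrite -subr_ge0.
  have -> : lam / 12 * y ^+ 2 + lam^-1 / 12 * y ^+ 4 - y ^+ 3 / 6 =
    (lam - y) ^+ 2 * y ^+ 2 / lam / 12 by field; rewrite gt_eqF.
  apply: divr_ge0 => //; apply: divr_ge0; last exact: ltW.
  by rewrite mulr_ge0 ?sqr_ge0.
rewrite RintD; [|exact: integZ..].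
rewrite !RintZ// EX2 mulrDl lerD//; first by rewrite mulrAC.
by rewrite mulrAC ler_pM2r// mulrC ler_pM2r// invr_gt0.
Qed.

(** An explicit bound rather than a limit, since the summands form a triangular array and change
    with [n]. *)
Lemma clt_cos (n : nat) (a : nat -> T -> R) (v K : R) : (0 < n)%N ->
  (forall i, (i < n)%N -> [/\ integ P (a i), integ P (fun w => a i w ^+ 2) & integ P (fun w => a i w ^+ 4)]) ->
  (forall i, (i < n)%N -> indep_rv P (fun w => \sum_(0 <= j < i) a j w) (a i)) ->
  (forall i, (i < n)%N -> [/\ \int[P]_w a i w = 0, \int[P]_w (a i w ^+ 2) = v / n%:R &
     \int[P]_w (a i w ^+ 4) <= K / n%:R ^+ 2]) ->
  `|\int[P]_w cos (\sum_(0 <= i < n) a i w) - expR (- (v / 2))| <= (K + v ^+ 2 + v) / Num.sqrt n%:R /\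
  `|\int[P]_w sin (\sum_(0 <= i < n) a i w)| <= (K + v ^+ 2 + v) / Num.sqrt n%:R.
Proof.
move=> n0 ia inda mom.
pose u : R := Num.sqrt n%:R.
have u0 : 0 < u by rewrite sqrtr_gt0 ltr0n.
have u2 : n%:R = u ^+ 2 by rewrite sqr_sqrtr.
have u1 : 1 <= u by rewrite -sqrtr1 ler_wsqrtr// ler1n.
have v0 : 0 <= v.
  have [_ h _] := mom _ n0; have : 0 <= v / n%:R.
    by rewrite -h; apply: Rintegral_ge0 => w _; exact: sqr_ge0.
  by rewrite pmulr_lge0// invr_gt0 ltr0n.
have K0 : 0 <= K.
  have [_ _ h] := mom _ n0; have : 0 <= K / n%:R ^+ 2.
    by rewrite (le_trans _ h)//; apply: Rintegral_ge0 => w _; exact: (@exprn_even_ge0 _ 4).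
  by rewrite pmulr_lge0// invr_gt0 exprn_gt0// ltr0n.
(* The error allowed per summand: as n = u^2, the total 2 n eta is the announced bound. *)
pose eta := (K + v ^+ 2 + v) / u ^+ 3 / 2.
have e2 : (K + v ^+ 2 + v) / u = 2 * n%:R * eta.
  by rewrite /eta u2; field; rewrite gt_eqF.
have rhoE : expR (- (v / 2)) = expR (- (v / n%:R / 2)) ^+ n.
  rewrite -expRM_natl; congr expR; field.
  by rewrite pnatr_eq0 -lt0n.
rewrite -/u e2 rhoE; apply: cos_sum_indep => //.
- by rewrite expR_ge0 -[leRHS]expR0 ler_expR oppr_le0 !divr_ge0.
- by move=> i /ia[/integ_measurable].
move=> i ni; have [i1 i2 i4] := ia _ ni; have [m1 m2 m4] := mom _ ni.
(* With lam = n^(-1/2) both parts of the sine error have order n^(-3/2): v / n times lam, and K /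
   n^2 divided by lam. *)
have lam0 : 0 < u^-1 by rewrite invr_gt0.
have [hc hs] := cos_sin_moments lam0 i1 i2 i4 m1 m2 m4.
have uk : (u ^+ 4)^-1 <= (u ^+ 3)^-1.
  by rewrite lef_pV2 ?posrE ?exprn_gt0// ler_weXn2l.
split.
  rewrite (le_trans hc)// u2 /eta -subr_ge0.
  have -> : (K + v ^+ 2 + v) / u ^+ 3 / 2 - (K / u ^+ 2 ^+ 2 / 24 + (v / u ^+ 2) ^+ 2 / 8) =
     (K / 2 + v ^+ 2 / 2 + v / 2) * (u ^+ 3)^-1 - (K / 24 + v ^+ 2 / 8) * (u ^+ 4)^-1.
    by field; rewrite gt_eqF.
  rewrite subr_ge0; apply: ler_pM => //.
  - by rewrite addr_ge0// divr_ge0// sqr_ge0.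
  - by rewrite invr_ge0 exprn_ge0// ltW.
  - by have := sqr_ge0 v; lra.
rewrite (le_trans hs)// u2 /eta -subr_ge0.
have -> : (K + v ^+ 2 + v) / u ^+ 3 / 2 - (u^-1 * (v / u ^+ 2) + K / u ^+ 2 ^+ 2 / u^-1) / 12 =
     (K / 2 + v ^+ 2 / 2 + v / 2 - v / 12 - K / 12) * (u ^+ 3)^-1.
  by field; rewrite gt_eqF.
rewrite mulr_ge0//; last by rewrite invr_ge0 exprn_ge0// ltW.
by have := sqr_ge0 v; lra.
Qed.

End CharacteristicCLT.

(** * Independence of successive time steps, for several independent sources *)

Section BlockIndependence.
Context d (T : measurableType d) (R : realType) (P : probability T R).
Variables (r n : nat) (F : 'I_r -> nat -> set (set T)).
Hypothesis mF : forall j i, F j i `<=` measurable.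
Hypothesis FI : forall j i, setI_closed (F j i).
Hypothesis FT : forall j i, F j i setT.
Hypothesis indF : forall A : 'I_r -> nat -> set T, (forall j i, F j i (A j i)) ->
  P (\bigcap_(j in [set: 'I_r]) \bigcap_(i in `I_n) A j i) =
  (\prod_(j < r) \prod_(0 <= i < n) P (A j i))%E.

(** A pi-system of rectangles: the product formula is known on rectangles, and those of [past m] and
    [present m] generate the information before step [m] and at step [m]. *)
Definition past m : set (set T) := [set B | exists2 A : 'I_r -> nat -> set T,
  (forall j i, F j i (A j i)) & B = \bigcap_(j in [set: 'I_r]) \bigcap_(i in `I_m) A j i].

Definition present m : set (set T) := [set B | exists2 A : 'I_r -> set T,
  (forall j, F j m (A j)) & B = \bigcap_(j in [set: 'I_r]) A j].

Lemma present_past i m : (i < m)%N -> present i `<=` past m.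
Proof.
move=> im B [A FA ->]; exists (fun j k => if k == i then A j else setT) => [j k|].
  by case: eqP => [->|_].
apply/seteqP; split => w h j _.
  by move=> k _; case: eqP => // _; exact: h.
by have := h j I i im; rewrite eqxx.
Qed.

Lemma past_measurable m : past m `<=` measurable.
Proof.
move=> B [A FA ->]; apply: fin_bigcap_measurable => // j _.
by apply: fin_bigcap_measurable => // i _; apply: mF; exact: FA.
Qed.

Lemma present_measurable m : present m `<=` measurable.
Proof. by move=> B /(present_past (ltnSn m)) /past_measurable. Qed.

Lemma past_setI m : setI_closed (past m).
Proof.
move=> B C [A FA ->] [A' FA' ->]; exists (fun j i => A j i `&` A' j i).
  by move=> j i; exact: FI.
apply/seteqP; split => w; first by move=> [h h'] j _ i im; split; [exact: h|exact: h'].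
by move=> h; split => j jT i im; have [] := h j jT i im.
Qed.

Lemma present_setI m : setI_closed (present m).
Proof.
move=> B C [A FA ->] [A' FA' ->]; exists (fun j => A j `&` A' j).
  by move=> j; exact: FI.
apply/seteqP; split => w; first by move=> [h h'] j _; split; [exact: h|exact: h'].
by move=> h; split => j jT; have [] := h j jT.
Qed.

Lemma past_setT m : past m setT.
Proof.
by exists (fun _ _ => setT) => //; apply/seteqP; split.
Qed.

Lemma present_setT m : present m setT.
Proof. by exists (fun _ => setT) => //; apply/seteqP; split. Qed.

(** Padding with [setT] turns both rectangles and their intersection into rectangles over all [n]
    steps, where the product formula [indF] applies. *)
Lemma indep2_past_present m : (m < n)%N -> indep2 P (past m) (present m).
Proof.
move=> mn B C [A FA ->] [A' FA' ->].
pose A1 j i := if (i < m)%N then A j i else setT.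
pose A2 j i := if i == m then A' j else setT.
pose A3 j i := A1 j i `&` A2 j i.
have FA1 j i : F j i (A1 j i) by rewrite /A1; case: ltnP.
have FA2 j i : F j i (A2 j i) by rewrite /A2; case: eqP => [->|].
have FA3 j i : F j i (A3 j i) by exact: FI.
have e1 : \bigcap_(j in [set: 'I_r]) \bigcap_(i in `I_m) A j i =
    \bigcap_(j in [set: 'I_r]) \bigcap_(i in `I_n) A1 j i.
  apply/seteqP; split => w h j jT i /= ii; rewrite /A1.
    by case: ltnP => // im; exact: h.
  by have := h j jT i (ltn_trans ii mn); rewrite /A1 ii.
have e2 : \bigcap_(j in [set: 'I_r]) A' j =
    \bigcap_(j in [set: 'I_r]) \bigcap_(i in `I_n) A2 j i.
  apply/seteqP; split => w h j jT.
    by move=> i _; rewrite /A2; case: eqP => // _; exact: h.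
  by have := h j jT m mn; rewrite /A2 eqxx.
have e3 : (\bigcap_(j in [set: 'I_r]) \bigcap_(i in `I_n) A1 j i) `&`
    (\bigcap_(j in [set: 'I_r]) \bigcap_(i in `I_n) A2 j i) =
    \bigcap_(j in [set: 'I_r]) \bigcap_(i in `I_n) A3 j i.
  apply/seteqP; split => w; first by move=> [h h'] j _ i im; split; [exact: h|exact: h'].
  by move=> h; split => j jT i im; have [] := h j jT i im.
rewrite e1 e2 e3 !indF// -big_split/=; apply: eq_bigr => j _.
rewrite -big_split/= !big_nat; apply: eq_bigr => i /andP[_ ii].
rewrite /A3 /A1 /A2; case: ltnP => im.
  by rewrite ltn_eqF// setIT probability_setT mule1.
by rewrite setTI probability_setT mul1e.
Qed.

(** The partial sum is measurable for the sigma-algebra generated by [past m], the next term for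
    that generated by [present m], and independence passes from pi-systems to the sigma-algebras. *)
Lemma block_indep_sum (phi : nat -> T -> R) :
  (forall i, (i < n)%N ->
    measurable_fun setT (phi i : g_sigma_algebraType (present i) -> R)) ->
  forall m, (m < n)%N -> indep_rv P (fun w => \sum_(0 <= i < m) phi i w) (phi m).
Proof.
move=> mphi m mn A B mA mB.
have := @indep2_sigma _ _ _ P (past m) (present m) (@past_measurable m)
  (@present_measurable m) (@past_setI m) (past_setT m) (@present_setI m)
  (present_setT m) (indep2_past_present mn).
apply; last first.
  by have := mphi _ mn measurableT _ mB; rewrite setTI.
pose S : g_sigma_algebraType (past m) -> R := fun w => \sum_(0 <= i < m) phi i w.
have mS : measurable_fun setT S.
  have -> : S = (fun w => \sum_(0 <= i < m) (if (i < m)%N then phi i w else 0)).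
    by apply/funext => w; rewrite /S !big_nat; apply: eq_bigr => i /andP[_ ->].
  apply: measurable_sum => i; case: ltnP => // im _ C mC.
  have := mphi _ (ltn_trans im mn) measurableT _ mC; rewrite !setTI.
  by apply: sub_sigma_algebra2; exact: present_past.
by have := mS measurableT _ mA; rewrite setTI.
Qed.

Lemma measurable_present_cV (k : nat) (V : T -> 'cV[R]_k) j i :
  (forall A : set (borel_cV R k), measurable A -> F j i (V @^-1` A)) ->
  measurable_fun setT (V : g_sigma_algebraType (present i) -> borel_cV R k).
Proof.
move=> FV _ A mA; rewrite setTI; apply: sub_sigma_algebra.
exists (fun l => if l == j then V @^-1` A else setT) => [l|].
  by case: eqP => [->|//]; exact: FV.
apply/seteqP; split => w h; first by move=> l _; case: eqP.
by have := h j I; rewrite eqxx.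
Qed.

End BlockIndependence.

(** * Wiener increments and Gaussian random variables *)

Lemma indep_rvC d (T : measurableType d) (R : realType) (P : probability T R)
  (X Y : T -> R) : indep_rv P X Y -> indep_rv P Y X.
Proof. by move=> h A B mA mB; rewrite setIC muleC; exact: h. Qed.

Section Laws.
Context (R : realType) d1 (T1 : measurableType d1) (P1 : probability T1 R).
Context d2 (T2 : measurableType d2) (P2 : probability T2 R).

(** Transfers expectations between probability spaces, so that a Gaussian expectation found for one
    realization of the law holds for all. *)
Lemma law_Rint (X1 : T1 -> R) (X2 : T2 -> R) (f : R -> R) :
  measurable_fun setT X1 -> measurable_fun setT X2 -> measurable_fun setT f ->
  (forall A, measurable A -> P1 (X1 @^-1` A) = P2 (X2 @^-1` A)) ->
  integ P1 (f \o X1) ->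
  integ P2 (f \o X2) /\ \int[P1]_w f (X1 w) = \int[P2]_w f (X2 w).
Proof.
move=> m1 m2 mf XX i1.
pose Y1 : {RV P1 >-> R} := HB.pack X1 (isMeasurableFun.Build _ _ _ _ _ m1).
pose Y2 : {RV P2 >-> R} := HB.pack X2 (isMeasurableFun.Build _ _ _ _ _ m2).
have mEf : measurable_fun setT (EFin \o f) by exact/measurable_EFinP.
have eqI (g : R -> \bar R) :
    (\int[distribution P1 Y1]_z g z = \int[distribution P2 Y2]_z g z)%E.
  by apply: eq_measure_integral => A mA _; exact: XX.
have i2 : integ P2 (f \o X2).
  apply/integrableP; split.
    by apply/measurable_EFinP; exact: measurableT_comp.
  move/integrableP : i1 => [_].
  pose g (x : R) : \bar R := `|(f x)%:E|%E.
  have mg : measurable_fun setT g by exact: measurableT_comp.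
  have g0 y : (0 <= g y)%E by exact: abse_ge0.
  rewrite -[X in (X < _)%E -> _]/(\int[P1]_x (g \o Y1) x)%E.
  rewrite -[X in _ -> (X < _)%E]/(\int[P2]_x (g \o Y2) x)%E.
  by rewrite -!ge0_integral_distribution// eqI.
split=> //; apply: EFin_inj; rewrite -!Rint_fin//.
rewrite -[LHS]/(\int[P1]_w ((EFin \o f) \o Y1) w)%E -[RHS]/(\int[P2]_w ((EFin \o f) \o Y2) w)%E.
by rewrite -(integral_distribution (X := Y1))// -(integral_distribution (X := Y2))// eqI.
Qed.

(** Under independence the joint law is the product of its marginals, so the marginals alone
    determine the law of the sum. *)
Lemma indep_sum_law (X1 Y1 : T1 -> R) (X2 Y2 : T2 -> R) :
  measurable_fun setT X1 -> measurable_fun setT Y1 ->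
  measurable_fun setT X2 -> measurable_fun setT Y2 ->
  indep_rv P1 X1 Y1 -> indep_rv P2 X2 Y2 ->
  (forall A, measurable A -> P1 (X1 @^-1` A) = P2 (X2 @^-1` A)) ->
  (forall A, measurable A -> P1 (Y1 @^-1` A) = P2 (Y2 @^-1` A)) ->
  forall A, measurable A -> P1 ((fun w => X1 w + Y1 w) @^-1` A) = P2 ((fun w => X2 w + Y2 w) @^-1` A).
Proof.
move=> mX1 mY1 mX2 mY2 i1 i2 XX YY A mA.
pose C := [set z : R * R | A (z.1 + z.2)].
have mC : measurable C.
  have mD : measurable_fun setT (fun z : R * R => z.1 + z.2).
    by apply: measurable_funD; [exact: measurable_fst|exact: measurable_snd].
  by have := mD measurableT _ mA; rewrite setTI.
have mXY2 : measurable_fun setT (fun w => (X2 w, Y2 w)) by exact: measurable_fun_pair.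
pose XYm : {RV P2 >-> (R * R)%type} := HB.pack (fun w => (X2 w, Y2 w)) (isMeasurableFun.Build _ _ _ _ _ mXY2).
rewrite -[LHS]/(P1 [set w | C (X1 w, Y1 w)]) (indep_rv_pushforward mX1 mY1 i1 mC).
apply: (@product_measure_unique _ _ _ _ _ _ _ (distribution P2 XYm)) => // B D mB mD.
rewrite -[RHS]/(P1 (X1 @^-1` B) * P1 (Y1 @^-1` D))%E XX// YY//.
exact: i2.
Qed.

End Laws.

Section Wiener.
Context (R : realType) d (Omega : measurableType d) (P : probability Omega R).

Lemma mutually_independent_nat m (F : nat -> set (set Omega)) (A : nat -> set Omega) :
  mutually_independent P (fun i : 'I_m => F i) -> (forall i, (i < m)%N -> F i (A i)) ->
  P (\bigcap_(i in `I_m) A i) = (\prod_(0 <= i < m) P (A i))%E.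
Proof.
move=> ind FA; have := ind [set: 'I_m]%SET (fun i => A i).
have -> : (\prod_(i in [set: 'I_m]%SET) P (A i) = \prod_(0 <= i < m) P (A i))%E.
  by rewrite big_mkord; apply: eq_bigl => i; rewrite finset.in_setT.
move=> <-; last by move=> i _; exact: FA.
congr (P _); apply/seteqP; split => w h i /=; first by move=> _; apply: h; exact: ltn_ord.
by move=> im; have := h (Ordinal im); apply; rewrite /= finset.in_setT.
Qed.

Lemma sigma_vec_measurable k (Z : Omega -> 'cV[R]_k) :
  random_vector Z -> sigma_vec Z `<=` measurable.
Proof. by move=> mZ _ [A mA <-]; exact: mZ. Qed.

Lemma sigma_vec_setI k (Z : Omega -> 'cV[R]_k) : setI_closed (sigma_vec Z).
Proof.
move=> _ _ [A mA <-] [B mB <-]; exists (A `&` B); first exact: measurableI.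
by rewrite !setTI preimage_setI.
Qed.

Lemma sigma_vec_setT k (Z : Omega -> 'cV[R]_k) : sigma_vec Z setT.
Proof. by exists setT => //; rewrite setTI. Qed.

Lemma sigma_vec_preimage k (Z : Omega -> 'cV[R]_k) (A : set (borel_cV R k)) :
  measurable A -> sigma_vec Z (Z @^-1` A).
Proof. by move=> mA; exists A => //; rewrite setTI. Qed.

Lemma random_vectorB k (Y Z : Omega -> 'cV[R]_k) :
  random_vector Y -> random_vector Z -> random_vector (fun w => Y w - Z w).
Proof.
move=> /measurable_cVP mY /measurable_cVP mZ; apply/measurable_cVP => i.
by under eq_fun do rewrite !mxE; exact: measurable_funB.
Qed.

Lemma random_vector_cst k (c : 'cV[R]_k) : random_vector (fun _ : Omega => c).
Proof. by apply/measurable_cVP => i; exact: measurable_cst. Qed.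

Lemma mulmx_cVE k (u : 'cV[R]_k) (x : 'cV[R]_k) :
  (u^T *m x) 0 0 = \sum_i u i 0 * x i 0.
Proof. by rewrite mxE; apply: eq_bigr => i _; rewrite mxE. Qed.

Lemma measurable_mulmx_cV d' (T' : measurableType d') k (u : 'cV[R]_k) (Z : T' -> borel_cV R k) :
  measurable_fun setT Z -> measurable_fun setT (fun w => (u^T *m Z w) 0 0).
Proof.
move=> /measurable_cVP mZ; under eq_fun do rewrite mulmx_cVE.
by apply: measurable_sum => i; exact: measurable_funM.
Qed.

Variables (T : R) (r : nat) (W : R -> Omega -> 'cV[R]_r).
Hypothesis HW : wiener P T W.

Lemma wiener_incr_meas s t : 0 <= s <= T -> 0 <= t <= T ->
  random_vector (fun w => W t w - W s w).
Proof. by move=> hs ht; apply: random_vectorB; exact: wiener_meas HW _ _. Qed.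

Lemma wiener_gauss_rv (u : 'cV[R]_r) s t : 0 <= s -> s < t -> t <= T ->
  gauss_rv P (fun w => (u^T *m (W t w - W s w)) 0 0) ((t - s) * (u^T *m u) 0 0).
Proof.
move=> s0 st tT; split.
  apply: measurable_mulmx_cV; apply: wiener_incr_meas.
    by rewrite s0 (ltW (lt_le_trans st tT)).
  by rewrite tT (le_trans s0 (ltW st)).
move=> A mA; have := wiener_incr HW s0 st tT u mA.
by rewrite mulmx0 mxE mul_mx_scalar -scalemxAl mxE.
Qed.

Section Grid.
Variables (n : nat) (t : nat -> R).
Hypotheses (t0 : 0 <= t 0%N) (tS : forall i, (i < n)%N -> t i < t i.+1) (tn : t n <= T).

Lemma grid_bounds i : (i <= n)%N -> 0 <= t i <= T.
Proof.
move=> ni; apply/andP; split.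
  elim: i ni => [//|i IH] ni.
  by rewrite (le_trans (IH (ltnW ni)))// ltW// tS.
have h k : (i + k <= n)%N -> t i <= t (i + k)%N.
  elim: k => [|k IH]; first by rewrite addn0.
  by rewrite addnS => ik; rewrite (le_trans (IH (ltnW ik)))// ltW// tS.
by rewrite (le_trans _ tn)// -(subnKC ni) h// subnKC.
Qed.

(** Extended by zero past the grid, so that measurability holds for every index. *)
Definition grid_incr i w := if (i < n)%N then W (t i.+1) w - W (t i) w else 0.

Lemma grid_incr_meas i : random_vector (grid_incr i).
Proof.
rewrite /grid_incr; case: ltnP => ni; last exact: random_vector_cst.
by apply: wiener_incr_meas; apply: grid_bounds => //; exact: ltnW.
Qed.

Lemma grid_incr_indep (A : nat -> set Omega) :
  (forall i, sigma_vec (grid_incr i) (A i)) ->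
  P (\bigcap_(i in `I_n) A i) = (\prod_(0 <= i < n) P (A i))%E.
Proof.
move=> FA; apply: (mutually_independent_nat (F := fun i => sigma_vec (fun w => W (t i.+1) w - W (t i) w))).
  exact: wiener_indep HW _ _ t0 tS tn.
by move=> i ni; have := FA i; rewrite /grid_incr ni.
Qed.

Lemma grid_sum_indep (phi : nat -> 'cV[R]_r -> R) :
  (forall i, measurable_fun setT (phi i : borel_cV R r -> R)) ->
  forall m, (m < n)%N -> indep_rv P
    (fun w => \sum_(0 <= i < m) phi i (grid_incr i w)) (fun w => phi m (grid_incr m w)).
Proof.
move=> mphi m mn.
pose F (j : 'I_1) i := sigma_vec (grid_incr i).
apply: (@block_indep_sum _ _ _ P 1 n F _ _ _ _ (fun i w => phi i (grid_incr i w))) => //.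
- by move=> j i; apply: sigma_vec_measurable; exact: grid_incr_meas.
- by move=> j i; exact: sigma_vec_setI.
- by move=> j i; exact: sigma_vec_setT.
- move=> A FA; rewrite big_ord_recl big_ord0 mule1.
  rewrite -(grid_incr_indep (FA ord0)); congr (P _).
  by apply/seteqP; split => w h; [exact: h|move=> j _; rewrite (ord1 j)].
- move=> i ni.
  have mV : measurable_fun setT (grid_incr i : g_sigma_algebraType (present F i) -> borel_cV R r).
    apply: (@measurable_present_cV _ _ _ 1 F _ r (grid_incr i) ord0 i) => //.
      by move=> j l; exact: sigma_vec_setT.
    by move=> A mA; exact: sigma_vec_preimage.
  exact: measurableT_comp (mphi i) mV.
Qed.

End Grid.

Hypotheses (T0 : 0 < T) (r0 : (0 < r)%N).

Let e0 : 'cV[R]_r := delta_mx (Ordinal r0) 0.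

Let e0E : (e0^T *m e0) 0 0 = 1.
Proof.
rewrite mulmx_cVE (bigD1 (Ordinal r0))//= !mxE !eqxx mulr1 big1 ?addr0// => i.
by move=> /negbTE i0; rewrite !mxE i0 mul0r.
Qed.

Let uuE l : ((l *: e0)^T *m (l *: e0)) 0 0 = l ^+ 2.
Proof.
rewrite -scalemxAr mxE (_ : (l *: e0)^T = l *: e0^T); last by rewrite linearZ.
by rewrite -scalemxAl mxE e0E mulr1 expr2.
Qed.

Lemma gauss1_0 (A : set R) : gauss1 0 0 A = \d_(0 : R) A.
Proof. by rewrite /gauss1 eqxx. Qed.

Lemma gauss_rv_cst0 d' (T' : measurableType d') (P' : probability T' R) :
  gauss_rv P' (fun=> 0) 0.
Proof.
split=> // A mA; rewrite gauss1_0 diracE.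
have [A0|A0] := boolP (0 \in A); rewrite preimage_cst ?A0 ?(negbTE A0).
  exact: probability_setT.
exact: measure0.
Qed.

Lemma gauss_law d1 (T1 : measurableType d1) (P1 : probability T1 R) X1
  d2 (T2 : measurableType d2) (P2 : probability T2 R) X2 v :
  gauss_rv P1 X1 v -> gauss_rv P2 X2 v ->
  forall A, measurable A -> P1 (X1 @^-1` A) = P2 (X2 @^-1` A).
Proof. by move=> [_ h1] [_ h2] A mA; rewrite h1// h2. Qed.

Lemma indep_rv_cst d' (T' : measurableType d') (P' : probability T' R) (c : R) (Y : T' -> R) :
  indep_rv P' (fun=> c) Y.
Proof.
move=> A B mA mB; rewrite preimage_cst; case: ifP => _.
  by rewrite setTI probability_setT mul1e.
by rewrite set0I measure0 mul0e.
Qed.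

(** The pair is compared in law with two adjacent increments of one Wiener process, scaled to
    variances [a] and [b]. These are independent and add up to an increment over [0, T], which is
    Gaussian by hypothesis, so no convolution is computed. Zero variances are treated apart, because
    an increment spans a nondegenerate interval. *)
Lemma gauss_rvD d' (T' : measurableType d') (P' : probability T' R) (X Y : T' -> R) a b :
  0 <= a -> 0 <= b -> gauss_rv P' X a -> gauss_rv P' Y b -> indep_rv P' X Y ->
  gauss_rv P' (fun w => X w + Y w) (a + b).
Proof.
move=> a0 b0 gX gY XY; have [mX _] := gX; have [mY _] := gY.
split; first exact: measurable_funD.
move=> A mA.
have [a00|an0] := eqVneq a 0.
  move: gX; rewrite a00 add0r => gX.
  rewrite -(gY.2 _ mA) (indep_sum_law mX mY (measurable_cst (0 : R)) mY XY
    (indep_rv_cst P' 0 Y) (gauss_law gX (gauss_rv_cst0 P')) (fun A _ => erefl) mA).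
  by under eq_fun do rewrite add0r.
have [b00|bn0] := eqVneq b 0.
  move: gY; rewrite b00 addr0 => gY.
  rewrite -(gX.2 _ mA) (indep_sum_law mX mY mX (measurable_cst (0 : R)) XY
    (indep_rvC (indep_rv_cst P' 0 X)) (fun A _ => erefl) (gauss_law gY (gauss_rv_cst0 P')) mA).
  by under eq_fun do rewrite addr0.
have a_gt0 : 0 < a by rewrite lt0r an0.
have b_gt0 : 0 < b by rewrite lt0r bn0.
have ab0 : 0 < a + b by exact: addr_gt0.
(* Chosen so that l^2 tau = a and l^2 (T - tau) = b. *)
pose tau := a * T / (a + b); pose l := Num.sqrt ((a + b) / T).
have l2 : l ^+ 2 = (a + b) / T by rewrite sqr_sqrtr// divr_ge0// ltW.
have tau0 : 0 < tau by rewrite divr_gt0// mulr_gt0.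
have tauT : tau < T by rewrite ltr_pdivrMr// mulrC ltr_pM2l// ltrDl.
pose t (i : nat) : R := if i == 0%N then 0 else if i == 1%N then tau else T.
have tS i : (i < 2)%N -> t i < t i.+1 by case: i => [|[|]].
pose u := l *: e0.
pose phi (x : 'cV[R]_r) := (u^T *m x) 0 0.
have phiD x y : phi x + phi y = phi (x + y) by rewrite /phi mulmxDr [in RHS]mxE.
have mphi (i : nat) : measurable_fun setT (phi : borel_cV R r -> R).
  by apply: measurable_mulmx_cV; exact: measurable_id.
have := @grid_sum_indep 2 t (lexx 0) tS (lexx T) (fun=> phi) mphi 1%N isT.
rewrite (_ : (fun w => _) = (fun w => phi (W tau w - W 0 w))); last first.
  by apply/funext => w; rewrite big_nat1.
move=> ind0.
have ind : indep_rv P (fun w => phi (W tau w - W 0 w)) (fun w => phi (W T w - W tau w)) := ind0.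
have g1 : gauss_rv P (fun w => phi (W tau w - W 0 w)) a.
  have := @wiener_gauss_rv u 0 tau (lexx 0) tau0 (ltW tauT).
  by rewrite uuE l2 subr0 /tau (_ : a * T / (a + b) * ((a + b) / T) = a)//; field; rewrite !gt_eqF.
have g2 : gauss_rv P (fun w => phi (W T w - W tau w)) b.
  have := @wiener_gauss_rv u tau T (ltW tau0) tauT (lexx T).
  by rewrite uuE l2 /tau (_ : (T - a * T / (a + b)) * ((a + b) / T) = b)//; field; rewrite !gt_eqF.
have g3 : gauss_rv P (fun w => phi (W T w - W 0 w)) (a + b).
  have := @wiener_gauss_rv u 0 T (lexx 0) T0 (lexx T).
  by rewrite uuE l2 subr0 (_ : T * ((a + b) / T) = a + b)//; field; rewrite !gt_eqF.
rewrite (indep_sum_law mX mY g1.1 g2.1 XY ind (gauss_law gX g1) (gauss_law gY g2) mA).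
have -> : (fun w => phi (W tau w - W 0 w) + phi (W T w - W tau w)) = (fun w => phi (W T w - W 0 w)).
  by apply/funext => w; rewrite phiD addrC subrKA.
exact: g3.2.
Qed.

(** The second conjunct expresses the symmetry of the law, from which [gauss_mean] deduces that the
    mean is zero. *)
Lemma gauss_model v : 0 <= v -> exists X, gauss_rv P X v /\ gauss_rv P (fun w => - X w) v.
Proof.
move=> v0; pose l := Num.sqrt (v / T).
have l2 : l ^+ 2 = v / T by rewrite sqr_sqrtr// divr_ge0// ltW.
exists (fun w => ((l *: e0)^T *m (W T w - W 0 w)) 0 0); split.
  have := @wiener_gauss_rv (l *: e0) 0 T (lexx 0) T0 (lexx T).
  by rewrite uuE l2 subr0 mulrCA divff ?mulr1// gt_eqF.
have := @wiener_gauss_rv ((- l) *: e0) 0 T (lexx 0) T0 (lexx T).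
rewrite uuE sqrrN l2 subr0 mulrCA divff ?mulr1 ?gt_eqF//.
by under eq_fun do rewrite scaleNr linearN/= mulNmx mxE.
Qed.

Lemma gauss_mean d' (T' : measurableType d') (P' : probability T' R) (X : T' -> R) v :
  0 <= v -> gauss_rv P' X v -> integ P' X /\ \int[P']_w X w = 0.
Proof.
move=> v0 gX; have [Y [gY gY']] := gauss_model v0.
have iX : integ P' X by exact: (integrable_gaussX v0 gX 1).
have [iY e1] := law_Rint gX.1 gY.1 (@measurable_id _ _ _) (gauss_law gX gY) iX.
have [iY' e2] := law_Rint gX.1 gY'.1 (@measurable_id _ _ _) (gauss_law gX gY') iX.
split=> //; have : \int[P']_w X w = - \int[P']_w X w.
  rewrite {1}e2 e1 -mulN1r -RintZ//.
  by apply: eq_Rintegral => w _; rewrite mulN1r.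
lra.
Qed.

(** For every [n] the increment over [0, T] is a sum of [n] independent Gaussian increments of
    variance v / n, so the central limit bound applies with every [n]. Its left side does not depend
    on [n], hence is zero. *)
Lemma gauss_cos_sin d' (T' : measurableType d') (P' : probability T' R) (X : T' -> R) v :
  0 <= v -> gauss_rv P' X v ->
  \int[P']_w cos (X w) = expR (- (v / 2)) /\ \int[P']_w sin (X w) = 0.
Proof.
move=> v0 gX; pose l := Num.sqrt (v / T).
have l2 : l ^+ 2 = v / T by rewrite sqr_sqrtr// divr_ge0// ltW.
pose u := l *: e0.
pose phi (x : 'cV[R]_r) := (u^T *m x) 0 0.
have phiD x y : phi x + phi y = phi (x + y) by rewrite /phi mulmxDr [in RHS]mxE.
have mphi : measurable_fun setT (phi : borel_cV R r -> R).
  by apply: measurable_mulmx_cV; exact: measurable_id.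
have gY : gauss_rv P (fun w => phi (W T w - W 0 w)) v.
  have := @wiener_gauss_rv u 0 T (lexx 0) T0 (lexx T).
  by rewrite uuE l2 subr0 mulrCA divff ?mulr1// gt_eqF.
have mc : measurable_fun setT (@cos R).
  by apply: continuous_measurable_fun; exact: continuous_cos.
have ms : measurable_fun setT (@sin R).
  by apply: continuous_measurable_fun; exact: continuous_sin.
have [_ ->] := law_Rint gX.1 gY.1 mc (gauss_law gX gY) (integ_cos P' gX.1).
have [_ ->] := law_Rint gX.1 gY.1 ms (gauss_law gX gY) (integ_sin P' gX.1).
have key n : (0 < n)%N ->
  `|\int[P]_w cos (phi (W T w - W 0 w)) - expR (- (v / 2))| <= (3 * v ^+ 2 + v ^+ 2 + v) / Num.sqrt n%:R /\
  `|\int[P]_w sin (phi (W T w - W 0 w))| <= (3 * v ^+ 2 + v ^+ 2 + v) / Num.sqrt n%:R.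
  move=> n0; have n0' : 0 < n%:R :> R by rewrite ltr0n.
  pose t (i : nat) : R := i%:R * (T / n%:R).
  have tS i : (i < n)%N -> t i < t i.+1.
    by move=> _; rewrite /t ltr_pM2r ?ltr_nat// divr_gt0.
  have t0 : 0 <= t 0%N by rewrite /t mul0r.
  have tT : t n = T by rewrite /t; field; rewrite gt_eqF.
  have tn : t n <= T by rewrite tT.
  have tB := grid_bounds t0 tS tn.
  pose a i w := phi (grid_incr n t i w).
  have ga i : (i < n)%N -> gauss_rv P (a i) (v / n%:R).
    move=> ni; rewrite /a /grid_incr ni.
    have /andP[ti0 _] := tB i (ltnW ni); have /andP[_ ti1] := tB i.+1 ni.
    have := @wiener_gauss_rv u _ _ ti0 (tS i ni) ti1.
    rewrite uuE l2 (_ : (t i.+1 - t i) * (v / T) = v / n%:R)//.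
    by rewrite /t -natr1; field; rewrite !gt_eqF.
  have vn0 : 0 <= v / n%:R by rewrite divr_ge0// ltW.
  have sumE w : \sum_(0 <= i < n) a i w = phi (W T w - W 0 w).
    have : forall m, (m <= n)%N -> \sum_(0 <= i < m) a i w = phi (W (t m) w - W (t 0%N) w).
      elim => [|m IH] mn; first by rewrite big_geq// subrr /phi mulmx0 mxE.
      by rewrite big_nat_recr//= IH ?(ltnW mn)// /a /grid_incr mn phiD addrC subrKA.
    by move=> /(_ n (leqnn n)) ->; rewrite tT /t mul0r.
  have -> : (fun w => cos (phi (W T w - W 0 w))) = (fun w => cos (\sum_(0 <= i < n) a i w)).
    by apply/funext => w; rewrite sumE.
  have -> : (fun w => sin (phi (W T w - W 0 w))) = (fun w => sin (\sum_(0 <= i < n) a i w)).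
    by apply/funext => w; rewrite sumE.
  apply: clt_cos => //.
  - move=> i ni; have g := ga i ni; split.
    + exact: (gauss_mean vn0 g).1.
    + exact: integrable_gaussX vn0 g 2.
    + exact: integrable_gaussX vn0 g 4.
  - exact: (grid_sum_indep t0 tS tn (fun=> mphi)).
  - move=> i ni; have g := ga i ni; have [m2 m4] := gauss_moments vn0 g; split => //.
    + exact: (gauss_mean vn0 g).2.
    + by rewrite m4 exprMn exprVn mulrA.
have lim0 (x C : R) : (forall n, (0 < n)%N -> `|x| <= C / Num.sqrt n%:R) -> x = 0.
  move=> h; apply/eqP; rewrite -normr_eq0 eq_le normr_ge0 andbT.
  apply/ler_addgt0Pl => e e_gt0; rewrite addr0.
  have C0 : 0 <= C by have := h 1%N isT; rewrite sqrtr1 divr1; apply: le_trans.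
  pose n := (Num.bound ((C / e) ^+ 2)).+1.
  have n0 : 0 < n%:R :> R by rewrite ltr0n.
  have sn : C / e <= Num.sqrt n%:R.
    rewrite -[leLHS]ger0_norm ?divr_ge0 ?(ltW e_gt0)// -sqrtr_sqr ler_wsqrtr//.
    by rewrite (le_trans (ltW (archi_boundP _)))// ?sqr_ge0// ler_nat.
  rewrite (le_trans (h n isT))// ler_pdivrMr ?sqrtr_gt0//.
  by rewrite -ler_pdivrMl// mulrC.
split.
  by apply/eqP; rewrite -subr_eq0; apply/eqP; apply: lim0 => n /key[h _]; exact: h.
by apply: lim0 => n /key[_ h]; exact: h.
Qed.

End Wiener.

(** * Weak convergence from characteristic functions *)

Section UniformContinuity.
Context (R : realType) (U V : normedModType R).

(** Only [x] is confined to [A]: the Bernstein nodes that will play the role of [y] are not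
    restricted to the unit cube. *)
Lemma compact_unif_continuous (f : U -> V) (A : set U) : compact A ->
  (forall x, A x -> {for x, continuous f}) -> forall e : R, 0 < e ->
  exists2 del : R, 0 < del & forall x y, A x -> `|x - y| < del -> `|f x - f y| < e.
Proof.
move=> cA fc e e0.
pose Q (del : R) (x : U) := forall y, `|x - y| < del -> `|f x - f y| < e.
have cov := (compact_near_coveringP A).1 cA R (0 : R)^'+ Q _.
have : \forall del \near (0 : R)^'+, forall x, A x -> Q del x.
  apply: cov => x Ax.
  have e2 : 0 < e / 2 by rewrite divr_gt0.
  have /fcvgrPdist_lt /(_ _ e2) /nbhs_ballP[r /= r0 hr] := fc x Ax.
  have r2 : 0 < r / 2 by rewrite divr_gt0.
  exists (ball x (r / 2), [set z : R | z < r / 2]); first split => /=.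
  - exact: nbhsx_ballx.
  - exact: nbhs_right_lt.
  case=> y del [/= xy dr] z yz.
  have bx : ball x r y.
    by apply: le_ball xy; rewrite ler_pdivrMr// ler_peMr ?ler1n// ltW.
  have bz : ball x r z.
    rewrite -ball_normE /= in xy *.
    rewrite (_ : x - z = (x - y) + (y - z)); last by rewrite addrA subrK.
    rewrite (le_lt_trans (ler_normD _ _))// (splitr r) ltrD//.
    exact: lt_trans yz dr.
  rewrite (_ : f y - f z = (f x - f z) - (f x - f y)); last by rewrite opprB [RHS]addrC subrKA.
  rewrite (le_lt_trans (ler_normB _ _))// (splitr e) ltrD//; [exact: hr|exact: hr].
move=> h.
have [del [d0 hd]] : exists del : R, 0 < del /\ forall x, A x -> Q del x.
  near (0 : R)^'+ => del; exists del; split; first by near: del; exact: nbhs_right_gt.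
  by near: del.
by exists del => // x y Ax; exact: hd.
Unshelve. all: by end_near. Qed.

End UniformContinuity.

Section ColumnVectors.
Variable R : realType.

Lemma continuous_at_sum (T : topologicalType) (I : Type) (r : seq I) (F : I -> T -> R) (x : T) :
  (forall i, {for x, continuous (F i)}) -> {for x, continuous (fun y => \sum_(i <- r) F i y)}.
Proof.
move=> cF; elim: r => [|i r IH].
  rewrite (_ : (fun y => _) = fun=> 0); last by apply/funext => y; rewrite big_nil.
  exact: cst_continuous.
rewrite (_ : (fun y => _) = (fun y => F i y + \sum_(i <- r) F i y)); last first.
  by apply/funext => y; rewrite big_cons.
exact: continuousD.
Qed.

Lemma normr_cV_lt k (x : 'cV[R]_k) (e : R) : 0 < e -> (forall i, `|x i 0| < e) -> `|x| < e.
Proof.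
move=> e0 xe; have [->|x0] := eqVneq x 0; first by rewrite normr0.
have [[i j] /= h] := @mx_norm_neq0 _ _ _ x (contra_neq (@mx_norm_eq0 _ _ _ x) x0).
by rewrite [`|x|]h (ord1 j).
Qed.

Lemma normr_coord_le k (x : 'cV[R]_k) i : `|x i 0| <= `|x|.
Proof.
rewrite [leRHS]mx_normrE.
exact: (le_bigmax_cond _ (fun ij : 'I_k * 'I_1 => `|x ij.1 ij.2|) (j := (i, 0))).
Qed.

Lemma continuous_cV_coord (T : topologicalType) k (f : T -> 'cV[R]_k) (x : T) :
  (forall i, {for x, continuous (fun y => f y i 0)}) -> {for x, continuous f}.
Proof.
move=> fc; apply/fcvgrPdist_lt => e e0.
have h (i : 'I_k) : \forall y \near x, `|f x i 0 - f y i 0| < e.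
  by have /fcvgrPdist_lt /(_ _ e0) := fc i.
have : \forall y \near x, forall i : 'I_k, `|f x i 0 - f y i 0| < e.
  exact: filter_forall.
apply: filterS => y hy; apply: normr_cV_lt => // i.
by rewrite !mxE; exact: hy.
Qed.

Lemma compact_box k (a b : R) : compact [set x : 'cV[R]_k | forall i, a <= x i 0 <= b].
Proof.
have c1 : compact [set x : 'rV[R]_k | forall i, `[a, b]%classic (x ord0 i)].
  by apply: (@rV_compact _ k (fun=> `[a, b]%classic)) => i; exact: segment_compact.
have -> : [set x : 'cV[R]_k | forall i, a <= x i 0 <= b] =
   (@trmx R 1 k) @` [set x : 'rV[R]_k | forall i, `[a, b]%classic (x ord0 i)].
  apply/seteqP; split => [x hx|_ [y hy <-] i].
    exists x^T; last by rewrite trmxK.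
    by move=> i; rewrite /= mxE in_itv/=; exact: hx.
  by have := hy i; rewrite /= mxE in_itv.
apply: continuous_compact => //; apply: continuous_subspaceT => x.
apply: continuous_cV_coord => i.
rewrite (_ : (fun y => _) = (fun y : 'rV[R]_k => y 0 i)); last by apply/funext => y; rewrite mxE.
exact: coord_continuous.
Qed.

End ColumnVectors.

(** * Bernstein polynomials and uniform approximation by trigonometric polynomials *)

Section Bernstein.
Variables (R : realType) (k : nat).

(* The mean of [g] over the success counts when each [i] in [L] is an independent trial
   with success probability [s i]: a multivariate Bernstein polynomial in [s]. *)
Fixpoint bern (L : seq 'I_k) (s : 'I_k -> R) (g : ('I_k -> nat) -> R) : R :=
  match L with
  | [::] => g (fun=> 0%N)
  | i :: L' => s i * bern L' s (fun J => g (fun j => (J j + (j == i))%N)) +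
              (1 - s i) * bern L' s g
  end.

Lemma bern_cst L s c : bern L s (fun=> c) = c.
Proof. by elim: L => //= i L ->; ring. Qed.

Lemma bern_lin L s a b f g : bern L s (fun J => a * f J + b * g J) = a * bern L s f + b * bern L s g.
Proof. by elim: L f g => //= i L IH f g; rewrite !IH; ring. Qed.

Lemma bern_le L s f g : (forall i, 0 <= s i <= 1) -> (forall J, f J <= g J) ->
  bern L s f <= bern L s g.
Proof.
move=> s01; elim: L f g => [//|i L IH] f g fg; first exact: fg.
have /andP[s0 s1] := s01 i.
by apply: lerD; apply: ler_wpM2l; rewrite ?subr_ge0//; apply: IH.
Qed.

Lemma bern_norm_le L s f g : (forall i, 0 <= s i <= 1) -> (forall J, `|f J| <= g J) ->
  `|bern L s f| <= bern L s g.
Proof.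
move=> s01 fg; rewrite ler_norml; apply/andP; split.
  have -> : - bern L s g = bern L s (fun J => (-1) * g J + 0 * g J) by rewrite bern_lin; ring.
  apply: bern_le => // J; have := fg J; rewrite ler_norml => /andP[]; lra.
by apply: bern_le => // J; have := fg J; rewrite ler_norml => /andP[].
Qed.

Lemma bern_sum L s (I : Type) (r : seq I) (f : I -> ('I_k -> nat) -> R) :
  bern L s (fun J => \sum_(i <- r) f i J) = \sum_(i <- r) bern L s (f i).
Proof.
elim: r => [|i r IH].
  rewrite big_nil -[RHS](bern_cst L s 0); congr bern.
  by apply/funext => J; rewrite big_nil.
rewrite big_cons -IH -[RHS](_ : 1 * bern L s (f i) + 1 * bern L s (fun J => \sum_(i <- r) f i J) = _); last by ring.
by rewrite -bern_lin; congr bern; apply/funext => J; rewrite big_cons; ring.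
Qed.

(** With x the centred count, a new trial for coordinate [i] turns x^2 into s (x + 1 - s)^2 + (1 -
    s) (x - s)^2 = x^2 + s (1 - s), so the induction closes on the variance without the mean. *)
Lemma bern_var L s i (c := count_mem i L) :
  bern L s (fun J => ((J i)%:R - c%:R * s i) ^+ 2) = c%:R * (s i * (1 - s i)).
Proof.
rewrite {}/c; elim: L => [|j L IH] /=; first by rewrite !mul0r subr0 expr0n.
set c := count_mem i L in IH *.
rewrite (eq_sym j i); have [<-|ij] := eqVneq i j; last first.
  rewrite add0n -bern_lin -IH; congr bern; apply/funext => J.
  by rewrite addn0; ring.
have -> : (true + c)%:R * (s i * (1 - s i)) =
    1 * bern L s (fun J => ((J i)%:R - c%:R * s i) ^+ 2) + 1 * bern L s (fun=> s i * (1 - s i)).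
  by rewrite IH bern_cst natrD /=; ring.
by rewrite -!bern_lin; congr bern; apply/funext => J; rewrite !natrD /=; ring.
Qed.

End Bernstein.

Section TrigPolynomials.
Variables (R : realType) (k : nat).

(** Real trigonometric polynomials with arbitrary frequencies. The phase [c] brings in the sines and
    lets products be linearized into cosines of sums and differences. *)
Inductive trigp : ('cV[R]_k -> R) -> Prop :=
| trigp_cos (u : 'cV[R]_k) (c : R) : trigp (fun x : 'cV[R]_k => cos ((u^T *m x) 0 0 + c))
| trigp_lin a b f g : trigp f -> trigp g -> trigp (fun x => a * f x + b * g x).

Lemma trigpZ a f : trigp f -> trigp (fun x => a * f x).
Proof.
move=> tf; have -> : (fun x => a * f x) = (fun x => a * f x + 0 * f x).
  by apply/funext => x; ring.
exact: trigp_lin.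
Qed.

Lemma trigpM f g : trigp f -> trigp g -> trigp (fun x => f x * g x).
Proof.
elim => {f} [u c|a b f1 f2 _ IH1 _ IH2] tg; last first.
  have -> : (fun x => (a * f1 x + b * f2 x) * g x) = (fun x => a * (f1 x * g x) + b * (f2 x * g x)).
    by apply/funext => x; ring.
  by apply: trigp_lin; [exact: IH1|exact: IH2].
elim: tg => {g} [u' c'|a b g1 g2 _ IH1 _ IH2]; last first.
  have -> : (fun x : 'cV[R]_k => cos ((u^T *m x) 0 0 + c) * (a * g1 x + b * g2 x)) =
      (fun x => a * (cos ((u^T *m x) 0 0 + c) * g1 x) + b * (cos ((u^T *m x) 0 0 + c) * g2 x)).
    by apply/funext => x; ring.
  exact: trigp_lin.
have -> : (fun x : 'cV[R]_k => cos ((u^T *m x) 0 0 + c) * cos ((u'^T *m x) 0 0 + c')) =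
   (fun x => 2^-1 * cos (((u + u')^T *m x) 0 0 + (c + c')) + 2^-1 * cos (((u - u')^T *m x) 0 0 + (c - c'))).
  apply/funext => x; rewrite linearD/= linearB/= mulmxDl mulmxBl.
  rewrite [X in cos (X + (c + c'))]mxE [X in cos (X + (c - c'))]mxE [X in (_ + X + (c - c'))]mxE.
  set p := (u^T *m x) 0 0; set q := (u'^T *m x) 0 0.
  rewrite (_ : p + q + (c + c') = (p + c) + (q + c')); last by ring.
  rewrite (_ : p + - q + (c - c') = (p + c) - (q + c')); last by ring.
  by rewrite (cosD (p + c)) (cosB (p + c)); field.
by apply: trigp_lin; exact: trigp_cos.
Qed.

Lemma trigp_cst c : trigp (fun=> c).
Proof.
have -> : (fun=> c) = (fun x : 'cV[R]_k => c * cos (((0 : 'cV[R]_k)^T *m x) 0 0 + 0)).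
  by apply/funext => x; rewrite trmx0 mul0mx mxE addr0 cos0 mulr1.
by apply: trigpZ; exact: trigp_cos.
Qed.

Lemma trigp_bern L (s : 'I_k -> 'cV[R]_k -> R) g : (forall i, trigp (s i)) ->
  trigp (fun x => bern L (fun i => s i x) g).
Proof.
move=> ts; elim: L g => [|i L IH] g /=; first exact: trigp_cst.
have -> : (fun x => s i x * bern L (fun i => s i x) (fun J => g (fun j => (J j + (j == i))%N)) +
     (1 - s i x) * bern L (fun i => s i x) g) =
   (fun x => 1 * (s i x * bern L (fun i => s i x) (fun J => g (fun j => (J j + (j == i))%N))) +
     1 * ((1 * 1 + (-1) * s i x) * bern L (fun i => s i x) g)).
  by apply/funext => x; ring.
apply: trigp_lin; apply: trigpM => //.
by apply: trigp_lin => //; exact: trigp_cst.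
Qed.

Lemma trigp_sin_coord i c : trigp (fun x => sin (x i 0 / c)).
Proof.
have -> : (fun x : 'cV[R]_k => sin (x i 0 / c)) =
    (fun x => cos (((c^-1 *: delta_mx i 0 : 'cV[R]_k)^T *m x) 0 0 + - (pi / 2))).
  apply/funext => x; rewrite mulmx_cVE (bigD1 i)//= big1 ?addr0.
    rewrite !mxE !eqxx mulr1 cosB cos_pihalf sin_pihalf mulr0 add0r mulr1.
    by rewrite mulrC.
  by move=> j /negbTE ji; rewrite !mxE ji mulr0 mul0r.
exact: trigp_cos.
Qed.

Lemma trigp_continuous g : trigp g -> continuous g.
Proof.
elim => {g} [u c|a b f g _ cf _ cg] x.
  apply: (continuous_comp (f := fun y : 'cV[R]_k => (u^T *m y) 0 0 + c)); last exact: continuous_cos.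
  apply: continuousD; last exact: cst_continuous.
  rewrite (_ : (fun y => _) = (fun y : 'cV[R]_k => \sum_i u i 0 * y i 0)); last by apply/funext => y; rewrite mulmx_cVE.
  apply: continuous_at_sum => i; apply: continuousM; first exact: cst_continuous.
  exact: coord_continuous.
suff : {for x, continuous (fun y => a * f y + b * g y)} by [].
by apply: continuousD; apply: continuousM; [exact: cst_continuous|exact: cf|exact: cst_continuous|exact: cg].
Qed.

(* On the cube, [f x] is a continuous function [H] of the numbers (1 + sin (x_i / c)) / 2,
   and the Bernstein polynomials of [H] in them are trigonometric polynomials with the
   same uniform bound [M] on the whole space. *)
Lemma trigp_approx (f : 'cV[R]_k -> R) (M K e : R) : continuous f ->
  (forall x, `|f x| <= M) -> 0 < K -> 0 < e ->
  exists2 g, trigp g & (forall x, `|g x| <= M) /\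
    (forall x : 'cV[R]_k, (forall i, `|x i 0| <= K) -> `|f x - g x| <= e).
Proof.
move=> cf fM K0 e0.
have M0 : 0 <= M := le_trans (normr_ge0 _) (fM 0).
(* Division by [cK] sends [-K, K] to [- pi / 4, pi / 4], where the sine is injective with values in
   [-a, a]. Since a < 1, truncation at [a] stays where [asin] is continuous. *)
pose a : R := sin (pi / 4).
pose cK := K / (pi / 4).
have pi4 : 0 < pi / 4 :> R by rewrite divr_gt0// pi_gt0.
have cK0 : 0 < cK by rewrite divr_gt0.
have a1 : a < 1.
  rewrite -sin_pihalf ltr_sin ?in_itv/= ?lexx ?andbT; have := pi_gt0 R; lra.
have a0 : 0 <= a.
  by rewrite sin_ge0_pi// ltW//=; have := pi_gt0 R; lra.
(* Truncation to [-a, a], in a form whose continuity is immediate. *)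
pose clamp (y : R) := (`|y + a| - `|y - a|) / 2.
have clampB y : `|clamp y| <= a.
  rewrite /clamp normrM normfV [`|2|]ger0_norm// ler_pdivrMr// (le_trans (ler_dist_dist _ _))//.
  by rewrite (_ : y + a - (y - a) = a * 2) ?ger0_norm ?mulr_ge0//; ring.
have clampE y : `|y| <= a -> clamp y = y.
  by rewrite ler_norml /clamp => /andP[h1 h2]; rewrite ger0_norm ?ler0_norm; [field|lra|lra].
pose phi (y : R) := cK * asin (clamp (2 * y - 1)).
have cclamp : continuous (fun y : R => clamp (2 * y - 1)).
  move=> y; have c1 : {for y, continuous (fun y : R => 2 * y - 1)}.
    by apply: cvgB; [apply: cvgM; [exact: cvg_cst|exact: cvg_id]|exact: cvg_cst].
  apply: cvgM; last exact: cvg_cst.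
  apply: cvgB; apply: cvg_norm.
    by apply: cvgD => //; exact: cvg_cst.
  by apply: cvgB => //; exact: cvg_cst.
have cphi : continuous phi.
  move=> y; apply: cvgM; first exact: cvg_cst.
  apply: (continuous_comp (f := fun y : R => clamp (2 * y - 1))); first exact: cclamp.
  apply: continuous_asin; have := clampB (2 * y - 1); rewrite ler_norml => /andP[].
  by move=> *; apply/andP; split; lra.
pose H (y : 'cV[R]_k) := f (\col_i phi (y i 0)).
have cH : continuous H.
  move=> y; apply: (continuous_comp (f := fun y : 'cV[R]_k => \col_i phi (y i 0))); last exact: cf.
  apply: continuous_cV_coord => i.
  rewrite (_ : (fun z => _) = phi \o (fun z : 'cV[R]_k => z i 0)); last by apply/funext => z; rewrite /= mxE.
  by apply: continuous_comp; [exact: coord_continuous|exact: cphi].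
pose s i (x : 'cV[R]_k) := (1 + sin (x i 0 / cK)) / 2.
have s01 x i : 0 <= s i x <= 1.
  by have := sin_le1 (x i 0 / cK); have := sin_geN1 (x i 0 / cK); rewrite /s => ? ?; apply/andP; split; lra.
have ts i : trigp (s i).
  have -> : s i = (fun x => 2^-1 * 1 + 2^-1 * sin (x i 0 / cK)).
    by apply/funext => x; rewrite /s; field.
  by apply: trigp_lin; [exact: trigp_cst|exact: trigp_sin_coord].
have HE (x : 'cV[R]_k) : (forall i, `|x i 0| <= K) -> f x = H (\col_i s i x).
  move=> xK; rewrite /H; congr f; apply/colP => i; rewrite !mxE /phi /s.
  have xi : `|x i 0 / cK| <= pi / 4.
    rewrite normrM normfV (gtr0_norm cK0) ler_pdivrMr//.
    by rewrite /cK mulrC divfK ?gt_eqF.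
  have sinm (z : R) : `|z| <= pi / 4 -> sin z <= a.
    rewrite ler_norml => /andP[z1 z2]; rewrite leNgt ltr_sin -?leNgt// in_itv/=; have := pi_gt0 R => ?.
      by apply/andP; split; lra.
    by apply/andP; split; lra.
  set z := x i 0 / cK in xi *.
  rewrite (_ : 2 * ((1 + sin z) / 2) - 1 = sin z); last by field.
  rewrite clampE; last first.
    by rewrite ler_norml sinm// andbT lerNl -sinN sinm// normrN.
  rewrite sinK; first by rewrite /z mulrC divfK// gt_eqF.
  by move: xi; rewrite ler_norml in_itv/= => /andP[*]; have := pi_gt0 R => ?; apply/andP; split; lra.
have e2 : 0 < e / 2 by rewrite divr_gt0.
have [del d0 hd] := compact_unif_continuous (@compact_box R k 0 1) (fun x _ => cH x) e2.
(* As in Chebyshev's inequality: if some success frequency is at distance [del] or more from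
   [s i x], the trivial bound 2 M is at most [C] times the squared deviation. *)
pose C := 2 * M / del ^+ 2.
have C0 : 0 <= C by apply: divr_ge0; [rewrite mulr_ge0|exact: sqr_ge0].
(* With [N] trials per coordinate the squared deviations of the frequencies have means adding up to
   at most k / N, and this [N] makes C k / N <= e / 2. *)
pose N := (Num.bound (C * k%:R / (e / 2))).+1.
have N0 : 0 < N%:R :> R by rewrite ltr0n.
pose L := flatten (nseq N (enum 'I_k)).
have cL i : count_mem i L = N.
  suff h n : count_mem i (flatten (nseq n (enum 'I_k))) = n by exact: h.
  elim: n => //= n IH.
  by rewrite count_cat IH count_uniq_mem ?enum_uniq// mem_enum.
pose g J := H (\col_i ((J i)%:R / N%:R)).
exists (fun x => bern L (fun i => s i x) g); first exact: trigp_bern.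
split => x.
  by rewrite -(bern_cst L (fun i => s i x) M); apply: bern_norm_le => // J; exact: fM.
move=> xK; rewrite (HE _ xK).
pose y : 'cV[R]_k := \col_i s i x.
rewrite -[H _](bern_cst L (fun i => s i x)).
have -> : bern L (fun i => s i x) (fun=> H y) - bern L (fun i => s i x) g =
    bern L (fun i => s i x) (fun J => 1 * H y + (-1) * g J) by rewrite bern_lin; ring.
apply: (@le_trans _ _ (bern L (fun i => s i x)
   (fun J => 1 * (e / 2) + (C / N%:R ^+ 2) * \sum_(i <- enum 'I_k) ((J i)%:R - (count_mem i L)%:R * s i x) ^+ 2))).
  apply: bern_norm_le => // J; rewrite !mul1r mulN1r.
  have yA : [set x : 'cV[R]_k | forall i, 0 <= x i 0 <= 1] y by move=> i; rewrite mxE.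
  have S0 : 0 <= \sum_(i <- enum 'I_k) ((J i)%:R - (count_mem i L)%:R * s i x) ^+ 2.
    by apply: sumr_ge0 => i _; exact: sqr_ge0.
  have [hh|] := pselect (forall i, `|y i 0 - (J i)%:R / N%:R| < del).
    rewrite ler_wpDr//; first by rewrite mulr_ge0// divr_ge0// exprn_ge0// ltW.
    apply/ltW/hd => //; apply: normr_cV_lt => // i; rewrite !mxE.
    by have := hh i; rewrite mxE.
  move=> /existsNP[i /negP]; rewrite -leNgt => hi.
  rewrite ler_wpDl ?(ltW e2)//.
  apply: (@le_trans _ _ (2 * M)).
    by rewrite (le_trans (ler_normB _ _))// mulr2n mulrDl !mul1r lerD// fM.
  apply: (@le_trans _ _ (C / N%:R ^+ 2 * ((J i)%:R - (count_mem i L)%:R * s i x) ^+ 2)).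
    rewrite cL [leRHS](_ : _ = C * (((J i)%:R - N%:R * s i x) / N%:R) ^+ 2); last by rewrite exprMn exprVn; ring.
    have -> : ((J i)%:R - N%:R * s i x) / N%:R = - (y i 0 - (J i)%:R / N%:R).
      by rewrite mxE; field; rewrite gt_eqF.
    rewrite sqrrN -(real_normK (num_real (y i 0 - _))).
    rewrite /C -mulrA ler_peMr ?mulr_ge0// ler_pdivlMl ?exprn_gt0// mulr1.
    by rewrite lerXn2r ?nnegrE// ltW.
  rewrite ler_wpM2l//; first by rewrite divr_ge0// exprn_ge0// ltW.
  rewrite (bigD1_seq i)//= ?mem_enum ?enum_uniq// lerDl.
  by apply: sumr_ge0 => j _; exact: sqr_ge0.
rewrite bern_lin bern_cst bern_sum mul1r [leRHS]splitr lerD2l.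
apply: (@le_trans _ _ (C / N%:R ^+ 2 * (N%:R * k%:R))).
  rewrite ler_wpM2l//; first by rewrite divr_ge0// exprn_ge0// ltW.
  have -> : N%:R * k%:R = \sum_(i <- enum 'I_k) (N%:R : R).
    by rewrite big_enum sumr_const card_ord mulr_natr.
  apply: ler_sum => i _; rewrite bern_var cL ler_piMr ?(ltW N0)//.
  by have /andP[] := s01 x i; nra.
rewrite (_ : C / N%:R ^+ 2 * (N%:R * k%:R) = C * k%:R / N%:R); last by field; rewrite gt_eqF.
rewrite ler_pdivrMr// [leRHS]mulrC -ler_pdivrMr//.
apply: (le_trans (ltW (archi_boundP _))); last by rewrite ler_nat /N.
by apply: divr_ge0; [apply: mulr_ge0 => //; exact: ltW|rewrite divr_ge0// ltW].
Qed.

End TrigPolynomials.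

Section WeakConvergence.
Context (R : realType) d (Omega : measurableType d) (P : probability Omega R) (k : nat).

Lemma measurable_trigp (g : 'cV[R]_k -> R) : trigp g -> measurable_fun setT (g : borel_cV R k -> R).
Proof. by move=> tg; apply: continuous_measurable_cV; exact: trigp_continuous. Qed.

Lemma trigp_bounded (g : 'cV[R]_k -> R) : trigp g -> exists B : R, forall x, `|g x| <= B.
Proof.
elim => {g} [u c|a b g1 g2 _ [B1 h1] _ [B2 h2]].
  by exists 1 => x; rewrite ler_norml cos_geN1 cos_le1.
exists (`|a| * B1 + `|b| * B2) => x; rewrite (le_trans (ler_normD _ _))//.
by rewrite !normrM lerD// ler_wpM2l.
Qed.

Lemma measurable_comp_cV (f : 'cV[R]_k -> R) (X : Omega -> 'cV[R]_k) :
  continuous f -> random_vector X -> measurable_fun setT (fun w => f (X w)).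
Proof. by move=> cf mX; apply: measurableT_comp mX; exact: continuous_measurable_cV. Qed.

Lemma continuous_mxnorm : continuous (fun x : 'cV[R]_k => `|x|).
Proof. exact: norm_continuous. Qed.

Lemma measurable_normr_gt (X : Omega -> 'cV[R]_k) (K : R) :
  random_vector X -> measurable [set w | K < `|X w|].
Proof.
move=> mX; have mn := measurable_comp_cV continuous_mxnorm mX.
rewrite -[X in measurable X]setTI.
by apply: measurable_fun_ltr => //; exact: measurable_cst.
Qed.

Lemma Rint_approx d' (T : measurableType d') (Q : probability T R) (F G : T -> R) (A : set T) (M e : R) :
  measurable_fun setT F -> measurable_fun setT G -> measurable A -> 0 <= e ->
  (forall w, `|F w| <= M) -> (forall w, `|G w| <= M) ->
  (forall w, ~ A w -> `|F w - G w| <= e) ->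
  `|\int[Q]_w F w - \int[Q]_w G w| <= e + 2 * M * fine (Q A).
Proof.
move=> mF mG mA e0 FM GM FG.
have iF := integ_bounded Q mF FM; have iG := integ_bounded Q mG GM.
rewrite -RintB// (le_trans (Rint_norm_le (integB iF iG)))//.
have iA := integZ (2 * M) (integ_indic Q mA).
have -> : e + 2 * M * fine (Q A) = \int[Q]_w (e + 2 * M * \1_A w).
  rewrite RintD//; last exact: integ_cst.
  by rewrite Rintegral_prob_cst RintZ ?Rint_indic//; exact: integ_indic.
apply: Rint_le => [||w].
- by apply: integ_norm; exact: integB.
- by apply: integD => //; exact: integ_cst.
rewrite indicE; case: (boolP (w \in A)) => wA.
  rewrite mulr1 ler_wpDl// (le_trans (ler_normB _ _))//.
  by rewrite mulr_natl mulr2n lerD.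
by rewrite mulr0 addr0; apply: FG; move: wA; rewrite notin_setE.
Qed.

(** On a large cube [f] is replaced by a trigonometric polynomial with the same uniform bound [M].
    Outside, both are bounded by [M], and tightness makes that region improbable under [mu] and, for
    large [n], under the law of [X n]. *)
Theorem trig_tight_cvg_in_distribution (X : nat -> Omega -> 'cV[R]_k)
    (mu : probability (borel_cV R k) R) :
  (forall n, random_vector (X n)) ->
  (forall (u : 'cV[R]_k) (c : R), \int[P]_w cos ((u^T *m X n w) 0 0 + c) @[n --> \oo] -->
     \int[mu]_x cos ((u^T *m (x : 'cV[R]_k)) 0 0 + c)) ->
  (forall e : R, 0 < e -> exists K : R,
     (\forall n \near \oo, fine (P [set w | K < `|X n w|]) <= e) /\
     fine (mu [set x : 'cV[R]_k | K < `|x|]) <= e) ->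
  cvg_in_distribution P X mu.
Proof.
move=> mX cosX tX f cf [M fM].
have M0 : 0 <= M := le_trans (normr_ge0 _) (fM 0).
have mid : random_vector (fun x : borel_cV R k => x : 'cV[R]_k) by exact: measurable_id.
have mf n : measurable_fun setT (fun w => f (X n w)) by exact: measurable_comp_cV.
have mfmu : measurable_fun setT (f : borel_cV R k -> R) by exact: continuous_measurable_cV.
have iX n : integ P (fun w => f (X n w)) by apply: (@integ_bounded _ _ _ _ _ M) => // w.
have imu : integ mu (f : borel_cV R k -> R) by apply: (@integ_bounded _ _ _ _ _ M) => // w.
have trig g : trigp g -> \int[P]_w g (X n w) @[n --> \oo] --> \int[mu]_x g (x : 'cV[R]_k).
  elim => {g} [u c|a b g h tg cg th ch]; first exact: cosX.
  have ig g' n : trigp g' -> integ P (fun w => g' (X n w)).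
    move=> tg'; have [B hB] := trigp_bounded tg'.
    apply: (@integ_bounded _ _ _ _ _ B) => // .
    by apply: measurable_comp_cV => //; exact: trigp_continuous.
  have igm g' : trigp g' -> integ mu (g' : borel_cV R k -> R).
    move=> tg'; have [B hB] := trigp_bounded tg'.
    by apply: (@integ_bounded _ _ _ _ _ B) => //; exact: measurable_trigp.
  have -> : (fun n => \int[P]_w (a * g (X n w) + b * h (X n w))) =
     (fun n => a * \int[P]_w g (X n w) + b * \int[P]_w h (X n w)).
    by apply/funext => n; rewrite RintD ?RintZ//; try apply: integZ; exact: ig.
  have -> : \int[mu]_x (a * g (x : 'cV[R]_k) + b * h (x : 'cV[R]_k)) =
      a * \int[mu]_x g (x : 'cV[R]_k) + b * \int[mu]_x h (x : 'cV[R]_k).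
    by rewrite RintD ?RintZ//; try apply: integZ; exact: igm.
  by apply: cvgD; apply: cvgM => //; exact: cvg_cst.
rewrite (_ : (fun n => _) = EFin \o (fun n => \int[P]_w f (X n w))); last first.
  by apply/funext => n; rewrite /= Rint_fin.
rewrite (Rint_fin imu); apply: (@cvg_comp _ _ _ _ _ _ (nbhs (\int[mu]_x f (x : 'cV[R]_k)))); last first.
  by move=> A /=.
apply/cvgrPdist_le => e e0.
(* The errors add up to e1 (3 + 4 M): e1 + 2 M e1 for each of the two replacements and e1 for the
   convergence of the polynomial. *)
pose e1 := e / (4 * (1 + M)).
have M1 : 0 < 1 + M by rewrite ltr_wpDr.
have e10 : 0 < e1 by rewrite divr_gt0// mulr_gt0.
have [K0 [tn tmu]] := tX _ e10.
pose K := Num.max 1 K0.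
have K_gt0 : 0 < K by rewrite lt_max ltr01.
have [g tg [gM fg]] := trigp_approx cf fM K_gt0 e10.
have KK T' (Y : T' -> 'cV[R]_k) w : ~ (K0 < `|Y w|) -> `|f (Y w) - g (Y w)| <= e1.
  move=> /negP; rewrite -leNgt => h; apply: fg => i.
  by rewrite (le_trans (normr_coord_le _ i))// /K le_max h orbT.
have mgX n : measurable_fun setT (fun w => g (X n w)).
  by apply: measurable_comp_cV => //; exact: trigp_continuous.
have hmu : `|\int[mu]_x f (x : 'cV[R]_k) - \int[mu]_x g (x : 'cV[R]_k)| <= e1 + 2 * M * e1.
  rewrite (le_trans (@Rint_approx _ _ mu _ _ [set x : 'cV[R]_k | K0 < `|x|] M e1 _ _ _ _ _ _ _))//.
  - exact: measurable_trigp.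
  - have mn := continuous_measurable_cV continuous_mxnorm.
    by rewrite -[X in measurable X]setTI; apply: measurable_fun_ltr => //; exact: measurable_cst.
  - exact: ltW.
  - by move=> w; exact: (KK _ id).
  - by rewrite lerD2l ler_wpM2l// mulr_ge0.
have hc : \forall n \near \oo, `|\int[mu]_x g (x : 'cV[R]_k) - \int[P]_w g (X n w)| <= e1.
  by move/cvgrPdist_le : (trig _ tg) => /(_ _ e10).
near=> n.
have hn : `|\int[P]_w f (X n w) - \int[P]_w g (X n w)| <= e1 + 2 * M * e1.
  rewrite (le_trans (@Rint_approx _ _ P _ _ [set w | K0 < `|X n w|] M e1 _ _ _ _ _ _ _))//.
  - exact: measurable_normr_gt.
  - exact: ltW.
  - by move=> w; exact: (KK _ (X n)).
  - by rewrite lerD2l ler_wpM2l ?mulr_ge0//; near: n.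
have h3 : `|\int[mu]_x g (x : 'cV[R]_k) - \int[P]_w g (X n w)| <= e1 by near: n.
move: hmu hn h3.
set a1 := \int[mu]_x f _; set a2 := \int[mu]_x g _; set a3 := \int[P]_w f _; set a4 := \int[P]_w g _.
move=> h1 h2 h3.
have -> : a1 - a3 = (a1 - a2) + (a2 - a4) - (a3 - a4) by ring.
rewrite (le_trans (ler_normB _ _))// (le_trans (lerD (le_trans (ler_normD _ _) (lerD h1 h3)) h2))//.
have -> : e1 + 2 * M * e1 + e1 + (e1 + 2 * M * e1) = e1 * (3 + 4 * M) by ring.
by rewrite /e1 mulrAC ler_pdivrMr ?mulr_gt0// ler_wpM2l ?(ltW e0)//; lra.
Unshelve. all: by end_near. Qed.

End WeakConvergence.

Section GaussianMeasures.
Context (R : realType) d (Omega : measurableType d) (P : probability Omega R).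
Variables (T : R) (r : nat) (W : R -> Omega -> 'cV[R]_r).
Hypotheses (HW : wiener P T W) (T0 : 0 < T) (r0 : (0 < r)%N).

Lemma gauss_rv_sum d' (T' : measurableType d') (P' : probability T' R) n
    (a : nat -> T' -> R) (v : nat -> R) :
  (forall i, (i < n)%N -> 0 <= v i) -> (forall i, (i < n)%N -> gauss_rv P' (a i) (v i)) ->
  (forall m, (m < n)%N -> indep_rv P' (fun w => \sum_(0 <= i < m) a i w) (a m)) ->
  gauss_rv P' (fun w => \sum_(0 <= i < n) a i w) (\sum_(0 <= i < n) v i).
Proof.
move=> v0 ga ind; have : forall m, (m <= n)%N ->
    gauss_rv P' (fun w => \sum_(0 <= i < m) a i w) (\sum_(0 <= i < m) v i); last first.
  by move=> h; exact: h.
elim => [|m IH] mn.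
  rewrite big_geq//; under eq_fun do rewrite big_geq//; exact: gauss_rv_cst0.
rewrite big_nat_recr//=; under eq_fun do rewrite big_nat_recr//=.
apply: (gauss_rvD HW T0 r0).
- rewrite big_nat; apply: sumr_ge0 => i /andP[_ im].
  by apply: v0; exact: ltn_trans im mn.
- exact: v0.
- exact: IH (ltnW mn).
- exact: ga.
- exact: ind.
Qed.

(* The law of [L] applied to normalized increments of [W], so no product measure is needed. *)
Lemma gaussian_measure_exists q (L : 'M[R]_q) :
  exists mu : probability (borel_cV R q) R,
    gaussian_vector mu (fun x : 'cV[R]_q => x) 0 (L *m L^T).
Proof.
pose t (i : nat) : R := i%:R * (T / q%:R).
have tS i : (i < q)%N -> t i < t i.+1.
  move=> iq; rewrite /t ltr_pM2r ?ltr_nat// divr_gt0// ltr0n.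
  exact: leq_ltn_trans iq.
have t0 : 0 <= t 0%N by rewrite /t mul0r.
have tn : t q <= T.
  rewrite /t; have [->|q0] := posnP q; first by rewrite mul0r ltW.
  by rewrite mulrCA divff ?mulr1// pnatr_eq0 -lt0n.
have tB := grid_bounds t0 tS tn.
(* Scales an increment over a step of length T / q to variance 1. The vector [e0] selects one
   coordinate of [W], and the [q] steps supply [q] independent standard Gaussians. *)
pose l := Num.sqrt (q%:R / T).
pose e0 : 'cV[R]_r := delta_mx (Ordinal r0) 0.
have e0E : (e0^T *m e0) 0 0 = 1.
  rewrite mulmx_cVE (bigD1 (Ordinal r0))//= !mxE !eqxx mulr1 big1 ?addr0// => i.
  by move=> /negbTE i0; rewrite !mxE i0 mul0r.
pose z (i : nat) w := l * (e0^T *m grid_incr W q t i w) 0 0.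
pose X w : 'cV[R]_q := L *m (\col_i z i w).
have uX (u : 'cV[R]_q) w : (u^T *m X w) 0 0 =
    \sum_(0 <= i < q) (if insub i is Some j then (u^T *m L) 0 j else 0) * z i w.
  rewrite /X mulmxA mxE big_mkord; apply: eq_bigr => i _.
  by rewrite (valK i) [X in _ * X = _]mxE.
have mX : random_vector X.
  apply/measurable_cVP => i.
  have -> : (fun w => X w i 0) = (fun w => ((delta_mx i 0 : 'cV[R]_q)^T *m X w) 0 0).
    by apply/funext => w; rewrite trmx_delta -rowE !mxE.
  under eq_fun do rewrite uX.
  apply: measurable_sum => j; apply: measurable_funM => //.
  apply: measurable_funM => //; apply: measurable_mulmx_cV.
  exact: (grid_incr_meas HW t0 tS tn).
pose XX : {RV P >-> borel_cV R q} := HB.pack (X : Omega -> borel_cV R q) (isMeasurableFun.Build _ _ _ _ _ mX).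
exists (distribution P XX) => u A mA.
rewrite mulmx0 [in gauss1 _]mxE.
have gU : gauss_rv P (fun w => (u^T *m X w) 0 0) ((u^T *m (L *m L^T) *m u) 0 0).
  pose b i : R := if insub i is Some j then (u^T *m L) 0 j else 0.
  have -> : (u^T *m (L *m L^T) *m u) 0 0 = \sum_(0 <= i < q) b i ^+ 2.
    have -> : u^T *m (L *m L^T) *m u = (u^T *m L) *m (u^T *m L)^T.
      by rewrite trmx_mul trmxK !mulmxA.
    rewrite mxE big_mkord; apply: eq_bigr => i _.
    by rewrite /b (valK i) expr2 [X in _ * X = _]mxE.
  under eq_fun do rewrite uX -/(b _).
  apply: gauss_rv_sum => [i _|i iq|m mq]; first exact: sqr_ge0.
    have /andP[ti0 _] := tB i (ltnW iq); have /andP[_ ti1] := tB i.+1 iq.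
    have := @wiener_gauss_rv _ _ _ _ _ _ _ HW ((b i * l) *: e0) _ _ ti0 (tS i iq) ti1.
    have -> : (t i.+1 - t i) * (((b i * l) *: e0)^T *m ((b i * l) *: e0)) 0 0 = b i ^+ 2.
      have -> : ((b i * l) *: e0)^T = (b i * l) *: e0^T by rewrite linearZ.
      have -> : ((b i * l) *: e0^T *m ((b i * l) *: e0)) 0 0 = b i * l * (b i * l).
        by rewrite -scalemxAr mxE -scalemxAl mxE e0E mulr1.
      rewrite (_ : b i * l * (b i * l) = b i ^+ 2 * l ^+ 2); last by ring.
      rewrite sqr_sqrtr ?divr_ge0 ?(ltW T0)// /t -(natr1 i).
      have q0 : (0 < q)%N by exact: leq_ltn_trans iq.
      by field; rewrite !(gt_eqF T0) pnatr_eq0 -lt0n q0.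
    congr gauss_rv; apply/funext => w.
    rewrite /z /grid_incr iq (_ : ((b i * l) *: e0)^T = (b i * l) *: e0^T) ?linearZ//.
    by rewrite -scalemxAl mxE mulrA.
  exact: (grid_sum_indep HW t0 tS tn
    (phi := fun i x => b i * (l * (e0^T *m x) 0 0)) (fun i => measurable_funM (measurable_cst _)
     (measurable_funM (measurable_cst _) (measurable_mulmx_cV e0 (@measurable_id _ _ _)))) mq).
by rewrite -(gU.2 _ mA).
Qed.

Lemma gaussian_vector_gauss_rv d' (T' : measurableType d') (P' : probability T' R) q
    (Z : T' -> 'cV[R]_q) (V : 'M[R]_q) (u : 'cV[R]_q) :
  random_vector Z -> gaussian_vector P' Z 0 V ->
  gauss_rv P' (fun w => (u^T *m Z w) 0 0) ((u^T *m V *m u) 0 0).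
Proof.
move=> mZ gZ; split; first exact: measurable_mulmx_cV.
by move=> A mA; have := gZ u A mA; rewrite mulmx0 [in gauss1 _]mxE.
Qed.

Lemma gauss_cos_shift d' (T' : measurableType d') (P' : probability T' R) (X : T' -> R) v (c : R) :
  0 <= v -> gauss_rv P' X v ->
  \int[P']_w cos (X w + c) = cos c * expR (- (v / 2)).
Proof.
move=> v0 gX; have [ec es] := gauss_cos_sin HW T0 r0 v0 gX.
under eq_Rintegral do rewrite cosD mulrC [X in _ - X]mulrC.
rewrite RintB; try by apply: integZ; [exact: integ_cos gX.1|exact: integ_sin gX.1].
- by rewrite !RintZ ?ec ?es ?mulr0 ?subr0//; [exact: integ_sin gX.1|exact: integ_cos gX.1].
- by apply: integZ; exact: integ_cos gX.1.
- by apply: integZ; exact: integ_sin gX.1.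
Qed.

End GaussianMeasures.

Lemma normr_cV_gt (R : realType) k (x : 'cV[R]_k) (K : R) : 0 <= K -> K < `|x| -> exists i, K < `|x i 0|.
Proof.
move=> K0 h; apply: contrapT => hn; move: h; apply/negP; rewrite -leNgt.
rewrite {1}/Num.norm/= mx_normrE; apply: bigmax_le => // -[i j] _ /=.
rewrite (ord1 j) leNgt; apply/negP => hi; apply: hn.
by exists i.
Qed.

(** * Linear combinations of independent Wiener processes *)

(* A Wiener process with the matrix through which it enters the p-dimensional noise. *)
Record noise_src (R : realType) (Omega : Type) (p : nat) := NoiseSrc {
  src_dim : nat;
  src_W : R -> Omega -> 'cV[R]_src_dim;
  src_A : 'M[R]_(p, src_dim) }.

Section Noise.
Context (R : realType) d (Omega : measurableType d) (P : probability Omega R).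
Variables (T : R) (r0 : nat) (W0 : R -> Omega -> 'cV[R]_r0).
Hypotheses (HW0 : wiener P T W0) (T0 : 0 < T) (r0_gt0 : (0 < r0)%N).
Variables (J p : nat) (s : 'I_J -> noise_src R Omega p).
Hypothesis Hs : forall j, wiener P T (src_W (s j)).
Hypothesis Hind : mutually_independent P (fun j => sigma_proc T (src_W (s j))).

Definition noise t w : 'cV[R]_p := \sum_j src_A (s j) *m src_W (s j) t w.

Definition noise_cov : 'M[R]_p := \sum_j src_A (s j) *m (src_A (s j))^T.

Variables (n : nat) (t : nat -> R).
Hypotheses (t0 : 0 <= t 0%N) (tS : forall i, (i < n)%N -> t i < t i.+1) (tn : t n <= T).

Definition dnoise i w : 'cV[R]_p := \sum_j src_A (s j) *m grid_incr (src_W (s j)) n t i w.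

Lemma dnoiseE i w : (i < n)%N -> dnoise i w = noise (t i.+1) w - noise (t i) w.
Proof.
move=> ni; rewrite /dnoise /noise -sumrB; apply: eq_bigr => j _.
by rewrite /grid_incr ni mulmxBr.
Qed.

Let gmeas j i : random_vector (grid_incr (src_W (s j)) n t i).
Proof. exact: (grid_incr_meas (Hs j) t0 tS tn). Qed.

Lemma grid_incr_sigma_proc (j : 'I_J) (i : nat) (A : set Omega) :
  sigma_vec (grid_incr (src_W (s j)) n t i) A -> sigma_proc T (src_W (s j)) A.
Proof.
move=> [C mC <-].
pose G := \bigcup_(t in `[0, T]) sigma_vec (src_W (s j) t).
have mW u : 0 <= u <= T -> random_vector (src_W (s j) u : g_sigma_algebraType G -> _).
  move=> uT _ B mB; apply: sub_sigma_algebra; exists u; first by rewrite /= in_itv.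
  by exists B.
have : random_vector (grid_incr (src_W (s j)) n t i : g_sigma_algebraType G -> _).
  rewrite /grid_incr; case: ltnP => ni; last exact: random_vector_cst.
  by apply: random_vectorB; apply: mW; apply: (grid_bounds t0 tS tn) => //; exact: ltnW.
by move=> /(_ measurableT _ mC).
Qed.

Let F (j : 'I_J) i := sigma_vec (grid_incr (src_W (s j)) n t i).

Let mF j i : F j i `<=` measurable.
Proof. by apply: sigma_vec_measurable; exact: gmeas. Qed.

(** Independence of the sources factors the probability over [j], independence of the increments of
    each source factors it over [i]. *)
Let indF (A : 'I_J -> nat -> set Omega) : (forall j i, F j i (A j i)) ->
  P (\bigcap_(j in [set: 'I_J]) \bigcap_(i in `I_n) A j i) =
  (\prod_(j < J) \prod_(0 <= i < n) P (A j i))%E.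
Proof.
move=> FA; have := Hind (J := [set: 'I_J]%SET) (A := fun j => \bigcap_(i in `I_n) A j i).
rewrite (_ : \bigcap_(i in [set` [set: 'I_J]%SET]) _ =
  \bigcap_(j in [set: 'I_J]) \bigcap_(i in `I_n) A j i); last first.
  by apply/seteqP; split => w h i _; apply: h => //=; rewrite finset.in_setT.
move=> ->.
  rewrite (eq_bigl xpredT); last by move=> i; rewrite finset.in_setT.
  apply: eq_bigr => j _; exact: (grid_incr_indep (Hs j) t0 tS tn (FA j)).
move=> j _; rewrite /sigma_proc; set G := \bigcup_(_ in _) _.
apply: (@fin_bigcap_measurable _ (g_sigma_algebraType G)) => // i _.
exact: grid_incr_sigma_proc (FA j i).
Qed.

Lemma random_vector_mulmx d' (T' : measurableType d') k l (A : 'M[R]_(l, k)) (Z : T' -> 'cV[R]_k) :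
  random_vector Z -> random_vector (fun w => A *m Z w).
Proof.
move=> /measurable_cVP mZ; apply/measurable_cVP => i; under eq_fun do rewrite mxE.
by apply: measurable_sum => j; apply: measurable_funM.
Qed.

Lemma random_vector_sum d' (T' : measurableType d') k (I : Type) (l : seq I) (Q : pred I)
    (Z : I -> T' -> 'cV[R]_k) :
  (forall i, random_vector (Z i)) -> random_vector (fun w => \sum_(i <- l | Q i) Z i w).
Proof.
move=> mZ; apply/measurable_cVP => i.
have -> : (fun w => (\sum_(j <- l | Q j) Z j w) i 0) = (fun w => \sum_(j <- l | Q j) Z j w i 0).
  by apply/funext => w; rewrite summxE.
elim: l => [|j l IH].
  by under eq_fun do rewrite big_nil; exact: measurable_cst.
under eq_fun do rewrite big_cons; case: (Q j) => //.
by apply: measurable_funD => //; move/measurable_cVP : (mZ j).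
Qed.

Lemma noise_meas u : 0 <= u <= T -> random_vector (noise u).
Proof.
by move=> uT; apply: random_vector_sum => j; apply: random_vector_mulmx; exact: wiener_meas (Hs j) _ uT.
Qed.

Lemma dnoise_indep (phi : nat -> 'cV[R]_p -> R) :
  (forall i, measurable_fun setT (phi i : borel_cV R p -> R)) ->
  forall m, (m < n)%N -> indep_rv P
    (fun w => \sum_(0 <= i < m) phi i (dnoise i w)) (fun w => phi m (dnoise m w)).
Proof.
move=> mphi m mn.
apply: (@block_indep_sum _ _ _ P J n F mF _ _ indF (fun i w => phi i (dnoise i w))) => //.
- by move=> j i; exact: sigma_vec_setI.
- by move=> j i; exact: sigma_vec_setT.
move=> i ni.
suff mV : measurable_fun setT (dnoise i : g_sigma_algebraType (present F i) -> borel_cV R p).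
  exact: measurableT_comp (mphi i) mV.
apply: random_vector_sum => j; apply: random_vector_mulmx.
apply: (@measurable_present_cV _ _ _ J F _ _ _ j i) => [k l|A mA].
  exact: sigma_vec_setT.
exact: sigma_vec_preimage.
Qed.

(** Within one step the sources contribute independent Gaussian variables, whose variances add up to
    the form of [noise_cov]. The sum lemma is indexed by natural numbers, hence [insub]; [HW0]
    supplies the reference process for adding Gaussian variables. *)
Lemma dnoise_gauss (u : 'cV[R]_p) i : (i < n)%N ->
  gauss_rv P (fun w => (u^T *m dnoise i w) 0 0)
    ((t i.+1 - t i) * (u^T *m noise_cov *m u) 0 0).
Proof.
move=> ni.
pose b k w := if insub k is Some j then
  (((src_A (s j))^T *m u)^T *m grid_incr (src_W (s j)) n t i w) 0 0 else 0.
pose v k := if insub k is Some j then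
  (t i.+1 - t i) * (((src_A (s j))^T *m u)^T *m ((src_A (s j))^T *m u)) 0 0 else 0.
have -> : (fun w => (u^T *m dnoise i w) 0 0) = (fun w => \sum_(0 <= k < J) b k w).
  apply/funext => w; rewrite /dnoise mulmx_sumr summxE big_mkord; apply: eq_bigr => j _.
  by rewrite /b (valK j) trmx_mul trmxK mulmxA.
have -> : (t i.+1 - t i) * (u^T *m noise_cov *m u) 0 0 = \sum_(0 <= k < J) v k.
  rewrite /noise_cov mulmx_sumr mulmx_suml summxE big_mkord mulr_sumr; apply: eq_bigr => j _.
  by rewrite /v (valK j) trmx_mul trmxK !mulmxA.
have /andP[ti0 _] := grid_bounds t0 tS tn (ltnW ni); have /andP[_ ti1] := grid_bounds t0 tS tn ni.
have dt := tS ni.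
apply: (gauss_rv_sum HW0 T0 r0_gt0).
- move=> k _; rewrite /v; case: insub => // j; apply: mulr_ge0; first by rewrite subr_ge0 ltW.
  by rewrite mulmx_cVE; apply: sumr_ge0 => l _; rewrite -expr2 sqr_ge0.
- move=> k kJ; rewrite /b /v insubT/=; rewrite /grid_incr ni.
  exact: (wiener_gauss_rv (Hs _) _ ti0 dt ti1).
- move=> m mJ.
  (* Block independence with a single row, in which the sources take the place of the time steps. *)
  pose F1 (_ : 'I_1) k := if insub k is Some j then F j i else [set setT].
  apply: (@block_indep_sum _ _ _ P 1 J F1 _ _ _ _ b) => //.
  + move=> j' k; rewrite /F1; case: insub => [j|]; first exact: mF.
    by move=> _ ->; exact: measurableT.
  + move=> j' k; rewrite /F1; case: insub => [j|]; first exact: sigma_vec_setI.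
    by move=> _ _ -> ->; rewrite setTI.
  + by move=> j' k; rewrite /F1; case: insub => [j|//]; exact: sigma_vec_setT.
  + move=> A FA; rewrite big_ord_recl big_ord0 mule1.
    have := Hind (J := [set: 'I_J]%SET) (A := fun j => A ord0 j).
    rewrite (_ : \bigcap_(i in [set` [set: 'I_J]%SET]) _ =
      \bigcap_(j in [set: 'I_1]) \bigcap_(k in `I_J) A j k); last first.
      apply/seteqP; split => w h.
        move=> k _ l /= lJ; rewrite (ord1 k); have := h (Ordinal lJ); apply.
        by rewrite /= finset.in_setT.
      by move=> k _; exact: (h ord0 I k (ltn_ord k)).
    move=> ->; first by rewrite big_mkord (eq_bigl xpredT)// => j; rewrite finset.in_setT.
    move=> j _; apply: (grid_incr_sigma_proc (i := i)).
    by have := FA ord0 j; rewrite /F1 (valK j).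
  + move=> k kJ; rewrite /b insubT/=.
    apply: (measurable_mulmx_cV (T' := g_sigma_algebraType (present F1 k))).
    apply: (@measurable_present_cV _ _ _ 1 F1 _ _ _ ord0 k) => [l a|A mA].
      by rewrite /F1; case: insub => [j|//]; exact: sigma_vec_setT.
    by rewrite /F1 insubT; exact: sigma_vec_preimage.
Qed.

End Noise.

(** * Sums of Gaussian quadratic forms *)

Section QuadraticForms.
Variable R : realType.

Lemma trmx00 (A : 'M[R]_1) : A^T 0 0 = A 0 0.
Proof. by rewrite mxE. Qed.

Lemma sqr_sum_le (I : finType) (y : I -> R) :
  (\sum_i y i) ^+ 2 <= #|I|%:R * \sum_i y i ^+ 2.
Proof.
rewrite expr2 big_distrl/=.
apply: (@le_trans _ _ (\sum_i \sum_j (y i ^+ 2 + y j ^+ 2) / 2)).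
  apply: ler_sum => i _; rewrite big_distrr/=; apply: ler_sum => j _.
  by have := sqr_ge0 (y i - y j); nra.
rewrite (eq_bigr (fun i => #|I|%:R * (y i ^+ 2 / 2) + (\sum_j y j ^+ 2) / 2)) => [|i _].
  rewrite big_split/= -mulr_sumr sumr_const -mulr_natl -mulr_suml.
  by set a := \sum_i _; lra.
under eq_bigr do rewrite mulrDl.
by rewrite big_split/= sumr_const -mulr_suml mulr_natl.
Qed.

(** Polarization in place of a spectral decomposition: e_i e_j^T + e_j e_i^T is (e_i + e_j)(e_i +
    e_j)^T minus e_i e_i^T and e_j e_j^T. Quadratic forms thus become combinations of squares of
    linear forms. *)
Lemma symmetric_sum_rank1 p (B : 'M[R]_p) : B^T = B ->
  exists (I : finType) (l : I -> R) (a : I -> 'cV[R]_p),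
    B = \sum_k l k *: (a k *m (a k)^T).
Proof.
move=> symB; pose e (i : 'I_p) : 'cV[R]_p := delta_mx i 0.
have eE i j : e i *m (e j)^T = delta_mx i j.
  by rewrite /e trmx_delta mul_delta_mx.
exists (('I_p * 'I_p) + 'I_p)%type.
exists (fun k => match k with inl x => B x.1 x.2 / 2 | inr i => - \sum_j B i j end).
exists (fun k => match k with inl x => e x.1 + e x.2 | inr i => e i end).
rewrite big_sumType/= -(pair_bigA _ (fun i j => (B i j / 2) *: ((e i + e j) *m (e i + e j)^T)))/=.
have -> : \sum_i \sum_j (B i j / 2) *: ((e i + e j) *m (e i + e j)^T) =
   \sum_i \sum_j (B i j / 2) *: delta_mx i i + \sum_i \sum_j (B i j / 2) *: delta_mx j j
   + 2^-1 *: B + 2^-1 *: B^T.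
  have -> : 2^-1 *: B = \sum_i \sum_j (B i j / 2) *: delta_mx i j.
    rewrite {1}[B]matrix_sum_delta scaler_sumr; apply: eq_bigr => i _.
    by rewrite scaler_sumr; apply: eq_bigr => j _; rewrite scalerA mulrC.
  have -> : 2^-1 *: B^T = \sum_i \sum_j (B i j / 2) *: delta_mx j i.
    rewrite [B^T]matrix_sum_delta exchange_big/= scaler_sumr; apply: eq_bigr => i _.
    by rewrite scaler_sumr; apply: eq_bigr => j _; rewrite mxE scalerA mulrC.
  rewrite -!big_split/=; apply: eq_bigr => i _.
  rewrite -!big_split/=; apply: eq_bigr => j _.
  rewrite linearD/= mulmxDl !mulmxDr !eE -!scalerDr.
  by congr (_ *: _); rewrite (AC (2*2) (((1*4)*2)*3)).
rewrite [X in _ + X + _ + _]exchange_big/= symB -(addrA _ (2^-1 *: B) (2^-1 *: B)) -scalerDl.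
rewrite (_ : 2^-1 + 2^-1 = 1 :> R) ?scale1r; last by lra.
rewrite [RHS]addrC [X in _ + X]addrC addrCA -!big_split/= big1 ?addr0// => i _.
rewrite eE -!scaler_suml -!scalerDl (_ : _ + _ = 0) ?scale0r//.
have -> : \sum_(j < p) B j i = \sum_(j < p) B i j by apply: eq_bigr => j _; rewrite -[in LHS]symB mxE.
by rewrite /GRing.scale/=; set x := \sum_j _; lra.
Qed.

Definition qform p (B : 'M[R]_p) (x : 'cV[R]_p) : R := (x^T *m B *m x) 0 0.

Lemma qform_rank1 p (a x : 'cV[R]_p) : qform (a *m a^T) x = (a^T *m x) 0 0 ^+ 2.
Proof.
rewrite /qform mulmxA -mulmxA mxE big_ord1 expr2; congr (_ * _).
by rewrite -trmx00 trmx_mul trmxK.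
Qed.

Lemma qform_sum p (I : finType) (l : I -> R) (A : I -> 'M[R]_p) x :
  qform (\sum_k l k *: A k) x = \sum_k l k * qform (A k) x.
Proof.
rewrite /qform mulmx_sumr mulmx_suml summxE; apply: eq_bigr => k _.
by rewrite -scalemxAr -scalemxAl mxE.
Qed.

Lemma mxtrace_rank1 p (a : 'cV[R]_p) (S : 'M[R]_p) :
  \tr (a *m a^T *m S) = (a^T *m S *m a) 0 0.
Proof. by rewrite -mulmxA mxtrace_mulC /mxtrace big_ord1. Qed.

Lemma mxtrace_qform p (B : 'M[R]_p) x : \tr (B *m (x *m x^T)) = qform B x.
Proof. by rewrite mulmxA mxtrace_mulC mulmxA /mxtrace big_ord1. Qed.

End QuadraticForms.

Section GaussianQuadratic.
Context (R : realType) d0 (Omega0 : measurableType d0) (P0 : probability Omega0 R).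
Variables (T : R) (r : nat) (W : R -> Omega0 -> 'cV[R]_r).
Hypotheses (HW : wiener P0 T W) (T0 : 0 < T) (r0 : (0 < r)%N).
Variables (p : nat) (S : 'M[R]_p).
Hypotheses (symS : S^T = S) (posS : forall u, 0 <= qform S u).

(** Only a constant common to all realizations is wanted; it exists because the moment depends on
    the law alone. *)
Lemma gauss_eighth_moment v : 0 <= v -> exists K : R,
  forall d (T' : measurableType d) (P' : probability T' R) (X : T' -> R),
  gauss_rv P' X v -> \int[P']_w (X w ^+ 8) = K.
Proof.
move=> v0; have [X0 [gX0 _]] := gauss_model HW T0 r0 v0.
exists (\int[P0]_w (X0 w ^+ 8)) => d T' P' X gX.
have mf : measurable_fun setT (fun x : R => x ^+ 8).
  by apply: measurable_funX; exact: measurable_id.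
by have [_] := law_Rint gX.1 gX0.1 mf (gauss_law gX gX0) (integrable_gaussX v0 gX 8).
Qed.

(** Covariance of the linear forms with coefficients [a] and [b] under N(0, S). *)
Let c2 (a b : 'cV[R]_p) := (a^T *m S *m b) 0 0.

Let c2C a b : c2 a b = c2 b a.
Proof. by rewrite /c2 -trmx00 !trmx_mul trmxK symS mulmxA. Qed.

Let c2Dl a b x : c2 (a + b) x = c2 a x + c2 b x.
Proof. by rewrite /c2 linearD/= !mulmxDl mxE. Qed.

Let c2Nl a x : c2 (- a) x = - c2 a x.
Proof. by rewrite /c2 linearN/= !mulNmx mxE. Qed.

Let qformE a : qform S a = c2 a a.
Proof. by []. Qed.

(** [K] comes before the probability space and [X], so that one constant serves all increments and
    all grid sizes. The rank-one decomposition reduces every moment to one-dimensional Gaussian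
    ones. *)
Lemma gauss_quad_moments (B : 'M[R]_p) : B^T = B -> exists K : R,
  forall d (T' : measurableType d) (P' : probability T' R) (X : T' -> 'cV[R]_p),
  (forall u, gauss_rv P' (fun w => (u^T *m X w) 0 0) (qform S u)) ->
  let xi w := qform B (X w) - \tr (B *m S) in
  [/\ integ P' xi, integ P' (fun w => xi w ^+ 2) & integ P' (fun w => xi w ^+ 4)] /\
  [/\ \int[P']_w xi w = 0, \int[P']_w (xi w ^+ 2) = 2 * \tr (B *m S *m (B *m S)) &
      \int[P']_w (xi w ^+ 4) <= K].
Proof.
move=> /symmetric_sum_rank1[I [l [a BE]]].
have [K8 hK8] : exists K8 : I -> R, forall k d (T' : measurableType d) (P' : probability T' R) (X : T' -> R),
    gauss_rv P' X (qform S (a k)) -> \int[P']_w (X w ^+ 8) = K8 k.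
  exists (fun k => sval (cid (gauss_eighth_moment (posS (a k))))) => k.
  by case: cid.
pose c := \tr (B *m S).
pose N : R := #|I|%:R.
exists (8 * (N ^+ 3 * (\sum_k l k ^+ 4 * K8 k) + c ^+ 4)) => d T' P' X gX xi.
pose x k w := ((a k)^T *m X w) 0 0.
have ix k n : integ P' (fun w => x k w ^+ n) := integrable_gaussX (posS (a k)) (gX (a k)) n.
have xiE w : xi w = \sum_k l k * x k w ^+ 2 - c.
  by rewrite /xi -/c {1}BE qform_sum; congr (_ - _); apply: eq_bigr => k _; rewrite qform_rank1.
have cE : c = \sum_k l k * c2 (a k) (a k).
  rewrite /c BE mulmx_suml raddf_sum/=; apply: eq_bigr => k _.
  by rewrite -scalemxAl mxtraceZ mxtrace_rank1.
have ssE : \tr (B *m S *m (B *m S)) = \sum_k l k * \sum_m (l m * c2 (a k) (a m) ^+ 2).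
  rewrite -mulmxA {1}BE mulmx_suml raddf_sum/=; apply: eq_bigr => k _.
  rewrite -scalemxAl mxtraceZ mxtrace_rank1; congr (_ * _).
  transitivity (qform B (S *m a k)); first by rewrite /qform trmx_mul symS !mulmxA.
  rewrite BE qform_sum; apply: eq_bigr => m _.
  by rewrite qform_rank1 mulmxA -/(c2 _ _) c2C.
(* Isserlis' formula for E x^2 y^2, obtained by polarization from the fourth moments of x + y, x -
   y, x and y. *)
have ExB k m : integ P' (fun w => x k w ^+ 2 * x m w ^+ 2) /\
    \int[P']_w (x k w ^+ 2 * x m w ^+ 2) = c2 (a k) (a k) * c2 (a m) (a m) + 2 * c2 (a k) (a m) ^+ 2.
  pose xp w := ((a k + a m)^T *m X w) 0 0; pose xm w := ((a k - a m)^T *m X w) 0 0.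
  have xpE w : xp w = x k w + x m w by rewrite /xp linearD/= mulmxDl mxE.
  have xmE w : xm w = x k w - x m w by rewrite /xm linearB/= mulmxBl mxE [X in _ + X]mxE.
  have id4 w : x k w ^+ 2 * x m w ^+ 2 = 12^-1 * (xp w ^+ 4) + 12^-1 * (xm w ^+ 4) -
      (6^-1 * (x k w ^+ 4) + 6^-1 * (x m w ^+ 4)).
    by rewrite xpE xmE; field.
  have ip : integ P' (fun w => xp w ^+ 4) := integrable_gaussX (posS _) (gX _) 4.
  have im : integ P' (fun w => xm w ^+ 4) := integrable_gaussX (posS _) (gX _) 4.
  have i1 := integD (integZ 12^-1 ip) (integZ 12^-1 im).
  have i2 := integD (integZ 6^-1 (ix k 4)) (integZ 6^-1 (ix m 4)).
  split; first by under eq_fun do rewrite id4; exact: integB.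
  under eq_Rintegral do rewrite id4.
  rewrite RintB// RintD; [|exact: integZ|exact: integZ].
  rewrite RintD; [|exact: integZ|exact: integZ].
  rewrite !RintZ//.
  have [_ ->] := gauss_moments (posS _) (gX (a k + a m)).
  have [_ ->] := gauss_moments (posS _) (gX (a k - a m)).
  have [_ ->] := gauss_moments (posS _) (gX (a k)).
  have [_ ->] := gauss_moments (posS _) (gX (a m)).
  have -> : qform S (a k + a m) = c2 (a k) (a k) + c2 (a m) (a m) + 2 * c2 (a k) (a m).
    by rewrite qformE !c2Dl ![c2 _ (_ + _)]c2C !c2Dl (c2C (a m) (a k)); ring.
  have -> : qform S (a k - a m) = c2 (a k) (a k) + c2 (a m) (a m) - 2 * c2 (a k) (a m).
    by rewrite qformE !c2Dl !c2Nl ![c2 _ (_ - _)]c2C !c2Dl !c2Nl (c2C (a m) (a k)); ring.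
  by rewrite !qformE; field.
have m2 k : \int[P']_w (x k w ^+ 2) = c2 (a k) (a k) by have [->] := gauss_moments (posS _) (gX (a k)).
have ilx k : integ P' (fun w => l k * x k w ^+ 2) by apply: integZ.
have iQ : integ P' (fun w => \sum_k l k * x k w ^+ 2) by exact: integ_sum.
have ixi : integ P' xi.
  have -> : xi = (fun w => \sum_k l k * x k w ^+ 2 - c) by apply/funext => w; rewrite xiE.
  by apply: integB => //; exact: integ_cst.
have EQ : \int[P']_w (\sum_k l k * x k w ^+ 2) = c.
  by rewrite Rint_sum// cE; apply: eq_bigr => k _; rewrite RintZ// m2.
have Q2E w : (\sum_k l k * x k w ^+ 2) ^+ 2 = \sum_k l k * \sum_m l m * (x k w ^+ 2 * x m w ^+ 2).
  rewrite expr2 big_distrl/=; apply: eq_bigr => k _; rewrite -mulrA; congr (_ * _).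
  by rewrite big_distrr/=; apply: eq_bigr => m _; ring.
have ikm k : integ P' (fun w => \sum_m l m * (x k w ^+ 2 * x m w ^+ 2)).
  by apply: integ_sum => m; apply: integZ; exact: (ExB k m).1.
have iQ2 : integ P' (fun w => (\sum_k l k * x k w ^+ 2) ^+ 2).
  by under eq_fun do rewrite Q2E; apply: integ_sum => k; exact: integZ.
have xi2E w : xi w ^+ 2 = (\sum_k l k * x k w ^+ 2) ^+ 2 - (2 * c * (\sum_k l k * x k w ^+ 2) - c ^+ 2).
  by rewrite xiE; ring.
have i3 : integ P' (fun w => 2 * c * (\sum_k l k * x k w ^+ 2) - c ^+ 2).
  by apply: integB; [exact: integZ|exact: integ_cst].
have ixi2 : integ P' (fun w => xi w ^+ 2) by under eq_fun do rewrite xi2E; exact: integB.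
(* The factor 8 is that of (q - c)^4 <= 8 (q^4 + c^4). The factor N^3 comes from Cauchy-Schwarz
   applied to the sum and then to the sum of squares. *)
have xi4 w : xi w ^+ 4 <= 8 * (N ^+ 3 * (\sum_k l k ^+ 4 * x k w ^+ 8) + c ^+ 4).
  rewrite xiE; set q := \sum_k _.
  have h1 : (q - c) ^+ 4 <= 8 * (q ^+ 4 + c ^+ 4).
    by have := sqr_ge0 (q + c); have := sqr_ge0 (q ^+ 2 - c ^+ 2); have := sqr_ge0 (q ^+ 2 - c ^+ 2 ); nra.
  have h2 : q ^+ 4 <= N ^+ 3 * \sum_k l k ^+ 4 * x k w ^+ 8.
    have s1 : q ^+ 2 <= N * \sum_k (l k * x k w ^+ 2) ^+ 2 := sqr_sum_le _.
    have s2 : (\sum_k (l k * x k w ^+ 2) ^+ 2) ^+ 2 <= N * \sum_k ((l k * x k w ^+ 2) ^+ 2) ^+ 2 := sqr_sum_le _.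
    have s3 : \sum_k ((l k * x k w ^+ 2) ^+ 2) ^+ 2 = \sum_k l k ^+ 4 * x k w ^+ 8.
      by apply: eq_bigr => k _; ring.
    rewrite s3 in s2; rewrite (_ : q ^+ 4 = (q ^+ 2) ^+ 2); last by ring.
    apply: (@le_trans _ _ ((N * \sum_k (l k * x k w ^+ 2) ^+ 2) ^+ 2)).
      by rewrite lerXn2r// nnegrE ?sqr_ge0//; apply: le_trans s1; exact: sqr_ge0.
    by rewrite exprMn (exprSr N 2) -[leRHS]mulrA ler_wpM2l// sqr_ge0.
  by rewrite (le_trans h1)// ler_wpM2l// lerD2r.
have i8 : integ P' (fun w => 8 * (N ^+ 3 * (\sum_k l k ^+ 4 * x k w ^+ 8) + c ^+ 4)).
  apply: integZ; apply: integD; last exact: integ_cst.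
  by apply: integZ; apply: integ_sum => k; exact: integZ.
have xi40 w : 0 <= xi w ^+ 4 by rewrite (_ : 4 = 2 * 2)%N// exprM sqr_ge0.
have ixi4 : integ P' (fun w => xi w ^+ 4).
  apply: (integ_le _ _ i8) => [|w]; last first.
    by rewrite ger0_norm.
  by apply: measurable_funX; exact: (integ_measurable ixi).
split => //; split.
- by under eq_Rintegral do rewrite xiE; rewrite RintB ?EQ ?Rintegral_prob_cst ?subrr//; exact: integ_cst.
- under eq_Rintegral do rewrite xi2E.
  rewrite RintB// RintB; [|exact: integZ|exact: integ_cst].
  rewrite RintZ// EQ Rintegral_prob_cst.
  under eq_Rintegral do rewrite Q2E.
  rewrite Rint_sum; last by move=> k; exact: integZ.
  rewrite (eq_bigr (fun k => l k * c2 (a k) (a k) * c + 2 * (l k * \sum_m l m * c2 (a k) (a m) ^+ 2))); last first.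
    move=> k _; rewrite RintZ// Rint_sum; last by move=> m; apply: integZ; exact: (ExB k m).1.
    rewrite (eq_bigr (fun m => c2 (a k) (a k) * (l m * c2 (a m) (a m)) + 2 * (l m * c2 (a k) (a m) ^+ 2))).
      by rewrite big_split/= -!mulr_sumr -cE; ring.
    by move=> m _; rewrite RintZ ?(ExB k m).1// (ExB k m).2; ring.
  by rewrite big_split/= -mulr_suml -mulr_sumr -cE -ssE; ring.
- apply: (le_trans (Rint_le ixi4 i8 xi4)).
  rewrite RintZ; last first.
    by apply: integD; [apply: integZ; apply: integ_sum => k; exact: integZ|exact: integ_cst].
  rewrite RintD; [|by apply: integZ; apply: integ_sum => k; exact: integZ|exact: integ_cst].
  rewrite Rintegral_prob_cst RintZ; last by apply: integ_sum => k; exact: integZ.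
  rewrite Rint_sum; last by move=> k; exact: integZ.
  under eq_bigr do rewrite RintZ// (hK8 _ _ _ _ _ (gX _)).
  exact: lexx.
Qed.

End GaussianQuadratic.

Lemma continuous_qform (R : realType) p (B : 'M[R]_p) : continuous (@qform R p B).
Proof.
move=> x.
have -> : @qform R p B = (fun x => \sum_i \sum_j (B j i * x i 0) * x j 0).
  apply/funext => y; rewrite /qform mxE; apply: eq_bigr => i _.
  rewrite mxE mulr_suml; apply: eq_bigr => j _; rewrite mxE; ring.
apply: continuous_at_sum => i; apply: continuous_at_sum => j.
have c i' : {for x, continuous (fun y : 'cV[R]_p => y i' 0)} by exact: coord_continuous.
by apply: (continuousM _ (c j)); apply: (continuousM _ (c i)); exact: cst_continuous.
Qed.

Section QuadraticCLT.
Context (R : realType) d (Omega : measurableType d) (P : probability Omega R).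
Variables (T : R) (r : nat) (W : R -> Omega -> 'cV[R]_r).
Hypotheses (HW : wiener P T W) (T0 : 0 < T) (r0 : (0 < r)%N).
Variables (p : nat) (S : 'M[R]_p).
Hypotheses (symS : S^T = S) (posS : forall u, 0 <= qform S u).

(** Independence is kept in the form that the central limit bound consumes: a functional at step [m]
    against its own partial sum. *)
Definition gauss_block n (V : nat -> Omega -> 'cV[R]_p) : Prop :=
  (forall i, (i < n)%N -> forall u, gauss_rv P (fun w => (u^T *m V i w) 0 0) (qform S u)) /\
  (forall phi : 'cV[R]_p -> R, measurable_fun setT (phi : borel_cV R p -> R) ->
    forall m, (m < n)%N ->
    indep_rv P (fun w => \sum_(0 <= i < m) phi (V i w)) (fun w => phi (V m w))).

Definition qsum (B : 'M[R]_p) n (V : nat -> Omega -> 'cV[R]_p) w :=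
  \sum_(0 <= i < n) (qform B (V i w) - \tr (B *m S)) / Num.sqrt n%:R.

(** The constant depends on [B] and [S] only. The phase [c] lets one statement cover the cosine and
    the sine of the sum. *)
Lemma qsum_clt (B : 'M[R]_p) : B^T = B -> exists K : R, forall n V, (0 < n)%N -> gauss_block n V ->
  forall c, `|\int[P]_w cos (qsum B n V w + c) - cos c * expR (- \tr (B *m S *m (B *m S)))|
    <= K / Num.sqrt n%:R.
Proof.
move=> symB; have [K hK] := gauss_quad_moments HW T0 r0 symS posS symB.
pose v := 2 * \tr (B *m S *m (B *m S)).
exists (2 * (K + v ^+ 2 + v)) => n V n0 [gV iV] c.
pose s : R := Num.sqrt n%:R.
have s0 : 0 < s by rewrite sqrtr_gt0 ltr0n.
have s2 : n%:R = s ^+ 2 by rewrite sqr_sqrtr.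
pose a i w := (qform B (V i w) - \tr (B *m S)) / s.
have aE i w : a i w = s^-1 * (qform B (V i w) - \tr (B *m S)) by rewrite /a mulrC.
have mq : measurable_fun setT (@qform R p B : borel_cV R p -> R).
  by apply: continuous_measurable_cV; exact: continuous_qform.
have [hc hs] : `|\int[P]_w cos (\sum_(0 <= i < n) a i w) - expR (- (v / 2))| <= (K + v ^+ 2 + v) / s /\
  `|\int[P]_w sin (\sum_(0 <= i < n) a i w)| <= (K + v ^+ 2 + v) / s.
  apply: clt_cos => //.
  - move=> i ni; have [[i1 i2 i4] _] := hK _ _ P _ (gV i ni).
    have aE' : a i = (fun w => s^-1 * (qform B (V i w) - \tr (B *m S))) by apply/funext => w; rewrite aE.
    split.
    + by rewrite aE'; exact: integZ.
    + by under eq_fun do rewrite aE exprMn; exact: integZ.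
    + by under eq_fun do rewrite aE exprMn; exact: integZ.
  - apply: (iV (fun x => (qform B x - \tr (B *m S)) / s)).
    apply: measurable_funM => //; apply: measurable_funB => //.
  - move=> i ni; have [[i1 i2 i4] [e1 e2 e4]] := hK _ _ P _ (gV i ni).
    split.
    + by under eq_Rintegral do rewrite aE; rewrite RintZ// e1 mulr0.
    + under eq_Rintegral do rewrite aE exprMn; rewrite RintZ// e2 s2 exprVn mulrC /v //.
    + under eq_Rintegral do rewrite aE exprMn; rewrite RintZ//.
      rewrite s2 -exprM mulrC exprVn ler_pM2r// invr_gt0 exprn_gt0//.
have mS : measurable_fun setT (fun w => \sum_(0 <= i < n) a i w).
  have -> : (fun w => \sum_(0 <= i < n) a i w) = (fun w => \sum_(0 <= i < n) (if (i < n)%N then a i w else 0)).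
    by apply/funext => w; rewrite !big_nat; apply: eq_bigr => i /andP[_ ->].
  apply: measurable_sum => i; case: ltnP => // ni.
  have [[/integ_measurable i1 _ _] _] := hK _ _ P _ (gV i ni).
  by under eq_fun do rewrite aE; apply: measurable_funM.
have ic := integ_cos P mS; have is_ := integ_sin P mS.
under eq_Rintegral do rewrite cosD mulrC [X in _ - X]mulrC.
rewrite RintB ?RintZ//; [|exact: integZ|exact: integZ].
move: hc hs; rewrite -/(a _ _) (_ : v / 2 = \tr (B *m S *m (B *m S))); last by rewrite /v; field.
set ec := \int[P]_w cos _; set es := \int[P]_w sin _; set e := expR _; set bd := (_ + _) / _ => hc hs.
rewrite (_ : _ - _ = cos c * (ec - e) - sin c * es); last by ring.
rewrite -mulrA -/bd (le_trans (ler_normB _ _))// !normrM.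
have hc1 : `|cos c| <= 1 by rewrite ler_norml cos_geN1 cos_le1.
have hs1 : `|sin c| <= 1 by rewrite ler_norml sin_geN1 sin_le1.
have := ler_pM (normr_ge0 _) (normr_ge0 _) hc1 hc.
have := ler_pM (normr_ge0 _) (normr_ge0 _) hs1 hs.
by rewrite !mul1r; lra.
Qed.

(** Cross terms vanish, each summand being centred and independent of the preceding partial sum. The
    exact value will give tightness. *)
Lemma qsum_second_moment (B : 'M[R]_p) n V : B^T = B -> (0 < n)%N -> gauss_block n V ->
  integ P (fun w => qsum B n V w ^+ 2) /\
  \int[P]_w (qsum B n V w ^+ 2) = 2 * \tr (B *m S *m (B *m S)).
Proof.
move=> symB n0 [gV iV]; have [K hK] := gauss_quad_moments HW T0 r0 symS posS symB.
pose v := 2 * \tr (B *m S *m (B *m S)).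
pose s : R := Num.sqrt n%:R.
have s0 : 0 < s by rewrite sqrtr_gt0 ltr0n.
have s2 : n%:R = s ^+ 2 by rewrite sqr_sqrtr.
pose a i w := (qform B (V i w) - \tr (B *m S)) / s.
have aE i w : a i w = s^-1 * (qform B (V i w) - \tr (B *m S)) by rewrite /a mulrC.
have mq : measurable_fun setT (@qform R p B : borel_cV R p -> R).
  by apply: continuous_measurable_cV; exact: continuous_qform.
have ia i : (i < n)%N -> [/\ integ P (a i), integ P (fun w => a i w ^+ 2),
    \int[P]_w a i w = 0 & \int[P]_w (a i w ^+ 2) = v / n%:R].
  move=> ni; have [[i1 i2 i4] [e1 e2 e4]] := hK _ _ P _ (gV i ni).
  have -> : a i = (fun w => s^-1 * (qform B (V i w) - \tr (B *m S))) by apply/funext => w; rewrite aE.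
  split.
  - exact: integZ.
  - by under eq_fun do rewrite exprMn; exact: integZ.
  - by rewrite RintZ// e1 mulr0.
  - by under eq_Rintegral do rewrite exprMn; rewrite RintZ// e2 s2 exprVn mulrC /v.
have : forall m, (m <= n)%N -> [/\ integ P (fun w => \sum_(0 <= i < m) a i w),
   integ P (fun w => (\sum_(0 <= i < m) a i w) ^+ 2) &
   \int[P]_w ((\sum_(0 <= i < m) a i w) ^+ 2) = m%:R * (v / n%:R)].
  elim => [|m IH] mn.
    have e0 : (fun w => \sum_(0 <= i < 0) a i w) = (fun=> 0) by apply/funext => w; rewrite big_geq.
    split; first by rewrite e0; exact: integ_cst.
      by under eq_fun do rewrite big_geq//; exact: integ_cst.
    by under eq_Rintegral do rewrite big_geq//; rewrite Rintegral_prob_cst expr0n mul0r.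
  have [j1 j2 j3] := IH (ltnW mn); have [i1 i2 e1 e2] := ia m mn.
  have [] := indep_rv_integral (integ_measurable j1) (integ_measurable i1) _ j1 i1.
    apply: (iV (fun x => (qform B x - \tr (B *m S)) / s)) => //.
    by apply: measurable_funM => //; apply: measurable_funB => //.
  rewrite e1 mulr0 => ix ex.
  have sqE w : (\sum_(0 <= i < m.+1) a i w) ^+ 2 = (\sum_(0 <= i < m) a i w) ^+ 2 +
      (2 * ((\sum_(0 <= i < m) a i w) * a m w) + a m w ^+ 2).
    by rewrite big_nat_recr//=; ring.
  have i3 : integ P (fun w => 2 * ((\sum_(0 <= i < m) a i w) * a m w) + a m w ^+ 2).
    by apply: integD => //; exact: integZ.
  split.
  - by under eq_fun do rewrite big_nat_recr//=; exact: integD.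
  - by under eq_fun do rewrite sqE; exact: integD.
  - under eq_Rintegral do rewrite sqE.
    rewrite RintD// RintD//; last exact: integZ.
    by rewrite RintZ// ex j3 e2 -natr1; ring.
move=> /(_ n (leqnn n))[_ i2 e2]; split; first exact: i2.
by rewrite [LHS]e2 mulrC divfK// pnatr_eq0 -lt0n.
Qed.

End QuadraticCLT.

(** * Negligibility of the drifts *)

Section DriftNoise.
Variable R : realType.

(* [f' = b] on [0, T], stated without derivatives: oscillations of [b] control those of [f]. *)
Definition primitive_on (T : R) (f b : R -> R) : Prop :=
  forall s t r eta, 0 <= s -> s <= t -> t <= T ->
    (forall u, s <= u <= t -> `|b u - r| <= eta) ->
    `|f t - f s - r * (t - s)| <= eta * (t - s).

Lemma abel_sum n (c g : nat -> R) :
  \sum_(0 <= i < n) c i * (g i.+1 - g i) =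
  c n * g n - c 0%N * g 0%N - \sum_(0 <= i < n) (c i.+1 - c i) * g i.+1.
Proof.
elim: n => [|n IH]; first by rewrite !big_geq// !subrr.
by rewrite !big_nat_recr//= IH; ring.
Qed.

Lemma sum_norm_sqrt n (g : nat -> R) (K : R) : \sum_(0 <= i < n) g i ^+ 2 <= K ->
  \sum_(0 <= i < n) `|g i| <= Num.sqrt n%:R * Num.sqrt K.
Proof.
move=> hK; have s0 : 0 <= \sum_(0 <= i < n) `|g i| by exact: sumr_ge0.
rewrite -sqrtrM// -[leLHS]ger0_norm// -sqrtr_sqr ler_wsqrtr// big_mkord.
apply: (le_trans (sqr_sum_le _)); rewrite card_ord ler_wpM2l//.
apply: le_trans hK; rewrite big_mkord; apply: ler_sum => i _.
by rewrite real_normK ?num_real.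
Qed.

Lemma continuous_clamp (T : R) (b : R -> R) : 0 <= T -> {within `[0, T], continuous b} ->
  continuous (fun x => b (Num.max 0 (Num.min T x))).
Proof.
move=> T0 /subspace_continuousP cb x.
pose cl (x : R) := Num.max 0 (Num.min T x).
have clT y : `[0, T]%classic (cl y) by rewrite /= in_itv/= /cl le_max lexx/= ge_max T0 ge_min lexx.
have ccl : {for x, continuous cl}.
  have c1 : {for x, continuous (fun y : R => Num.min T y)}.
    by apply: (@continuous_min _ _ (cst T) id); [exact: cst_continuous|exact: cvg_id].
  by apply: (@continuous_max _ _ (cst 0) _ x _ c1); exact: cst_continuous.
apply: (@cvg_comp _ _ _ cl b _ (within `[0, T]%classic (nbhs (cl x))) _ _ (cb _ (clT x))).
move=> A /=; rewrite /within/= => hA.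
have hB : nbhs x (cl @^-1` [set y | `[0, T]%classic y -> A y]) := ccl _ hA.
change (nbhs x (cl @^-1` A)); apply: filterS hB => y; apply; exact: clT.
Qed.

Lemma unif_continuous_itv (T e : R) (b : R -> R) : 0 <= T -> 0 < e -> {within `[0, T], continuous b} ->
  exists2 del : R, 0 < del & forall u v, 0 <= u <= T -> 0 <= v <= T ->
    `|u - v| <= del -> `|b u - b v| <= e.
Proof.
move=> T0 e0 /(continuous_clamp T0) cb.
have [del del0 hdel] := @compact_unif_continuous R R^o R^o _ _ (@segment_compact R 0 T) (fun x _ => cb x) e e0.
exists (del / 2) => [|u v uT vT uv]; first by rewrite divr_gt0.
have clE w : 0 <= w <= T -> Num.max 0 (Num.min T w) = w.
  by move=> /andP[w0 wT]; rewrite min_r// max_r.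
have := hdel u v; rewrite !clE// => h; apply/ltW/h; first by rewrite /= in_itv.
by rewrite (le_lt_trans uv)// ltr_pdivrMr// ltr_pMr// ltr1n.
Qed.

(* Replace [f'] by a difference quotient [c] of [f] at a fixed small scale. It is uniformly
   close to [b], an error controlled by Cauchy-Schwarz and [K], and it is Lipschitz, so Abel
   summation moves the increments from the rough [g] to [c]. *)
Lemma drift_noise_vanish (T G K e : R) (f b g : R -> R) : 0 < T -> 0 < e ->
  {within `[0, T], continuous b} -> primitive_on T f b ->
  (forall t, 0 <= t <= T -> `|g t| <= G) ->
  exists n0 : nat, forall n, (n0 <= n)%N ->
    let t (i : nat) := i%:R * (T / n%:R) in
    \sum_(0 <= i < n) (g (t i.+1) - g (t i)) ^+ 2 <= K ->
    `|Num.sqrt n%:R * \sum_(0 <= i < n) (f (t i.+1) - f (t i)) * (g (t i.+1) - g (t i))| <= e.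
Proof.
move=> T0 e0 cb fb gG.
have G0 : 0 <= G by apply: (le_trans (normr_ge0 (g 0))); apply: gG; rewrite lexx ltW.
have [M0 hM0] : exists M, forall u, 0 <= u <= T -> `|b u| <= M.
  have [M [_ hM]] := compact_bounded (continuous_compact cb (@segment_compact _ 0 T)).
  exists (M + 1) => u uT; apply: (hM (M + 1)); first by rewrite ltrDl.
  by exists u => //=; rewrite in_itv.
have M_ge0 : 0 <= M0 by apply: (le_trans (normr_ge0 (b 0))); apply: hM0; rewrite lexx ltW.
(* Makes the contribution 2 eta T sqrt K of the uniform error at most e / 2. *)
pose eta := e / (4 * T * (1 + Num.sqrt K)).
have K1 : 0 < 1 + Num.sqrt K by rewrite ltr_wpDr.
have eta0 : 0 < eta by rewrite divr_gt0// !mulr_gt0.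
have [del del0 hdel] : exists2 del : R, 0 < del & forall u v, 0 <= u <= T -> 0 <= v <= T ->
    `|u - v| <= del -> `|b u - b v| <= eta.
  exact: (unif_continuous_itv (ltW T0) eta0 cb).
pose del' := Num.min del T.
have del'0 : 0 < del' by rewrite lt_min del0.
have del'T : del' <= T by rewrite ge_min lexx orbT.
have del'd : del' <= del by rewrite ge_min lexx.
(* Affine contraction of [0, T] onto [0, T - del']: the window from rho t to rho t + del' contains
   [t] and never leaves [0, T], which a window on a fixed side of [t] would do near an endpoint. *)
pose rho t := t * ((T - del') / T).
have rho0 t : 0 <= t <= T -> 0 <= rho t.
  by move=> /andP[t0 _]; rewrite /rho mulr_ge0// divr_ge0 ?subr_ge0// ltW.
have rhoE t : rho t = t - t / T * del' by rewrite /rho; field; rewrite gt_eqF.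
have rhot t : 0 <= t <= T -> rho t <= t <= rho t + del'.
  move=> /andP[t0 tT]; rewrite rhoE lerBlDr lerDl mulr_ge0 ?divr_ge0 ?(ltW T0) ?(ltW del'0)//=.
  by rewrite -addrA lerDl addrC subr_ge0 ler_piMl ?(ltW del'0)// ler_pdivrMr// mul1r.
have rhoT t : 0 <= t <= T -> rho t + del' <= T.
  move=> /andP[t0 tT]; rewrite -lerBrDr /rho mulrA ler_pdivrMr// mulrC ler_wpM2l// subr_ge0//.
have lipf s t : 0 <= s -> s <= t -> t <= T -> `|f t - f s| <= M0 * (t - s).
  move=> s0 st tT; have := fb s t 0 M0 s0 st tT; rewrite mul0r subr0; apply => u /andP[su ut].
  by rewrite subr0 hM0// (le_trans s0 su) (le_trans ut tT).
have lipf' s t : 0 <= s <= T -> 0 <= t <= T -> `|f t - f s| <= M0 * `|t - s|.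
  move=> /andP[s0 sT] /andP[t0 tT]; have [st|/ltW ts] := leP s t.
    by rewrite [X in _ * X]ger0_norm ?subr_ge0// lipf.
  by rewrite distrC [X in _ * X]distrC [X in _ * X]ger0_norm ?subr_ge0// lipf.
pose c t := (f (rho t + del') - f (rho t)) / del'.
have cb' t : 0 <= t <= T -> `|c t - b t| <= eta.
  move=> tT; have /andP[r1 r2] := rhot t tT.
  have := fb (rho t) (rho t + del') (b t) eta (rho0 t tT) _ (rhoT t tT).
  rewrite lerDl (ltW del'0) => /(_ isT); rewrite (_ : rho t + del' - rho t = del'); last by ring.
  move=> h.
  have -> : c t - b t = (f (rho t + del') - f (rho t) - b t * del') / del'.
    by rewrite /c; field; rewrite gt_eqF.
  rewrite normrM normfV (gtr0_norm del'0) ler_pdivrMr//; apply: h => u /andP[u1 u2].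
  apply: hdel => //.
    by rewrite (le_trans (rho0 t tT) u1) (le_trans u2)// rhoT.
  rewrite (le_trans _ del'd)// ler_distl.
  by rewrite lerBlDr (le_trans r2) ?lerD2r//= (le_trans u2)// lerD2r.
have cM t : 0 <= t <= T -> `|c t| <= M0.
  move=> tT; rewrite /c normrM normfV (gtr0_norm del'0) ler_pdivrMr//.
  have := lipf (rho t) (rho t + del') (rho0 t tT) _ (rhoT t tT).
  by rewrite lerDl (ltW del'0) => /(_ isT); rewrite (_ : rho t + del' - rho t = del')//; ring.
have clip s t : 0 <= s <= T -> 0 <= t <= T -> s <= t -> `|c t - c s| <= 2 * M0 / del' * (t - s).
  move=> sT tT st.
  have -> : c t - c s = ((f (rho t + del') - f (rho s + del')) - (f (rho t) - f (rho s))) / del'.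
    by rewrite /c; ring.
  rewrite normrM normfV (gtr0_norm del'0) mulrAC ler_pM2r ?invr_gt0//.
  have rd : `|rho t - rho s| <= t - s.
    rewrite /rho -mulrBl normrM ger0_norm ?subr_ge0// ler_piMr ?subr_ge0//.
    by rewrite ger0_norm ?divr_ge0 ?subr_ge0 ?(ltW T0)// ler_pdivrMr// mul1r gerBl ltW.
  have b1 := @lipf' (rho s + del') (rho t + del').
  have b2 := @lipf' (rho s) (rho t).
  have rr u : 0 <= u <= T -> (0 <= rho u <= T) * (0 <= rho u + del' <= T).
    move=> uT; split; first by rewrite rho0//= (le_trans _ (rhoT u uT))// lerDl ltW.
    by rewrite rhoT// andbT addr_ge0 ?rho0// ltW.
  rewrite (le_trans (ler_normB _ _))// (le_trans (lerD (b1 _ _) (b2 _ _))) ?rr//.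
  rewrite [rho t + del' - _](_ : _ = rho t - rho s); last by ring.
  by rewrite -mulrDr -mulrA mulrCA ler_wpM2l//; move: rd; lra.
clearbody c.
(* T times the bound obtained from summation by parts; it contributes C / sqrt n to the final
   error. *)
pose C := T * (2 * M0 * G + 2 * M0 / del' * T * G).
have C0 : 0 <= C.
  by rewrite mulr_ge0 ?(ltW T0)// addr_ge0// !mulr_ge0 ?invr_ge0 ?(ltW T0)// ltW.
(* The first term brings the mesh below [del], the second brings C / sqrt n below e / 2. *)
pose n0 := maxn (Num.bound (T / del)).+1 (Num.bound ((2 * C / e) ^+ 2)).+1.
exists n0 => n n0n t hK.
have n1 : (Num.bound (T / del) < n)%N by rewrite (leq_trans _ n0n)// leq_max leqnn.
have n2 : (Num.bound ((2 * C / e) ^+ 2) < n)%N by rewrite (leq_trans _ n0n)// leq_max leqnn orbT.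
have n_gt0 : (0 < n)%N by exact: leq_ltn_trans n1.
have n_gt0' : 0 < n%:R :> R by rewrite ltr0n.
pose h := T / n%:R.
have h0 : 0 < h by rewrite divr_gt0.
have hdel1 : h <= del.
  rewrite ler_pdivrMr// mulrC -ler_pdivrMr//.
  by rewrite (le_trans (ltW (archi_boundP _)))// ?ler_nat ?(ltnW n1)// divr_ge0// ltW.
have tT i : (i <= n)%N -> 0 <= t i <= T.
  move=> ni; rewrite /t mulr_ge0 ?(ltW h0)//= mulrCA ler_piMr ?(ltW T0)//.
  by rewrite ler_pdivrMr// mul1r ler_nat.
have tS i : t i.+1 - t i = h by rewrite /t -natr1 /h; ring.
pose s := Num.sqrt n%:R : R.
have s0 : 0 < s by rewrite sqrtr_gt0.
have s2 : n%:R = s ^+ 2 by rewrite sqr_sqrtr// ltW.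
pose dg i := g (t i.+1) - g (t i).
pose df i := f (t i.+1) - f (t i).
have fc i : (i < n)%N -> `|df i - h * c (t i)| <= 2 * eta * h.
  move=> ni; have /andP[ti0 tiT] := tT i (ltnW ni); have /andP[tj0 tjT] := tT i.+1 ni.
  have tij : t i <= t i.+1 by rewrite -subr_ge0 tS ltW.
  have h1 : `|df i - b (t i) * h| <= eta * h.
    have := fb (t i) (t i.+1) (b (t i)) eta ti0 tij tjT; rewrite tS; apply => u /andP[u1 u2].
    apply: hdel; rewrite ?tT ?(ltnW ni)//; first by rewrite (le_trans ti0 u1) (le_trans u2 tjT).
    by rewrite ger0_norm ?subr_ge0// (le_trans _ hdel1)// -(tS i) lerD2r.
  have h2 := cb' _ (tT i (ltnW ni)).
  have -> : df i - h * c (t i) = (df i - b (t i) * h) - (c (t i) - b (t i)) * h by ring.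
  rewrite (le_trans (ler_normB _ _))// normrM (gtr0_norm h0) -mulrA mulr_natl mulr2n lerD//.
  by rewrite ler_wpM2r// ltW.
have hsg : \sum_(0 <= i < n) `|dg i| <= s * Num.sqrt K by exact: sum_norm_sqrt.
have e1 : `|\sum_(0 <= i < n) (df i - h * c (t i)) * dg i| <= 2 * eta * h * (s * Num.sqrt K).
  rewrite (le_trans (ler_norm_sum _ _ _))// (@le_trans _ _ (2 * eta * h * \sum_(0 <= i < n) `|dg i|))//.
    rewrite mulr_sumr !big_nat; apply: ler_sum => i /andP[_ ni].
    by rewrite normrM ler_wpM2r// fc.
  by rewrite ler_wpM2l// mulr_ge0 ?(ltW h0)// mulr_ge0 ?(ltW eta0).
have e2 : `|\sum_(0 <= i < n) c (t i) * dg i| <= 2 * M0 * G + 2 * M0 / del' * T * G.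
  rewrite (abel_sum n (fun i => c (t i)) (fun i => g (t i))).
  rewrite (le_trans (ler_normB _ _))// lerD//.
    rewrite (le_trans (ler_normB _ _))// !normrM (_ : 2 * M0 * G = M0 * G + M0 * G); last by ring.
    by rewrite lerD// ler_pM// ?cM ?gG ?tT.
  rewrite (le_trans (ler_norm_sum _ _ _))//.
  rewrite (@le_trans _ _ (\sum_(0 <= i < n) 2 * M0 / del' * h * G))//.
    rewrite !big_nat; apply: ler_sum => i /andP[_ ni].
    rewrite normrM ler_pM// ?gG ?tT// -(tS i) clip ?tT ?(ltnW ni)//.
    by rewrite -subr_ge0 tS ltW.
  rewrite sumr_const_nat subn0 -[_ *+ n]mulr_natr /h.
  by rewrite (_ : _ * n%:R = 2 * M0 / del' * T * G)//; field; rewrite !gt_eqF.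
have -> : \sum_(0 <= i < n) df i * dg i =
   \sum_(0 <= i < n) (df i - h * c (t i)) * dg i + h * \sum_(0 <= i < n) c (t i) * dg i.
  by rewrite mulr_sumr -big_split/=; apply: eq_bigr => i _; ring.
rewrite normrM (gtr0_norm s0).
apply: (@le_trans _ _ (s * (2 * eta * h * (s * Num.sqrt K) + h * (2 * M0 * G + 2 * M0 / del' * T * G)))).
  rewrite ler_wpM2l ?(ltW s0)// (le_trans (ler_normD _ _))// lerD// normrM (gtr0_norm h0).
  by rewrite ler_wpM2l// ltW.
have -> : s * (2 * eta * h * (s * Num.sqrt K) + h * (2 * M0 * G + 2 * M0 / del' * T * G)) =
   2 * eta * T * Num.sqrt K + C / s.
  by rewrite /h /C s2; field; rewrite !gt_eqF.
rewrite [leRHS]splitr lerD//.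
  rewrite /eta ler_pdivlMr//.
  rewrite (_ : _ * 2 = e * (Num.sqrt K / (1 + Num.sqrt K))); last by field; rewrite !gt_eqF.
  by rewrite ler_piMr ?(ltW e0)// ler_pdivrMr// mul1r lerDr.
rewrite ler_pdivrMr// mulrC -ler_pdivrMr ?divr_gt0//.
rewrite (_ : C / (e / 2) = 2 * C / e); last by field; rewrite gt_eqF.
rewrite (le_trans (ler_norm _))// -sqrtr_sqr ler_wsqrtr//.
by rewrite (le_trans (ltW (archi_boundP _)))// ?sqr_ge0// ler_nat ltnW.
Qed.

End DriftNoise.

Lemma normr_cosB_le (R : realType) (x y : R) : `|cos x - cos y| <= `|x - y|.
Proof.
wlog xy : x y / y <= x.
  by move=> h; have [|/ltW] := leP y x => /h//; rewrite distrC [leRHS]distrC.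
have [c _ ->] := @MVT_segment R (@cos R) (fun z => - sin z) y x xy
  (fun z _ => is_derive_cos z) (continuous_subspaceT (@continuous_cos R)).
by rewrite normrM normrN ler_piMl// ler_norml sin_geN1 sin_le1.
Qed.

(** * Convergence to zero and tightness in probability *)

Section VanishingInProbability.
Context (R : realType) d (Omega : measurableType d) (P : probability Omega R).

Definition prob_vanish (Y : nat -> Omega -> R) : Prop :=
  forall e eta : R, 0 < e -> 0 < eta ->
    \forall n \near \oo, fine (P [set w | e < `|Y n w|]) <= eta.

Definition prob_tight (Y : nat -> Omega -> R) : Prop :=
  forall eta : R, 0 < eta -> exists K : R,
    \forall n \near \oo, fine (P [set w | K < `|Y n w|]) <= eta.

Lemma measurable_norm_gt (Y : Omega -> R) (e : R) : measurable_fun setT Y ->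
  measurable [set w | e < `|Y w|].
Proof.
move=> mY; rewrite -[X in measurable X]setTI; apply: measurable_fun_ltr => //.
exact: measurableT_comp.
Qed.

(** Almost surely the indicators are eventually zero, so dominated convergence applies with the
    constant 1. *)
Lemma prob_vanish_ae (E : nat -> set Omega) : (forall n, measurable (E n)) ->
  {ae P, forall w, exists n0 : nat, forall n, (n0 <= n)%N -> ~ E n w} ->
  forall eta : R, 0 < eta -> \forall n \near \oo, fine (P (E n)) <= eta.
Proof.
move=> mE aeE eta eta0.
have mI n : measurable_fun setT (EFin \o (\1_(E n) : Omega -> R)).
  by apply/measurable_EFinP; exact: measurable_indic.
have cI : {ae P, forall w, setT w -> (EFin \o (\1_(E n) : Omega -> R)) w @[n --> \oo] --> ((cst 0%E : Omega -> \bar R) w)}.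
  apply: filterS aeE => w [n0 hn0] _.
  apply: cvg_near_cst; exists n0 => //= n /= nn0.
  by rewrite indicE memNset//; exact: hn0.
have dom : {ae P, forall w, forall n : nat, setT w -> (`|(EFin \o (\1_(E n) : Omega -> R)) w| <= (EFin \o (fun=> 1%R)) w)%E}.
  by apply: aeW => w n _ /=; rewrite lee_fin ger0_norm// indicE; case: (_ \in _).
have [_ _] := dominated_convergence measurableT mI (measurable_cst _) cI (integ_cst P 1) dom.
rewrite /= integral0 => cv.
have {cv} : (P (E n)) @[n --> \oo] --> (0 : R)%:E.
    apply: cvg_trans cv; apply: near_eq_cvg; apply: nearW => n /=.
    by rewrite integral_indic// setIT.
  move=> /fine_cvgP[_] /cvgrPdist_le/(_ _ eta0); apply: filterS => n /=.
  by rewrite sub0r normrN; apply: le_trans; exact: ler_norm.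
Qed.

(** The pathwise bound holds only while [S n] is at most [K], and [S n] need not stay bounded along
    a path. The events [E n] therefore include this restriction, and its complement is estimated by
    Markov's inequality. *)
Lemma prob_vanish_trunc (Y S : nat -> Omega -> R) (C : R) :
  (forall n, measurable_fun setT (Y n)) ->
  (forall n w, 0 <= S n w) -> (forall n, integ P (S n)) -> (forall n, \int[P]_w S n w <= C) ->
  {ae P, forall w, forall K e : R, 0 < e -> exists n0 : nat, forall n, (n0 <= n)%N ->
    S n w <= K -> `|Y n w| <= e} ->
  prob_vanish Y.
Proof.
move=> mY S0 iS SC aeY e eta e0 eta0.
have mS n := integ_measurable (iS n).
have C0 : 0 <= C.
  apply: le_trans (SC 0%N); rewrite -(Rintegral_prob_cst P 0).
  by apply: Rint_le => //; exact: integ_cst.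
(* Markov's inequality then gives C / K <= eta / 2; the added 1 keeps [K] positive. *)
pose K := 2 * C / eta + 1.
have K0 : 0 < K by rewrite ltr_wpDl// divr_ge0 ?mulr_ge0// ltW.
pose E n := [set w | S n w <= K] `&` [set w | e < `|Y n w|].
have mE n : measurable (E n).
  apply: measurableI; last exact: measurable_norm_gt.
  by rewrite -[X in measurable X]setTI; apply: measurable_fun_le.
have aeE : {ae P, forall w, exists n0 : nat, forall n, (n0 <= n)%N -> ~ E n w}.
  apply: filterS aeY => w /(_ K e e0)[n0 hn0]; exists n0 => n nn0 [/= h].
  by rewrite ltNge hn0.
have eta2 : 0 < eta / 2 by rewrite divr_gt0.
have mK n : measurable [set w | K <= S n w].
  by rewrite -[X in measurable X]setTI; apply: measurable_fun_le.
apply: filterS (prob_vanish_ae mE aeE eta2) => n hn.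
rewrite (le_trans (@prob_fine_leU _ _ _ P _ (E n) [set w | K <= S n w] _ _ _ _))//.
- exact: measurable_norm_gt.
- move=> w /= h; have [h1|/ltW h1] := leP (S n w) K; [left|right] => //; split => //.
- rewrite [leRHS]splitr lerD// (le_trans (markov_ineq K0 (S0 n) (iS n)))//.
  rewrite ler_pdivrMr// (le_trans (SC n))// -ler_pdivrMl// invf_div mulrC mulrA.
  by rewrite [C * 2]mulrC /K lerDl.
Qed.

Lemma prob_vanishZ c Y : prob_vanish Y -> prob_vanish (fun n w => c * Y n w).
Proof.
move=> vY e eta e0 eta0; have [->|c0] := eqVneq c 0.
  apply: nearW => n; rewrite (_ : [set w | _] = set0) ?measure0 ?ltW//.
  by apply/seteqP; split => w //=; rewrite mul0r normr0 ltNge ltW.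
have cn : 0 < `|c| by rewrite normr_gt0.
have ec : 0 < e / `|c| by rewrite divr_gt0.
apply: filterS (vY _ _ ec eta0) => n.
rewrite (_ : [set w | e / `|c| < `|Y n w|] = [set w | e < `|c * Y n w|])//.
by apply/seteqP; split => w /=; rewrite normrM ltr_pdivrMr// mulrC.
Qed.

Lemma prob_vanishD Y Z : (forall n, measurable_fun setT (Y n)) ->
  (forall n, measurable_fun setT (Z n)) -> prob_vanish Y -> prob_vanish Z ->
  prob_vanish (fun n w => Y n w + Z n w).
Proof.
move=> mY mZ vY vZ e eta e0 eta0.
have e2 : 0 < e / 2 by rewrite divr_gt0.
have h2 : 0 < eta / 2 by rewrite divr_gt0.
near=> n.
rewrite (le_trans (@prob_fine_leU _ _ _ P _ [set w | e / 2 < `|Y n w|] [set w | e / 2 < `|Z n w|] _ _ _ _))//.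
- by apply: measurable_norm_gt; exact: measurable_funD.
- exact: measurable_norm_gt.
- exact: measurable_norm_gt.
- move=> w /= h; apply: contrapT => /not_orP[/= /negP + /negP].
  rewrite -!leNgt => h1 h3; move: h; apply/negP; rewrite -leNgt.
  by rewrite (le_trans (ler_normD _ _))// [leRHS]splitr lerD.
- by rewrite [leRHS]splitr lerD//; near: n; [exact: vY|exact: vZ].
Unshelve. all: by end_near. Qed.

Lemma prob_vanish0 : prob_vanish (fun _ _ => 0).
Proof.
move=> e eta e0 eta0; apply: nearW => n; rewrite (_ : [set w | _] = set0) ?measure0 ?ltW//.
by apply/seteqP; split => w //=; rewrite normr0 ltNge ltW.
Qed.

Lemma prob_vanish_sum (I : Type) (r : seq I) (Y : I -> nat -> Omega -> R) :
  (forall i n, measurable_fun setT (Y i n)) -> (forall i, prob_vanish (Y i)) ->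
  prob_vanish (fun n w => \sum_(i <- r) Y i n w).
Proof.
move=> mY vY; elim: r => [|i r IH].
  by under eq_fun do under eq_fun do rewrite big_nil; exact: prob_vanish0.
under eq_fun do under eq_fun do rewrite big_cons.
by apply: prob_vanishD => // n; exact: measurable_sum.
Qed.

Lemma prob_vanish_tight Y : prob_vanish Y -> prob_tight Y.
Proof. by move=> vY eta eta0; exists 1; exact: vY. Qed.

Lemma prob_tightD Y Z : (forall n, measurable_fun setT (Y n)) ->
  (forall n, measurable_fun setT (Z n)) -> prob_tight Y -> prob_tight Z ->
  prob_tight (fun n w => Y n w + Z n w).
Proof.
move=> mY mZ vY vZ eta eta0.
have h2 : 0 < eta / 2 by rewrite divr_gt0.
have [K1 hK1] := vY _ h2; have [K2 hK2] := vZ _ h2; exists (K1 + K2).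
near=> n.
rewrite (le_trans (@prob_fine_leU _ _ _ P _ [set w | K1 < `|Y n w|] [set w | K2 < `|Z n w|] _ _ _ _))//.
- by apply: measurable_norm_gt; exact: measurable_funD.
- exact: measurable_norm_gt.
- exact: measurable_norm_gt.
- move=> w /= h; apply: contrapT => /not_orP[/= /negP + /negP].
  rewrite -!leNgt => h1 h3; move: h; apply/negP; rewrite -leNgt.
  by rewrite (le_trans (ler_normD _ _))// lerD.
- by rewrite [leRHS]splitr lerD//; near: n.
Unshelve. all: by end_near. Qed.

Lemma prob_tight_norm Y : prob_tight Y -> prob_tight (fun n w => `|Y n w|).
Proof.
move=> tY eta eta0; have [K hK] := tY _ eta0; exists K.
by apply: filterS hK => n; under eq_set do rewrite -normr_id.
Qed.

Lemma prob_tight_sum (I : Type) (r : seq I) (Y : I -> nat -> Omega -> R) :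
  (forall i n, measurable_fun setT (Y i n)) -> (forall i, prob_tight (Y i)) ->
  prob_tight (fun n w => \sum_(i <- r) Y i n w).
Proof.
move=> mY vY; elim: r => [|i r IH].
  under eq_fun do under eq_fun do rewrite big_nil.
  exact: (prob_vanish_tight prob_vanish0).
under eq_fun do under eq_fun do rewrite big_cons.
by apply: prob_tightD => // n; exact: measurable_sum.
Qed.

Lemma prob_tight_second_moment Y (C : R) : (forall n, (0 < n)%N -> integ P (fun w => Y n w ^+ 2)) ->
  (forall n, (0 < n)%N -> measurable_fun setT (Y n)) ->
  (forall n, (0 < n)%N -> \int[P]_w (Y n w ^+ 2) <= C) -> prob_tight Y.
Proof.
move=> iY mY YC eta eta0.
have C0 : 0 <= C.
  apply: le_trans (YC 1%N isT); rewrite -(Rintegral_prob_cst P 0).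
  by apply: Rint_le => //; [exact: integ_cst|exact: iY|move=> w; exact: sqr_ge0].
pose K := C / eta + 1.
have K0 : 0 < K by rewrite ltr_wpDl// divr_ge0// ltW.
have K1 : 1 <= K by rewrite /K lerDr divr_ge0// ltW.
exists K; exists 1%N => // n /= n0.
have mK : measurable [set w | K <= Y n w ^+ 2].
  rewrite -[X in measurable X]setTI; apply: measurable_fun_le => //.
  by apply: measurable_funX; exact: mY.
apply: (@le_trans _ _ (fine (P [set w | K <= Y n w ^+ 2]))).
  apply: prob_fine_le => //; first by apply: measurable_norm_gt; exact: mY.
  move=> w /= h; rewrite -real_normK ?num_real// expr2.
  rewrite (le_trans (ltW h))// ler_peMl// (le_trans K1)// ltW//.
rewrite (le_trans (markov_ineq K0 _ (iY n n0)))// => [w|]; first exact: sqr_ge0.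
rewrite ler_pdivrMr// (le_trans (YC n n0))// -ler_pdivrMl//.
by rewrite mulrC /K lerDl.
Qed.

(** The cosine is 1-Lipschitz, which handles small values of [Y n], and bounded by 1, which handles
    the rare event of large ones. *)
Lemma Ecos_slutsky (Z Y : nat -> Omega -> R) (l : R) :
  (forall n, measurable_fun setT (Y n)) -> (forall n, measurable_fun setT (Z n)) ->
  prob_vanish Y ->
  \int[P]_w cos (Z n w) @[n --> \oo] --> l ->
  \int[P]_w cos (Z n w + Y n w) @[n --> \oo] --> l.
Proof.
move=> mY mZ vY cZ; apply/cvgrPdist_le => e e0.
have e4 : 0 < e / 4 by rewrite divr_gt0.
have /cvgrPdist_le/(_ _ e4) hZ := cZ.
near=> n.
have h1 : `|l - \int[P]_w cos (Z n w)| <= e / 4 by near: n.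
have h2 : fine (P [set w | e / 4 < `|Y n w|]) <= e / 4 by near: n; exact: vY.
have mE : measurable [set w | e / 4 < `|Y n w|] by exact: measurable_norm_gt.
have i1 := integ_cos P (mZ n).
have i2 := integ_cos P (measurable_funD (mZ n) (mY n)).
have h3 : `|\int[P]_w cos (Z n w) - \int[P]_w cos (Z n w + Y n w)| <= e / 4 + 2 * (e / 4).
  rewrite -RintB//; apply: (le_trans (Rint_norm_le (integB i1 i2))).
  apply: (@le_trans _ _ (\int[P]_w (e / 4 + 2 * \1_[set w | e / 4 < `|Y n w|] w))).
    apply: Rint_le => [||w].
    - by apply: integ_norm; exact: integB.
    - by apply: integD; [exact: integ_cst|apply: integZ; exact: integ_indic].
    - rewrite indicE; have [yw|yw] := boolP (w \in _).
        rewrite mulr1 (@le_trans _ _ 2)//; last by rewrite lerDr ltW.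
        rewrite (le_trans (ler_normB _ _))// (_ : 2 = 1 + 1)//.
        by rewrite lerD// ler_norml cos_geN1 cos_le1.
      rewrite mulr0 addr0 distrC (le_trans (normr_cosB_le _ _))//.
      rewrite addrC addKr.
      by move: yw; rewrite notin_setE/= => /negP; rewrite -leNgt.
  rewrite RintD; [|exact: integ_cst|by apply: integZ; exact: integ_indic].
  have iI : integ P (\1_[set w | e / 4 < `|Y n w|] : Omega -> R) by exact: integ_indic.
  by rewrite (RintZ 2 iI) (Rint_indic P mE) Rintegral_prob_cst lerD2l ler_pM2l.
rewrite (_ : l - _ = (l - \int[P]_w cos (Z n w)) + (\int[P]_w cos (Z n w) - \int[P]_w cos (Z n w + Y n w))); last by ring.
rewrite (le_trans (ler_normD _ _))//; move: h1 h3; lra.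
Unshelve. all: by end_near. Qed.

End VanishingInProbability.

Section Drifts.
Variable R : realType.

(** A C^1 path in integral form: stable under linear combinations and read off directly from the
    integrated equation. *)
Definition drift_path (T : R) (f : R -> R) : Prop :=
  exists a (b : R -> R), {within `[0, T], continuous b} /\
    forall t, 0 <= t <= T -> f t = a + \int[lebesgue_measure]_(s in `[0, t]) b s.

Lemma within_integrable (T : R) (b : R -> R) t : {within `[0, T], continuous b} -> t <= T ->
  lebesgue_measure.-integrable `[0, t] (EFin \o b).
Proof.
move=> cb tT; apply: continuous_compact_integrable; first exact: segment_compact.
by apply: continuous_subspaceW cb; apply: subset_itvl; rewrite bnd_simp.
Qed.

Lemma within_continuous_cV (A : set R) k (Y : R -> 'cV[R]_k) (g : 'cV[R]_k -> R) :
  {within A, continuous Y} -> continuous g -> {within A, continuous (fun s => g (Y s))}.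
Proof.
move=> /subspace_continuousP cY cg; apply/subspace_continuousP => x Ax.
exact: (cvg_comp _ _ (cY x Ax) (cg (Y x))).
Qed.

Lemma drift_pathD T f g : drift_path T f -> drift_path T g -> drift_path T (fun t => f t + g t).
Proof.
move=> [a [b [cb fE]]] [a' [b' [cb' gE]]]; exists (a + a'), (b \+ b'); split.
  by move=> x; apply: continuousD; [exact: cb|exact: cb'].
move=> t /andP[t0 tT]; rewrite fE ?gE ?t0// RintegralD//.
- by rewrite addrACA.
- exact: (within_integrable cb tT).
- exact: (within_integrable cb' tT).
Qed.

Lemma drift_pathZ T c f : drift_path T f -> drift_path T (fun t => c * f t).
Proof.
move=> [a [b [cb fE]]]; exists (c * a), (fun s => c * b s); split.
  by move=> x; apply: continuousM; [exact: cst_continuous|exact: cb].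
move=> t /andP[t0 tT]; rewrite fE ?t0// mulrDr RintegralZl//.
exact: (within_integrable cb tT).
Qed.

Lemma drift_path_cst T a : drift_path T (fun=> a).
Proof.
exists a, (fun=> 0); split; first by move=> x; exact: cst_continuous.
by move=> t _; rewrite Rintegral_cst// mul0r addr0.
Qed.

Lemma drift_path_sum T (I : Type) (r : seq I) (f : I -> R -> R) :
  (forall i, drift_path T (f i)) -> drift_path T (fun t => \sum_(i <- r) f i t).
Proof.
move=> df; elim: r => [|i r IH].
  by under eq_fun do rewrite big_nil; exact: drift_path_cst.
by under eq_fun do rewrite big_cons; exact: drift_pathD.
Qed.

Lemma drift_path_eq T f g : (forall t, 0 <= t <= T -> f t = g t) ->
  drift_path T f -> drift_path T g.
Proof. by move=> fg [a [b [cb fE]]]; exists a, b; split => // t tT; rewrite -fg// fE. Qed.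

Lemma integral_primitive_on (T : R) (f : R -> R) (a : R) (b : R -> R) : {within `[0, T], continuous b} ->
  (forall t, 0 <= t <= T -> f t = a + \int[lebesgue_measure]_(s in `[0, t]) b s) ->
  primitive_on T f b.
Proof.
move=> cb fE s t r eta s0 st tT hb.
have t0 := le_trans s0 st; have sT := le_trans st tT.
rewrite !fE ?t0 ?s0//.
have it : lebesgue_measure.-integrable `[0, t] (EFin \o b) := within_integrable cb tT.
have ist : lebesgue_measure.-integrable `]s, t] (EFin \o b).
  apply: integrableS it => //; apply: subset_itv => //; rewrite bnd_simp//.
have := Rintegral_itvB it (x := s); rewrite !bnd_simp => /(_ s0 st) eq1.
have -> : a + \int[lebesgue_measure]_(u in `[0, t]) b u - (a + \int[lebesgue_measure]_(u in `[0, s]) b u) =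
    \int[lebesgue_measure]_(u in `]s, t]) b u by rewrite -eq1; ring.
have mst : fine (lebesgue_measure `]s, t]) = t - s.
  rewrite lebesgue_measure_itv/= lte_fin; case: ltP => // ts.
  by apply/eqP; rewrite eq_sym subr_eq0 eq_le ts st.
have ic c : lebesgue_measure.-integrable `]s, t] (EFin \o (fun _ : R => c)).
  apply: integrableS (within_integrable (T := t) _ (lexx t)) => //.
    by apply: subset_itv => //; rewrite bnd_simp.
  by move=> x; exact: cst_continuous.
have -> : r * (t - s) = \int[lebesgue_measure]_(u in `]s, t]) r by rewrite Rintegral_cst// mst.
have -> : eta * (t - s) = \int[lebesgue_measure]_(u in `]s, t]) eta by rewrite Rintegral_cst// mst.
rewrite -RintegralB//.
have ibr : lebesgue_measure.-integrable `]s, t] (EFin \o (fun u => b u - r)).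
  by have := integrableB _ ist (ic r); apply.
apply: (le_trans (le_normr_Rintegral _ ibr)) => //.
apply: le_Rintegral => //.
- exact: (integrable_norm ibr).
- by move=> u /=; rewrite in_itv/= => /andP[/ltW su ut]; apply: hb; rewrite su.
Qed.

Lemma drift_path_lipschitz T f : 0 <= T -> drift_path T f -> exists M, 0 <= M /\
  forall s t, 0 <= s -> s <= t -> t <= T -> `|f t - f s| <= M * (t - s).
Proof.
move=> T0 [a [b [cb fE]]].
have pf := integral_primitive_on cb fE.
have [M [_ hM]] := compact_bounded (continuous_compact cb (@segment_compact _ 0 T)).
have hM1 u : 0 <= u <= T -> `|b u| <= M + 1.
  move=> uT; apply: (hM (M + 1)); first by rewrite ltrDl.
  by exists u => //=; rewrite in_itv.
exists (M + 1); split.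
  by apply: le_trans (normr_ge0 (b 0)) _; apply: hM1; rewrite lexx.
move=> s t s0 st tT; have := pf s t 0 (M + 1) s0 st tT; rewrite mul0r subr0; apply.
move=> u /andP[su ut]; rewrite subr0 hM1// (le_trans s0 su) (le_trans ut tT)//.
Qed.

Lemma drift_noise_cov_vanish (T G K e : R) (f g : R -> R) : 0 < T -> 0 < e ->
  drift_path T f -> (forall t, 0 <= t <= T -> `|g t| <= G) ->
  exists n0 : nat, forall n, (n0 <= n)%N ->
    let t (i : nat) := i%:R * (T / n%:R) in
    \sum_(0 <= i < n) (g (t i.+1) - g (t i)) ^+ 2 <= K ->
    `|Num.sqrt n%:R * \sum_(0 <= i < n) (f (t i.+1) - f (t i)) * (g (t i.+1) - g (t i))| <= e.
Proof.
move=> T0 e0 [a [b [cb fE]]] gG.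
exact: (drift_noise_vanish K T0 e0 cb (integral_primitive_on cb fE) gG).
Qed.

Lemma unif_grid_in (T : R) n i : 0 < T -> (i <= n)%N -> 0 <= i%:R * (T / n%:R) <= T.
Proof.
move=> T0; have [->|n0 ni] := posnP n.
  by rewrite leqn0 => /eqP ->; rewrite mul0r lexx ltW.
have n0' : 0 < n%:R :> R by rewrite ltr0n.
rewrite mulr_ge0 ?divr_ge0 ?(ltW T0)//= mulrCA ler_piMr ?(ltW T0)//.
by rewrite ler_pdivrMr// mul1r ler_nat.
Qed.

Lemma unif_grid_lt (T : R) n i : 0 < T -> (i < n)%N -> i%:R * (T / n%:R) < i.+1%:R * (T / n%:R).
Proof.
move=> T0 ni; rewrite ltr_pM2r ?ltr_nat// divr_gt0// ltr0n.
exact: leq_ltn_trans ni.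
Qed.

Lemma unif_grid_step (T : R) n i : i.+1%:R * (T / n%:R) - i%:R * (T / n%:R) = T / n%:R.
Proof. by rewrite -mulrBl -natr1 [_ - _]addrC addKr mul1r. Qed.

(** A drift path is bounded and, being Lipschitz, has realized variance at most M^2 T^2, so it can
    take the place of the noise in the preceding estimate. *)
Lemma drift_drift_cov_vanish (T e : R) (f g : R -> R) : 0 < T -> 0 < e ->
  drift_path T f -> drift_path T g ->
  exists n0 : nat, forall n, (n0 <= n)%N ->
    let t (i : nat) := i%:R * (T / n%:R) in
    `|Num.sqrt n%:R * \sum_(0 <= i < n) (f (t i.+1) - f (t i)) * (g (t i.+1) - g (t i))| <= e.
Proof.
move=> T0 e0 df dg; have [M [M0 hM]] := drift_path_lipschitz (ltW T0) dg.
have gG t : 0 <= t <= T -> `|g t| <= `|g 0| + M * T.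
  move=> /andP[t0 tT]; rewrite -[g t](subrK (g 0)) addrC (le_trans (ler_normD _ _))// lerD2l.
  by rewrite (le_trans (hM 0 t _ t0 tT))// subr0 ler_wpM2l.
have [n0 hn0] := drift_noise_cov_vanish (M ^+ 2 * T ^+ 2) T0 e0 df gG.
exists n0 => n nn0; apply: hn0 => //.
have [->|n_gt0] := posnP n; first by rewrite big_geq// mulr_ge0// sqr_ge0.
have n_gt0' : 0 < n%:R :> R by rewrite ltr0n.
apply: (@le_trans _ _ (\sum_(0 <= i < n) M ^+ 2 * (T / n%:R) ^+ 2)).
  rewrite !big_nat; apply: ler_sum => i /andP[_ ni].
  rewrite -[leLHS]real_normK ?num_real// -exprMn lerXn2r ?nnegrE ?mulr_ge0 ?divr_ge0 ?(ltW T0)//.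
  have /andP[ti0 _] := @unif_grid_in T n i T0 (ltnW ni).
  have /andP[_ ti1] := @unif_grid_in T n i.+1 T0 ni.
  by have := hM _ _ ti0 (ltW (unif_grid_lt T0 ni)) ti1; rewrite unif_grid_step.
rewrite sumr_const_nat subn0 -[_ *+ n]mulr_natr -mulrA ler_wpM2l ?sqr_ge0//.
rewrite (_ : (T / n%:R) ^+ 2 * n%:R = T ^+ 2 / n%:R); last by field; rewrite gt_eqF.
by rewrite ler_pdivrMr// ler_peMr ?sqr_ge0// ler1n.
Qed.

End Drifts.

Section SdeDrift.
Context (R : realType) d (Omega : measurableType d) (P : probability Omega R).

(** Subtracting the additive noise leaves the integral of the drift along the path, whose integrand
    is continuous in time. *)
Lemma sde_drift_path (T : R) k r (W : R -> Omega -> 'cV[R]_r) (B : 'cV[R]_k -> 'cV[R]_k)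
    (S : 'M[R]_(k, r)) c Y :
  sde_solution P T W B S c Y -> regular_drift B ->
  {ae P, forall w, forall i, drift_path T (fun t => (Y t w - S *m W t w) i 0)}.
Proof.
move=> sY [_ regB]; have cY := sde_cont sY; have eY := sde_eq sY.
near=> w => i.
have cYw : {within `[0, T], continuous (fun t => Y t w)} by near: w.
have eYw : forall t, 0 <= t <= T ->
    Y t w = c + \col_i (\int[lebesgue_measure]_(s in `[0, t]) B (Y s w) i 0) + S *m W t w by near: w.
have cB : continuous (fun x => B x i 0) by have [[_ h] _] := regB i; exact: (h [::]).
exists (c i 0), (fun s => B (Y s w) i 0); split.
  exact: (within_continuous_cV cYw cB).
by move=> t tT; rewrite eYw// addrK !mxE.
Unshelve. all: by end_near. Qed.

End SdeDrift.

(** * Asymptotics of the realized covariation *)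

Lemma qformE_sum (R : realType) p (B : 'M[R]_p) x :
  qform B x = \sum_a \sum_b B a b * (x a 0 * x b 0).
Proof.
rewrite /qform mxE exchange_big/=; apply: eq_bigr => b _.
rewrite mxE mulr_suml; apply: eq_bigr => a _; rewrite mxE; ring.
Qed.

Lemma qformZ (R : realType) p (B : 'M[R]_p) c x : qform B (c *: x) = c ^+ 2 * qform B x.
Proof.
rewrite !qformE_sum mulr_sumr; apply: eq_bigr => a _; rewrite mulr_sumr; apply: eq_bigr => b _.
by rewrite !mxE; ring.
Qed.

Section QuadraticVariation.
Context (R : realType) d (Omega : measurableType d) (P : probability Omega R).
Variables (T : R) (r0 : nat) (W0 : R -> Omega -> 'cV[R]_r0).
Hypotheses (HW0 : wiener P T W0) (T0 : 0 < T) (r0_gt0 : (0 < r0)%N).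
Variables (J p : nat) (s : 'I_J -> noise_src R Omega p).
Hypothesis Hs : forall j, wiener P T (src_W (s j)).
Hypothesis Hind : mutually_independent P (fun j => sigma_proc T (src_W (s j))).
Variable X : R -> Omega -> 'cV[R]_p.
Hypothesis mX : forall t, 0 <= t <= T -> random_vector (X t).
Hypothesis dX : {ae P, forall w, forall a, drift_path T (fun t => (X t w - noise s t w) a 0)}.

Let S := noise_cov s.

Lemma noise_cov_sym : S^T = S.
Proof.
rewrite /S /noise_cov linear_sum/=; apply: eq_bigr => j _.
by rewrite trmx_mul trmxK.
Qed.

Lemma noise_cov_ge0 u : 0 <= qform S u.
Proof.
rewrite /qform /S /noise_cov mulmx_sumr mulmx_suml summxE; apply: sumr_ge0 => j _.
have -> : u^T *m (src_A (s j) *m (src_A (s j))^T) *m u = ((src_A (s j))^T *m u)^T *m ((src_A (s j))^T *m u).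
  by rewrite trmx_mul trmxK !mulmxA.
by rewrite mulmx_cVE; apply: sumr_ge0 => l _; rewrite -expr2 sqr_ge0.
Qed.

Let tg n (i : nat) : R := i%:R * (T / n%:R).

Let t0 n : 0 <= tg n 0.
Proof. by rewrite /tg mul0r. Qed.

Let tS n i : (i < n)%N -> tg n i < tg n i.+1.
Proof. exact: unif_grid_lt. Qed.

Let tn n : tg n n <= T.
Proof. by have /andP[] := @unif_grid_in _ T n n T0 (leqnn n). Qed.

(** Increments normalized to covariance [S], so that the limit statements apply with one matrix for
    all [n]. *)
Let V n i w := (Num.sqrt (T / n%:R))^-1 *: dnoise s n (tg n) i w.

Let V_block n : (0 < n)%N -> gauss_block P S n (V n).
Proof.
move=> n0; have h0 : 0 < T / n%:R by rewrite divr_gt0// ltr0n.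
have sh0 : 0 < Num.sqrt (T / n%:R) by rewrite sqrtr_gt0.
split=> [i ni u|phi mphi m mn].
  have := dnoise_gauss HW0 T0 r0_gt0 Hs Hind (t0 n) (@tS n) (tn n)
    ((Num.sqrt (T / n%:R))^-1 *: u) ni.
  rewrite unif_grid_step; set v := (X in gauss_rv P _ X).
  have -> : v = qform S u.
    rewrite [v](_ : _ = T / n%:R * qform S ((Num.sqrt (T / n%:R))^-1 *: u))// qformZ.
    by rewrite exprVn sqr_sqrtr ?(ltW h0)// mulVKf// gt_eqF.
  congr gauss_rv; apply/funext => w.
  have -> : ((Num.sqrt (T / n%:R))^-1 *: u)^T = (Num.sqrt (T / n%:R))^-1 *: u^T by rewrite linearZ.
  by rewrite -scalemxAl -scalemxAr.
apply: (dnoise_indep Hs Hind (t0 n) (@tS n) (tn n) (phi := fun _ x => phi (_ *: x))) => // _.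
suff mZ : measurable_fun setT ((fun x : 'cV[R]_p => (Num.sqrt (T / n%:R))^-1 *: x) : borel_cV R p -> borel_cV R p).
  exact: measurableT_comp mphi mZ.
apply/measurable_cVP => i; under eq_fun do rewrite mxE.
by apply: measurable_funM => //; exact: measurable_coord.
Qed.

Let dN n i b w := noise s (tg n i.+1) w b 0 - noise s (tg n i) w b 0.
Let dD n i a w := (X (tg n i.+1) w - noise s (tg n i.+1) w) a 0 - (X (tg n i) w - noise s (tg n i) w) a 0.

Let cDN a b n w := Num.sqrt n%:R * \sum_(0 <= i < n) dD n i a w * dN n i b w.
Let cDD a b n w := Num.sqrt n%:R * \sum_(0 <= i < n) dD n i a w * dD n i b w.

Let mN n i : (i <= n)%N -> random_vector (noise s (tg n i)).
Proof. by move=> ni; apply: (noise_meas Hs); exact: unif_grid_in. Qed.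

Let mco (Z : Omega -> 'cV[R]_p) a : random_vector Z -> measurable_fun setT (fun w => Z w a 0).
Proof. by move=> /measurable_cVP. Qed.

Let mdN n i a : (i < n)%N -> measurable_fun setT (dN n i a).
Proof.
by move=> ni; apply: measurable_funB; apply: mco; apply: mN => //; exact: ltnW.
Qed.

Let mdD n i a : (i < n)%N -> measurable_fun setT (dD n i a).
Proof.
move=> ni; have m j : (j <= n)%N -> measurable_fun setT (fun w => (X (tg n j) w - noise s (tg n j) w) a 0).
  move=> nj; apply: (mco (Z := fun w => X (tg n j) w - noise s (tg n j) w)); apply: random_vectorB; last exact: mN.
  by apply: mX; exact: unif_grid_in.
by apply: measurable_funB; apply: m => //; exact: ltnW.
Qed.

Let mcDN a b n : measurable_fun setT (cDN a b n).
Proof.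
apply: measurable_funM => //; under eq_fun do rewrite big_mkord.
by apply: measurable_sum => i; apply: measurable_funM; [exact: mdD|exact: mdN].
Qed.

Let mcDD a b n : measurable_fun setT (cDD a b n).
Proof.
apply: measurable_funM => //; under eq_fun do rewrite big_mkord.
by apply: measurable_sum => i; apply: measurable_funM; exact: mdD.
Qed.

Let cN : {ae P, forall w, forall b, exists G, forall t, 0 <= t <= T -> `|noise s t w b 0| <= G}.
Proof.
have cW : {ae P, forall w, forall j, {within `[0, T], continuous (fun t => src_W (s j) t w)}}.
  by apply: filter_forall => j; exact: wiener_cont (Hs j).
apply: filterS cW => w cw b.
have cNb : {within `[0, T], continuous (fun t => noise s t w b 0)}.
  rewrite (_ : (fun t => _) = (fun t => \sum_j (src_A (s j) *m src_W (s j) t w) b 0)); last first.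
    by apply/funext => t; rewrite /noise summxE.
  move=> x; apply: continuous_at_sum => j.
  apply: (within_continuous_cV (g := fun y => (src_A (s j) *m y) b 0) (cw j)) => y.
  rewrite (_ : (fun y : 'cV[R]_ _ => _) = (fun y : 'cV[R]_(src_dim (s j)) => \sum_k src_A (s j) b k * y k 0)).
    apply: continuous_at_sum => k; apply: continuousM; first exact: cst_continuous.
    exact: coord_continuous.
  by apply/funext => z; rewrite mxE.
have [M [_ hM]] := compact_bounded (continuous_compact cNb (@segment_compact _ 0 T)).
exists (M + 1) => u uT; apply: (hM (M + 1)); first by rewrite ltrDl.
by exists u => //=; rewrite in_itv.
Qed.

Let vanish_cDN a b : prob_vanish P (cDN a b).
Proof.
(* The truncation statistic: realized variance of one noise coordinate, with mean at most
   [T * qform S (delta_mx b 0)] for every [n]. *)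
pose Sn n w := \sum_(0 <= i < n) dN n i b w ^+ 2.
have gN n i : (i < n)%N -> gauss_rv P (dN n i b) (T / n%:R * qform S (delta_mx b 0)).
  move=> ni; have := dnoise_gauss HW0 T0 r0_gt0 Hs Hind (t0 n) (@tS n) (tn n) (delta_mx b 0) ni.
  rewrite unif_grid_step; congr gauss_rv; apply/funext => w.
  by rewrite trmx_delta -rowE mxE dnoiseE// mxE [X in _ + X]mxE.
have v0 n : 0 <= T / n%:R * qform S (delta_mx b 0).
  by apply: mulr_ge0; [rewrite divr_ge0// ltW|exact: noise_cov_ge0].
have iS n : integ P (Sn n).
  rewrite /Sn; under eq_fun do rewrite big_mkord.
  by apply: integ_sum => i; exact: (integrable_gaussX (v0 n) (gN n i (ltn_ord i)) 2).
apply: (@prob_vanish_trunc _ _ _ P (cDN a b) Sn (T * qform S (delta_mx b 0))) => //.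
- by move=> n w; apply: sumr_ge0 => i _; exact: sqr_ge0.
- move=> n; rewrite /Sn; under eq_Rintegral do rewrite big_mkord.
  rewrite Rint_sum; last by move=> i; exact: (integrable_gaussX (v0 n) (gN n i (ltn_ord i)) 2).
  rewrite (eq_bigr (fun=> T / n%:R * qform S (delta_mx b 0))); last first.
    by move=> i _; have [] := gauss_moments (v0 n) (gN n i (ltn_ord i)).
  rewrite sumr_const card_ord -[_ *+ n]mulr_natr; have [->|n0] := posnP n.
    by rewrite mulr0 mulr_ge0 ?(ltW T0)// noise_cov_ge0.
  by rewrite mulrAC divfK// pnatr_eq0 -lt0n.
- near=> w => K e e0.
  have [G hG] : exists G, forall t, 0 <= t <= T -> `|noise s t w b 0| <= G.
    by move: b {Sn gN v0 iS}; near: w; exact: cN.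
  have df : drift_path T (fun t => (X t w - noise s t w) a 0) by move: (a); near: w.
  have [n0 hn0] := drift_noise_cov_vanish K T0 e0 df hG.
  by exists n0 => n nn0; exact: (hn0 n nn0).
Unshelve. all: by end_near. Qed.

Let vanish_cDD a b : prob_vanish P (cDD a b).
Proof.
apply: (@prob_vanish_trunc _ _ _ P (cDD a b) (fun _ _ => 0) 0) => //.
- by move=> n; exact: integ_cst.
- by move=> n; rewrite Rintegral_prob_cst.
- near=> w => K e e0.
  have da : forall a, drift_path T (fun t => (X t w - noise s t w) a 0) by near: w.
  have [n0 hn0] := drift_drift_cov_vanish T0 e0 (da a) (da b).
  by exists n0 => n nn0 _; exact: (hn0 n nn0).
Unshelve. all: by end_near. Qed.

Lemma quad_varE n w : quad_var T X n w =
  T^-1 *: \sum_(0 <= i < n) (X (tg n i.+1) w - X (tg n i) w) *m (X (tg n i.+1) w - X (tg n i) w)^T.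
Proof. by rewrite /quad_var big_add1. Qed.

Lemma quad_var_meas n a b : measurable_fun setT (fun w => quad_var T X n w a b).
Proof.
under eq_fun do rewrite quad_varE mxE big_mkord summxE.
apply: measurable_funM => //; apply: measurable_sum => i.
under eq_fun do rewrite mxE big_ord1 [X in _ * X]mxE.
have mXc j c : (j <= n)%N -> measurable_fun setT (fun w => X (tg n j) w c 0).
  by move=> jn; apply: mco; apply: mX; exact: unif_grid_in.
have mdX c : measurable_fun setT (fun w => (X (tg n i.+1) w - X (tg n i) w) c 0).
  under eq_fun do rewrite mxE [X in _ + X]mxE.
  by apply: measurable_funB; apply: mXc => //; exact: ltnW.
by apply: measurable_funM; exact: mdX.
Qed.

(** Traces against symmetric [B] exhaust the linear functionals of the symmetric error matrix, so
    the cosines of [zstat] determine the joint behaviour of all its entries. *)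
Definition zstat (B : 'M[R]_p) n w := Num.sqrt n%:R * \tr (B *m (quad_var T X n w - S)).

Lemma zstat_meas B n : measurable_fun setT (zstat B n).
Proof.
apply: measurable_funM => //.
have -> : (fun w => \tr (B *m (quad_var T X n w - S))) =
    (fun w => \sum_i \sum_j B i j * (quad_var T X n w j i - S j i)).
  apply/funext => w; rewrite /mxtrace; apply: eq_bigr => i _; rewrite mxE; apply: eq_bigr => j _.
  by rewrite mxE [X in _ * (_ + X)]mxE.
apply: measurable_sum => i; apply: measurable_sum => j; apply: measurable_funM => //.
by apply: measurable_funB => //; exact: quad_var_meas.
Qed.

Let rem B n w := \sum_a \sum_b T^-1 * B a b * (cDN a b n w + cDN b a n w + cDD a b n w).

Let mrem B n : measurable_fun setT (rem B n).
Proof.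
apply: measurable_sum => a; apply: measurable_sum => b; apply: measurable_funM => //.
by apply: measurable_funD => //; exact: measurable_funD.
Qed.

Let vanish_rem B : prob_vanish P (rem B).
Proof.
apply: prob_vanish_sum => [a n|a].
  apply: measurable_sum => b; apply: measurable_funM => //.
  by apply: measurable_funD => //; exact: measurable_funD.
apply: prob_vanish_sum => [b n|b].
  by apply: measurable_funM => //; apply: measurable_funD => //; exact: measurable_funD.
apply: prob_vanishZ; apply: prob_vanishD => //.
  by move=> n; exact: measurable_funD.
exact: prob_vanishD.
Qed.

(** An exact identity, from expanding the square of noise plus drift increments: [rem] holds every
    product that contains a drift increment. *)
Let zstatE B n w : (0 < n)%N -> zstat B n w = qsum S B n (V n) w + rem B n w.
Proof.
move=> n0; have n0' : 0 < n%:R :> R by rewrite ltr0n.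
have sn0 : 0 < Num.sqrt n%:R :> R by rewrite sqrtr_gt0.
have sn2 : Num.sqrt n%:R ^+ 2 = n%:R :> R by rewrite sqr_sqrtr// ltW.
have h0 : 0 < T / n%:R by rewrite divr_gt0.
pose dX' i := X (tg n i.+1) w - X (tg n i) w.
have dXE i c : dX' i c 0 = dN n i c w + dD n i c w.
  by rewrite /dX' /dN /dD !mxE; ring.
have qE i : qform B (dX' i) = \sum_a \sum_b B a b * (dN n i a w * dN n i b w) +
    \sum_a \sum_b B a b * (dD n i a w * dN n i b w + dD n i b w * dN n i a w + dD n i a w * dD n i b w).
  rewrite qformE_sum -big_split/=; apply: eq_bigr => a _; rewrite -big_split/=; apply: eq_bigr => b _.
  by rewrite !dXE; ring.
have qV i : (i < n)%N -> qform B (V n i w) = n%:R / T * \sum_a \sum_b B a b * (dN n i a w * dN n i b w).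
  move=> ni; rewrite /V qformZ exprVn sqr_sqrtr ?(ltW h0)// invf_div qformE_sum; congr (_ * _).
  by apply: eq_bigr => a _; apply: eq_bigr => b _; rewrite dnoiseE// !mxE.
have trE : \tr (B *m quad_var T X n w) = T^-1 * \sum_(0 <= i < n) qform B (dX' i).
  rewrite quad_varE -scalemxAr mxtraceZ mulmx_sumr raddf_sum/=; congr (_ * _).
  by apply: eq_bigr => i _; rewrite mxtrace_qform.
have remE : rem B n w = Num.sqrt n%:R / T * \sum_(0 <= i < n) \sum_a \sum_b B a b *
    (dD n i a w * dN n i b w + dD n i b w * dN n i a w + dD n i a w * dD n i b w).
  rewrite exchange_big/= mulr_sumr; apply: eq_bigr => a _.
  rewrite exchange_big/= mulr_sumr; apply: eq_bigr => b _.
  by rewrite /cDN /cDD -!mulrDr -!big_split/= -mulr_sumr; ring.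
rewrite /zstat mulmxBr raddfB/= trE remE /qsum.
under eq_bigr do rewrite qE.
rewrite big_split/= [in RHS]big_nat.
under [in RHS]eq_bigr => i /andP[_ ni] do rewrite qV//.
rewrite -[in RHS]big_nat -mulr_suml sumrB sumr_const_nat subn0 -mulr_sumr.
set q1 := \sum_(0 <= i < n) _; set q2 := \sum_(0 <= i < n) _; set c := \tr _.
rewrite -[c *+ n]mulr_natr; move: sn0 sn2; set u := Num.sqrt _ => u0 u2.
by rewrite -u2; field; rewrite !gt_eqF.
Qed.

Lemma zstat_cos B c : B^T = B ->
  \int[P]_w cos (zstat B n w + c) @[n --> \oo] --> cos c * expR (- \tr (B *m S *m (B *m S))).
Proof.
move=> symB.
have [K hK] := qsum_clt HW0 T0 r0_gt0 noise_cov_sym noise_cov_ge0 symB.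
have mz n : measurable_fun setT (fun w => zstat B n w - rem B n w + c).
  apply: measurable_funD => //; apply: measurable_funB => //; exact: zstat_meas.
have -> : (fun n => \int[P]_w cos (zstat B n w + c)) =
   (fun n => \int[P]_w cos ((zstat B n w - rem B n w + c) + rem B n w)).
  by apply/funext => n; apply: eq_Rintegral => w _; congr cos; ring.
apply: Ecos_slutsky => //.
apply/cvgrPdist_le => e e0.
pose N := (Num.bound ((K / e) ^+ 2)).+1.
exists N => // n /= Nn.
have n0 : (0 < n)%N by exact: leq_trans Nn.
have s0 : 0 < Num.sqrt n%:R :> R by rewrite sqrtr_gt0 ltr0n.
rewrite distrC.
have -> : \int[P]_w cos (zstat B n w - rem B n w + c) = \int[P]_w cos (qsum S B n (V n) w + c).
  by apply: eq_Rintegral => w _; rewrite zstatE// addrK.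
rewrite (le_trans (hK n (V n) n0 (V_block n0) c))//.
rewrite ler_pdivrMr// mulrC -ler_pdivrMr//.
rewrite (le_trans (ler_norm _))// -sqrtr_sqr ler_wsqrtr//.
by rewrite (le_trans (ltW (archi_boundP _)))// ?sqr_ge0// ler_nat ltnW.
Qed.

Lemma zstat_tight B : B^T = B -> prob_tight P (zstat B).
Proof.
move=> symB.
have -> : zstat B = (fun n w => (zstat B n w - rem B n w) + rem B n w).
  by apply/funext => n; apply/funext => w; rewrite subrK.
apply: prob_tightD => [n||| ] //.
- by apply: measurable_funB => //; exact: zstat_meas.
- have h n : (0 < n)%N -> (fun w => zstat B n w - rem B n w) = qsum S B n (V n).
    by move=> n0; apply/funext => w; rewrite zstatE// addrK.
  apply: (@prob_tight_second_moment _ _ _ P _ (2 * \tr (B *m S *m (B *m S)))) => n n0; last 2 first.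
  + by apply: measurable_funB => //; exact: zstat_meas.
  + rewrite (_ : (fun w => (zstat B n w - rem B n w) ^+ 2) = (fun w => qsum S B n (V n) w ^+ 2)); last first.
      by apply/funext => w; rewrite -(h n n0).
    by have [_ ->] := qsum_second_moment HW0 T0 r0_gt0 noise_cov_sym noise_cov_ge0 symB n0 (V_block n0).
  rewrite (_ : (fun w => (zstat B n w - rem B n w) ^+ 2) = (fun w => qsum S B n (V n) w ^+ 2)); last first.
    by apply/funext => w; rewrite -(h n n0).
  by have [] := qsum_second_moment HW0 T0 r0_gt0 noise_cov_sym noise_cov_ge0 symB n0 (V_block n0).
- exact: prob_vanish_tight.
Qed.

End QuadraticVariation.

(** * Positive definite matrices and the log-determinant divergence *)

Section EntrywiseNorm.
Variable R : realType.

(** The entrywise l^1 norm. It is submultiplicative, additive over blocks and dominates the trace;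
    [n1_sqr_le] and [trace_mulT_le] compare it with the Frobenius norm. *)
Definition n1 m n (A : 'M[R]_(m, n)) : R := \sum_i \sum_j `|A i j|.

Lemma n1_ge0 m n (A : 'M[R]_(m, n)) : 0 <= n1 A.
Proof. by apply: sumr_ge0 => i _; exact: sumr_ge0. Qed.

Lemma n1_0 m n : n1 (0 : 'M[R]_(m, n)) = 0.
Proof. by apply: big1 => i _; apply: big1 => j _; rewrite mxE normr0. Qed.

Lemma n1N m n (A : 'M[R]_(m, n)) : n1 (- A) = n1 A.
Proof. by apply: eq_bigr => i _; apply: eq_bigr => j _; rewrite mxE normrN. Qed.

Lemma n1D m n (A B : 'M[R]_(m, n)) : n1 (A + B) <= n1 A + n1 B.
Proof.
rewrite -big_split/=; apply: ler_sum => i _; rewrite -big_split/=; apply: ler_sum => j _.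
by rewrite mxE ler_normD.
Qed.

Lemma n1B m n (A B : 'M[R]_(m, n)) : n1 (A - B) <= n1 A + n1 B.
Proof. by rewrite -(n1N B) n1D. Qed.

Lemma n1Z m n c (A : 'M[R]_(m, n)) : n1 (c *: A) = `|c| * n1 A.
Proof.
rewrite mulr_sumr; apply: eq_bigr => i _; rewrite mulr_sumr; apply: eq_bigr => j _.
by rewrite mxE normrM.
Qed.

Lemma n1T m n (A : 'M[R]_(m, n)) : n1 A^T = n1 A.
Proof.
rewrite /n1 exchange_big/=; apply: eq_bigr => i _; apply: eq_bigr => j _.
by rewrite mxE.
Qed.

Lemma n1_entry m n (A : 'M[R]_(m, n)) i j : `|A i j| <= n1 A.
Proof.
rewrite /n1 (bigD1 i)//= (bigD1 j)//= -addrA lerDl addr_ge0//.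
  exact: sumr_ge0.
by apply: sumr_ge0 => k _; exact: sumr_ge0.
Qed.

Lemma n1M m n k (A : 'M[R]_(m, n)) (B : 'M[R]_(n, k)) : n1 (A *m B) <= n1 A * n1 B.
Proof.
have rowB j : \sum_l `|B j l| <= n1 B.
  rewrite /n1 [leRHS](bigD1 j)//= lerDl.
  by apply: sumr_ge0 => i _; exact: sumr_ge0.
rewrite [leRHS]mulr_suml; apply: ler_sum => i _.
apply: (@le_trans _ _ (\sum_l \sum_j `|A i j| * `|B j l|)).
  apply: ler_sum => l _; rewrite mxE (le_trans (ler_norm_sum _ _ _))//.
  by apply: ler_sum => j _; rewrite normrM.
rewrite exchange_big/= mulr_suml; apply: ler_sum => j _.
by rewrite -mulr_sumr ler_wpM2l.
Qed.

Lemma n1_trace n (A : 'M[R]_n) : `|\tr A| <= n1 A.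
Proof.
apply: (le_trans (ler_norm_sum _ _ _)); apply: ler_sum => i _.
by rewrite (bigD1 i)//= lerDl sumr_ge0.
Qed.

Lemma trace_mulT m n (A : 'M[R]_(m, n)) : \tr (A *m A^T) = \sum_i \sum_j A i j ^+ 2.
Proof. by apply: eq_bigr => i _; rewrite mxE; apply: eq_bigr => j _; rewrite mxE expr2. Qed.

Lemma n1_sqr_le m n (A : 'M[R]_(m, n)) : n1 A ^+ 2 <= (m * n)%:R * \tr (A *m A^T).
Proof.
rewrite trace_mulT /n1 !pair_bigA/=; apply: (le_trans (sqr_sum_le _)).
rewrite card_prod !card_ord ler_wpM2l//; apply: ler_sum => i _.
by rewrite real_normK ?num_real.
Qed.

Lemma trace_mulT_le m n (A : 'M[R]_(m, n)) : \tr (A *m A^T) <= n1 A ^+ 2.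
Proof.
rewrite trace_mulT expr2 {1}/n1 mulr_suml; apply: ler_sum => i _; rewrite mulr_suml.
apply: ler_sum => j _; rewrite -real_normK ?num_real// expr2 ler_wpM2l// n1_entry//.
Qed.

Lemma n1_block m1 m2 n1' n2 (A : 'M[R]_(m1, n1')) (B : 'M[R]_(m1, n2)) (C : 'M[R]_(m2, n1')) (D : 'M[R]_(m2, n2)) :
  n1 (block_mx A B C D) = n1 A + n1 B + n1 C + n1 D.
Proof.
rewrite /n1 big_split_ord/=.
have e1 i : \sum_j `|block_mx A B C D (lshift m2 i) j| = \sum_j `|A i j| + \sum_j `|B i j|.
  by rewrite big_split_ord/=; congr (_ + _); apply: eq_bigr => j _; rewrite ?block_mxEul ?block_mxEur.
have e2 i : \sum_j `|block_mx A B C D (rshift m1 i) j| = \sum_j `|C i j| + \sum_j `|D i j|.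
  by rewrite big_split_ord/=; congr (_ + _); apply: eq_bigr => j _; rewrite ?block_mxEdl ?block_mxEdr.
by rewrite (eq_bigr _ (fun i _ => e1 i)) (eq_bigr _ (fun i _ => e2 i)) !big_split/= !addrA.
Qed.

Lemma n1_scalar (a : R) : n1 (a%:M : 'M[R]_1) = `|a|.
Proof. by rewrite /n1 !big_ord1 mxE. Qed.

End EntrywiseNorm.

Section PositiveDefinite.
Variable R : realType.

Lemma pdmx_trmx n (A : 'M[R]_n) : pdmx A -> A^T = A.
Proof. by case. Qed.

Lemma pdmx_congr n (A : 'M[R]_n) (L : 'M[R]_n) : L \in unitmx -> pdmx A -> pdmx (L *m A *m L^T).
Proof.
move=> Lu [As Ap]; split; first by rewrite !trmx_mul trmxK As mulmxA.
move=> x x0; have := Ap (L^T *m x); rewrite trmx_mul trmxK !mulmxA; apply.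
apply: contra x0 => /eqP h; rewrite -(mulKmx (_ : L^T \in unitmx) x) ?unitmx_tr// h mulmx0//.
Qed.

Lemma pdmx_psd n (A : 'M[R]_n) : pdmx A -> psdmx A.
Proof.
move=> [As Ap]; split => // x; have [->|x0] := eqVneq x 0.
  by rewrite mulmx0 mxE.
exact/ltW/Ap.
Qed.

(** One step of symmetric Gaussian elimination, the engine of the inductions on the dimension. *)
Lemma schur_factor n (a : R) (b : 'cV[R]_n) (C : 'M[R]_n) : a != 0 ->
  block_mx a%:M b^T b C =
  block_mx 1%:M 0 (a^-1 *: b) 1%:M *m block_mx a%:M 0 0 (C - a^-1 *: (b *m b^T)) *m
  (block_mx 1%:M 0 (a^-1 *: b) 1%:M)^T.
Proof.
move=> a0; rewrite tr_block_mx !(mulmx_block, mul0mx, mulmx0, mul1mx, mulmx1, trmx0, trmx1, addr0, add0r).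
congr block_mx.
- by rewrite mul_scalar_mx linearZ/= scalerA divff// scale1r.
- by rewrite mul_mx_scalar scalerA divff// scale1r.
- rewrite mul_mx_scalar scalerA divff// scale1r linearZ/= -scalemxAr addrC subrK//.
Qed.

Lemma schur_unit n (b : 'cV[R]_n) :
  (block_mx 1%:M 0 b 1%:M : 'M[R]_(1 + n)) \in unitmx.
Proof. by rewrite unitmxE det_lblock !det1 mulr1 unitr1. Qed.

Lemma pdmx_schur n (a : R) (b : 'cV[R]_n) (C : 'M[R]_n) :
  pdmx (block_mx a%:M b^T b C : 'M[R]_(1 + n)) -> 0 < a /\ pdmx (C - a^-1 *: (b *m b^T)).
Proof.
move=> hpd; have a0 : 0 < a.
  have /(_ (col_mx 1%:M 0)) := hpd.2.
  rewrite tr_col_mx mul_row_block mul_row_col !(mul0mx, mulmx0, mul1mx, mulmx1, trmx0, trmx1, addr0, add0r).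
  rewrite mxE eqxx mulr1n; apply; apply/eqP => /(congr1 usubmx)/eqP.
  by rewrite col_mxKu linear0 oner_eq0.
split=> //; set S := C - _.
pose U : 'M[R]_(1 + n) := block_mx 1%:M 0 (a^-1 *: b) 1%:M.
have Uu : U \in unitmx by exact: schur_unit.
have := hpd; rewrite schur_factor ?gt_eqF// -/U -/S.
move=> /(pdmx_congr (L := invmx U)); rewrite unitmx_inv => /(_ Uu).
rewrite !mulmxA mulVmx// mul1mx -mulmxA -trmx_mul mulVmx// trmx1 mulmx1 => -[sy po].
split.
  have := sy; rewrite tr_block_mx => /(congr1 drsubmx).
  by rewrite !block_mxKdr.
move=> x x0; have := po (col_mx 0 x).
rewrite tr_col_mx mul_row_block mul_row_col !(mulmx0, mul0mx, trmx0, addr0, add0r); apply.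
by apply: contra x0 => /eqP/(congr1 dsubmx); rewrite col_mxKd linear0 => ->.
Qed.

Lemma block_symE n (A : 'M[R]_(1 + n)) : A^T = A ->
  A = block_mx (A 0 0)%:M (dlsubmx A)^T (dlsubmx A) (drsubmx A).
Proof.
move=> As; rewrite -{1}[A]submxK trmx_dlsub As; congr block_mx.
apply/matrixP => i j; rewrite !ord1 !mxE eqxx mulr1n.
by congr (A _ _); apply: val_inj.
Qed.

(** Induction on the Schur complement of the first entry. Only invertibility of the factor is used
    later, so its triangular shape is not recorded. *)
Lemma cholesky n (A : 'M[R]_n) : pdmx A -> exists2 L : 'M[R]_n, L \in unitmx & A = L *m L^T.
Proof.
elim: n A => [|n IH] A.
  by move=> _; exists 1%:M; [exact: unitmx1|rewrite [A]flatmx0 [RHS]flatmx0].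
rewrite -[n.+1]/(1 + n)%N in A * => pA; have := pA; rewrite [A in pdmx A](block_symE pA.1).
move: (A 0 0) (dlsubmx A) (drsubmx A) (block_symE pA.1) => a b C AE /pdmx_schur[a0 /IH[L Lu SE]].
exists (block_mx 1%:M 0 (a^-1 *: b) 1%:M *m block_mx (Num.sqrt a)%:M 0 0 L).
  rewrite unitmx_mul schur_unit unitmxE det_lblock det_scalar1 unitrM -[\det L \is a _]unitmxE Lu andbT.
  by rewrite unitfE gt_eqF// sqrtr_gt0.
rewrite AE schur_factor ?gt_eqF// SE trmx_mul -!mulmxA; congr (_ *m _).
rewrite !mulmxA; congr (_ *m _).
rewrite [in RHS]tr_block_mx mulmx_block !trmx0 !(mulmx0, mul0mx, addr0, add0r) tr_scalar_mx.
by rewrite -scalar_mxM -expr2 sqr_sqrtr// ltW.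
Qed.

Lemma cholesky_pd n (L : 'M[R]_n) : L \in unitmx -> pdmx (L *m L^T).
Proof.
move=> Lu; rewrite -[L in L *m _]mulmx1; apply: pdmx_congr => //; split; first by rewrite trmx1.
move=> x x0; rewrite mulmx1 mulmx_cVE lt_neqAle sumr_ge0 ?andbT => [|i _]; last by rewrite -expr2 sqr_ge0.
apply: contra x0; rewrite eq_sym psumr_eq0 => [/allP h|i _]; last by rewrite -expr2 sqr_ge0.
apply/eqP/colP => i; rewrite mxE; have := h i (mem_index_enum _).
by rewrite -expr2 sqrf_eq0 => /eqP.
Qed.

Lemma pdmx_det_gt0 n (A : 'M[R]_n) : pdmx A -> 0 < \det A.
Proof.
move=> /cholesky[L Lu ->]; rewrite det_mulmx det_tr -expr2.
by rewrite lt_neqAle sqr_ge0 andbT eq_sym sqrf_eq0 -unitfE -unitmxE.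
Qed.

Lemma pdmx_unit n (A : 'M[R]_n) : pdmx A -> A \in unitmx.
Proof. by move=> /pdmx_det_gt0 h; rewrite unitmxE unitfE gt_eqF. Qed.

Lemma pdmx_inv n (A : 'M[R]_n) : pdmx A -> pdmx (invmx A).
Proof.
move=> pA; have Au := pdmx_unit pA.
rewrite -[invmx A]mulmx1 -[1%:M](mulmxV Au) mulmxA -{3}(pdmx_trmx pA) -trmx_inv.
by apply: pdmx_congr => //; rewrite unitmx_inv.
Qed.

Lemma pdmx_lower n (A : 'M[R]_n) : pdmx A ->
  exists2 c : R, 0 < c & forall x, c * n1 x ^+ 2 <= qform A x.
Proof.
move=> /cholesky[L Lu AE].
(* Comes from x = L^-T y and the comparison of [n1] with the Euclidean norm of y; the added ones
   keep it positive in dimension 0. *)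
pose K := (1 + n%:R) * (1 + n1 (invmx L^T)) ^+ 2.
have K1 : 0 < 1 + n1 (invmx L^T) by rewrite ltr_wpDr ?n1_ge0.
have K0 : 0 < K by rewrite mulr_gt0 ?exprn_gt0// ltr_wpDr.
exists K^-1 => [|x]; first by rewrite invr_gt0.
rewrite ler_pdivrMl// /K.
pose y := L^T *m x.
have xE : x = invmx L^T *m y by rewrite mulKmx// unitmx_tr.
have -> : qform A x = \tr (y *m y^T).
  rewrite trace_mulT /qform AE /y !mulmxA -{1}[L]trmxK -trmx_mul -mulmxA mulmx_cVE.
  by apply: eq_bigr => i _; rewrite big_ord1 expr2.
have h : n1 y ^+ 2 <= (1 + n%:R) * \tr (y *m y^T).
  rewrite (le_trans (n1_sqr_le y))// muln1 ler_wpM2r ?lerDr//.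
  by rewrite trace_mulT; apply: sumr_ge0 => i _; apply: sumr_ge0 => j _; exact: sqr_ge0.
rewrite {1}xE mulrAC -[leRHS]mulrC.
apply: (@le_trans _ _ ((n1 (invmx L^T) * n1 y) ^+ 2)).
  by rewrite lerXn2r ?nnegrE ?n1M ?mulr_ge0 ?n1_ge0.
rewrite exprMn ler_pM ?sqr_ge0//.
by rewrite lerXn2r ?nnegrE ?n1_ge0 ?(ltW K1)// lerDr.
Qed.

(** If x^T A x = 0 while y = A x is nonzero, moving [x] by - s y changes the form by - 2 s |y|^2 +
    s^2 (y^T A y), which is negative for the [s] chosen below. *)
Lemma psdmx_unit_pd n (A : 'M[R]_n) : psdmx A -> A \in unitmx -> pdmx A.
Proof.
move=> [As Ap] Au; split => // x x0; rewrite lt_neqAle Ap andbT; apply/eqP => h.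
pose y := A *m x.
have y0 : y != 0 by apply: contra x0 => /eqP yE; rewrite -(mulKmx Au x) -/y yE mulmx0.
have yy : 0 < (y^T *m y) 0 0.
  have := (cholesky_pd (unitmx1 R n)).2 y y0; rewrite trmx1 !mulmx1//.
pose d := qform A y.
have d0 : 0 <= d := Ap y.
pose s := (y^T *m y) 0 0 / (1 + d).
have key : qform A (x - s *: y) = - 2 * s * (y^T *m y) 0 0 + s ^+ 2 * d.
  have -> : qform A (x - s *: y) = ((x^T - s *: y^T) *m A *m (x - s *: y)) 0 0.
    by rewrite /qform [(x - s *: y)^T]linearB/= [(s *: y)^T]linearZ.
  rewrite !mulmxBl !mulmxBr -!(scalemxAl, scalemxAr).
  have e11 (A1 A2 A3 A4 : 'M[R]_1) : (A1 - s *: A2 - (s *: A3 - s *: (s *: A4))) 0 0 =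
      A1 0 0 - s * A2 0 0 - (s * A3 0 0 - s * (s * A4 0 0)) by rewrite !mxE.
  rewrite e11 -h -[X in s * (s * X)]/d.
  have -> : (y^T *m A *m x) 0 0 = (y^T *m y) 0 0 by rewrite -mulmxA.
  have -> : (x^T *m A *m y) 0 0 = (y^T *m y) 0 0 by rewrite /y trmx_mul As mulmxA.
  ring.
have := Ap (x - s *: y); rewrite -/(qform _ _) key.
have s0 : 0 < s by rewrite divr_gt0// ltr_wpDr.
have : s * (1 + d) = (y^T *m y) 0 0 by rewrite /s divfK// gt_eqF// ltr_wpDr.
move: yy; set z := (_ *m _) 0 0; nra.
Qed.

End PositiveDefinite.

Section LogDetDivergence.
Variable R : realType.

Lemma ln_le_sub1 (x : R) : 0 < x -> ln x <= x - 1.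
Proof.
move=> x0; have := @le_ln1Dx R (x - 1); rewrite addrCA subrr addr0; apply.
by rewrite ltrBrDl subrr.
Qed.

(** The function [h] vanishes at 1 and has derivative - (x - 1)^2 / x, so the mean value theorem
    applies. The factor 2 bounds 1 / x, points between 1 and [a] being at least 1/2. *)
Lemma ln_quad (a : R) : `|a - 1| <= 2^-1 ->
  `|a - 1 - ln a - (a - 1) ^+ 2 / 2| <= 2 * `|a - 1| ^+ 3.
Proof.
move=> ha; pose h (x : R) := x - 1 - ln x - (x - 1) ^+ 2 / 2.
pose dh (x : R) := 1 - x^-1 - (x - 1).
have ih (x : R) : 0 < x -> is_derive x 1 h (dh x).
  move=> x0; have := is_derive1_ln x0 => d1.
  by apply: is_derive_eq; rewrite /dh /GRing.scale/=; field; rewrite gt_eqF.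
have dhE x : 0 < x -> dh x = - (x - 1) ^+ 2 / x by move=> x0; rewrite /dh; field; rewrite gt_eqF.
have h1 : h 1 = 0 by rewrite /h ln1 !subrr expr0n mul0r subrr.
have bound c : 2^-1 <= c -> `|c - 1| <= `|a - 1| -> `|dh c| <= 2 * `|a - 1| ^+ 2.
  move=> c2 ca; have c0 : 0 < c by apply: lt_le_trans c2; rewrite invr_gt0.
  rewrite dhE// mulNr normrN normrM normrX normfV (gtr0_norm c0) mulrC.
  rewrite ler_pM ?invr_ge0 ?(ltW c0) ?exprn_ge0//.
    by rewrite invf_ple ?posrE ?invr_gt0.
  by rewrite lerXn2r ?nnegrE.
rewrite -/(h a) exprS mulrCA [leRHS]mulrC.
have ch x : 0 < x -> {for x, continuous h} by move=> x0; apply: differentiable_continuous; apply/derivable1_diffP; exact: (@ex_derive _ _ _ _ _ _ _ (ih x x0)).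
have [a1|a1] := leP 1 a.
  have [||c + e] := @MVT_segment R h dh 1 a a1.
    by move=> x; rewrite in_itv/= => /andP[x1 _]; apply: ih; exact: lt_trans x1.
    by apply: continuous_in_subspaceT => x; rewrite inE/= in_itv/= => /andP[x1 _]; apply: ch; exact: lt_le_trans x1.
  rewrite in_itv/= => /andP[c1 ca].
  move: e; rewrite h1 subr0 => ->; rewrite normrM ler_wpM2r// bound//.
    by rewrite (le_trans _ c1)// invf_le1// ler1n.
  by rewrite !ger0_norm ?subr_ge0// lerD2r.
have a2 : 2^-1 <= a by move: ha; rewrite ler_norml => /andP[]; lra.
have a0 : 0 < a by apply: lt_le_trans a2; rewrite invr_gt0.
have [||c + e] := @MVT_segment R h dh a 1 (ltW a1).
  by move=> x; rewrite in_itv/= => /andP[xa _]; apply: ih; exact: lt_trans xa.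
  by apply: continuous_in_subspaceT => x; rewrite inE/= in_itv/= => /andP[xa _]; apply: ch; exact: lt_le_trans xa.
rewrite in_itv/= => /andP[ca c1].
move: e; rewrite h1 sub0r => /eqP; rewrite eqr_oppLR => /eqP ->.
rewrite normrN normrM [`|1 - a|]distrC ler_wpM2r// bound//; first exact: le_trans ca.
by rewrite distrC [leRHS]distrC !ger0_norm ?subr_ge0// ?(ltW a1)// lerD2l lerN2.
Qed.

(** With s = sqrt a, the inequality ln a = 2 ln s <= 2 (s - 1) gives (s - 1)^2 <= a - 1 - ln a. *)
Lemma ln_gap (a k : R) : 0 < a -> 0 <= k -> a - 1 - ln a <= k ^+ 2 -> `|a - 1| <= k * (2 + k).
Proof.
move=> a0 k0 hk; pose s := Num.sqrt a.
have s0 : 0 < s by rewrite sqrtr_gt0.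
have s2 : a = s ^+ 2 by rewrite sqr_sqrtr// ltW.
have h1 : ln a <= 2 * (s - 1).
  by rewrite s2 lnXn// mulr_natl ler_wMn2r// ln_le_sub1.
have h2 : (s - 1) ^+ 2 <= k ^+ 2 by move: hk h1; rewrite s2; nra.
have h3 : `|s - 1| <= k by rewrite -(ger0_norm k0) -ler_sqr ?nnegrE// !real_normK ?num_real.
rewrite (_ : a - 1 = (s - 1) * (s + 1)); last by rewrite s2; ring.
rewrite normrM ler_pM// gtr0_norm ?addr_gt0//.
by move: h3; rewrite ler_norml => /andP[]; lra.
Qed.

(* The contrast up to congruence. Eliminating one row by a Schur complement reduces it to
   the scalar a - 1 - ln a, hence the inductions on the dimension. *)
Definition Phi n (N : 'M[R]_n) : R := \tr N - n%:R - ln (\det N).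

Lemma det_schur n (a : R) (b : 'cV[R]_n) (C : 'M[R]_n) : a != 0 ->
  \det (block_mx a%:M b^T b C : 'M[R]_(1 + n)) = a * \det (C - a^-1 *: (b *m b^T)).
Proof.
move=> a0; rewrite schur_factor// !det_mulmx det_tr !det_lblock !det1 !mul1r !mulr1.
by rewrite det_scalar1.
Qed.

Lemma trace_outer n (b : 'cV[R]_n) : \tr (b *m b^T) = \tr (b^T *m b).
Proof. exact: mxtrace_mulC. Qed.

Lemma Phi_schur n (a : R) (b : 'cV[R]_n) (C : 'M[R]_n) (S := C - a^-1 *: (b *m b^T)) :
  0 < a -> 0 < \det S ->
  Phi (block_mx a%:M b^T b C : 'M[R]_(1 + n)) =
  (a - 1 - ln a) + a^-1 * \tr (b *m b^T) + Phi S.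
Proof.
move=> a0 S0; rewrite /Phi det_schur ?gt_eqF// lnM ?posrE//.
rewrite mxtrace_block mxtrace_scalar mulr1n /S raddfB/= mxtraceZ natrD; ring.
Qed.

Lemma Phi_ge0 n (N : 'M[R]_n) : pdmx N -> 0 <= Phi N.
Proof.
elim: n N => [|n IH] N.
  by move=> _; rewrite /Phi [N]flatmx0 det_mx00 ln1 mxtrace0 !subr0.
rewrite -[n.+1]/(1 + n)%N in N * => pN; have := pN; rewrite {1}(block_symE pN.1) => /pdmx_schur[a0 pS].
rewrite (block_symE pN.1) Phi_schur// ?pdmx_det_gt0//.
rewrite addr_ge0 ?IH// addr_ge0//.
  by rewrite subr_ge0 ln_le_sub1.
rewrite mulr_ge0 ?invr_ge0 ?(ltW a0)// trace_mulT.
by apply: sumr_ge0 => i _; apply: sumr_ge0 => j _; exact: sqr_ge0.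
Qed.

Lemma n1_outer n (b : 'cV[R]_n) : n1 (b *m b^T) <= n1 b ^+ 2.
Proof. by rewrite (le_trans (n1M _ _))// n1T expr2. Qed.

Lemma block_sub1 n (a : R) (b : 'cV[R]_n) (C : 'M[R]_n) :
  (block_mx a%:M b^T b C : 'M[R]_(1 + n)) - 1%:M = block_mx (a - 1)%:M b^T b (C - 1%:M).
Proof.
rewrite (@scalar_mx_block R 1 n 1) opp_block_mx add_block_mx !oppr0 !addr0.
by rewrite raddfB.
Qed.

Lemma trace_outer_ge0 n (b : 'cV[R]_n) : 0 <= \tr (b *m b^T).
Proof.
rewrite trace_mulT; apply: sumr_ge0 => i _; apply: sumr_ge0 => j _; exact: sqr_ge0.
Qed.

(** [Phi_schur] splits [Phi] into three nonnegative terms. Each of them is then small, and they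
    control the corner, the border and, by induction, the Schur complement. *)
Lemma Phi_small n (e : R) : 0 < e -> exists2 eta : R, 0 < eta &
  forall N : 'M[R]_n, pdmx N -> Phi N <= eta -> n1 (N - 1%:M) <= e.
Proof.
elim: n e => [|n IH] e e0.
  by exists 1 => // N _ _; rewrite [N - _]flatmx0 n1_0 ltW.
have e4 : 0 < e / 4 by rewrite divr_gt0.
have [eta1 eta10 hS] := IH _ e4.
(* The bound e / 12 leaves 3 k <= e / 4 for the corner. The last bound gives k (1 + n) <= e / 16,
   hence e / 4 for the two borders and e / 16 for the passage from the Schur complement to [C]. *)
pose k := Num.min 1 (Num.min (e / 12) (e / (16 * (1 + n%:R)))).
have n10 : 0 < 1 + n%:R :> R by rewrite ltr_wpDr.
have k0 : 0 < k by rewrite !lt_min ltr01 !divr_gt0// mulr_gt0.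
have k1 : k <= 1 by rewrite ge_min lexx.
have k2 : k <= e / 12 by rewrite !ge_min lexx !orbT.
have k3 : k <= e / (16 * (1 + n%:R)) by rewrite !ge_min lexx !orbT.
exists (Num.min eta1 (k ^+ 2)) => [|N]; first by rewrite lt_min eta10 exprn_gt0.
rewrite -[n.+1]/(1 + n)%N in N * => pN; have NE := block_symE pN.1.
move: pN; rewrite NE {NE}; move: (N 0 0) (dlsubmx N) (drsubmx N) => a b C /pdmx_schur[a0 pS].
rewrite Phi_schur ?pdmx_det_gt0// block_sub1 n1_block n1_scalar n1T.
set S := C - _ in pS *.
have := Phi_ge0 pS; have : 0 <= a - 1 - ln a by rewrite subr_ge0 ln_le_sub1.
have tb := trace_outer_ge0 b.
have : 0 <= a^-1 * \tr (b *m b^T) by rewrite mulr_ge0// invr_ge0 ltW.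
set x := a - 1 - ln a; set y := a^-1 * _ => y0 x0 z0; rewrite le_min => /andP[h1 h2].
have ha : `|a - 1| <= 3 * k.
  have hk : x <= k ^+ 2 by lra.
  by rewrite (le_trans (ln_gap a0 (ltW k0) hk))// mulrC ler_wpM2r ?(ltW k0)//; lra.
have hSS : n1 (S - 1%:M) <= e / 4 by apply: hS => //; lra.
have ha4 : a <= 4 by move: ha; rewrite ler_norml => /andP[]; lra.
have hb : \tr (b *m b^T) <= 4 * k ^+ 2.
  have : a * y <= a * k ^+ 2 by rewrite ler_pM2l//; lra.
  rewrite /y mulrA divff ?gt_eqF// mul1r => /le_trans; apply.
  by rewrite ler_wpM2r ?sqr_ge0.
have hnb : n1 b <= 2 * k * (1 + n%:R).
  have nb0 := n1_ge0 b.
  have A0 : 0 <= 2 * k * (1 + n%:R) by rewrite !mulr_ge0// ltW.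
  rewrite -ler_sqr ?nnegrE// (le_trans (n1_sqr_le b))// muln1.
  apply: (@le_trans _ _ (n%:R * (4 * k ^+ 2))); first by rewrite ler_wpM2l.
  rewrite (_ : (2 * k * (1 + n%:R)) ^+ 2 = (1 + n%:R) ^+ 2 * (4 * k ^+ 2)); last by ring.
  rewrite ler_wpM2r//; first by rewrite mulr_ge0 ?sqr_ge0.
  by have : 0 <= n%:R :> R by []; nra.
have hy : a^-1 * n1 (b *m b^T) <= n%:R * k ^+ 2.
  apply: (@le_trans _ _ (a^-1 * (n%:R * \tr (b *m b^T)))).
    rewrite ler_wpM2l ?invr_ge0 ?(ltW a0)// (le_trans (n1_outer _))//.
    by rewrite (le_trans (n1_sqr_le b))// muln1.
  by rewrite mulrCA ler_wpM2l//; move: (h2); rewrite -/y; lra.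
have hC : n1 (C - 1%:M) <= e / 4 + n%:R * k ^+ 2.
  have -> : C - 1%:M = (S - 1%:M) + a^-1 *: (b *m b^T).
    by rewrite /S addrAC subrK.
  rewrite (le_trans (n1D _ _))// lerD// n1Z gtr0_norm ?invr_gt0//.
have hkn : k * (1 + n%:R) <= e / 16.
  by move: k3; rewrite invfM mulrA ler_pdivlMr.
have hk2 : n%:R * k ^+ 2 <= e / 16.
  rewrite (le_trans _ hkn)// expr2 mulrA [leRHS]mulrC -[leRHS]mulr1.
  have kn : 0 <= k * n%:R by rewrite mulr_ge0// ltW.
  have : 0 <= n%:R :> R by []. nra.
move: ha hnb hC; lra.
Qed.

Lemma trace_sqr_block n (a : R) (b : 'cV[R]_n) (C : 'M[R]_n) (N := block_mx a%:M b^T b C : 'M[R]_(1 + n)) :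
  \tr (N *m N) = a ^+ 2 + 2 * \tr (b *m b^T) + \tr (C *m C).
Proof.
rewrite /N mulmx_block mxtrace_block !raddfD/= -scalar_mxM mxtrace_scalar mulr1n.
by rewrite -trace_outer; ring.
Qed.

Lemma trace_sqrD n (E F : 'M[R]_n) :
  \tr ((E + F) *m (E + F)) = \tr (E *m E) + 2 * \tr (E *m F) + \tr (F *m F).
Proof. by rewrite mulmxDl !mulmxDr !mxtraceD (mxtrace_mulC F E); ring. Qed.

(** To second order the term a^-1 tr(b b^T) accounts for the two borders in tr((N - 1)^2) / 2. The
    Schur complement differs from [C] by a second-order matrix, which changes the squared trace at
    third order only. Since [N] is merely symmetric, positivity of its determinant is part of the
    conclusion. *)
Lemma Phi_quad n (e : R) : 0 < e -> exists2 del : R, 0 < del &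
  forall N : 'M[R]_n, N^T = N -> n1 (N - 1%:M) <= del ->
    0 < \det N /\ `|Phi N - \tr ((N - 1%:M) *m (N - 1%:M)) / 2| <= e * n1 (N - 1%:M) ^+ 2.
Proof.
elim: n e => [|n IH] e e0.
  exists 1 => // N _ _; rewrite det_mx00; split => //.
  have -> : N - 1%:M = 0 by exact: flatmx0.
  by rewrite /Phi det_mx00 ln1 [N]flatmx0 mulmx0 mxtrace0 n1_0 mul0r !subr0 normr0 expr0n mulr0.
have e8 : 0 < e / 8 by rewrite divr_gt0.
have [del1 del10 hS] := IH _ e8.
(* The bound 1/4 ensures 1 / a <= 2, and del1 / 2 lets the induction hypothesis apply, as S - 1 has
   norm at most 2 D. With e / 32 the cubic terms, at most 10 D^3, fit beside the inductive share e
   D^2 / 2. *)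
pose del := Num.min (4^-1) (Num.min (del1 / 2) (e / 32)).
have del0 : 0 < del by rewrite !lt_min; apply/and3P; split; [rewrite invr_gt0|exact: divr_gt0|exact: divr_gt0].
have d1 : del <= 4^-1 by rewrite ge_min lexx.
have d2 : del <= del1 / 2 by rewrite !ge_min lexx !orbT.
have d3 : del <= e / 32 by rewrite !ge_min lexx !orbT.
exists del => // N; rewrite -[n.+1]/(1 + n)%N in N * => sN.
rewrite (block_symE sN).
move: (N 0 0) (dlsubmx N) (drsubmx N) (block_symE sN) => a b C NE.
have sC : C^T = C by move: sN; rewrite NE tr_block_mx => /(congr1 drsubmx); rewrite !block_mxKdr.
rewrite block_sub1 trace_sqr_block n1_block n1_scalar n1T.
set x := `|a - 1|; set y := n1 b; set z := n1 (C - 1%:M) => hd.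
have x0 : 0 <= x := normr_ge0 _. have y0 : 0 <= y := n1_ge0 b. have z0 : 0 <= z := n1_ge0 _.
pose D := x + y + y + z.
have D0 : 0 <= D by rewrite !addr_ge0.
have a34 : 3 / 4 <= a by have : x <= 4^-1; [lra|rewrite /x ler_norml => /andP[]; lra].
have a0 : 0 < a by apply: lt_le_trans a34; rewrite divr_gt0.
have ai : a^-1 <= 2 by rewrite invf_ple ?posrE ?invr_gt0//; lra.
have ai0 : 0 < a^-1 by rewrite invr_gt0.
pose S := C - a^-1 *: (b *m b^T).
have sS : S^T = S by rewrite /S linearB/= linearZ/= trmx_mul trmxK sC.
have nbb := n1_outer b.
have hab : n1 (a^-1 *: (b *m b^T)) <= 2 * y ^+ 2.
  by rewrite n1Z (gtr0_norm ai0) ler_pM ?n1_ge0// ltW.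
have hS1 : n1 (S - 1%:M) <= z + 2 * y ^+ 2.
  by rewrite /S addrAC (le_trans (n1B _ _))// lerD.
have hSD : n1 (S - 1%:M) <= 2 * D by rewrite (le_trans hS1)// /D; nra.
have [|detS PS] := hS S sS; first by rewrite (le_trans hSD)// /D; lra.
split; first by rewrite det_schur ?gt_eqF// mulr_gt0.
rewrite Phi_schur// -/S.
have -> : C - 1%:M = (S - 1%:M) + a^-1 *: (b *m b^T) by rewrite /S addrAC subrK.
set E := S - 1%:M in PS hSD *; set F := a^-1 *: (b *m b^T) in hab *.
rewrite trace_sqrD.
set tb := \tr (b *m b^T).
have tb0 : 0 <= tb := trace_outer_ge0 b.
have tby : tb <= y ^+ 2 := trace_mulT_le b.
have hlq : `|a - 1 - ln a - (a - 1) ^+ 2 / 2| <= 2 * x ^+ 3.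
  by apply: ln_quad; rewrite -/x; lra.
have hEF : `|\tr (E *m F)| <= (2 * D) * (2 * y ^+ 2).
  by rewrite (le_trans (n1_trace _))// (le_trans (n1M _ _))// ler_pM ?n1_ge0.
have hFF : `|\tr (F *m F)| <= (2 * y ^+ 2) * (2 * y ^+ 2).
  by rewrite (le_trans (n1_trace _))// (le_trans (n1M _ _))// ler_pM ?n1_ge0.
have hai : `|a^-1 - 1| <= 2 * x.
  have -> : a^-1 - 1 = - (a - 1) * a^-1 by field; rewrite gt_eqF.
  by rewrite normrM normrN (gtr0_norm ai0) mulrC ler_wpM2r.
have PS' : `|Phi S - \tr (E *m E) / 2| <= e / 8 * (2 * D) ^+ 2.
  rewrite (le_trans PS)// ler_wpM2l ?(ltW e8)// lerXn2r ?nnegrE ?n1_ge0 ?mulr_ge0//.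
rewrite (_ : _ - _ = (a - 1 - ln a - (a - 1) ^+ 2 / 2) + (a^-1 - 1) * tb + (Phi S - \tr (E *m E) / 2)
   - \tr (E *m F) - \tr (F *m F) / 2); last by field; rewrite gt_eqF.
apply: (@le_trans _ _ (2 * x ^+ 3 + 2 * x * y ^+ 2 + e / 8 * (2 * D) ^+ 2 + (2 * D) * (2 * y ^+ 2) + (2 * y ^+ 2) * (2 * y ^+ 2) / 2)).
  rewrite (le_trans (ler_normB _ _))// lerD//; last first.
    by rewrite normrM (ger0_norm (_ : 0 <= 2^-1)) ?invr_ge0// ler_wpM2r ?invr_ge0.
  rewrite (le_trans (ler_normB _ _))// lerD// (le_trans (ler_normD _ _))// lerD//.
  rewrite (le_trans (ler_normD _ _))// lerD//.
  by rewrite normrM (ger0_norm tb0) ler_pM.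
have xD : x <= D by rewrite /D; lra.
have yD : y <= D by rewrite /D; lra.
have Dd : D <= e / 32 by rewrite /D; lra.
have D4 : D <= 4^-1 by rewrite /D; lra.
have x2 : x ^+ 2 <= D ^+ 2 by rewrite lerXn2r ?nnegrE.
have y2 : y ^+ 2 <= D ^+ 2 by rewrite lerXn2r ?nnegrE.
rewrite -/D.
have e1 : x ^+ 3 <= D * D ^+ 2 by rewrite exprS ler_pM ?sqr_ge0.
have e2 : x * y ^+ 2 <= D * D ^+ 2 by rewrite ler_pM ?sqr_ge0.
have e3 : D * y ^+ 2 <= D * D ^+ 2 by rewrite ler_wpM2l.
have e4 : y ^+ 2 * y ^+ 2 <= D * D ^+ 2.
  by rewrite ler_pM ?sqr_ge0// (le_trans y2)// expr2; nra.
have e5 : D * D ^+ 2 <= e / 32 * D ^+ 2 by rewrite ler_wpM2r ?sqr_ge0.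
have e6 : 0 <= e * D ^+ 2 by rewrite mulr_ge0 ?sqr_ge0 ?ltW.
move: e1 e2 e3 e4 e5 e6; clear; lra.
Qed.

End LogDetDivergence.

Section ContrastExpansion.
Variable R : realType.

Lemma invmx_mulmx p (A B : 'M[R]_p) : A \in unitmx -> B \in unitmx ->
  invmx (A *m B) = invmx B *m invmx A.
Proof.
move=> Au Bu; have ABu : A *m B \in unitmx by rewrite unitmx_mul Au.
by rewrite -[RHS](mulmxK ABu) -(mulmxA (invmx B)) mulKmx// mulVmx// mul1mx.
Qed.

(** The contrast is invariant under congruence: with S = L L^T it depends only on N = L^-1 Q L^-T,
    and its quadratic part becomes tr((N - 1)^2). *)
Lemma contrast_Phi p (Q L : 'M[R]_p) (S := L *m L^T) (N := invmx L *m Q *m (invmx L)^T) :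
  L \in unitmx -> 0 < \det Q ->
  contrast Q S = Phi N /\ \tr ((N - 1%:M) *m (N - 1%:M)) = \tr (invmx S *m (Q - S) *m (invmx S *m (Q - S))).
Proof.
move=> Lu Q0; have Su : S \in unitmx by rewrite unitmx_mul unitmx_tr Lu.
have detL : \det L != 0 by rewrite -unitfE -unitmxE.
have S0 : 0 < \det S by rewrite pdmx_det_gt0//; exact: cholesky_pd.
have SiE : invmx S = (invmx L)^T *m invmx L by rewrite /S invmx_mulmx ?unitmx_tr// trmx_inv.
have NE : N - 1%:M = invmx L *m (Q - S) *m (invmx L)^T.
  rewrite mulmxBr mulmxBl /S !mulmxA mulVmx// mul1mx -trmx_mul mulVmx// trmx1//.
split; last first.
  by rewrite NE SiE mulmxA mxtrace_mulC !mulmxA.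
rewrite /contrast /Phi.
have -> : \tr N = \tr (invmx S *m Q) by rewrite /N SiE mxtrace_mulC mulmxA.
have -> : \det N = \det Q / \det S.
  by rewrite /N /S !det_mulmx !det_tr det_inv; field; rewrite detL.
by rewrite ln_div ?posrE//; ring.
Qed.

Lemma psdmx_gram p m (A : 'M[R]_(p, m)) : psdmx (A *m A^T).
Proof.
split; first by rewrite trmx_mul trmxK.
move=> x; have -> : x^T *m (A *m A^T) *m x = (A^T *m x)^T *m (A^T *m x) by rewrite trmx_mul trmxK !mulmxA.
by rewrite mulmx_cVE; apply: sumr_ge0 => i _; rewrite -expr2 sqr_ge0.
Qed.

Lemma contrast_ge0 p (Q S : 'M[R]_p) : pdmx Q -> pdmx S -> 0 <= contrast Q S.
Proof.
move=> pQ /cholesky[L Lu ->]; have [-> _] := contrast_Phi Lu (pdmx_det_gt0 pQ).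
by apply: Phi_ge0; apply: pdmx_congr => //; rewrite unitmx_inv.
Qed.

Lemma n1_cholesky p (L : 'M[R]_p) : n1 L ^+ 2 <= (p * p)%:R * n1 (L *m L^T).
Proof.
apply: (le_trans (n1_sqr_le L)); rewrite ler_wpM2l//.
by apply: (le_trans (ler_norm _)); exact: n1_trace.
Qed.

(** Uniform in [S]: the norm of its Cholesky factor is bounded through that of [S] alone, so
    smallness of N - 1 passes to Q - S = L (N - 1) L^T. *)
Lemma contrast_small p (K e : R) : 0 <= K -> 0 < e -> exists2 eta : R, 0 < eta &
  forall Q S : 'M[R]_p, pdmx Q -> pdmx S -> n1 S <= K -> contrast Q S <= eta -> n1 (Q - S) <= e.
Proof.
move=> K0 e0; pose c : R := (p * p)%:R * K + 1.
have c0 : 0 < c by rewrite ltr_wpDl// mulr_ge0.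
have [eta eta0 h] := Phi_small p (divr_gt0 e0 c0).
exists eta => // Q S pQ /cholesky[L Lu SE] SK; rewrite SE in SK *.
have [-> _] := contrast_Phi Lu (pdmx_det_gt0 pQ) => hPhi.
have Liu : invmx L \in unitmx by rewrite unitmx_inv.
have := h _ (pdmx_congr Liu pQ) hPhi; set N := _ *m _ *m _ => hN.
have -> : Q - L *m L^T = L *m (N - 1%:M) *m L^T.
  rewrite mulmxBr mulmxBl mulmx1 /N !mulmxA mulmxV// mul1mx -mulmxA -trmx_mul mulmxV// trmx1 mulmx1//.
rewrite (le_trans (n1M _ _))// n1T.
apply: (@le_trans _ _ (n1 L ^+ 2 * n1 (N - 1%:M))).
  by rewrite expr2 mulrAC ler_wpM2r ?n1_ge0// n1M.
have hL : n1 L ^+ 2 <= c.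
  by rewrite (le_trans (n1_cholesky L))// /c ler_wpDr// ler_wpM2l.
rewrite -(divfK (lt0r_neq0 c0) e) mulrC.
by rewrite ler_pM ?n1_ge0 ?sqr_ge0.
Qed.

(** From S^-1 - S0^-1 = - S^-1 (S - S0) S0^-1. The first bound on S - S0 controls the norm of S^-1,
    the second then makes the difference small. *)
Lemma invmx_near p (S0 : 'M[R]_p) (e : R) : S0 \in unitmx -> 0 < e ->
  exists2 del : R, 0 < del & forall S, S \in unitmx -> n1 (S - S0) <= del ->
    n1 (invmx S - invmx S0) <= e.
Proof.
move=> S0u e0; pose k := 1 + n1 (invmx S0).
have k1 : 1 <= k by rewrite lerDl n1_ge0.
have k0 : 0 < k by exact: lt_le_trans k1.
exists (Num.min ((2 * k)^-1) (e / (2 * k ^+ 2))).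
  by rewrite lt_min invr_gt0 mulr_gt0// divr_gt0// mulr_gt0// exprn_gt0.
move=> S Su; rewrite le_min => /andP[h1 h2].
set A := invmx S; set A0 := invmx S0; set D := S - S0 in h1 h2.
have AE : A - A0 = - (A *m D *m A0).
  by rewrite /D mulmxBr mulVmx// mulmxBl mul1mx -mulmxA mulmxV// mulmx1 opprB.
have kA0 : n1 A0 <= k by rewrite /k lerDr.
have A0p := n1_ge0 A0; have Ap := n1_ge0 A; have Dp := n1_ge0 D.
have hAD : n1 (A - A0) <= n1 A * (n1 D * k).
  rewrite AE n1N -mulmxA (le_trans (n1M _ _))// ler_wpM2l//.
  by rewrite (le_trans (n1M _ _))// ler_wpM2l.
have Dk : n1 D * k <= 2^-1.
  have : n1 D * k <= (2 * k)^-1 * k by rewrite ler_wpM2r// ltW.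
  by rewrite (_ : (2 * k)^-1 * k = 2^-1)//; field; rewrite gt_eqF.
have hA : n1 A <= 2 * k.
  have : n1 A <= n1 A0 + n1 (A - A0).
    by rewrite -[A in leLHS](subrK A0) addrC n1D.
  have : n1 A * (n1 D * k) <= n1 A * 2^-1 by rewrite ler_wpM2l.
  by move: kA0 hAD; lra.
rewrite (le_trans hAD)//; apply: (@le_trans _ _ (2 * k * (e / (2 * k ^+ 2) * k))).
  by rewrite ler_pM// ?mulr_ge0 ?(ltW k0)// ler_wpM2r// ltW.
by rewrite (_ : 2 * k * _ = e)//; field; rewrite gt_eqF.
Qed.

(** Continuity of the Cholesky factor in [S] is not involved: only the norm of its inverse enters,
    bounded through S^-1. Afterwards S^-1 is replaced by S0^-1 in the quadratic form. *)
Lemma contrast_quad p (S0 : 'M[R]_p) (e : R) : pdmx S0 -> 0 < e ->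
  exists2 del : R, 0 < del & forall Q S, Q^T = Q -> pdmx S ->
    n1 (Q - S0) <= del -> n1 (S - S0) <= del ->
    0 < \det Q /\
    `|contrast Q S - \tr (invmx S0 *m (Q - S) *m (invmx S0 *m (Q - S))) / 2| <= e * n1 (Q - S) ^+ 2.
Proof.
move=> pS0 e0; have S0u := pdmx_unit pS0.
pose k := n1 (invmx S0).
have k0 : 0 <= k := n1_ge0 _.
pose c : R := (p * p)%:R * (k + 1) + 1.
have c0 : 0 < c by rewrite ltr_wpDl// mulr_ge0// addr_ge0.
have e1 : 0 < e / (2 * c ^+ 2) by rewrite divr_gt0// mulr_gt0// exprn_gt0.
have [del1 del10 hPhi] := Phi_quad p e1.
have e2 : 0 < Num.min 1 (e / (2 * k + 1)).
  by rewrite lt_min ltr01 divr_gt0// ltr_wpDl// mulr_ge0.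
have [del2 del20 hinv] := invmx_near S0u e2.
exists (Num.min del2 (del1 / (2 * c))) => [|Q S sQ pS].
  by rewrite lt_min del20 divr_gt0// mulr_gt0.
rewrite !le_min => /andP[_ hQ] /andP[hS1 hS2].
have := hinv S (pdmx_unit pS) hS1; rewrite le_min => /andP[hA1 hA2].
have EE : n1 (Q - S) <= del1 / c.
  have -> : Q - S = (Q - S0) - (S - S0) by rewrite opprB addrA subrK.
  have -> : del1 / c = del1 / (2 * c) + del1 / (2 * c) by field; rewrite gt_eqF.
  by rewrite (le_trans (n1B _ _))// lerD.
move: hA1 hA2; have [L Lu SE] := cholesky pS.
set A := invmx S; set A0 := invmx S0 => hA1 hA2.
have hA : n1 A <= k + 1.
  by rewrite -[A](subrK A0) addrC (le_trans (n1D _ _))// lerD2l.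
have hLi : n1 (invmx L) ^+ 2 <= c.
  rewrite -n1T (le_trans (n1_cholesky _))// trmxK.
  have -> : (invmx L)^T *m invmx L = A by rewrite /A SE invmx_mulmx ?unitmx_tr// trmx_inv.
  by rewrite /c ler_wpDr// ler_wpM2l.
pose N := invmx L *m Q *m (invmx L)^T.
have NE : N - 1%:M = invmx L *m (Q - S) *m (invmx L)^T.
  by rewrite mulmxBr mulmxBl SE !mulmxA mulVmx// mul1mx -trmx_mul mulVmx// trmx1.
have hN : n1 (N - 1%:M) <= c * n1 (Q - S).
  rewrite NE (le_trans (n1M _ _))// n1T.
  apply: (@le_trans _ _ (n1 (invmx L) ^+ 2 * n1 (Q - S))).
    by rewrite expr2 mulrAC ler_wpM2r ?n1_ge0// n1M.
  by rewrite ler_wpM2r ?n1_ge0.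
have sN : N^T = N by rewrite /N !trmx_mul trmxK sQ mulmxA.
have [|detN PN] := hPhi N sN.
  by rewrite (le_trans hN)// mulrC -ler_pdivlMr.
have detQ : 0 < \det Q.
  have detL : \det L != 0 by rewrite -unitfE -unitmxE.
  have -> : \det Q = \det N * \det L ^+ 2.
    by rewrite /N !det_mulmx det_tr det_inv; field; rewrite detL.
  by rewrite mulr_gt0// lt_neqAle sqr_ge0 andbT eq_sym sqrf_eq0.
split=> //.
have [cE trE] := contrast_Phi Lu detQ; rewrite -SE in cE trE.
rewrite cE -/N; rewrite -/N -/A in trE; rewrite trE in PN.
set E := Q - S in PN hN EE *.
have Ep := n1_ge0 E.
have h1 : `|Phi N - \tr (A *m E *m (A *m E)) / 2| <= e / 2 * n1 E ^+ 2.
  rewrite (le_trans PN)//.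
  have -> : e / 2 * n1 E ^+ 2 = e / (2 * c ^+ 2) * (c * n1 E) ^+ 2 by field; rewrite gt_eqF.
  rewrite ler_wpM2l ?(ltW e1)// lerXn2r ?nnegrE ?n1_ge0// mulr_ge0// ltW//.
have h2 : `|\tr (A *m E *m (A *m E)) - \tr (A0 *m E *m (A0 *m E))| <= e * n1 E ^+ 2.
  have -> : \tr (A *m E *m (A *m E)) - \tr (A0 *m E *m (A0 *m E)) =
     \tr ((A - A0) *m E *m (A *m E)) + \tr (A0 *m E *m ((A - A0) *m E)).
    by rewrite -!raddfB -raddfD/= !mulmxBl !mulmxBr addrA subrK.
  have nb (X Y : 'M[R]_p) : `|\tr (X *m E *m (Y *m E))| <= n1 X * n1 Y * n1 E ^+ 2.
    rewrite (le_trans (n1_trace _))// (le_trans (n1M _ _))//.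
    rewrite (_ : n1 X * n1 Y * _ = (n1 X * n1 E) * (n1 Y * n1 E)); last by ring.
    by rewrite ler_pM ?n1_ge0// n1M.
  rewrite (le_trans (ler_normD _ _))// (le_trans (lerD (nb _ _) (nb _ _)))//.
  rewrite -mulrDl ler_wpM2r ?sqr_ge0//.
  have hd0 := n1_ge0 (A - A0).
  have : n1 (A - A0) * (n1 A + k) <= e / (2 * k + 1) * (2 * k + 1).
    by rewrite ler_pM// ?addr_ge0 ?n1_ge0//; lra.
  rewrite divfK ?gt_eqF ?ltr_wpDl ?mulr_ge0// => h.
  by move: h; rewrite -/k; lra.
move: h1 h2; rewrite !ler_norml => /andP[? ?] /andP[? ?]; apply/andP; split; lra.
Qed.

End ContrastExpansion.

(** * Half-vectorization and the asymptotic covariance *)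

Section HalfVectorization.
Variable R : realType.

Lemma vecE m n (A : 'M[R]_(m, n)) i j : vec A (mxtens_index (j, i)) 0 = A i j.
Proof. by rewrite mxE mxtens_indexK. Qed.

Lemma vecP m n (x : 'cV[R]_(n * m)) (A : 'M[R]_(m, n)) :
  (forall i j, x (mxtens_index (j, i)) 0 = A i j) -> x = vec A.
Proof. by move=> h; apply/colP => k; case: (mxtens_indexP k) => j i; rewrite vecE h. Qed.

Lemma sum_mxtens m n (F : 'I_(m * n) -> R) :
  \sum_k F k = \sum_i \sum_j F (mxtens_index (i, j)).
Proof.
rewrite pair_bigA/= (reindex (@mxtens_index m n))/=.
  by apply: eq_bigr => -[i j].
by exists (@mxtens_unindex m n) => x _; rewrite ?mxtens_indexK ?mxtens_unindexK.
Qed.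

Lemma vec_tens m n (A : 'M[R]_m) (B : 'M[R]_n) (X : 'M[R]_(n, m)) :
  (A *t B) *m vec X = vec (B *m X *m A^T).
Proof.
apply: vecP => i j; rewrite !mxE sum_mxtens.
under eq_bigr do under eq_bigr do rewrite tensmxE vecE.
apply: eq_bigr => l _; rewrite !mxE mulr_suml; apply: eq_bigr => k _; ring.
Qed.

Lemma vec_dot p (A B : 'M[R]_p) : B^T = B -> ((vec A)^T *m vec B) 0 0 = \tr (A *m B).
Proof.
move=> sB; rewrite mulmx_cVE sum_mxtens exchange_big/=; apply: eq_bigr => i _.
by rewrite mxE; apply: eq_bigr => j _; rewrite !vecE -[in LHS]sB mxE.
Qed.

Definition symx p (x : 'cV[R]_(pbar p)) : 'M[R]_p :=
  \matrix_(i, j) (dupmx R p *m x) (mxtens_index (j, i)) 0.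

Lemma vec_symx p (x : 'cV[R]_(pbar p)) : vec (symx x) = dupmx R p *m x.
Proof. by apply/esym/vecP => i j; rewrite [RHS]mxE. Qed.

Lemma symx_sym p (x : 'cV[R]_(pbar p)) : (symx x)^T = symx x.
Proof.
apply/matrixP => i j; rewrite !mxE; apply: eq_bigr => l _.
by rewrite !mxE !mxtens_indexK/= orbC.
Qed.

Lemma vech_symx p (x : 'cV[R]_(pbar p)) : vech (symx x) = x.
Proof.
apply/colP => l; rewrite !mxE (bigD1 l)//= !mxE mxtens_indexK/= -surjective_pairing eqxx mul1r.
rewrite big1 ?addr0// => k kl; rewrite !mxE mxtens_indexK/= -surjective_pairing.
rewrite (inj_eq enum_val_inj) (negbTE kl)/=; case: eqP => [kE|]; last by rewrite mul0r.
exfalso; case/eqP: kl; apply: enum_val_inj; rewrite kE.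
have := enum_valP l; have := enum_valP k; rewrite kE !inE/= => h1 h2.
have /val_inj e : (enum_val l).1 = (enum_val l).2 :> nat by apply/anti_leq/andP.
by rewrite [RHS]surjective_pairing e.
Qed.

Lemma symx_vech p (A : 'M[R]_p) : A^T = A -> symx (vech A) = A.
Proof. by move=> sA; apply/matrixP => i j; rewrite mxE -dupmxP// vecE. Qed.

Lemma vechB p (A B : 'M[R]_p) : vech (A - B) = vech A - vech B.
Proof. by apply/colP => i; rewrite !mxE. Qed.

Lemma eq_mulmx_cV m n (A B : 'M[R]_(m, n)) : (forall x : 'cV[R]_n, A *m x = B *m x) -> A = B.
Proof.
move=> h; apply/matrixP => i j; have /colP/(_ i) := h (delta_mx j 0).
by rewrite -!colE !mxE.
Qed.

(** The duplication matrix is injective, because [vech] recovers the argument, so it cancels on the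
    left of the first Penrose equation. *)
Lemma mpinv_dupmx p : mpinv (dupmx R p) *m dupmx R p = 1%:M.
Proof.
have [DXD _ _ _] := mpinvP (dupmx R p).
have Dinj (x y : 'cV[R]_(pbar p)) : dupmx R p *m x = dupmx R p *m y -> x = y.
  move=> h; rewrite -(vech_symx x) -(vech_symx y); congr vech.
  by apply/matrixP => i j; rewrite [LHS]mxE [RHS]mxE h.
by apply: eq_mulmx_cV => x; apply: Dinj; rewrite mul1mx !mulmxA DXD.
Qed.

Section Asymptotic.
Variables (p : nat) (S : 'M[R]_p).
Hypothesis pS : pdmx S.

Let D := dupmx R p.
Let Dp := mpinv D.
Let sS : S^T = S := pdmx_trmx pS.
Let Su : S \in unitmx := pdmx_unit pS.

(** Closed form of the inverse of [Wmx S]: duplication matrices stand where [Wmx] has their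
    Moore-Penrose inverses. *)
Definition Winv : 'M[R]_(pbar p) := 2^-1 *: (D^T *m (invmx S *t invmx S) *m D).

Let DDp_sym : (D *m Dp)^T = D *m Dp.
Proof. by have [_ _ h _] := mpinvP D. Qed.

Lemma Winv_mul (x : 'cV[R]_(pbar p)) :
  Winv *m x = 2^-1 *: (D^T *m vec (invmx S *m symx x *m invmx S)).
Proof.
rewrite /Winv -scalemxAl -(mulmxA _ (dupmx R p) x) -(mulmxA (dupmx R p)^T) -vec_symx vec_tens.
by rewrite trmx_inv sS.
Qed.

(** D D^+ is symmetric and fixes the vectorization of every symmetric matrix, so it disappears
    between the two Kronecker products, which then cancel. *)
Lemma Wmx_Winv : Wmx S *m Winv = 1%:M.
Proof.
apply: eq_mulmx_cV => x; rewrite mul1mx -mulmxA Winv_mul /Wmx -scalemxAl -scalemxAr scalerA.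
rewrite mulfV ?pnatr_eq0// scale1r -/D -/Dp.
set Y := invmx S *m symx x *m invmx S.
have sY : Y^T = Y by rewrite !trmx_mul symx_sym trmx_inv sS mulmxA.
have -> : Dp *m (S *t S) *m Dp^T *m (D^T *m vec Y) = Dp *m ((S *t S) *m vec Y).
  rewrite -!mulmxA; do 2 congr (_ *m _).
  rewrite mulmxA -trmx_mul DDp_sym dupmxP// -/D -mulmxA (mulmxA Dp D) mpinv_dupmx mul1mx//.
rewrite vec_tens sS /Y !mulmxA mulmxV// mul1mx -mulmxA mulVmx// mulmx1 vec_symx.
by rewrite mulmxA mpinv_dupmx mul1mx.
Qed.

Lemma Wmx_unit : Wmx S \in unitmx.
Proof. by have [] := mulmx1_unit Wmx_Winv. Qed.

Lemma invmx_Wmx : invmx (Wmx S) = Winv.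
Proof. by rewrite -[RHS](mulKmx Wmx_unit) Wmx_Winv mulmx1. Qed.

(** Identifies the trace form in the expansion of the contrast with the form of W^-1 at a
    half-vectorization. *)
Lemma qform_Winv (x : 'cV[R]_(pbar p)) :
  qform Winv x = \tr (invmx S *m symx x *m (invmx S *m symx x)) / 2.
Proof.
rewrite /qform -mulmxA Winv_mul -scalemxAr mxE mulrC (mulmxA x^T) -trmx_mul -vec_symx vec_dot.
  by rewrite mxtrace_mulC !mulmxA; congr (_ * _); rewrite mxtrace_mulC !mulmxA.
by rewrite !trmx_mul symx_sym trmx_inv sS mulmxA.
Qed.

Lemma Winv_sym : Winv^T = Winv.
Proof.
by rewrite /Winv linearZ/= !trmx_mul trmxK trmx_tens !trmx_inv sS mulmxA.
Qed.

(** The form is half the squared Frobenius norm of L^-1 X L^-T, where S = L L^T and X is the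
    symmetric matrix with half-vectorization [x]. *)
Lemma Winv_pd : pdmx Winv.
Proof.
split; first exact: Winv_sym.
move=> x x0; rewrite -/(qform _ _) qform_Winv divr_gt0//.
have [L Lu SE] := cholesky pS.
pose N := invmx L *m symx x *m (invmx L)^T.
have sN : N^T = N by rewrite /N !trmx_mul trmxK symx_sym mulmxA.
have -> : \tr (invmx S *m symx x *m (invmx S *m symx x)) = \tr (N *m N^T).
  rewrite sN /N SE invmx_mulmx ?unitmx_tr// -trmx_inv.
  by symmetry; rewrite mulmxA mxtrace_mulC !mulmxA.
rewrite trace_mulT lt_neqAle; apply/andP; split; last first.
  by apply: sumr_ge0 => i _; apply: sumr_ge0 => j _; exact: sqr_ge0.
rewrite eq_sym; apply: contra x0 => /eqP h0.
have N0 : N = 0.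
  have : n1 N ^+ 2 <= 0 by rewrite (le_trans (n1_sqr_le N))// trace_mulT h0 mulr0.
  rewrite le_eqVlt ltNge sqr_ge0 orbF sqrf_eq0 => /eqP n0.
  by apply/matrixP => i j; rewrite [RHS]mxE; apply/eqP; rewrite -normr_eq0 eq_le normr_ge0 -n0 n1_entry.
have X0 : symx x = 0.
  have -> : symx x = L *m N *m L^T.
    by rewrite /N !mulmxA mulmxV// mul1mx -mulmxA -trmx_mul mulmxV// trmx1 mulmx1.
  by rewrite N0 mulmx0 mul0mx.
by rewrite -(vech_symx x) X0; apply/eqP/colP => i; rewrite !mxE.
Qed.

(** The symmetric matrix B representing b^T vech A as tr(B A): its vectorization is (D^+)^T b, and a
    further D^+ turns that into its half-vectorization. *)
Definition dualx (b : 'cV[R]_(pbar p)) : 'M[R]_p := symx (Dp *m Dp^T *m b).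

Let vec_dualx b : vec (dualx b) = Dp^T *m b.
Proof.
rewrite /dualx vec_symx -/D !mulmxA -DDp_sym -trmx_mul mulmxA.
by have [_ h _ _] := mpinvP D; rewrite [Dp *m D *m Dp]h.
Qed.

Lemma dualx_dot b (A : 'M[R]_p) : A^T = A -> (b^T *m vech A) 0 0 = \tr (dualx b *m A).
Proof.
move=> sA; rewrite -vec_dot// vec_dualx dupmxP// trmx_mul trmxK -mulmxA (mulmxA Dp).
by rewrite mpinv_dupmx mul1mx.
Qed.

(** Matches the limiting variance 2 tr(B S B S) of the trace statistics with the quadratic form of
    W. *)
Lemma qform_Wmx b : qform (Wmx S) b = 2 * \tr (dualx b *m S *m (dualx b *m S)).
Proof.
rewrite /qform /Wmx -/D -/Dp -scalemxAr -scalemxAl mxE; congr (_ * _).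
have -> : b^T *m (Dp *m (S *t S) *m Dp^T) *m b = (Dp^T *m b)^T *m ((S *t S) *m (Dp^T *m b)).
  by rewrite trmx_mul trmxK !mulmxA.
rewrite -vec_dualx vec_tens vec_dot; last by rewrite !trmx_mul trmxK sS symx_sym mulmxA.
by rewrite sS !mulmxA.
Qed.

End Asymptotic.

Section GaussMarkov.
Variables (p q : nat) (S : 'M[R]_p) (Del : 'M[R]_(pbar p, q)).
Hypotheses (pS : pdmx S) (rDel : \rank Del = q).

Definition infomx := Del^T *m Winv S *m Del.

Lemma infomx_pd : pdmx infomx.
Proof.
have [sW pW] := Winv_pd pS; split; first by rewrite /infomx !trmx_mul trmxK sW mulmxA.
move=> x x0; have := pW (Del *m x); rewrite trmx_mul !mulmxA; apply.
apply: contra x0 => /eqP h.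
have Df : row_free Del^T by rewrite /row_free mxrank_tr rDel.
have : x^T *m Del^T = 0 *m Del^T by rewrite -trmx_mul h trmx0 mul0mx.
by move=> /(row_free_inj Df)/(congr1 trmx); rewrite trmxK trmx0 => ->.
Qed.

(* The generalized least squares estimator in the linear model [Del *m u] with weight
   [Winv S]. *)
Definition gainmx := invmx infomx *m Del^T *m Winv S.

Lemma gainmx_cov : gainmx *m Wmx S *m gainmx^T = invmx infomx.
Proof.
have Iu := pdmx_unit infomx_pd.
have -> : gainmx^T = Winv S *m Del *m invmx infomx.
  by rewrite /gainmx !trmx_mul trmxK (Winv_sym pS) trmx_inv (pdmx_trmx infomx_pd) mulmxA.
rewrite {1}/gainmx -!mulmxA (mulmxA (Wmx S)) (Wmx_Winv pS) mul1mx.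
have -> : Del^T *m (Winv S *m (Del *m invmx infomx)) = infomx *m invmx infomx by rewrite /infomx !mulmxA.
by rewrite mulmxV// mulmx1.
Qed.

Lemma gainmx_orth (x : 'cV[R]_(pbar p)) : Del^T *m Winv S *m (x - Del *m (gainmx *m x)) = 0.
Proof.
have Iu := pdmx_unit infomx_pd.
by rewrite mulmxBr !mulmxA -/infomx mulmxV// mul1mx subrr.
Qed.

(** The residual of the weighted projection is orthogonal to the range of [Del] for the inner
    product of [Winv S]. *)
Lemma gainmx_pythagoras (x : 'cV[R]_(pbar p)) (u : 'cV[R]_q) :
  qform (Winv S) (x - Del *m u) = qform (Winv S) (x - Del *m (gainmx *m x)) + qform infomx (u - gainmx *m x).
Proof.
set r := x - Del *m (gainmx *m x); set v := u - gainmx *m x.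
have -> : x - Del *m u = r - Del *m v by rewrite /r /v mulmxBr opprB addrA subrK.
have o1 : (Del *m v)^T *m Winv S *m r = 0.
  by rewrite trmx_mul -!mulmxA (mulmxA (Del^T)) gainmx_orth mulmx0.
have o2 : r^T *m Winv S *m (Del *m v) = 0.
  by rewrite -[LHS]trmxK trmx_mul [(_ *m Winv S)^T]trmx_mul trmxK (Winv_sym pS) mulmxA o1 trmx0.
clearbody r v; rewrite {1}/qform [(r - _)^T]linearB/= !mulmxBl !mulmxBr o1 o2 subr0 sub0r opprK mxE; congr (_ + _).
by rewrite /qform /infomx trmx_mul !mulmxA.
Qed.

End GaussMarkov.
End HalfVectorization.

(** * The structural covariance model *)

Section SemCovariance.
Variable R : realType.

(** [A] and [B] are the loadings of xi and zeta after the structural equation is solved for eta; the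
    remaining noise enters block diagonally. *)
Lemma sem_cov_factor p1 p2 k1 k2 (m : sem p1 p2 k1 k2 R)
  (A := col_mx (Lx1 m) (Lx2 m *m invmx (Psi m) *m Gam m))
  (B := col_mx 0 (Lx2 m *m invmx (Psi m)) : 'M[R]_(p1 + p2, k2)) :
  (Sxixi m)^T = Sxixi m ->
  sem_cov m = A *m Sxixi m *m A^T + B *m Szz m *m B^T + block_mx (Sdd m) 0 0 (See m).
Proof.
move=> sX; rewrite /sem_cov /A /B !tr_col_mx (mul_col_mx _ _ (Sxixi m)) (mul_col_mx _ _ (Szz m)) !mul_col_row !add_block_mx.
rewrite !trmx0 !mulmx0 !mul0mx !addr0.
congr block_mx.
- by rewrite !trmx_mul !mulmxA.
- by rewrite !trmx_mul !trmxK sX !mulmxA.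
- by rewrite !trmx_mul mulmxDr !mulmxDl !mulmxA.
Qed.

Lemma psdmx_congr n k (A : 'M[R]_n) (L : 'M[R]_(k, n)) : psdmx A -> psdmx (L *m A *m L^T).
Proof.
move=> [As Ap]; split; first by rewrite !trmx_mul trmxK As mulmxA.
by move=> x; have := Ap (L^T *m x); rewrite trmx_mul trmxK !mulmxA.
Qed.

Lemma pdmxD n (A B : 'M[R]_n) : psdmx A -> pdmx B -> pdmx (A + B).
Proof.
move=> [As Ap] [Bs Bp]; split; first by rewrite linearD/= As Bs.
by move=> x x0; rewrite mulmxDr mulmxDl mxE ltr_wpDl ?Ap ?Bp.
Qed.

Lemma psdmxD n (A B : 'M[R]_n) : psdmx A -> psdmx B -> psdmx (A + B).
Proof.
move=> [As Ap] [Bs Bp]; split; first by rewrite linearD/= As Bs.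
by move=> x; rewrite mulmxDr mulmxDl mxE addr_ge0 ?Ap ?Bp.
Qed.

Lemma psdmxZ n c (A : 'M[R]_n) : 0 <= c -> psdmx A -> psdmx (c *: A).
Proof.
move=> c0 [As Ap]; split; first by rewrite linearZ/= As.
by move=> x; rewrite -scalemxAr -scalemxAl mxE mulr_ge0.
Qed.

Lemma psdmx0 n : psdmx (0 : 'M[R]_n).
Proof. by split; [rewrite trmx0|move=> x; rewrite mulmx0 mul0mx mxE]. Qed.

Lemma pdmx_block n1 n2 (A : 'M[R]_n1) (B : 'M[R]_n2) : pdmx A -> pdmx B -> pdmx (block_mx A 0 0 B).
Proof.
move=> pA pB; split; first by rewrite tr_block_mx !trmx0 pA.1 pB.1.
move=> x x0; rewrite -[x]vsubmxK in x0 *; move: (usubmx x) (dsubmx x) x0 => u v uv0.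
rewrite tr_col_mx mul_row_block mul_row_col !mulmx0 addr0 add0r mxE.
have [u0|u0] := eqVneq u 0; last first.
  by rewrite ltr_pwDl ?pA.2//; exact: (pdmx_psd pB).2.
have v0 : v != 0 by apply: contra uv0 => /eqP ->; rewrite u0 col_mx0.
by rewrite ltr_wpDl ?pB.2//; exact: (pdmx_psd pA).2.
Qed.

Lemma sem_cov_pd p1 p2 k1 k2 (m : sem p1 p2 k1 k2 R) : sem_admissible m -> pdmx (sem_cov m).
Proof.
move=> [_ _ [pX pZ] pD pE]; rewrite sem_cov_factor; last by case: pX.
apply: pdmxD; last exact: pdmx_block.
by apply: psdmxD; exact: psdmx_congr.
Qed.

End SemCovariance.

(** * Differentiability of matrix functions of the parameter *)

Section DifferentiableMatrices.
Variables (R : realType) (q : nat) (t : 'cV[R]_q).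

Definition mxdiff m n (A : 'cV[R]_q -> 'M[R]_(m, n)) : Prop :=
  forall i j, differentiable (fun x => A x i j) t.

Lemma diff_sum (I : Type) (r : seq I) (Q : pred I) (f : I -> 'cV[R]_q -> R) :
  (forall i, differentiable (f i) t) -> differentiable (fun x => \sum_(i <- r | Q i) f i x) t.
Proof.
move=> df; elim: r => [|i r IH].
  by under eq_fun do rewrite big_nil; exact: differentiable_cst.
under eq_fun do rewrite big_cons.
by case: (Q i) => //; exact: differentiableD.
Qed.

Lemma diff_prod (I : Type) (r : seq I) (Q : pred I) (f : I -> 'cV[R]_q -> R) :
  (forall i, differentiable (f i) t) -> differentiable (fun x => \prod_(i <- r | Q i) f i x) t.
Proof.
move=> df; elim: r => [|i r IH].
  by under eq_fun do rewrite big_nil; exact: differentiable_cst.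
under eq_fun do rewrite big_cons.
by case: (Q i) => //; exact: differentiableM.
Qed.

Lemma mxdiff_mul m n k (A : 'cV[R]_q -> 'M[R]_(m, n)) (B : 'cV[R]_q -> 'M[R]_(n, k)) :
  mxdiff A -> mxdiff B -> mxdiff (fun x => A x *m B x).
Proof.
move=> dA dB i j; under eq_fun do rewrite mxE.
by apply: diff_sum => l; exact: differentiableM.
Qed.

Lemma mxdiff_add m n (A B : 'cV[R]_q -> 'M[R]_(m, n)) :
  mxdiff A -> mxdiff B -> mxdiff (fun x => A x + B x).
Proof. by move=> dA dB i j; under eq_fun do rewrite mxE; exact: differentiableD. Qed.

Lemma mxdiff_tr m n (A : 'cV[R]_q -> 'M[R]_(m, n)) : mxdiff A -> mxdiff (fun x => (A x)^T).
Proof. by move=> dA i j; under eq_fun do rewrite mxE; exact: dA. Qed.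

Lemma mxdiff_scale m n (c : 'cV[R]_q -> R) (A : 'cV[R]_q -> 'M[R]_(m, n)) :
  differentiable c t -> mxdiff A -> mxdiff (fun x => c x *: A x).
Proof. by move=> dc dA i j; under eq_fun do rewrite mxE; exact: differentiableM. Qed.

Lemma mxdiff_block m1 m2 n1 n2 (A : 'cV[R]_q -> 'M[R]_(m1, n1)) (B : 'cV[R]_q -> 'M[R]_(m1, n2))
    (C : 'cV[R]_q -> 'M[R]_(m2, n1)) (D : 'cV[R]_q -> 'M[R]_(m2, n2)) :
  mxdiff A -> mxdiff B -> mxdiff C -> mxdiff D -> mxdiff (fun x => block_mx (A x) (B x) (C x) (D x)).
Proof.
move=> dA dB dC dD i j; case: (split_ordP i) => i' ->; case: (split_ordP j) => j' ->.
- by under eq_fun do rewrite block_mxEul; exact: dA.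
- by under eq_fun do rewrite block_mxEur; exact: dB.
- by under eq_fun do rewrite block_mxEdl; exact: dC.
- by under eq_fun do rewrite block_mxEdr; exact: dD.
Qed.

Lemma diff_det n (A : 'cV[R]_q -> 'M[R]_n) : mxdiff A -> differentiable (fun x => \det (A x)) t.
Proof.
move=> dA; rewrite /determinant; apply: diff_sum => s; apply: differentiableM.
  exact: differentiable_cst.
by apply: diff_prod => i; exact: dA.
Qed.

Lemma mxdiff_adj n (A : 'cV[R]_q -> 'M[R]_n) : mxdiff A -> mxdiff (fun x => \adj (A x)).
Proof.
move=> dA i j; under eq_fun do rewrite mxE /cofactor.
apply: differentiableM; first exact: differentiable_cst.
apply: diff_det => a b; under eq_fun do rewrite !mxE; exact: dA.
Qed.

Lemma mxdiff_inv n (A : 'cV[R]_q -> 'M[R]_n) : \det (A t) != 0 -> mxdiff A ->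
  mxdiff (fun x => (\det (A x))^-1 *: \adj (A x)).
Proof.
move=> A0 dA; apply: mxdiff_scale; last exact: mxdiff_adj.
by apply: differentiableV => //; exact: diff_det.
Qed.

Lemma mxdiff_param m n (A : 'M[R + 'I_q]_(m, n)) : mxdiff (fun x => map_mx (param_entry x) A).
Proof.
move=> i j; under eq_fun do rewrite mxE; case: (A i j) => [c|k] /=.
  exact: differentiable_cst.
exact: differentiable_coord.
Qed.

End DifferentiableMatrices.

Section CompactBounds.
Variables (R : realType) (q : nat).

Lemma normr_le_n1 k (x : 'cV[R]_k) : `|x| <= n1 x.
Proof.
rewrite {1}/Num.norm/= mx_normrE; apply: bigmax_le => [|[i j] _]/=; first exact: n1_ge0.
exact: n1_entry.
Qed.

Lemma continuous_n1 k : continuous (@n1 R k 1).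
Proof.
move=> x; rewrite (_ : @n1 R k 1 = (fun y => \sum_i \sum_j `|y i j|))//.
apply: continuous_at_sum => i; apply: continuous_at_sum => j.
apply: (@continuous_comp _ _ _ (fun y : 'cV[R]_k => y i j) (fun z : R => `|z|)).
  exact: coord_continuous.
exact: norm_continuous.
Qed.

Lemma compact_image_for (K : set 'cV[R]_q) (h : 'cV[R]_q -> R) : compact K ->
  (forall x, K x -> {for x, continuous h}) -> compact (h @` K).
Proof.
move=> cK ch; apply: continuous_compact => //.
by apply: continuous_in_subspaceT => x; rewrite inE => /ch.
Qed.

Lemma compact_pos_lower (K : set 'cV[R]_q) (h : 'cV[R]_q -> R) : compact K ->
  (forall x, K x -> {for x, continuous h}) -> (forall x, K x -> 0 < h x) ->
  exists2 del : R, 0 < del & forall x, K x -> del <= h x.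
Proof.
move=> cK ch hp; have cI := compact_image_for cK ch.
have clI : closed (h @` K) by apply: compact_closed => //; exact: Rhausdorff.
have : nbhs (0 : R) (~` (h @` K)).
  by apply: open_nbhs_nbhs; split; [exact: closed_openC|move=> [x /hp + hx]; rewrite hx ltxx].
move=> /nbhs_ballP[e /= e0 he]; exists e => // x Kx; rewrite leNgt; apply/negP => hxe.
apply: (he (h x)); last by exists x.
by rewrite /ball/= sub0r normrN gtr0_norm// hp.
Qed.

Lemma compact_upper (K : set 'cV[R]_q) (h : 'cV[R]_q -> R) : compact K ->
  (forall x, K x -> {for x, continuous h}) -> exists2 B : R, 0 <= B & forall x, K x -> h x <= B.
Proof.
move=> cK ch; have [M [_ hM]] := compact_bounded (compact_image_for cK ch).
exists (`|M| + 1) => [|x Kx]; first by rewrite addr_ge0.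
apply: (le_trans (ler_norm _)); apply: (hM (`|M| + 1)); last by exists x.
by rewrite (le_lt_trans (ler_norm M))// ltrDl.
Qed.

Lemma diff_expand (g : 'cV[R]_q -> R) (t : 'cV[R]_q) (e : R) : differentiable g t -> 0 < e ->
  \forall v \near (0 : 'cV[R]_q), `|g (t + v) - g t - \sum_j partial j g t * v j 0| <= e * n1 v.
Proof.
move=> dg e0; have := diff_locally dg => /eqaddoP/(_ e e0).
apply: filterS => v /= hv.
have -> : \sum_j partial j g t * v j 0 = 'd g t v.
  rewrite {2}[v](_ : _ = \sum_j v j 0 *: delta_mx j 0); last first.
    by rewrite {1}[v]matrix_sum_delta; apply: eq_bigr => j _; rewrite big_ord1.
  rewrite linear_sum; apply: eq_bigr => j _.
  by rewrite linearZ/= /partial deriveE// mulrC.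
have -> : g (t + v) - g t - 'd g t v = g (v + t) - (g t + 'd g t v) by rewrite [t + v]addrC; ring.
by apply: (le_trans hv); rewrite ler_wpM2l ?(ltW e0)// normr_le_n1.
Qed.

End CompactBounds.

Section ParametricModel.
Variables (R : realType) (p1 p2 k1 k2 q : nat) (M : sem p1 p2 k1 k2 (R + 'I_q)).

Definition invadj n (A : 'M[R]_n) := (\det A)^-1 *: \adj A.

(* [Sigma] with the inverse of [Psi] replaced by a function differentiable wherever
   [Psi] is invertible. *)
Definition Sigma_adj (x : 'cV[R]_q) : 'M[R]_(p1 + p2) :=
  let m := sem_at M x in
  block_mx (Lx1 m *m Sxixi m *m (Lx1 m)^T + Sdd m)
    (Lx1 m *m Sxixi m *m (Gam m)^T *m (invadj (Psi m))^T *m (Lx2 m)^T)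
    (Lx1 m *m Sxixi m *m (Gam m)^T *m (invadj (Psi m))^T *m (Lx2 m)^T)^T
    (Lx2 m *m invadj (Psi m) *m (Gam m *m Sxixi m *m (Gam m)^T + Szz m)
       *m (invadj (Psi m))^T *m (Lx2 m)^T + See m).

Lemma Sigma_adjE x : Psi (sem_at M x) \in unitmx -> Sigma M x = Sigma_adj x.
Proof. by move=> Pu; rewrite /Sigma /sem_cov /Sigma_adj /invadj /invmx Pu. Qed.

Lemma mxdiff_Sigma_adj x : Psi (sem_at M x) \in unitmx -> mxdiff x Sigma_adj.
Proof.
rewrite unitmxE unitfE => Pn.
have dP m n (A : 'M[R + 'I_q]_(m, n)) : mxdiff x (fun y => map_mx (param_entry y) A) by exact: mxdiff_param.
have dPi : mxdiff x (fun y => invadj (Psi (sem_at M y))) by exact: (mxdiff_inv (A := fun y => Psi (sem_at M y)) Pn (dP _ _ _)).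
have d12 : mxdiff x (fun y => let m := sem_at M y in
    Lx1 m *m Sxixi m *m (Gam m)^T *m (invadj (Psi m))^T *m (Lx2 m)^T).
  by do ![apply: mxdiff_mul | apply: mxdiff_tr | exact: dP | exact: dPi].
rewrite /Sigma_adj; apply: mxdiff_block.
- by apply: mxdiff_add => //; do ![apply: mxdiff_mul | apply: mxdiff_tr | exact: dP].
- exact: d12.
- exact: (mxdiff_tr d12).
- apply: mxdiff_add; last exact: dP.
  by do ![exact: dP | exact: dPi | apply: mxdiff_mul | apply: mxdiff_add | apply: mxdiff_tr].
Qed.

Variables (Theta : set 'cV[R]_q) (t0 : 'cV[R]_q).
Hypothesis cTheta : compact Theta.
Hypothesis admTheta : forall t, Theta t -> sem_admissible (sem_at M t).
Hypothesis t0_int : interior Theta t0.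
Hypothesis ident : forall t1 t2, Theta t1 -> Theta t2 -> Sigma M t1 = Sigma M t2 -> t1 = t2.

Lemma Psi_unit t : Theta t -> Psi (sem_at M t) \in unitmx.
Proof. by move=> /admTheta[_ [_ ?]]. Qed.

Lemma t0_in : Theta t0.
Proof. exact: interior_subset. Qed.

Lemma Sigma_pd t : Theta t -> pdmx (Sigma M t).
Proof. by move=> /admTheta; exact: sem_cov_pd. Qed.

Lemma Sigma_adj_cvg t (A : 'M[R]_(p1 + p2)) : Theta t -> {for t, continuous (fun x => n1 (Sigma_adj x - A))}.
Proof.
move=> Tt; have dS := mxdiff_Sigma_adj (Psi_unit Tt).
apply: continuous_at_sum => i; apply: continuous_at_sum => j.
apply: (@continuous_comp _ _ _ (fun y : 'cV[R]_q => (Sigma_adj y - A) i j) (fun z : R => `|z|)); last exact: norm_continuous.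
rewrite (_ : (fun y : 'cV[R]_q => _) = (fun y => Sigma_adj y i j - A i j)); last by apply/funext => y; rewrite mxE [X in _ + X]mxE.
apply: continuousB; last exact: cst_continuous.
exact: differentiable_continuous.
Qed.

Lemma Sigma_bounded : exists2 K : R, 0 <= K & forall t, Theta t -> n1 (Sigma M t) <= K.
Proof.
have [K K0 hK] := compact_upper cTheta (fun t Tt => @Sigma_adj_cvg t 0 Tt).
by exists K => // t Tt; rewrite (Sigma_adjE (Psi_unit Tt)); have := hK t Tt; rewrite subr0.
Qed.

(** On the compact part of [Theta] at distance at least [e] from [t0], the distance of Sigma to its
    value at [t0] is continuous and, by identifiability, positive, hence bounded below. *)
Lemma Sigma_identify (e : R) : 0 < e -> exists2 del : R, 0 < del &
  forall t, Theta t -> n1 (Sigma M t - Sigma M t0) < del -> n1 (t - t0) < e.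
Proof.
move=> e0; pose K := Theta `&` [set t | e <= n1 (t - t0)].
have cf : continuous (fun t : 'cV[R]_q => n1 (t - t0)).
  move=> t; apply: (@continuous_comp _ _ _ (fun t : 'cV[R]_q => t - t0) (@n1 R q 1)).
    by apply: continuousB; [exact: cvg_id|exact: cst_continuous].
  exact: continuous_n1.
have cK : compact K.
  apply: compact_closedI => //; apply: (closed_comp (f := fun t : 'cV[R]_q => n1 (t - t0)) (D := [set x | e <= x])).
    by move=> x _; exact: cf.
  exact: closed_ge.
have [||del del0 hdel] := @compact_pos_lower _ _ K (fun t => n1 (Sigma_adj t - Sigma M t0)) cK.
- by move=> t [Tt _]; exact: Sigma_adj_cvg.
- move=> t [Tt /= et]; rewrite -Sigma_adjE ?Psi_unit// lt_neqAle n1_ge0 andbT eq_sym.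
  apply/eqP => n0; have ee : t = t0.
    apply: ident => //; first exact: t0_in.
    apply/eqP; rewrite -subr_eq0; apply/eqP/matrixP => i j; rewrite [RHS]mxE.
    by apply/eqP; rewrite -normr_eq0 eq_le normr_ge0 -n0 n1_entry.
  by move: et; rewrite ee subrr n1_0 leNgt e0.
exists del => // t Tt; rewrite (Sigma_adjE (Psi_unit Tt)) => hd; rewrite ltNge; apply/negP => et.
by have := hdel t (conj Tt et); rewrite leNgt hd.
Qed.

Lemma near_t0_shift (P : set 'cV[R]_q) : (\forall t \near t0, P t) -> \forall v \near (0 : 'cV[R]_q), P (t0 + v).
Proof.
move=> hP; have ca : {for (0 : 'cV[R]_q), continuous (fun v : 'cV[R]_q => t0 + v)}.
  by apply: continuousD; [exact: cst_continuous|exact: cvg_id].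
have h : nbhs (t0 + 0) P by rewrite addr0.
exact: (ca _ h).
Qed.

Lemma near0_n1 (P : set 'cV[R]_q) : (\forall v \near (0 : 'cV[R]_q), P v) ->
  exists2 del : R, 0 < del & forall v, n1 v <= del -> P v.
Proof.
move=> /nbhs_norm0P[e /= e0 he]; exists (e / 2) => [|v hv]; first by rewrite divr_gt0.
apply: he => /=; rewrite (le_lt_trans (normr_le_n1 v))// (le_lt_trans hv)//.
by rewrite ltr_pdivrMr// ltr_pMr// ltr1n.
Qed.

Lemma Sigma_local : exists2 del : R, 0 < del & forall v, n1 v <= del -> Theta (t0 + v).
Proof. by apply: near0_n1; apply: near_t0_shift; exact: t0_int. Qed.

Let Delta := jacobian_mx (fun t => vech (Sigma M t)) t0.

Lemma Sigma_expand (e : R) : 0 < e -> exists2 del : R, 0 < del & forall v, n1 v <= del ->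
  n1 (vech (Sigma M (t0 + v)) - vech (Sigma M t0) - Delta *m v) <= e * n1 v.
Proof.
move=> e0; apply: near0_n1.
pose N : R := (pbar (p1 + p2))%:R + 1.
have N0 : 0 < N by rewrite ltr_wpDl.
have eN : 0 < e / N by rewrite divr_gt0.
have eqS : \forall t \near t0, Sigma M t = Sigma_adj t.
  by apply: filterS t0_int => t Tt; rewrite Sigma_adjE// Psi_unit.
(* As [t0] is interior, [invmx] and the adjugate formula agree near it, hence have the same partial
   derivatives there. *)
have DeltaE i j : Delta i j = partial j (fun t => vech (Sigma_adj t) i 0) t0.
  rewrite mxE; apply: near_eq_derive; apply: filterS eqS => t -> //.
have dv i : differentiable (fun t => vech (Sigma_adj t) i 0) t0.
  under eq_fun do rewrite mxE; apply: (mxdiff_Sigma_adj (Psi_unit t0_in)).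
have hexp : \forall v \near (0 : 'cV[R]_q), forall i,
    `|vech (Sigma_adj (t0 + v)) i 0 - vech (Sigma_adj t0) i 0 - \sum_j partial j (fun t => vech (Sigma_adj t) i 0) t0 * v j 0| <= e / N * n1 v.
  pose err (i : 'I_(pbar (p1 + p2))) : set 'cV[R]_q := fun v => `|vech (Sigma_adj (t0 + v)) i 0 - vech (Sigma_adj t0) i 0 -
    \sum_j partial j (fun t => vech (Sigma_adj t) i 0) t0 * v j 0| <= e / N * n1 v.
  exact: (filter_forall (nbhs_filter (0 : 'cV[R]_q)) (f := err) (fun i => diff_expand (dv i) eN)).
have eqS' := near_t0_shift eqS.
near=> v.
have -> : Sigma M (t0 + v) = Sigma_adj (t0 + v) by near: v.
have -> : Sigma M t0 = Sigma_adj t0 by rewrite Sigma_adjE// Psi_unit//; exact: t0_in.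
have hv : forall i, `|vech (Sigma_adj (t0 + v)) i 0 - vech (Sigma_adj t0) i 0 - \sum_j partial j (fun t => vech (Sigma_adj t) i 0) t0 * v j 0| <= e / N * n1 v by near: v.
apply: (@le_trans _ _ (\sum_(i < pbar (p1 + p2)) e / N * n1 v)).
  apply: ler_sum => i _; rewrite big_ord1 mxE [X in _ + X]mxE [X in X - _]mxE [X in _ + X - _]mxE.
  rewrite [X in _ - X]mxE; apply: le_trans (hv i); rewrite le_eqVlt; apply/orP; left; apply/eqP.
  by congr (`|_ - _|); apply: eq_bigr => j _; rewrite DeltaE.
rewrite sumr_const card_ord -[_ *+ _]mulr_natr mulrAC ler_wpM2r ?n1_ge0//.
by rewrite mulrAC ler_pdivrMr// ler_wpM2l ?(ltW e0)// lerDl.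
Unshelve. all: by end_near. Qed.

End ParametricModel.

(** * Minimizers of the contrast *)

Lemma subr_sub_assoc (V : zmodType) (a b c : V) : a - b - c = a - (b + c).
Proof. by rewrite opprD addrA. Qed.

Section HalfVectorNorms.
Variables (R : realType) (p : nat).

Lemma n1_vec (A : 'M[R]_p) : n1 (vec A) = n1 A.
Proof.
rewrite /n1 sum_mxtens exchange_big/=; apply: eq_bigr => i _; apply: eq_bigr => j _.
by rewrite big_ord1 vecE.
Qed.

Lemma n1_sym_le (A : 'M[R]_p) : A^T = A -> n1 A <= n1 (dupmx R p) * n1 (vech A).
Proof. by move=> sA; rewrite -n1_vec dupmxP// n1M. Qed.

Lemma n1_vech_le (A : 'M[R]_p) : A^T = A -> n1 (vech A) <= n1 (mpinv (dupmx R p)) * n1 A.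
Proof. by move=> sA; rewrite -n1_vec -[vech A]mul1mx -mpinv_dupmx -mulmxA -dupmxP// n1M. Qed.

Lemma qformB_le m (A : 'M[R]_m) x r :
  `|qform A (x - r) - qform A x| <= n1 A * (2 * n1 x * n1 r + n1 r ^+ 2).
Proof.
have bl (u v : 'cV[R]_m) : `|(u^T *m A *m v) 0 0| <= n1 A * (n1 u * n1 v).
  rewrite (le_trans (n1_entry _ _ _))// (le_trans (n1M _ _))//.
  rewrite mulrA ler_wpM2r ?n1_ge0// (le_trans (n1M _ _))// n1T mulrC//.
have -> : qform A (x - r) - qform A x = - (x^T *m A *m r) 0 0 - (r^T *m A *m x) 0 0 + (r^T *m A *m r) 0 0.
  rewrite /qform [(x - r)^T]linearB/= !mulmxBl !mulmxBr.
  have e11 (A1 A2 A3 A4 : 'M[R]_1) : (A1 - A2 - (A3 - A4)) 0 0 = A1 0 0 - A2 0 0 - (A3 0 0 - A4 0 0).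
    by rewrite !mxE.
  by rewrite e11; ring.
rewrite (le_trans (ler_normD _ _))//.
rewrite (_ : _ * _ = n1 A * (n1 x * n1 r) + n1 A * (n1 r * n1 x) + n1 A * (n1 r * n1 r)); last by ring.
by rewrite lerD// (le_trans (ler_normB _ _))// normrN lerD.
Qed.

End HalfVectorNorms.

Section MinimumContrast.
Variables (R : realType) (p1 p2 k1 k2 q : nat) (M : sem p1 p2 k1 k2 (R + 'I_q)).
Variables (Theta : set 'cV[R]_q) (t0 : 'cV[R]_q).
Hypothesis cTheta : compact Theta.
Hypothesis admTheta : forall t, Theta t -> sem_admissible (sem_at M t).
Hypothesis t0_int : interior Theta t0.
Hypothesis ident : forall t1 t2, Theta t1 -> Theta t2 -> Sigma M t1 = Sigma M t2 -> t1 = t2.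

Let p := (p1 + p2)%N.
Let S0 : 'M[R]_p := Sigma M t0.
Let Delta := jacobian_mx (fun t => vech (Sigma M t)) t0.
Hypothesis rDelta : \rank Delta = q.

Let Tt0 : Theta t0 := t0_in t0_int.
Let pS0 : pdmx S0 := Sigma_pd admTheta Tt0.
Let Wi := Winv S0.
Let G := gainmx S0 Delta.

(** [f1] and [f2] stand for the contrast at a minimizer and at the linear candidate G x. The exact
    quadratic forms differ by the form of [infomx] at u - G x, so f1 <= f2 leaves room only for the
    approximation errors. *)
Lemma gain_algebra (e : R) : 0 < e -> exists2 e1 : R, 0 < e1 &
  forall (x : 'cV[R]_(pbar p)) (u : 'cV[R]_q) (f1 f2 : R), f1 <= f2 ->
    `|f1 - qform Wi (x - Delta *m u)| <= e1 * (n1 x ^+ 2 + n1 u ^+ 2) ->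
    `|f2 - qform Wi (x - Delta *m (G *m x))| <= e1 * (n1 x ^+ 2 + n1 (G *m x) ^+ 2) ->
    n1 (u - G *m x) <= e * n1 x.
Proof.
move=> e0; have [c c0 hc] := pdmx_lower (infomx_pd pS0 rDelta).
pose g := n1 G; have g0 : 0 <= g := n1_ge0 _.
(* With V and X the squared norms of u - G x and x, the estimate below reads c V <= e1 (2 X + 2 V +
   3 g^2 X). The condition e1 <= c / 4 absorbs V, and e1 a <= c e^2 bounds the rest. *)
pose a := 2 * (2 + 3 * g ^+ 2).
have a0 : 0 < a by rewrite mulr_gt0// ltr_wpDr// mulr_ge0// sqr_ge0.
pose e1 := Num.min (c / 4) (c * e ^+ 2 / a).
have e10 : 0 < e1 by rewrite lt_min !divr_gt0// mulr_gt0// exprn_gt0.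
have e1c : e1 <= c / 4 by rewrite ge_min lexx.
have e1a : e1 * a <= c * e ^+ 2 by rewrite -ler_pdivlMr// ge_min lexx orbT.
exists e1 => // x u f1 f2 f12 h1 h2.
have := gainmx_pythagoras pS0 rDelta x u; rewrite -/Wi -/G => pyth.
have := hc (u - G *m x); move: pyth h1 h2.
set v := u - G *m x; set Q1 := qform _ (x - Delta *m u); set Q2 := qform _ (x - _); set Q3 := qform _ v.
move=> pyth h1 h2 h3.
have hG : n1 (G *m x) <= g * n1 x := n1M _ _.
have hu : n1 u <= n1 v + g * n1 x.
  by rewrite -[u](subrK (G *m x)) (le_trans (n1D _ _))// lerD2l.
have X0 := n1_ge0 x; have V0 := n1_ge0 v; have U0 := n1_ge0 u; have GX0 := n1_ge0 (G *m x).
have hG2 : n1 (G *m x) ^+ 2 <= g ^+ 2 * n1 x ^+ 2.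
  by rewrite -exprMn lerXn2r ?nnegrE// mulr_ge0.
have hu2 : n1 u ^+ 2 <= 2 * n1 v ^+ 2 + 2 * (g ^+ 2 * n1 x ^+ 2).
  apply: (@le_trans _ _ ((n1 v + g * n1 x) ^+ 2)).
    by rewrite lerXn2r ?nnegrE// addr_ge0// mulr_ge0.
  by have := sqr_ge0 (n1 v - g * n1 x); move: (n1 v) (n1 x) => V X; nra.
have Q3le : Q3 <= e1 * (2 * n1 x ^+ 2 + n1 u ^+ 2 + n1 (G *m x) ^+ 2).
  by move: h1 h2; rewrite !ler_norml => /andP[? ?] /andP[? ?]; lra.
have key : c * n1 v ^+ 2 <= e1 * (2 * n1 x ^+ 2 + (2 * n1 v ^+ 2 + 2 * (g ^+ 2 * n1 x ^+ 2)) + g ^+ 2 * n1 x ^+ 2).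
  by rewrite (le_trans h3)// (le_trans Q3le)// ler_wpM2l ?(ltW e10)// lerD// lerD2l.
have e1v : e1 * (2 * n1 v ^+ 2) <= c / 4 * (2 * n1 v ^+ 2) by rewrite ler_wpM2r// mulr_ge0// sqr_ge0.
have e1x : e1 * a * n1 x ^+ 2 <= c * e ^+ 2 * n1 x ^+ 2 by rewrite ler_wpM2r// sqr_ge0.
have : c * n1 v ^+ 2 <= c * (e * n1 x) ^+ 2.
  rewrite exprMn; move: key e1v e1x; rewrite /a; move: (n1 v ^+ 2) (n1 x ^+ 2) (g ^+ 2) (e ^+ 2) => V X GG E.
  by lra.
by rewrite ler_pM2l// ler_sqr// nnegrE mulr_ge0// ltW.
Qed.

(** [contrast_quad] is applied at Q - Sigma(t0 + v), whose half-vectorization is x - Delta v - rho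
    with [rho] the error of linearizing Sigma. Dropping [rho] changes the form by a small multiple
    of the same squares. *)
Lemma contrast_local_quad (e : R) : 0 < e -> exists2 del : R, 0 < del &
  forall (Q : 'M[R]_p) (v : 'cV[R]_q), Q^T = Q -> Theta (t0 + v) -> n1 (Q - S0) <= del -> n1 v <= del ->
    0 < \det Q /\
    `|contrast Q (Sigma M (t0 + v)) - qform Wi (vech (Q - S0) - Delta *m v)|
      <= e * (n1 (vech (Q - S0)) ^+ 2 + n1 v ^+ 2).
Proof.
move=> e0.
pose kD := n1 (dupmx R p); have kD0 : 0 <= kD := n1_ge0 _.
pose dl := n1 Delta + 1; have dl1 : 1 <= dl by rewrite lerDr n1_ge0.
have dl0 : 0 < dl by exact: lt_le_trans dl1.
pose w := n1 Wi; have w0 : 0 <= w := n1_ge0 _.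
(* Half of [e] goes to each error: [e2] pays for the expansion of the contrast, where the squared
   norm of Q - S is at most 2 kD^2 dl^2 times the sum of squares, and [e3] pays for the
   linearization of Sigma. *)
pose e2 := e / (4 * (kD ^+ 2 * dl ^+ 2 + 1)).
have b0 : 0 < kD ^+ 2 * dl ^+ 2 + 1 by rewrite ltr_wpDl// mulr_ge0// sqr_ge0.
have e20 : 0 < e2 by rewrite divr_gt0// mulr_gt0.
pose e3 := Num.min 1 (e / (8 * (w * dl + 1))).
have wd0 : 0 < w * dl + 1 by rewrite ltr_wpDl// mulr_ge0// ltW.
have e30 : 0 < e3 by rewrite lt_min ltr01 divr_gt0// mulr_gt0.
have e31 : e3 <= 1 by rewrite ge_min lexx.
have e32 : e3 * (8 * (w * dl + 1)) <= e by rewrite -ler_pdivlMr ?mulr_gt0// ge_min lexx orbT.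
have [d1 d10 hquad] := contrast_quad pS0 e20.
have [d2 d20 hexp] := Sigma_expand admTheta t0_int e30.
pose del := Num.min (Num.min d1 d2) (d1 / (kD * dl + 1)).
have kd0 : 0 < kD * dl + 1 by rewrite ltr_wpDl// mulr_ge0// ltW.
exists del => [|Q v sQ Tv]; first by rewrite !lt_min d10 d20 divr_gt0.
rewrite !le_min => /andP[/andP[hQ1 _] _] /andP[/andP[_ hv2] hv3].
pose S := Sigma M (t0 + v); have pS : pdmx S by exact: (Sigma_pd admTheta Tv).
have sS := pS.1; have sS0 := pS0.1.
pose x := vech (Q - S0); pose y := x - Delta *m v.
pose rho := vech S - vech S0 - Delta *m v.
have hrho : n1 rho <= e3 * n1 v by exact: hexp.
have X0 := n1_ge0 x; have V0 := n1_ge0 v; have rho0 := n1_ge0 rho.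
have hDv : n1 (Delta *m v) <= n1 Delta * n1 v := n1M _ _.
have rhov : n1 rho <= n1 v by rewrite (le_trans hrho)// ler_piMl.
have hy : n1 y <= n1 x + dl * n1 v.
  by rewrite (le_trans (n1B _ _))// lerD2l (le_trans hDv)// ler_wpM2r// /dl lerDl.
have yr : vech (Q - S) = y - rho.
  by rewrite /y /x /rho !vechB; move: (vech Q) (vech S0) (vech S) (Delta *m v) => a b c d0; rewrite opprB opprB addrA; apply/colP => i; rewrite !mxE; ring.
have hyr : n1 (y - rho) <= n1 x + dl * n1 v.
  have -> : y - rho = x - (Delta *m v + rho) by exact: subr_sub_assoc.
  rewrite (le_trans (n1B _ _))// lerD2l (le_trans (n1D _ _))// /dl mulrDl mul1r lerD//.
have sQS : (Q - S)^T = Q - S by rewrite linearB/= sQ sS.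
have hQS : n1 (Q - S) <= kD * (n1 x + dl * n1 v).
  by rewrite (le_trans (n1_sym_le sQS))// -/kD yr ler_wpM2l.
have hS : n1 (S - S0) <= d1.
  have sSS : (S - S0)^T = S - S0 by rewrite linearB/= sS sS0.
  have : n1 (vech (S - S0)) <= dl * n1 v.
    have -> : vech (S - S0) = rho + Delta *m v by rewrite vechB /rho subrK.
    by rewrite (le_trans (n1D _ _))// /dl mulrDl mul1r addrC lerD.
  move=> h; rewrite (le_trans (n1_sym_le sSS))// -/kD.
  apply: (@le_trans _ _ (kD * (dl * n1 v))); first by rewrite ler_wpM2l.
  rewrite mulrA (@le_trans _ _ ((kD * dl + 1) * n1 v))//; first by rewrite ler_wpM2r// lerDl.
  by rewrite mulrC -ler_pdivlMr.
have [detQ hq] := hquad Q S sQ pS hQ1 hS.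
split=> //; rewrite -/S -/x -/y.
have -> : contrast Q S - qform Wi y =
   (contrast Q S - \tr (invmx S0 *m (Q - S) *m (invmx S0 *m (Q - S))) / 2) + (qform Wi (y - rho) - qform Wi y).
  have -> : qform Wi (y - rho) = \tr (invmx S0 *m (Q - S) *m (invmx S0 *m (Q - S))) / 2.
    by rewrite -yr /Wi (qform_Winv pS0) symx_vech.
  by rewrite [RHS]addrA subrK.
have hxv : (n1 x + dl * n1 v) ^+ 2 <= 2 * dl ^+ 2 * (n1 x ^+ 2 + n1 v ^+ 2).
  have h1 := sqr_ge0 (n1 x - dl * n1 v).
  have h2 : n1 x ^+ 2 <= dl ^+ 2 * n1 x ^+ 2 by rewrite ler_peMl ?sqr_ge0// expr_ge1// ltW.
  by move: (n1 x) (n1 v) h1 h2 => X V; nra.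
rewrite (le_trans (ler_normD _ _))// [leRHS](_ : _ = e / 2 * (n1 x ^+ 2 + n1 v ^+ 2) + e / 2 * (n1 x ^+ 2 + n1 v ^+ 2)); last by field.
apply: lerD.
  apply: (le_trans hq); apply: (@le_trans _ _ (e2 * (kD ^+ 2 * (2 * dl ^+ 2 * (n1 x ^+ 2 + n1 v ^+ 2))))).
    rewrite ler_wpM2l ?(ltW e20)//.
    apply: (@le_trans _ _ ((kD * (n1 x + dl * n1 v)) ^+ 2)).
      by rewrite lerXn2r ?nnegrE ?n1_ge0// mulr_ge0// addr_ge0// mulr_ge0// ltW.
    by rewrite exprMn ler_wpM2l ?sqr_ge0.
  have z0 : 0 <= n1 x ^+ 2 + n1 v ^+ 2 by rewrite addr_ge0// sqr_ge0.
  rewrite (_ : e2 * _ = e2 * (2 * (kD ^+ 2 * dl ^+ 2)) * (n1 x ^+ 2 + n1 v ^+ 2)); last by ring.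
  rewrite ler_wpM2r// /e2 mulrAC ler_pdivrMr ?mulr_gt0//.
  rewrite (_ : e / 2 * _ = e * (2 * (kD ^+ 2 * dl ^+ 2 + 1))); last by field.
  by rewrite ler_wpM2l ?(ltW e0)// ler_wpM2l// lerDl.
apply: (le_trans (qformB_le _ _ _)); rewrite -/w.
apply: (@le_trans _ _ (w * (2 * (n1 x + dl * n1 v) * (e3 * n1 v) + n1 v * (e3 * n1 v)))).
  rewrite ler_wpM2l// lerD//.
    by rewrite ler_pM// ?mulr_ge0 ?n1_ge0// ler_wpM2l.
  by rewrite expr2 ler_pM.
have hb : 2 * (n1 x + dl * n1 v) * n1 v + n1 v * n1 v <= 4 * dl * (n1 x ^+ 2 + n1 v ^+ 2).
  have h1 := sqr_ge0 (n1 x - n1 v).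
  have h2 : n1 x ^+ 2 <= dl * n1 x ^+ 2 by rewrite ler_peMl ?sqr_ge0.
  have h3 : n1 v ^+ 2 <= dl * n1 v ^+ 2 by rewrite ler_peMl ?sqr_ge0.
  by move: (n1 x) (n1 v) h1 h2 h3 => X V; nra.
have -> : w * (2 * (n1 x + dl * n1 v) * (e3 * n1 v) + n1 v * (e3 * n1 v)) =
   e3 * w * (2 * (n1 x + dl * n1 v) * n1 v + n1 v * n1 v) by ring.
apply: (@le_trans _ _ (e3 * w * (4 * dl * (n1 x ^+ 2 + n1 v ^+ 2)))).
  by rewrite ler_wpM2l// mulr_ge0// ltW.
rewrite mulrA ler_wpM2r ?addr_ge0 ?sqr_ge0//.
move: e32; have : 0 <= e3 by exact: ltW.
nra.
Qed.

Definition minimizer (Q : 'M[R]_p) (t : 'cV[R]_q) :=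
  Theta t /\ contrast_n Q (Sigma M t) = inf [set contrast_n Q (Sigma M u) | u in Theta].

(** A positive determinant selects the likelihood branch of [contrast_n]. The infimum is a genuine
    lower bound because the contrast is nonnegative. *)
Lemma minimizer_le Q t u : psdmx Q -> 0 < \det Q -> minimizer Q t -> Theta u ->
  contrast Q (Sigma M t) <= contrast Q (Sigma M u).
Proof.
move=> pQ dQ [Tt mt] Tu.
have Qu : Q \in unitmx by rewrite unitmxE unitfE gt_eqF.
have cE s : contrast_n Q (Sigma M s) = contrast Q (Sigma M s) by rewrite /contrast_n Qu.
rewrite -!cE mt; apply: ge_inf; last by exists u.
exists 0 => _ [s Ts <-]; rewrite cE; apply: contrast_ge0; last exact: (Sigma_pd admTheta Ts).
exact: psdmx_unit_pd.
Qed.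

(** A chain of closeness: [Q] near [S0] makes the contrast small at [t0], hence at the minimizer; a
    small contrast puts Sigma(t) near [Q], and identifiability puts [t] near [t0]. *)
Lemma minimizer_consistent (e : R) : 0 < e -> exists2 del : R, 0 < del &
  forall Q t, psdmx Q -> minimizer Q t -> n1 (Q - S0) <= del -> n1 (t - t0) < e.
Proof.
move=> e0; have [d1 d10 hid] := Sigma_identify cTheta admTheta t0_int ident e0.
have [K K0 hK] := Sigma_bounded cTheta admTheta.
have d14 : 0 < d1 / 4 by rewrite divr_gt0.
have [eta eta0 hsm] := contrast_small p K0 d14.
have [d2 d20 hq] := contrast_local_quad ltr01.
pose k := n1 (mpinv (dupmx R p)); have k0 : 0 <= k := n1_ge0 _.
pose c := (n1 Wi + 1) * k ^+ 2 + 1.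
have c0 : 0 < c by rewrite ltr_wpDl// mulr_ge0 ?sqr_ge0// addr_ge0// n1_ge0.
pose del := Num.min (Num.min 1 d2) (Num.min (d1 / 4) (eta / c)).
exists del => [|Q t pQ mt]; first by rewrite !lt_min ltr01 d20 d14 divr_gt0.
rewrite !le_min => /andP[/andP[hQ1 hQ2] /andP[hQ3 hQ4]].
have T0 : Theta (t0 + 0) by rewrite addr0.
have [|detQ] := hq Q 0 pQ.1 T0 hQ2; first by rewrite n1_0 ltW.
rewrite addr0 mulmx0 subr0 n1_0 expr0n addr0 mul1r => hF.
have Qu : Q \in unitmx by rewrite unitmxE unitfE gt_eqF.
have pdQ := psdmx_unit_pd pQ Qu.
have x1 : n1 (vech (Q - S0)) <= k * n1 (Q - S0).
  by apply: n1_vech_le; rewrite linearB/= pQ.1 pS0.1.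
have Q0 := n1_ge0 (Q - S0).
have x2 : n1 (vech (Q - S0)) ^+ 2 <= k ^+ 2 * n1 (Q - S0).
  apply: (@le_trans _ _ ((k * n1 (Q - S0)) ^+ 2)).
    by rewrite lerXn2r ?nnegrE ?n1_ge0// mulr_ge0.
  by rewrite exprMn ler_wpM2l ?sqr_ge0// expr2 ler_piMr.
have qb : qform Wi (vech (Q - S0)) <= n1 Wi * n1 (vech (Q - S0)) ^+ 2.
  rewrite (le_trans (ler_norm _))// (le_trans (n1_entry _ _ _))// (le_trans (n1M _ _))//.
  by rewrite expr2 mulrA ler_wpM2r ?n1_ge0// (le_trans (n1M _ _))// n1T mulrC.
have hF2 : contrast Q S0 <= eta.
  have : contrast Q S0 <= (n1 Wi + 1) * n1 (vech (Q - S0)) ^+ 2.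
    by move: hF; rewrite ler_norml => /andP[]; rewrite -/S0; lra.
  move=> /le_trans; apply.
  apply: (@le_trans _ _ ((n1 Wi + 1) * (k ^+ 2 * n1 (Q - S0)))).
    by rewrite ler_wpM2l// addr_ge0// n1_ge0.
  rewrite mulrA (@le_trans _ _ (c * n1 (Q - S0)))//; first by rewrite ler_wpM2r// /c lerDl.
  by rewrite mulrC -ler_pdivlMr.
have hF3 := minimizer_le pQ detQ mt Tt0.
have [Tt _] := mt.
have := hsm Q (Sigma M t) pdQ (Sigma_pd admTheta Tt) (hK t Tt) (le_trans hF3 hF2).
move=> h; apply: hid => //.
have -> : Sigma M t - Sigma M t0 = (Q - S0) - (Q - Sigma M t) by rewrite opprB [RHS]addrC addrA subrK.
by rewrite (le_lt_trans (n1B _ _))// (le_lt_trans (lerD hQ3 h))//; lra.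
Qed.

(** The minimizer is compared with t0 + G x, a competitor in [Theta] because [t0] is interior and x
    is small. *)
Lemma minimizer_linear (e : R) : 0 < e -> exists2 del : R, 0 < del &
  forall Q t, psdmx Q -> minimizer Q t -> n1 (Q - S0) <= del ->
    n1 (t - t0 - G *m vech (Q - S0)) <= e * n1 (vech (Q - S0)).
Proof.
move=> e0; have [e1 e10 hg] := gain_algebra e0.
have [d1 d10 hq] := contrast_local_quad e10.
have [d2 d20 hc] := minimizer_consistent d10.
have [d3 d30 hT] := Sigma_local t0_int.
pose k := n1 (mpinv (dupmx R p)); have k0 : 0 <= k := n1_ge0 _.
pose g := n1 G * k + 1; have g0 : 0 < g by rewrite ltr_wpDl// mulr_ge0// n1_ge0.
pose del := Num.min (Num.min d1 d2) (Num.min (d1 / g) (d3 / g)).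
exists del => [|Q t pQ mt]; first by rewrite !lt_min d10 d20 !divr_gt0.
rewrite !le_min => /andP[/andP[hQ1 hQ2] /andP[hQ3 hQ4]].
have ht := hc Q t pQ mt hQ2.
have [Tt _] := mt.
pose x := vech (Q - S0); pose u := t - t0.
have x1 : n1 x <= k * n1 (Q - S0).
  by apply: n1_vech_le; rewrite linearB/= pQ.1 pS0.1.
have Q0 := n1_ge0 (Q - S0).
have gx : n1 (G *m x) <= g * n1 (Q - S0).
  rewrite (le_trans (n1M _ _))// (@le_trans _ _ (n1 G * (k * n1 (Q - S0))))//.
    by rewrite ler_wpM2l ?n1_ge0.
  by rewrite mulrA ler_wpM2r// /g lerDl.
have gx1 : n1 (G *m x) <= d1 by rewrite (le_trans gx)// mulrC -ler_pdivlMr.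
have gx3 : n1 (G *m x) <= d3 by rewrite (le_trans gx)// mulrC -ler_pdivlMr.
have Tgx := hT _ gx3.
have tE : t0 + u = t by rewrite /u addrC subrK.
have Tu : Theta (t0 + u) by rewrite tE.
have [detQ h1] := hq Q u pQ.1 Tu hQ1 (ltW ht).
have [_ h2] := hq Q (G *m x) pQ.1 Tgx hQ1 gx1.
apply: (hg x u _ _ _ h1 h2); rewrite tE.
exact: minimizer_le.
Qed.

End MinimumContrast.

Section VanishingComparison.
Context (R : realType) d (Omega : measurableType d) (P : probability Omega R).

Lemma prob_vanish_le (Y Z : nat -> Omega -> R) :
  (forall n, measurable_fun setT (Y n)) -> (forall n, measurable_fun setT (Z n)) ->
  (forall n w, `|Y n w| <= `|Z n w|) -> prob_vanish P Z -> prob_vanish P Y.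
Proof.
move=> mY mZ YZ vZ e eta e0 eta0; have := vZ e eta e0 eta0; apply: filterS => n.
apply: le_trans; apply: prob_fine_le; try exact: measurable_norm_gt.
by move=> w /= /lt_le_trans; apply.
Qed.

Lemma prob_tight_le (Y Z : nat -> Omega -> R) :
  (forall n, measurable_fun setT (Y n)) -> (forall n, measurable_fun setT (Z n)) ->
  (forall n w, `|Y n w| <= `|Z n w|) -> prob_tight P Z -> prob_tight P Y.
Proof.
move=> mY mZ YZ tZ eta eta0; have [K hK] := tZ eta eta0; exists K; move: hK; apply: filterS => n.
apply: le_trans; apply: prob_fine_le; try exact: measurable_norm_gt.
by move=> w /= /lt_le_trans; apply.
Qed.

Lemma prob_tightZ c (Y : nat -> Omega -> R) : (forall n, measurable_fun setT (Y n)) ->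
  prob_tight P Y -> prob_tight P (fun n w => c * Y n w).
Proof.
move=> mY tY eta eta0; have [K hK] := tY eta eta0; exists (`|c| * `|K|); move: hK; apply: filterS => n.
apply: le_trans; apply: prob_fine_le; try exact: measurable_norm_gt.
  by apply: measurable_norm_gt; exact: measurable_funM.
move=> w /=; rewrite normrM => h; rewrite ltNge; apply/negP => h2.
by move: h; rewrite ltNge ler_wpM2l// (le_trans h2)// ler_norm.
Qed.

Lemma prob_tight_root_vanish (Y : nat -> Omega -> R) : (forall n, measurable_fun setT (Y n)) ->
  prob_tight P (fun n w => Num.sqrt n%:R * Y n w) -> prob_vanish P Y.
Proof.
move=> mY tY e eta e0 eta0; have [K hK] := tY eta eta0.
have [n0 hn0] : exists n0 : nat, (`|K| / e) ^+ 2 < n0%:R.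
  by exists (Num.bound ((`|K| / e) ^+ 2)); apply: archi_boundP; exact: sqr_ge0.
have hn : \forall n \near \oo, (n0 <= n)%N by exists n0.
apply: filterS2 hK hn => n hKn hn.
apply: le_trans hKn; apply: prob_fine_le; try exact: measurable_norm_gt.
  by apply: measurable_norm_gt; exact: measurable_funM.
move=> w /= hw; rewrite normrM [`|Num.sqrt _|]ger0_norm ?sqrtr_ge0//.
apply: (le_lt_trans (ler_norm K)); apply: (@le_lt_trans _ _ (Num.sqrt n%:R * e)).
  rewrite -ler_pdivrMr// -[`|K| / e]ger0_norm ?divr_ge0 ?(ltW e0)// -sqrtr_sqr.
  by rewrite ler_wsqrtr// (le_trans (ltW hn0))// ler_nat.
rewrite ltr_pM2l// sqrtr_gt0 (lt_le_trans _ (_ : n0%:R <= n%:R))// ?ler_nat//.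
by rewrite (le_lt_trans _ hn0)// sqr_ge0.
Qed.

Lemma measurable_n1 m n (A : Omega -> 'M[R]_(m, n)) :
  (forall i j, measurable_fun setT (fun w => A w i j)) -> measurable_fun setT (fun w => n1 (A w)).
Proof.
move=> mA; apply: measurable_sum => i; apply: measurable_sum => j.
exact: (measurableT_comp (@normr_measurable R setT) (mA i j)).
Qed.

Lemma probability_cV_tight k (mu : probability (borel_cV R k) R) (e : R) : 0 < e ->
  exists K0 : R, forall K, K0 <= K -> fine (mu [set x : 'cV[R]_k | K < `|x|]) <= e.
Proof.
move=> e0; pose E (n : nat) := [set x : borel_cV R k | n%:R < `|x : 'cV[R]_k|].
have mN (K : R) : measurable [set x : borel_cV R k | K < `|x : 'cV[R]_k|].
  by apply: (measurable_normr_gt (X := fun x : borel_cV R k => x)); exact: measurable_id.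
have [] := @prob_vanish_ae _ _ _ mu E (fun n => mN n%:R) _ e e0.
  apply: aeW => x /=; exists (Num.bound `|x : 'cV[R]_k|) => n hn; apply/negP; rewrite -leNgt.
  by rewrite (le_trans (ltW (archi_boundP _)))// ler_nat.
move=> n0 _ h; exists n0%:R => K hK; apply: (le_trans _ (h n0 (leqnn _))).
by apply: (prob_fine_le mu (mN K) (mN n0%:R)) => x /=; apply: le_lt_trans.
Qed.

End VanishingComparison.

Lemma enorm_le_n1 (R : realType) k (x : 'cV[R]_k) : enorm x <= n1 x.
Proof.
rewrite /enorm -[n1 x]ger0_norm ?n1_ge0// -sqrtr_sqr ler_wsqrtr//.
apply: le_trans (trace_mulT_le x); rewrite trace_mulT.
by apply: ler_sum => i _; rewrite big_ord1.
Qed.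

(** * Consistency and limit law of the estimator *)

Section MinimumContrastAsymptotics.
Context (R : realType) d (Omega : measurableType d) (P : probability Omega R).
Variables (T : R) (r0 : nat) (W0 : R -> Omega -> 'cV[R]_r0).
Hypotheses (HW0 : wiener P T W0) (T0 : 0 < T) (r0_gt0 : (0 < r0)%N).
Variables (p1 p2 k1 k2 q : nat) (M : sem p1 p2 k1 k2 (R + 'I_q)).
Variables (Theta : set 'cV[R]_q) (t0 : 'cV[R]_q).
Hypothesis cTheta : compact Theta.
Hypothesis admTheta : forall t, Theta t -> sem_admissible (sem_at M t).
Hypothesis t0_int : interior Theta t0.
Hypothesis ident : forall t1 t2, Theta t1 -> Theta t2 -> Sigma M t1 = Sigma M t2 -> t1 = t2.

Let p := (p1 + p2)%N.
Let S0 : 'M[R]_p := Sigma M t0.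
Let Delta := jacobian_mx (fun t => vech (Sigma M t)) t0.
Hypothesis rDelta : \rank Delta = q.

Variable Q : nat -> Omega -> 'M[R]_p.
Hypothesis pQ : forall n w, psdmx (Q n w).
Hypothesis mQ : forall n i j, measurable_fun setT (fun w => Q n w i j).
Hypothesis cosQ : forall (B : 'M[R]_p) c, B^T = B ->
  \int[P]_w cos (Num.sqrt n%:R * \tr (B *m (Q n w - S0)) + c) @[n --> \oo] -->
    cos c * expR (- \tr (B *m S0 *m (B *m S0))).
Hypothesis tightQ : forall B : 'M[R]_p, B^T = B ->
  prob_tight P (fun n w => Num.sqrt n%:R * \tr (B *m (Q n w - S0))).

Variable th : nat -> Omega -> 'cV[R]_q.
Hypothesis mth : forall n, (0 < n)%N -> random_vector (th n).
Hypothesis min_th : forall n w, (0 < n)%N -> minimizer M Theta (Q n w) (th n w).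

Let G := gainmx S0 Delta.
Let pS0 : pdmx S0 := Sigma_pd admTheta (t0_in t0_int).
Let x n w := vech (Q n w - S0).
Let Z n w := Num.sqrt n%:R *: (th n w - t0).
Let rho n w := n1 (Z n w - Num.sqrt n%:R *: (G *m x n w)).

Let sQS n w : (Q n w - S0)^T = Q n w - S0.
Proof. by rewrite linearB/= (pQ n w).1 pS0.1. Qed.

Let mQS n i j : measurable_fun setT (fun w => (Q n w - S0) i j).
Proof.
rewrite (_ : (fun _ => _) = (fun w => Q n w i j - S0 i j)); last by apply/funext => w; rewrite !mxE.
exact: measurable_funB.
Qed.

Let mx n i j : measurable_fun setT (fun w => x n w i j).
Proof.
rewrite (_ : (fun _ => _) = (fun w => (Q n w - S0) (enum_val i).2 (enum_val i).1)) //.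
by apply/funext => w; rewrite /x mxE.
Qed.

Let rx n : random_vector (x n).
Proof. by apply: measurable_cV => i; exact: mx. Qed.

Let mnx n : measurable_fun setT (fun w => n1 (x n w)).
Proof. exact: measurable_n1. Qed.

Let mnQ n : measurable_fun setT (fun w => n1 (Q n w - S0)).
Proof. exact: measurable_n1. Qed.

(* [th 0] need not be measurable, but sqrt 0 = 0 annihilates it. *)
Let rZ n : random_vector (Z n).
Proof.
case: n => [|n].
  rewrite (_ : Z 0%N = fun=> 0); first exact: random_vector_cst.
  by apply/funext => w; rewrite /Z sqrtr0 scale0r.
rewrite (_ : Z n.+1 = fun w => (Num.sqrt n.+1%:R)%:M *m (th n.+1 w - t0)).
  apply: random_vector_mulmx; apply: random_vectorB; first exact: mth.
  exact: random_vector_cst.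
by apply/funext => w; rewrite mul_scalar_mx.
Qed.

Let rGx n : random_vector (fun w => Num.sqrt n%:R *: (G *m x n w)).
Proof.
rewrite (_ : (fun _ => _) = fun w => (Num.sqrt n%:R)%:M *m (G *m x n w)).
  by do 2 apply: random_vector_mulmx.
by apply/funext => w; rewrite mul_scalar_mx.
Qed.

Let mrho n : measurable_fun setT (rho n).
Proof.
apply: measurable_n1 => i j; rewrite ord1.
by have /measurable_cVP := random_vectorB (rZ n) (rGx n).
Qed.

(** Each coordinate of the half-vectorization is a trace against the dual matrix of a basis vector,
    so tightness of traces suffices. *)
Let tight_x : prob_tight P (fun n w => Num.sqrt n%:R * n1 (x n w)).
Proof.
pose D k := dualx (delta_mx k 0 : 'cV[R]_(pbar p)).
have xE n w k : x n w k 0 = \tr (D k *m (Q n w - S0)).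
  by rewrite -(dualx_dot _ (sQS n w)) trmx_delta -rowE [RHS]mxE.
rewrite (_ : (fun _ _ => _) = fun n w => \sum_k `|Num.sqrt n%:R * \tr (D k *m (Q n w - S0))|).
  apply: prob_tight_sum => [k n|k]; last by apply: prob_tight_norm; apply: tightQ; exact: symx_sym.
  apply: (measurableT_comp (@normr_measurable R setT)); apply: measurable_funM => //.
  by under eq_fun do rewrite -xE; exact: mx.
apply/funext => n; apply/funext => w; rewrite /n1 mulr_sumr; apply: eq_bigr => k _.
by rewrite big_ord1 normrM [`|Num.sqrt _|]ger0_norm ?sqrtr_ge0// xE.
Qed.

Let vanish_Q : prob_vanish P (fun n w => n1 (Q n w - S0)).
Proof.
pose c := n1 (dupmx R p).
apply: (prob_vanish_le (Z := fun n w => c * n1 (x n w))) => //.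
- by move=> n; apply: measurable_funM.
- move=> n w; rewrite !ger0_norm ?mulr_ge0 ?n1_ge0//; exact: n1_sym_le.
- by apply: prob_vanishZ; apply: prob_tight_root_vanish => //; exact: tight_x.
Qed.

(** Off two rare events, sqrt n n1(x) is at most [K] and [Q] is within [del] of [S0]; there the
    deterministic expansion bounds [rho] by e1 |K| <= e. *)
Let vanish_rho : prob_vanish P rho.
Proof.
move=> e eta e0 eta0; have eta2 : 0 < eta / 2 by rewrite divr_gt0.
have [K hK] := tight_x eta2.
pose e1 := e / (`|K| + 1); have K1 : 0 < `|K| + 1 by rewrite ltr_wpDl.
have e10 : 0 < e1 by rewrite divr_gt0.
have [del del0 hlin] := minimizer_linear cTheta admTheta t0_int ident rDelta e10.
have hQ := vanish_Q del0 eta2.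
have hn : \forall n \near \oo, (0 < n)%N by exists 1%N.
apply: filterS3 hn hK hQ => n n0 hKn hQn.
have mA : measurable [set w | K < `|Num.sqrt n%:R * n1 (x n w)|].
  by apply: measurable_norm_gt; exact: measurable_funM.
have mB : measurable [set w | del < `|n1 (Q n w - S0)|] by exact: measurable_norm_gt.
rewrite [eta](_ : _ = eta / 2 + eta / 2); last by field.
apply: le_trans (lerD hKn hQn); apply: prob_fine_leU => //; first exact: measurable_norm_gt.
move=> w /= hw; have [h1|h1] := ltP K `|Num.sqrt n%:R * n1 (x n w)|; first by left.
right; rewrite ltNge; apply/negP => h2; move: hw; apply/negP; rewrite -leNgt.
rewrite ger0_norm ?n1_ge0// /rho /Z -scalerBr n1Z [`|Num.sqrt _|]ger0_norm ?sqrtr_ge0//.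
have h3 : n1 (th n w - t0 - G *m x n w) <= e1 * n1 (x n w).
  by apply: hlin => //; [exact: min_th|rewrite -/S0 (le_trans (ler_norm _))].
apply: (@le_trans _ _ (Num.sqrt n%:R * (e1 * n1 (x n w)))); first by rewrite ler_wpM2l ?sqrtr_ge0.
rewrite mulrCA /e1 mulrAC ler_pdivrMr// ler_wpM2l ?(ltW e0)//.
by rewrite (le_trans (ler_norm _))// (le_trans h1)// (le_trans (ler_norm _))// lerDl.
Qed.

Let tight_Z : prob_tight P (fun n w => n1 (Z n w)).
Proof.
apply: (prob_tight_le (Z := fun n w => rho n w + n1 G * (Num.sqrt n%:R * n1 (x n w)))).
- by move=> n; apply: measurable_n1 => i j; rewrite ord1; have /measurable_cVP := rZ n.
- by move=> n; apply: measurable_funD => //; do 2 apply: measurable_funM => //.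
- move=> n w; rewrite !ger0_norm ?addr_ge0 ?mulr_ge0 ?sqrtr_ge0 ?n1_ge0//.
  rewrite -[Z n w](subrK (Num.sqrt n%:R *: (G *m x n w))) (le_trans (n1D _ _))// lerD2l.
  by rewrite n1Z ger0_norm ?sqrtr_ge0// mulrCA ler_wpM2l ?sqrtr_ge0// n1M.
- apply: prob_tightD => //; first by move=> n; do 2 apply: measurable_funM => //.
    exact: (prob_vanish_tight vanish_rho).
  by apply: prob_tightZ; [move=> n; apply: measurable_funM|exact: tight_x].
Qed.

Lemma minimizer_cvg_in_probability : cvg_in_probability P th t0.
Proof.
move=> e e0; have [del del0 hcons] := minimizer_consistent cTheta admTheta t0_int ident e0.
have menorm n : (0 < n)%N -> measurable [set w | e <= enorm (th n w - t0)].
  move=> n0; rewrite (_ : [set w | _] = (fun w => \sum_i (th n w - t0) i 0 ^+ 2) @^-1` `[e ^+ 2, +oo[).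
    rewrite -[X in measurable X]setTI.
    have m : measurable_fun setT (fun w => \sum_i (th n w - t0) i 0 ^+ 2).
      apply: measurable_sum => i; apply: measurable_funX.
      by have /measurable_cVP := random_vectorB (mth n0) (random_vector_cst t0).
    by apply: m => //; exact: measurable_itv.
  apply/seteqP; split => w /=; rewrite in_itv/= andbT => h.
    have s0 : 0 <= \sum_i (th n w - t0) i 0 ^+ 2 by apply: sumr_ge0 => i _; exact: sqr_ge0.
    by rewrite -[leRHS]sqr_sqrtr// lerXn2r ?nnegrE ?sqrtr_ge0// ltW.
  by rewrite /enorm -[e]ger0_norm ?(ltW e0)// -sqrtr_sqr ler_wsqrtr.
apply/fine_cvgP; split.
  exists 1%N => // n n0; rewrite prob_fin//; exact: menorm.
apply/cvgr0Pnorm_le => eta eta0; have := vanish_Q del0 eta0.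
have hn : \forall n \near \oo, (0 < n)%N by exists 1%N.
apply: filterS2 hn => n n0 /=; rewrite ger0_norm ?fine_ge0//.
apply: le_trans; apply: prob_fine_le; [exact: menorm|exact: measurable_norm_gt|].
move=> w /= hw; rewrite ltNge; apply/negP => h.
have := hcons (Q n w) (th n w) (pQ n w) (min_th w n0) (le_trans (ler_norm _) h).
by rewrite ltNge (le_trans hw)// enorm_le_n1.
Qed.

Let V := invmx (infomx S0 Delta).

(** For each [u], the form u^T Z differs by a vanishing term from the trace statistic with matrix
    [dualx (G^T *m u)], whose cosines have a known limit. The Gaussian limit measure is built from a
    Cholesky factor of [V]. *)
Lemma minimizer_cvg_to_normal : cvg_to_normal P Z 0 V.
Proof.
have pV : pdmx V by apply: pdmx_inv; exact: infomx_pd.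
have [L _ VE] := cholesky pV.
have [mu gmu] := gaussian_measure_exists HW0 T0 r0_gt0 L; rewrite -VE in gmu.
exists mu; split=> //; apply: trig_tight_cvg_in_distribution => //.
- move=> u c.
  have v0 : 0 <= (u^T *m V *m u) 0 0 by exact: (pdmx_psd pV).2.
  have muE : \int[mu]_x cos ((u^T *m (x : 'cV[R]_q)) 0 0 + c) = cos c * expR (- ((u^T *m V *m u) 0 0 / 2)).
    apply: (gauss_cos_shift HW0 T0 r0_gt0 c v0).
    by apply: gaussian_vector_gauss_rv gmu; exact: measurable_id.
  rewrite muE.
  pose B := dualx (G^T *m u).
  have BE n w : \tr (B *m (Q n w - S0)) = (u^T *m (G *m x n w)) 0 0.
    by rewrite -(dualx_dot _ (sQS n w)) trmx_mul trmxK -mulmxA.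
  (* [qform_Wmx] equates 2 tr(B S0 B S0) with u^T G W G^T u, and G W G^T = V by [gainmx_cov]. *)
  have vE : \tr (B *m S0 *m (B *m S0)) = (u^T *m V *m u) 0 0 / 2.
    have := qform_Wmx pS0 (G^T *m u); rewrite -/B /qform trmx_mul trmxK => h.
    rewrite (_ : u^T *m V *m u = u^T *m G *m Wmx S0 *m (G^T *m u)) ?h; first by rewrite mulrC mulKf.
    by rewrite /V -(gainmx_cov pS0 rDelta) !mulmxA.
  have hcos := @cosQ B c (symx_sym _); rewrite vE in hcos.
  pose Y n w := (u^T *m (Z n w - Num.sqrt n%:R *: (G *m x n w))) 0 0.
  rewrite (_ : (fun n => _) = fun n => \int[P]_w cos (Num.sqrt n%:R * \tr (B *m (Q n w - S0)) + c + Y n w)); last first.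
    apply/funext => n; apply: eq_Rintegral => w _; congr cos.
    have e11 (A1 A2 : 'M[R]_1) a : (A1 - a *: A2) 0 0 = A1 0 0 - a * A2 0 0 by rewrite !mxE.
    have eu (z y : 'cV[R]_q) a : (u^T *m (z - a *: y)) 0 0 = (u^T *m z) 0 0 - a * (u^T *m y) 0 0.
      by rewrite mulmxBr -scalemxAr; exact: e11.
    by rewrite /Y eu BE [RHS]addrAC subrKC.
  apply: Ecos_slutsky => //.
  + by move=> n; apply: measurable_mulmx_cV; exact: random_vectorB.
  + move=> n; apply: measurable_funD => //; apply: measurable_funM => //.
    by under eq_fun do rewrite BE; apply: measurable_mulmx_cV; exact: random_vector_mulmx.
  + apply: (prob_vanish_le (Z := fun n w => n1 u * rho n w)).
    * by move=> n; apply: measurable_mulmx_cV; exact: random_vectorB.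
    * by move=> n; apply: measurable_funM.
    * move=> n w; rewrite [leRHS]ger0_norm ?mulr_ge0 ?n1_ge0// (le_trans (n1_entry _ _ _))//.
      by rewrite (le_trans (n1M _ _))// n1T.
    * exact: prob_vanishZ.
- move=> e e0; have [K1 hK1] := tight_Z e0.
  have [K2 hK2] := probability_cV_tight mu e0.
  exists (Num.max 0 (Num.max K1 K2)); split; last by apply: hK2; rewrite !le_max lexx !orbT.
  apply: filterS hK1 => n; apply: le_trans; apply: prob_fine_le.
  + exact: measurable_normr_gt.
  + by apply: measurable_norm_gt; apply: measurable_n1 => i j; rewrite ord1; have /measurable_cVP := rZ n.
  + move=> w /= /normr_cV_gt [|i]; first by rewrite le_max lexx.
    rewrite !gt_max => /and3P[_ h _]; rewrite ger0_norm ?n1_ge0// (lt_le_trans h)//; exact: n1_entry.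
Qed.

End MinimumContrastAsymptotics.

Lemma drift_path_mulmx (R : realType) (T : R) k l (A : 'M[R]_(l, k)) (v : R -> 'cV[R]_k) :
  (forall i, drift_path T (fun t => v t i 0)) -> forall a, drift_path T (fun t => (A *m v t) a 0).
Proof.
move=> hv a; apply: (@drift_path_eq _ T (fun t => \sum_i A a i * v t i 0)) => [t _|].
  by rewrite mxE.
by apply: drift_path_sum => i; exact: drift_pathZ.
Qed.

Lemma random_vectorD (R : realType) d (Omega : measurableType d) k (Y Z : Omega -> 'cV[R]_k) :
  random_vector Y -> random_vector Z -> random_vector (fun w => Y w + Z w).
Proof.
move=> /measurable_cVP mY /measurable_cVP mZ; apply: measurable_cV => i.
by under eq_fun do rewrite mxE; apply: measurable_funD; [exact: mY|exact: mZ].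
Qed.

Lemma quad_var_psd (R : realType) (Omega : Type) p (T : R) (X : R -> Omega -> 'cV[R]_p) n w :
  0 < T -> psdmx (quad_var T X n w).
Proof.
move=> T0; apply: psdmxZ; first by rewrite invr_ge0 ltW.
by elim/big_rec: _ => [|i A _ pA]; [exact: psdmx0|apply: psdmxD => //; exact: psdmx_gram].
Qed.

(** Solving the structural equation for [et] makes the observation linear in the four latent
    processes. *)
Lemma observed_latent (R : realType) (p1 p2 k1 k2 : nat) (L1 : 'M[R]_(p1, k1)) (L2 : 'M[R]_(p2, k2))
    (G : 'M[R]_(k2, k1)) (B : 'M[R]_k2) (xi : 'cV[R]_k1) (de : 'cV[R]_p1) (et ze : 'cV[R]_k2) (ep : 'cV[R]_p2) :
  1%:M - B \in unitmx -> et = B *m et + G *m xi + ze ->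
  col_mx (L1 *m xi + de) (L2 *m et + ep) =
  col_mx L1 (L2 *m invmx (1%:M - B) *m G) *m xi + col_mx 1%:M 0 *m de + col_mx 0 1%:M *m ep
  + col_mx 0 (L2 *m invmx (1%:M - B)) *m ze.
Proof.
move=> uB eE; have -> : et = invmx (1%:M - B) *m (G *m xi + ze).
  apply: (canRL (mulKmx uB)); rewrite mulmxBl mul1mx [X in X - _]eE; move: (B *m et) => b.
  by rewrite -(addrA b) [LHS]addrC addKr.
rewrite !mul_col_mx !mul0mx !mul1mx !add_col_mx !addr0; congr col_mx.
by rewrite mulmxDr mulmxDr !mulmxA addrAC.
Qed.

Theorem theorem2 (R : realType) (d : measure_display) (Omega : measurableType d)
    (P : probability Omega R)
    (p1 p2 k1 k2 r1 r2 r3 r4 q : nat)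
    (p1_gt0 : (0 < p1)%N) (p2_gt0 : (0 < p2)%N)
    (k1_gt0 : (0 < k1)%N) (k2_gt0 : (0 < k2)%N)
    (r1_gt0 : (0 < r1)%N) (r2_gt0 : (0 < r2)%N)
    (r3_gt0 : (0 < r3)%N) (r4_gt0 : (0 < r4)%N)
    (k1_le_p1 : (k1 <= p1)%N) (k2_le_p2 : (k2 <= p2)%N)
    (T : R) (T_gt0 : 0 < T)
    (* driving noise *)
    (W1 : R -> Omega -> 'cV[R]_r1) (W2 : R -> Omega -> 'cV[R]_r2)
    (W3 : R -> Omega -> 'cV[R]_r3) (W4 : R -> Omega -> 'cV[R]_r4)
    (W1_wiener : wiener P T W1) (W2_wiener : wiener P T W2)
    (W3_wiener : wiener P T W3) (W4_wiener : wiener P T W4)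
    (W_indep : mutually_independent P
       (tnth [tuple sigma_proc T W1; sigma_proc T W2;
                    sigma_proc T W3; sigma_proc T W4]))
    (* latent processes *)
    (B1 : 'cV[R]_k1 -> 'cV[R]_k1) (B2 : 'cV[R]_p1 -> 'cV[R]_p1)
    (B3 : 'cV[R]_p2 -> 'cV[R]_p2) (B4 : 'cV[R]_k2 -> 'cV[R]_k2)
    (S10 : 'M[R]_(k1, r1)) (S20 : 'M[R]_(p1, r2))
    (S30 : 'M[R]_(p2, r3)) (S40 : 'M[R]_(k2, r4))
    (c1 : 'cV[R]_k1) (c2 : 'cV[R]_p1) (c3 : 'cV[R]_p2) (c4 : 'cV[R]_k2)
    (xi0 : R -> Omega -> 'cV[R]_k1) (delta0 : R -> Omega -> 'cV[R]_p1)
    (eps0 : R -> Omega -> 'cV[R]_p2) (zeta0 : R -> Omega -> 'cV[R]_k2)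
    (xi0_sde : sde_solution P T W1 B1 S10 c1 xi0)
    (delta0_sde : sde_solution P T W2 B2 S20 c2 delta0)
    (eps0_sde : sde_solution P T W3 B3 S30 c3 eps0)
    (zeta0_sde : sde_solution P T W4 B4 S40 c4 zeta0)
    (Sdd0_pd : pdmx (S20 *m S20^T)) (See0_pd : pdmx (S30 *m S30^T))
    (B1_regular : regular_drift B1) (B2_regular : regular_drift B2)
    (B3_regular : regular_drift B3) (B4_regular : regular_drift B4)
    (xi0_moments : bounded_moments P T xi0)
    (delta0_moments : bounded_moments P T delta0)
    (eps0_moments : bounded_moments P T eps0)
    (zeta0_moments : bounded_moments P T zeta0)
    (* true structural equation model *)
    (Lx10 : 'M[R]_(p1, k1)) (Lx20 : 'M[R]_(p2, k2))
    (Gam0 : 'M[R]_(k2, k1)) (B0 : 'M[R]_k2)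
    (Lx10_full : \rank Lx10 = k1)
    (B0_diag : forall i, B0 i i = 0) (Psi0_unit : 1%:M - B0 \in unitmx)
    (eta0 : R -> Omega -> 'cV[R]_k2)
    (eta0_eq : forall t w, 0 <= t <= T ->
       eta0 t w = B0 *m eta0 t w + Gam0 *m xi0 t w + zeta0 t w)
    (* parametric model *)
    (Theta : set 'cV[R]_q)
    (Theta_convex : convex_set (Theta : set (convex_lmodType 'cV[R]_q)))
    (Theta_compact : compact Theta)
    (M : sem p1 p2 k1 k2 (R + 'I_q))
    (M_admissible : forall theta, Theta theta -> sem_admissible (sem_at M theta))
    (theta0 : 'cV[R]_q) (theta0_int : interior Theta theta0)
    (theta0_true : sem_cov (Sem Lx10 Lx20 Gam0 (1%:M - B0)
         (S10 *m S10^T) (S20 *m S20^T) (S30 *m S30^T) (S40 *m S40^T))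
       = Sigma M theta0)
    (identifiable : forall theta1 theta2, Theta theta1 -> Theta theta2 ->
       Sigma M theta1 = Sigma M theta2 -> theta1 = theta2)
    (Delta_rank :
       \rank (jacobian_mx (fun theta => vech (Sigma M theta)) theta0) = q)
    (* minimum contrast estimator *)
    (theta_hat : nat -> Omega -> 'cV[R]_q)
    (theta_hat_meas : forall n, (0 < n)%N -> random_vector (theta_hat n))
    (theta_hat_in : forall n w, (0 < n)%N -> Theta (theta_hat n w))
    (theta_hat_min : forall n w, (0 < n)%N ->
       let Q := quad_var T (observed Lx10 Lx20 xi0 delta0 eta0 eps0) n w in
       contrast_n Q (Sigma M (theta_hat n w)) =
       inf [set contrast_n Q (Sigma M theta) | theta in Theta]) :
  let Delta := jacobian_mx (fun theta => vech (Sigma M theta)) theta0 in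
  cvg_in_probability P theta_hat theta0 /\
  cvg_to_normal P
    (fun n w => Num.sqrt n%:R *: (theta_hat n w - theta0))
    0 (invmx (Delta^T *m invmx (Wmx (Sigma M theta0)) *m Delta)).
Proof.

(* [A1] to [A4] are the loadings of the latent processes once eta is eliminated. Each noise source
   carries its loading times its diffusion matrix. *)
pose iPsi := invmx (1%:M - B0).
pose A1 : 'M[R]_(p1 + p2, k1) := col_mx Lx10 (Lx20 *m iPsi *m Gam0).
pose A2 : 'M[R]_(p1 + p2, p1) := col_mx 1%:M 0.
pose A3 : 'M[R]_(p1 + p2, p2) := col_mx 0 1%:M.
pose A4 : 'M[R]_(p1 + p2, k2) := col_mx 0 (Lx20 *m iPsi).
pose s : 'I_4 -> noise_src R Omega (p1 + p2) := tnth [tuple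
  NoiseSrc W1 (A1 *m S10); NoiseSrc W2 (A2 *m S20); NoiseSrc W3 (A3 *m S30); NoiseSrc W4 (A4 *m S40)].
have sum4 (V : nmodType) (F : noise_src R Omega (p1 + p2) -> V) : \sum_j F (s j) =
    F (NoiseSrc W1 (A1 *m S10)) + F (NoiseSrc W2 (A2 *m S20)) + F (NoiseSrc W3 (A3 *m S30))
    + F (NoiseSrc W4 (A4 *m S40)).
  by rewrite !big_ord_recl big_ord0 addr0 !addrA.
have Hs j : wiener P T (src_W (s j)).
  by case: j => [[|[|[|[|j]]]] hj].
have Hind : mutually_independent P (fun j => sigma_proc T (src_W (s j))).
  rewrite (_ : (fun _ => _) = tnth [tuple sigma_proc T W1; sigma_proc T W2; sigma_proc T W3; sigma_proc T W4]) //.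
  by apply/funext; case=> [[|[|[|[|j]]]] hj].
set X := observed Lx10 Lx20 xi0 delta0 eta0 eps0.
have XE t w : 0 <= t <= T -> X t w = A1 *m xi0 t w + A2 *m delta0 t w + A3 *m eps0 t w + A4 *m zeta0 t w.
  by move=> tT; apply: observed_latent => //; exact: eta0_eq.
have mX t : 0 <= t <= T -> random_vector (X t).
  move=> tT; rewrite (_ : X t = fun w => A1 *m xi0 t w + A2 *m delta0 t w + A3 *m eps0 t w + A4 *m zeta0 t w).
    by do ![apply: random_vectorD]; apply: random_vector_mulmx;
      [exact: (sde_meas xi0_sde)|exact: (sde_meas delta0_sde)|exact: (sde_meas eps0_sde)|exact: (sde_meas zeta0_sde)].
  by apply/funext => w; exact: XE.
have dX : {ae P, forall w, forall a, drift_path T (fun t => (X t w - noise s t w) a 0)}.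
  have h1 := sde_drift_path xi0_sde B1_regular; have h2 := sde_drift_path delta0_sde B2_regular.
  have h3 := sde_drift_path eps0_sde B3_regular; have h4 := sde_drift_path zeta0_sde B4_regular.
  apply: filterS2 (filterI h1 h2) (filterI h3 h4) => w [d1 d2] [d3 d4] a.
  apply: (@drift_path_eq _ T (fun t => (A1 *m (xi0 t w - S10 *m W1 t w)) a 0 + (A2 *m (delta0 t w - S20 *m W2 t w)) a 0
     + (A3 *m (eps0 t w - S30 *m W3 t w)) a 0 + (A4 *m (zeta0 t w - S40 *m W4 t w)) a 0)); last first.
    by do ![apply: drift_pathD]; apply: drift_path_mulmx.
  move=> t tT; rewrite XE// /noise (sum4 _ (fun z => src_A z *m src_W z t w))/= !mulmxBr !mulmxA.
  have e8 (b1 b2 b3 b4 c1' c2' c3' c4' : 'cV[R]_(p1 + p2)) :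
      (b1 + b2 + b3 + b4 - (c1' + c2' + c3' + c4')) a 0 =
      (b1 - c1') a 0 + (b2 - c2') a 0 + (b3 - c3') a 0 + (b4 - c4') a 0.
    by rewrite !mxE; ring.
  by rewrite e8.
(* The loadings of xi and zeta are those of [sem_cov_factor], and the noise of delta and eps fills
   the two diagonal blocks. *)
have covE : noise_cov s = Sigma M theta0.
  rewrite -theta0_true sem_cov_factor/=; last by rewrite trmx_mul trmxK.
  rewrite /noise_cov (sum4 _ (fun z => src_A z *m (src_A z)^T))/= -/iPsi -/A1 -/A4.
  have cg m n (A : 'M[R]_(p1 + p2, m)) (S : 'M[R]_(m, n)) : (A *m S) *m (A *m S)^T = A *m (S *m S^T) *m A^T.
    by rewrite trmx_mul !mulmxA.
  rewrite !cg -!addrA; congr (_ + _); rewrite addrA addrC; congr (_ + _).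
  have A2E n (S : 'M[R]_(p1, n)) : A2 *m S = col_mx S 0 by rewrite mul_col_mx mul1mx mul0mx.
  have A3E n (S : 'M[R]_(p2, n)) : A3 *m S = col_mx 0 S by rewrite mul_col_mx mul1mx mul0mx.
  rewrite A2E A3E !tr_col_mx !trmx1 !trmx0 !mul_col_row !mulmx1 !mulmx0.
  by rewrite add_block_mx !addr0 !add0r.
have pQ n w : psdmx (quad_var T X n w) by exact: quad_var_psd.
have mQ n a b : measurable_fun setT (fun w => quad_var T X n w a b) by exact: quad_var_meas.
have cosQ (B : 'M[R]_(p1 + p2)) c : B^T = B ->
    \int[P]_w cos (Num.sqrt n%:R * \tr (B *m (quad_var T X n w - Sigma M theta0)) + c) @[n --> \oo] -->
    cos c * expR (- \tr (B *m Sigma M theta0 *m (B *m Sigma M theta0))).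
  by rewrite -covE; exact: (zstat_cos W1_wiener T_gt0 r1_gt0 Hs Hind mX dX).
have tightQ (B : 'M[R]_(p1 + p2)) : B^T = B ->
    prob_tight P (fun n w => Num.sqrt n%:R * \tr (B *m (quad_var T X n w - Sigma M theta0))).
  by rewrite -covE; exact: (zstat_tight W1_wiener T_gt0 r1_gt0 Hs Hind mX dX).
have min_th n w : (0 < n)%N -> minimizer M Theta (quad_var T X n w) (theta_hat n w).
  by move=> n0; split; [exact: theta_hat_in|exact: theta_hat_min].
split; first exact: (minimizer_cvg_in_probability Theta_compact M_admissible theta0_int identifiable pQ mQ tightQ theta_hat_meas min_th).
have := minimizer_cvg_to_normal W1_wiener T_gt0 r1_gt0 Theta_compact M_admissible theta0_int identifiable Delta_rank pQ mQ cosQ tightQ theta_hat_meas min_th.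
by rewrite /infomx -invmx_Wmx//; exact: (Sigma_pd M_admissible (t0_in theta0_int)).
Qed.
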